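(* Let $s$ be a natural number with $s\ge13$. Suppose that $a_{ij}$ $(1\le i\le3,\ 1\le j\le s)$ are non-zero integers. Suppose, in addition, that the system of equations $\phi_i(\mathbf x)=0$ $(1\le i\le3)$ possesses non-singular real solutions and non-singular $p$-adic solutions for each prime number $p$. Then one has $$N(B)\sim\sigma_\infty\Bigl(\prod_p\sigma_p\Bigr)B^{s-6}\quad(B\to\infty).$$ In particular, the system $\phi_i(\mathbf x)=0$ $(1\le i\le 3)$ satisfies the Hasse principle.
   Context: For integers $a_{ij}$, put $\phi_i(\mathbf x)=\sum_{j=1}^s a_{ij}x_j^i$ $(1\le i\le3)$, so the system consists of a diagonal linear, quadratic and cubic equation in $s$ variables. $N(B)$ is the number of integral solutions $\mathbf x\in\mathbb Z^s$ of $\phi_i(\mathbf x)=0$ $(1\le i\le 3)$ with $|\mathbf x|\le B$ (max norm). For $L>0$ let $\lambda_L(\eta)=L(1-L|\eta|)$ when $|\eta|\le L^{-1}$ and $\lambda_L(\eta)=0$ otherwise; put $\mu_L=\int_{|\boldsymbol\xi|\le1}\prod_{i=1}^3\lambda_L(\phi_i(\boldsymbol\xi))\,d\boldsymbol\xi$, and the real density is $\sigma_\infty=\lim_{L\to\infty}\mu_L$. For a natural number $q$, $M(q)$ is the number of $\mathbf x\in(\mathbb Z/q\mathbb Z)^s$ with $\phi_i(\mathbf x)\equiv0\pmod q$ $(1\le i\le3)$, and for each prime $p$ the $p$-adic density is $\sigma_p=\lim_{H\to\infty}p^{H(3-s)}M(p^H)$. *)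

(* Defs.v *)
From HB Require Import structures.
From mathcomp Require Import all_boot all_order all_algebra finmap.
From mathcomp Require Import all_classical all_reals all_analysis.

Set Implicit Arguments.
Unset Strict Implicit.
Unset Printing Implicit Defensive.

Import Order.TTheory GRing.Theory Num.Theory.
Import numFieldNormedType.Exports.

Local Open Scope classical_set_scope.
Local Open Scope ring_scope.

(** Z_p as the inverse limit of the rings Z/p^n: [residue x n] is the
    representative in [0, p^n) of the image of x in Z/p^n. *)
Record padic_int (p : nat) (p_pr : prime p) := PadicInt {
  residue : nat -> nat;
  residueP : forall n, (residue n = residue n.+1 %% p ^ n)%N
}.

Section PadicInt.
Variables (p : nat) (p_pr : prime p).
Local Notation Zp := (padic_int p_pr).

HB.instance Definition _ := gen_eqMixin Zp.
HB.instance Definition _ := gen_choiceMixin Zp.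

Lemma padic_int_eq (x y : Zp) : residue x =1 residue y -> x = y.
Proof.
case: x y => [x xP] [y yP] /= /funext xy; subst y.
by congr PadicInt; exact: Prop_irrelevance.
Qed.

Lemma residue_mod (x : Zp) n m :
  (n <= m)%N -> (residue x m %% p ^ n = residue x n)%N.
Proof.
elim: m => [|m IHm].
  by rewrite leqn0 => /eqP ->; rewrite [in RHS](residueP x) expn0 !modn1.
rewrite leq_eqVlt => /predU1P[->|].
  by rewrite (residueP x m.+1) modn_mod.
by rewrite ltnS => nm; rewrite -IHm// (residueP x m) modn_dvdm ?dvdn_exp2l.
Qed.

Lemma residue_id (x : Zp) n : (residue x n %% p ^ n = residue x n)%N.
Proof. exact: residue_mod. Qed.

Definition coherent (f : nat -> nat) := forall n, f n = f n.+1 %[mod p ^ n].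

Lemma mkpadic_subproof (f : nat -> nat) : coherent f ->
  forall n, (f n %% p ^ n = (f n.+1 %% p ^ n.+1) %% p ^ n)%N.
Proof. by move=> fP n; rewrite modn_dvdm ?dvdn_exp2l// fP. Qed.

Definition mkpadic (f : nat -> nat) (fP : coherent f) : Zp :=
  PadicInt p_pr (mkpadic_subproof fP).

Lemma cst_coherent c : coherent (fun=> c).
Proof. by []. Qed.

Lemma add_coherent (x y : Zp) : coherent (fun n => residue x n + residue y n)%N.
Proof. by move=> n; rewrite (residueP x n) (residueP y n) modnDm. Qed.

Lemma mul_coherent (x y : Zp) : coherent (fun n => residue x n * residue y n)%N.
Proof. by move=> n; rewrite (residueP x n) (residueP y n) modnMm. Qed.

Lemma opp_coherent (x : Zp) : coherent (fun n => p ^ n - residue x n)%N.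
Proof.
have xlt k : (residue x k <= p ^ k)%N.
  by rewrite -residue_id ltnW// ltn_mod expn_gt0 prime_gt0.
move=> n; apply/eqP; rewrite -(eqn_modDr (residue x n)) subnK// modnn.
rewrite {1}(residueP x n) modnDmr subnK// expnS.
by rewrite mulnC -modnMm modnn mul0n mod0n.
Qed.

Definition padic_zero : Zp := mkpadic (cst_coherent 0).
Definition padic_one : Zp := mkpadic (cst_coherent 1).
Definition padic_add x y : Zp := mkpadic (add_coherent x y).
Definition padic_opp x : Zp := mkpadic (opp_coherent x).
Definition padic_mul x y : Zp := mkpadic (mul_coherent x y).

Let addA : associative padic_add.
Proof. by move=> x y z; apply: padic_int_eq => n /=; rewrite modnDmr modnDml addnA. Qed.

Let addC : commutative padic_add.
Proof. by move=> x y; apply: padic_int_eq => n /=; rewrite addnC. Qed.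

Let add0 : left_id padic_zero padic_add.
Proof. by move=> x; apply: padic_int_eq => n /=; rewrite mod0n add0n residue_id. Qed.

Let addN : left_inverse padic_zero padic_opp padic_add.
Proof.
move=> x; apply: padic_int_eq => n /=; rewrite modnDml subnK ?modnn ?mod0n//.
by rewrite -residue_id ltnW// ltn_mod expn_gt0 prime_gt0.
Qed.

HB.instance Definition _ := GRing.isZmodule.Build Zp addA addC add0 addN.

Let mulA : associative padic_mul.
Proof. by move=> x y z; apply: padic_int_eq => n /=; rewrite modnMmr modnMml mulnA. Qed.

Let mulC : commutative padic_mul.
Proof. by move=> x y; apply: padic_int_eq => n /=; rewrite mulnC. Qed.

Let mul1 : left_id padic_one padic_mul.
Proof. by move=> x; apply: padic_int_eq => n /=; rewrite modnMml mul1n residue_id. Qed.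

Let mulD : left_distributive padic_mul padic_add.
Proof.
by move=> x y z; apply: padic_int_eq => n /=; rewrite modnMml modnDm mulnDl.
Qed.

Let one_neq0 : padic_one != padic_zero.
Proof.
apply/eqP => /(congr1 (fun x => residue x 1)) /=.
by rewrite mod0n modn_small// expn1 prime_gt1.
Qed.

HB.instance Definition _ :=
  GRing.Zmodule_isComNzRing.Build Zp mulA mulC mul1 mulD one_neq0.

Let unit (x : Zp) := `[< exists y, y * x = 1 >].
Let inv (x : Zp) :=
  if pselect (exists y, y * x = 1) is left h then projT1 (cid h) else x.

Let mulV : {in unit, left_inverse 1 inv *%R}.
Proof.
move=> x /asboolP ux; rewrite /inv; case: pselect => // h.
exact: projT2 (cid h).
Qed.

Let unitP (x y : Zp) : y * x = 1 -> unit x.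
Proof. by move=> yx; apply/asboolP; exists y. Qed.

Let inv_out : {in [predC unit], inv =1 id}.
Proof. by move=> x /asboolP ux; rewrite /inv; case: pselect. Qed.

HB.instance Definition _ :=
  GRing.ComNzRing_hasMulInverse.Build Zp mulV unitP inv_out.

Lemma ndvdn_exp_mul n m a b :
  ~~ (p ^ n %| a)%N -> ~~ (p ^ m %| b)%N -> ~~ (p ^ (n + m) %| a * b)%N.
Proof.
case: a => [|a]; first by rewrite dvdn0.
case: b => [|b]; first by rewrite dvdn0.
rewrite !pfactor_dvdn ?muln_gt0// lognM// -!ltnNge => an bm.
by rewrite -addnS leq_add// ltnW.
Qed.

Let idom (x y : Zp) : x * y = 0 -> (x == 0) || (y == 0).
Proof.
move=> xy0; apply: contrapT => /negP; rewrite negb_or => /andP[/eqP x0 /eqP y0].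
have nz (z : Zp) : z <> 0 -> exists n, ~~ (p ^ n %| residue z n)%N.
  move=> z0; apply: contrapT => /forallNP zP; apply: z0.
  apply: padic_int_eq => n /=; rewrite mod0n -residue_id; apply/eqP.
  exact/negPn/negP/(zP n).
have [n xn] := nz x x0; have [m ym] := nz y y0.
have /(_ (n + m)%N) : residue (x * y) =1 residue (0 : Zp) by rewrite xy0.
move=> /= /eqP; rewrite mod0n; apply/negP/ndvdn_exp_mul.
- by apply: contra xn => /eqP h; rewrite -(residue_mod x (leq_addr m n)) /dvdn modn_mod h.
- by apply: contra ym => /eqP h; rewrite -(residue_mod y (leq_addl n m)) /dvdn modn_mod h.
Qed.

HB.instance Definition _ := GRing.ComUnitRing_isIntegral.Build Zp idom.

End PadicInt.

Definition padic (p : nat) (p_pr : prime p) : fieldType :=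
  {fraction (padic_int p_pr)}.

(** The measure on T^(n+1) corresponding to the product of a measure on T and a
    measure on T^n. *)
Section ConsMeasure.
Context d (T : measurableType d) (R : realType) (n : nat).
Variable nu : {sigma_finite_measure set T -> \bar R}.
Variable mu : {sigma_finite_measure set (n.-tuple T) -> \bar R}.

Let tcons (u : T * n.-tuple T) : n.+1.-tuple T := [tuple of u.1 :: u.2].

Let mtcons : measurable_fun [set: T * n.-tuple T] tcons.
Proof. exact: measurable_cons. Qed.

Definition cons_measure : set (n.+1.-tuple T) -> \bar R :=
  pushforward (nu \x mu)%E tcons.

Let cons_measure0 : cons_measure set0 = 0%E.
Proof. by rewrite /cons_measure /pushforward preimage_set0 measure0. Qed.

Let cons_measure_ge0 A : (0 <= cons_measure A)%E.
Proof. exact: measure_ge0. Qed.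

Let preim_meas A : measurable A -> measurable (tcons @^-1` A).
Proof. by move=> mA; rewrite -[X in measurable X]setTI; exact: mtcons. Qed.

Let cons_measure_sigma_additive : semi_sigma_additive cons_measure.
Proof.
move=> F mF tF mUF; rewrite /cons_measure /pushforward preimage_bigcup.
apply: measure_semi_sigma_additive.
- by move=> k; exact: preim_meas.
- apply/trivIsetP => /= i j _ _ ij; rewrite -preimage_setI.
  by move/trivIsetP : tF => /(_ _ _ _ _ ij) ->//; rewrite preimage_set0.
- by rewrite -preimage_bigcup; exact: preim_meas.
Qed.

HB.instance Definition _ := isMeasure.Build _ _ _ cons_measure
  cons_measure0 cons_measure_ge0 cons_measure_sigma_additive.

Let cons_measure_sigma_finite : sigma_finite setT cons_measure.
Proof.
have [F TF Foo] : sigma_finite setT (nu \x mu)%E.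
  have /sigma_finiteP[F [TF ndF Foo]] := sigma_finiteT nu.
  have /sigma_finiteP[G [TG ndG Goo]] := sigma_finiteT mu.
  exists (fun k => F k `*` G k).
    rewrite -setXTT TF TG predeqE => -[x y]; split.
      move=> [/= [k _ Fkx] [l _ Gly]]; exists (maxn k l) => //; split.
      - by move: x Fkx; exact/subsetPset/ndF/leq_maxl.
      - by move: y Gly; exact/subsetPset/ndG/leq_maxr.
    by move=> [k _ []/= ? ?]; split; exists k.
  move=> k; have [? ?] := Foo k; have [? ?] := Goo k.
  split; first exact: measurableX.
  by rewrite product_measure1E// lte_mul_pinfty// ge0_fin_numE.
pose u (t : n.+1.-tuple T) : T * n.-tuple T := (thead t, [tuple of behead t]).
have mu_ : measurable_fun setT u.
  apply/measurable_fun_pairP; split.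
    exact: measurable_tnth.
  exact: measurable_behead.
exists (fun k => u @^-1` F k).
  by rewrite -preimage_bigcup -TF preimage_setT.
move=> k; have [mF Fk] := Foo k; split.
  by rewrite -[X in measurable X]setTI; exact: mu_.
rewrite /cons_measure /pushforward -comp_preimage.
suff -> : u \o tcons = id by [].
apply/funext => -[x t]; congr pair; exact/val_inj.
Qed.

HB.instance Definition _ := Measure_isSigmaFinite.Build _ _ _ cons_measure
  cons_measure_sigma_finite.

End ConsMeasure.

Fixpoint lebesgue_tuple (R : realType) (n : nat) :
    {sigma_finite_measure set (n.-tuple (measurableTypeR R)) -> \bar R} :=
  match n with
  | 0 => \d_[tuple]
  | m.+1 => cons_measure lebesgue_measure (lebesgue_tuple R m)
  end.

(** The forms are numbered from 0, so that [phi a i] has degree [i.+1]. *)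
Definition phi (K : pzRingType) (s : nat) (a : 'M[int]_(3, s)) (i : 'I_3)
    (x : 'I_s -> K) : K :=
  \sum_j (a i j)%:~R * x j ^+ i.+1.

Definition solution (K : pzRingType) (s : nat) (a : 'M[int]_(3, s))
    (x : 'I_s -> K) : Prop :=
  forall i, phi a i x = 0.

Definition jacobian (K : pzRingType) (s : nat) (a : 'M[int]_(3, s))
    (x : 'I_s -> K) : 'M[K]_(3, s) :=
  \matrix_(i, j) ((i.+1)%:R * (a i j)%:~R * x j ^+ i).

Definition nonsingular_solution (K : fieldType) (s : nat) (a : 'M[int]_(3, s))
    (x : 'I_s -> K) : Prop :=
  solution a x /\ \rank (jacobian a x) = 3%N.

Definition nontrivially_soluble (K : pzRingType) (s : nat)
    (a : 'M[int]_(3, s)) : Prop :=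
  exists2 x : 'I_s -> K, solution a x & exists j, x j != 0.

Definition hasse_principle (R : realType) (s : nat) (a : 'M[int]_(3, s)) : Prop :=
  nontrivially_soluble R a ->
  (forall (p : nat) (p_pr : prime p), nontrivially_soluble (padic p_pr) a) ->
  nontrivially_soluble rat a.

Definition count_solutions (R : realType) (s : nat) (a : 'M[int]_(3, s))
    (B : R) : nat :=
  (#|` fset_set [set x : {ffun 'I_s -> int} |
        solution a x /\ forall j, `|x j|%:~R <= B]|)%fset.

Definition lambda (R : realType) (L eta : R) : R :=
  if `|eta| <= L^-1 then L * (1 - L * `|eta|) else 0.

Definition real_density_approx (R : realType) (s : nat) (a : 'M[int]_(3, s))
    (L : R) : R :=
  \int[lebesgue_tuple R s]_(xi in [set t | forall j, `|tnth t j| <= 1])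
    \prod_(i < 3) lambda L (phi a i (tnth xi : 'I_s -> R)).

Definition real_density (R : realType) (s : nat) (a : 'M[int]_(3, s)) : R :=
  lim (real_density_approx a L @[L --> (+oo : set_system R)]).

(** Residue classes modulo q are given by their representatives in [0, q). *)
Definition count_mod (s : nat) (a : 'M[int]_(3, s)) (q : nat) : nat :=
  #|[pred x : {ffun 'I_s -> 'I_q} |
      [forall i, (q%:Z %| phi a i (fun j => (x j : nat)%:Z))%Z]]|.

Definition padic_density_approx (R : realType) (s : nat) (a : 'M[int]_(3, s))
    (p H : nat) : R :=
  (p%:R : R) ^ (H%:Z * (3 - s%:Z)) * (count_mod a (p ^ H))%:R.

Definition padic_density (R : realType) (s : nat) (a : 'M[int]_(3, s))
    (p : nat) : R :=
  lim (padic_density_approx R a p @ \oo).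

Definition padic_partial_product (R : realType) (s : nat)
    (a : 'M[int]_(3, s)) (n : nat) : R :=
  \prod_(p < n | prime p) padic_density R a p.

Definition padic_product (R : realType) (s : nat) (a : 'M[int]_(3, s)) : R :=
  lim (padic_partial_product R a @ \oo).

(* Main.v *)
(** The circle method, with averages over the finitely many frequencies
    (t_1, t_2, t_3) / Q instead of integrals over the unit cube.

    Weight an integer point x by Fejer kernels that detect q | phi_i(x) and
    force |phi_i(x)| to be at most n^i / L.  On the major arcs the Fourier
    weights of these kernels are close to 1 as soon as L is large and q is
    divisible by a suitable W; on the other frequencies the thirteenth power of
    the cubic exponential sum has a small mean.  The latter follows from
    Vinogradov's mean value at the lengths p^H (Heath-Brown's efficient
    congruencing), which bounds the number of large values of the sum, and from
    an inverse of Weyl's inequality, which moves sets of large values from one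
    length to another.  The smoothed count is a Riemann sum, asymptotic to
    chi(q) mu_L n^(s-6) with chi(q) = q^(3-s) M(q).  Hence N(n) / n^(s-6) is a
    Cauchy sequence, and chi(q) mu_L is close to its limit c whenever W | q and
    L is large.

    The function chi is multiplicative and bounded below: Hensel's lemma at a
    nonsingular p-adic point handles each prime, and exponential sums modulo p
    give chi(p^H) >= 1 - O(p^(-3/2)).  Also mu_L is bounded below, since
    Newton's iteration produces many lattice points near a nonsingular real
    point.  These lower bounds let the factors be separated: mu_L, chi(p^H) and
    the partial Euler products converge because N(n) / n^(s-6) does, and the
    product of their limits is c > 0. *)

From HB Require Import structures.
Require Import Defs.
From mathcomp Require Import all_boot all_order all_algebra.
From mathcomp Require Import boolp classical_sets reals topology normedtype sequences derive realfun exp trigo.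
From mathcomp Require Import complex.
From mathcomp Require Import ring lra zify.

Set Implicit Arguments.
Unset Strict Implicit.
Unset Printing Implicit Defensive.

Import Order.TTheory GRing.Theory Num.Theory.

Local Open Scope ring_scope.

(** * The additive character of the reals *)

Section Exponential.
Import numFieldNormedType.Exports.
Variable R : realType.
Implicit Types (x y : R) (z w : R[i]).

(** The mean value at the critical exponent 12 loses a factor 64^H at length p^H, that is the power
    log 64 / log p of the length, and with only thirteen variables such a loss at full length would
    destroy the asymptotics. For values of size N/K it is therefore used at a length P that is a
    fixed power of K: the inverse Weyl inequality puts every such frequency near a fraction of small
    denominator, where the sum of length N is a rescaled copy of the sum of length P. With K = 4^k
    and p large in terms of the exponents of the inverse Weyl inequality the loss becomes 2^k,
    whereas the thirteenth power gains 4^k. Only values below a power of N smaller than N itself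
    meet the loss at length N, and they can afford it. In the comparison of the counts Q is a prime
    larger than every quantity in sight. Congruences modulo Q between the values concerned are then
    equalities, and multiplication by the nonzero coefficients permutes the grid, so that all
    variables have the same moments. No singular series or integral is expanded into frequencies;
    chi(q) and mu_L enter as densities of points. *)

Definition nm z : R := Normc.normc z.

Lemma nmE z : (nm z)%:C%C = `|z|.
Proof. by case: z. Qed.

Lemma nm_ge0 z : 0 <= nm z.
Proof. by case: z => a b; exact: sqrtr_ge0. Qed.

Lemma nm0 : nm 0 = 0. Proof. exact: Normc.normc0. Qed.

Lemma nm1 : nm 1 = 1. Proof. exact: Normc.normc1. Qed.

Lemma nmM z w : nm (z * w) = nm z * nm w.
Proof. exact: Normc.normcM. Qed.

Lemma nmD z w : nm (z + w) <= nm z + nm w.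
Proof. exact: le_normcD. Qed.

Lemma nmN z : nm (- z) = nm z.
Proof. exact: normcN. Qed.

Lemma nm_sub z w : nm (z - w) = nm (w - z).
Proof. by rewrite -nmN opprB. Qed.

Lemma nm_conj z : nm z^*%C = nm z.
Proof. by case: z => a b; rewrite /nm /= sqrrN. Qed.

Lemma nmX z n : nm (z ^+ n) = nm z ^+ n.
Proof. by elim: n => [|n IHn]; rewrite ?expr0 ?nm1// !exprS nmM IHn. Qed.

Lemma nm_sum (I : Type) (r : seq I) (P : pred I) (F : I -> R[i]) :
  nm (\sum_(i <- r | P i) F i) <= \sum_(i <- r | P i) nm (F i).
Proof.
elim/big_ind2 : _ => //; first by rewrite nm0.
by move=> z x w y zx wy; exact: le_trans (nmD _ _) (lerD zx wy).
Qed.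

Lemma nm_prod (I : Type) (r : seq I) (P : pred I) (F : I -> R[i]) :
  nm (\prod_(i <- r | P i) F i) = \prod_(i <- r | P i) nm (F i).
Proof. by elim/big_rec2 : _ => [|i x z _ <-]; rewrite ?nm1 ?nmM. Qed.

Lemma nm_real x : nm x%:C%C = `|x|.
Proof. by rewrite /nm /= expr0n addr0 sqrtr_sqr. Qed.

Lemma nm_sqr z : ((nm z) ^+ 2)%:C%C = z * z^*%C.
Proof. by rewrite rmorphXn /= nmE sqr_normc. Qed.

Lemma nm_subr z w : nm z - nm w <= nm (z - w).
Proof. by rewrite lerBlDr; apply: le_trans (nmD _ _); rewrite subrK. Qed.

Lemma Re_le_nm z : complex.Re z <= nm z.
Proof.
case: z => a b; rewrite /nm /=; apply: le_trans (ler_norm _) _.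
by rewrite -sqrtr_sqr ler_wsqrtr// lerDl sqr_ge0.
Qed.

Lemma nm_nat n : nm n%:R = n%:R.
Proof. by have := nm_real n%:R; rewrite ger0_norm// rmorph_nat. Qed.

Definition e x : R[i] := (cos (pi *+ 2 * x) +i* sin (pi *+ 2 * x))%C.

Lemma e0 : e 0 = 1.
Proof. by rewrite /e mulr0 cos0 sin0. Qed.

Lemma eD x y : e (x + y) = e x * e y.
Proof. by rewrite /e mulrDr cosD sinD; simpc; congr (_ +i* _)%C; ring. Qed.

Lemma eN x : e (- x) = (e x)^*%C.
Proof. by rewrite /e mulrN cosN sinN. Qed.

Lemma nm_e x : nm (e x) = 1.
Proof. by rewrite /nm /= cos2Dsin2 sqrtr1. Qed.

Lemma e_nat n : e n%:R = 1.
Proof.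
rewrite /e; have := @periodicn _ _ cos (pi *+ 2) (@cosD2pi R) n 0.
have := @periodicn _ _ sin (pi *+ 2) (@sinD2pi R) n 0.
by rewrite add0r cos0 sin0 -[X in sin X]mulr_natr -[X in cos X]mulr_natr => -> ->.
Qed.

Lemma e_int (n : int) : e n%:~R = 1.
Proof.
case: n => n; first exact: e_nat.
by rewrite NegzE rmorphN /= eN e_nat conjc1.
Qed.

Lemma eDint x (n : int) : e (x + n%:~R) = e x.
Proof. by rewrite eD e_int mulr1. Qed.

Lemma eMn x n : e (x * n%:R) = e x ^+ n.
Proof.
elim: n => [|n IHn]; first by rewrite mulr0 e0.
by rewrite exprS -IHn -eD -natr1; congr e; ring.
Qed.

Lemma e_sum (I : Type) (r : seq I) (P : pred I) (F : I -> R) :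
  e (\sum_(i <- r | P i) F i) = \prod_(i <- r | P i) e (F i).
Proof. by apply: (big_morph e eD e0). Qed.

Lemma sin_le x : 0 <= x -> sin x <= x.
Proof.
rewrite le_eqVlt => /predU1P[<-|x0]; first by rewrite sin0.
have [c _] := @MVT R sin cos 0 x x0 (fun t _ => is_derive_sin t)
  (continuous_subspaceT (@continuous_sin R)).
rewrite sin0 !subr0 => ->; rewrite ler_piMl ?cos_le1//; exact: ltW.
Qed.

Lemma norm_sin_le x : `|sin x| <= `|x|.
Proof.
wlog x0 : x / 0 <= x.
  move=> H; have [x0|x0] := leP 0 x; first exact: H.
  by rewrite -(normrN x) -(normrN (sin x)) -sinN; apply: H; lra.
rewrite (ger0_norm x0) ler_norml sin_le// andbT.
have [x1|x1] := leP x 1; last first.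
  by have := sin_geN1 x; lra.
rewrite (le_trans _ (sin_ge0_pi _))//; first lra.
by rewrite x0 /=; apply: le_trans x1 _; have := pi_ge2 R; lra.
Qed.

Lemma cos_ge x : 1 - x ^+ 2 / 2 <= cos x.
Proof.
have -> : x = (x / 2) *+ 2 by rewrite mulr2n; lra.
rewrite cos_mulr2n.
have H := cos2sin2 (x / 2); rewrite H.
have := norm_sin_le (x / 2); rewrite -ler_sqr ?nnegrE// !real_normK ?num_real//.
move: (x / 2) (sin _) => y w H'.
have -> : (y *+ 2) ^+ 2 / 2 = y ^+ 2 *+ 2 by field.
by rewrite !mulr2n; move: (w ^+ 2) (y ^+ 2) H' => ? ? ?; lra.
Qed.

Lemma sin_ge_quarter x : 0 <= x -> x <= pi / 2 -> x / 4 <= sin x.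
Proof.
move=> x0 xpi.
have H : forall t : R, 0 <= t <= 1 -> t / 2 <= sin t.
  move=> t /andP[]; rewrite le_eqVlt => /predU1P[<-|t0] t1; first by rewrite sin0; lra.
  have [c] := @MVT R sin cos 0 t t0 (fun t _ => is_derive_sin t)
    (continuous_subspaceT (@continuous_sin R)).
  rewrite in_itv /= sin0 !subr0 => /andP[c0 ct] ->.
  by have := cos_ge c; nra.
have [x1|x1] := leP x 1; first by have := H x; rewrite x0 x1 => /(_ isT); lra.
have x2 : x < 2 by apply: le_lt_trans xpi (@pihalf_lt2 R).
have := H 1; rewrite ler01 lexx => /(_ isT) s1.
have := @ltr_sin R 1 x; rewrite !in_itv/= xpi x1.
have p2 := @pihalf_ge1 R; rewrite p2 !(le_trans _ x0) ?(le_trans _ ler01) ?andbT; try lra.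
Qed.

Lemma nm_eB1 x : nm (e x - 1) = 2 * `|sin (pi * x)|.
Proof.
apply/eqP; rewrite -(@eqrXn2 _ 2) ?nm_ge0 ?mulr_ge0//.
rewrite exprMn real_normK ?num_real// /nm /e /=.
have -> : pi *+ 2 * x = (pi * x) *+ 2 by rewrite mulrnAl.
rewrite sqr_sqrtr ?addr_ge0 ?sqr_ge0// cos_mulr2n sin_mulr2n cos2sin2.
apply/eqP; rewrite subr0; have := cos2sin2 (pi * x).
set c := cos _; set s := sin _ => Hc.
have -> : (c * s *+ 2) ^+ 2 = 4 * c ^+ 2 * s ^+ 2 by ring.
by rewrite Hc; ring.
Qed.

Lemma pi_le4 : pi <= 4 :> R.
Proof. by have := @pihalf_lt2 R; lra. Qed.

Lemma e_lip x y : nm (e x - e y) <= 8 * `|x - y|.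
Proof.
have -> : e x - e y = e y * (e (x - y) - 1).
  by rewrite mulrBr mulr1 -eD; congr (e _ - _); ring.
rewrite nmM nm_e mul1r nm_eB1.
have := norm_sin_le (pi * (x - y)); rewrite normrM (ger0_norm (pi_ge0 R)).
by have := pi_le4; have := normr_ge0 (x - y); nra.
Qed.

Lemma near_int x : exists a : int, `|x - a%:~R| <= 1 / 2.
Proof.
exists (Num.floor (x + 1 / 2)); have := floor_itv (x + 1 / 2) => /andP[].
by rewrite intrD mulr1z => h1 h2; rewrite ler_norml; lra.
Qed.

(** Since |e(x) - 1| = 2 |sin(pi x)|, the bound sin y >= y/4 on [0, pi/2] makes |e(x) - 1| dominate
    the distance from x to the nearest integer. *)
Lemma e_dist x : exists a : int, `|x - a%:~R| <= nm (e x - 1).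
Proof.
have [a xa] := near_int x; exists a.
have -> : e x = e (x - a%:~R) by rewrite -rmorphN eDint.
move: (x - _) xa => {}x xh.
have H : forall t : R, 0 <= t -> t <= 1 / 2 -> t <= nm (e t - 1).
  move=> t t0 th; rewrite nm_eB1.
  have p2 := pi_ge2 R.
  have := @sin_ge_quarter (pi * t) (mulr_ge0 (pi_ge0 R) t0).
  have /[swap]/[apply] : pi * t <= pi / 2 by have := pi_ge0 R; nra.
  by move=> h; apply: le_trans (ler_wpM2l _ (ler_norm _)); nra.
have [x0|x0] := leP 0 x.
  by rewrite ger0_norm//; apply: H => //; rewrite (le_trans (ler_norm _)).
rewrite -normrN; have := H (- x); rewrite eN.
have -> : (e x)^*%C - 1 = (e x - 1)^*%C by rewrite rmorphB rmorph1.
rewrite nm_conj gtr0_norm ?oppr_gt0//; apply; first lra.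
by rewrite (le_trans _ xh)// -normrN ler_norm.
Qed.

(** The geometric sum has modulus at most 2 / |e(x) - 1|, so a sum of size N / K pushes e(x) towards
    1. This is the linear case of the inverse Weyl inequality. *)
Lemma geom_bound x (N : nat) (K : R) : 0 < K -> (0 < N)%N ->
  N%:R / K <= nm (\sum_(i < N) e (x * i%:R)) ->
  exists a : int, `|x - a%:~R| <= 2 * K / N%:R.
Proof.
move=> K0 N0 H; have [a xa] := e_dist x; exists a.
have N0' : 0 < N%:R :> R by rewrite ltr0n.
have E : (e x - 1) * (\sum_(i < N) e (x * i%:R)) = e x ^+ N - 1.
  rewrite subrX1; congr (_ * _); apply: eq_bigr => i _; by rewrite eMn.
have : nm (e x - 1) * (N%:R / K) <= 2.
  apply: (@le_trans _ _ (nm (e x - 1) * nm (\sum_(i < N) e (x * i%:R)))).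
    by apply: ler_wpM2l => //; exact: nm_ge0.
  rewrite -nmM E; apply: le_trans (nmD _ _) _.
  by rewrite nmN nmX nm_e expr1n nm1; lra.
rewrite mulrA ler_pdivrMr// => h; rewrite ler_pdivlMr//.
by apply: le_trans h; rewrite ler_wpM2r// ltW.
Qed.

End Exponential.

(** * Characters on the grid of frequencies t / Q *)

Section Grid.
Variables (R : realType) (Q : nat).
Hypothesis Q0 : (0 < Q)%N.

Local Notation freq := {ffun 'I_3 -> int}.
Local Notation grid := {ffun 'I_3 -> 'I_Q}.
Implicit Types (u v : freq) (t : grid).

Definition pt t (i : 'I_3) : R := (t i)%:R / Q%:R.

Definition ch v t : R[i] := e (\sum_i (v i)%:~R * pt t i).

Lemma chD u v t : ch (u + v) t = ch u t * ch v t.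
Proof.
rewrite /ch -eD -big_split /=; congr e; apply: eq_bigr => i _.
by rewrite ffunE intrD mulrDl.
Qed.

Lemma chN v t : ch (- v) t = (ch v t)^*%C.
Proof.
rewrite /ch -eN -sumrN; congr e; apply: eq_bigr => i _.
by rewrite ffunE intrN mulNr.
Qed.

Lemma ch0 t : ch 0 t = 1.
Proof. by rewrite /ch big1 ?e0// => i _; rewrite ffunE mul0r. Qed.

Lemma ch_sum (I : Type) (r : seq I) (P : pred I) (F : I -> freq) t :
  ch (\sum_(i <- r | P i) F i) t = \prod_(i <- r | P i) ch (F i) t.
Proof. by apply: (big_morph (ch^~ t) (fun u v => chD u v t) (ch0 t)). Qed.

Lemma sum_root_unity (n : int) :
  \sum_(k < Q) e (n%:~R * (k%:R / Q%:R : R)) = if (Q%:Z %| n)%Z then Q%:R else 0.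
Proof.
have Qn0 : Q%:R != 0 :> R by rewrite pnatr_eq0 -lt0n.
case: ifPn => [/dvdzP[m ->]|ndiv].
  rewrite (eq_bigr (fun=> 1)) ?sumr_const ?card_ord// => k _.
  rewrite intrM; have -> : m%:~R * Q%:~R * (k%:R / Q%:R) = (m * k%:Z)%:~R :> R.
    by rewrite intrM -!pmulrn; field.
  exact: e_int.
pose x : R := n%:~R / Q%:R.
have E : \sum_(k < Q) e (n%:~R * (k%:R / Q%:R : R)) = \sum_(k < Q) e x ^+ k.
  by apply: eq_bigr => k _; rewrite -eMn; congr e; rewrite /x; ring.
have H : (e x - 1) * \sum_(k < Q) e x ^+ k = 0.
  rewrite -subrX1 -eMn /x divfK// e_int subrr //.
rewrite E; move/eqP: H; rewrite mulf_eq0 => /orP[|/eqP//].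
rewrite subr_eq0 => /eqP ex1; exfalso.
have [a xa] := e_dist x; move: xa; rewrite ex1 subrr nm0 => xa.
have {xa} : x = a%:~R by apply/eqP; rewrite -subr_eq0 -normr_le0.
rewrite /x => /(canRL (divfK Qn0)).
rewrite -[Q%:R]/(Q%:~R) -intrM => /intr_inj nE.
by move: ndiv; rewrite nE dvdz_mull.
Qed.

Lemma orthogonality v :
  \sum_t ch v t = if [forall i, (Q%:Z %| v i)%Z] then Q%:R ^+ 3 else 0.
Proof.
rewrite /ch.
rewrite (eq_bigr (fun t : grid => \prod_i e ((v i)%:~R * ((t i)%:R / Q%:R : R)))); last first.
  by move=> t _; rewrite e_sum.
rewrite -(bigA_distr_bigA (fun i (k : 'I_Q) => e ((v i)%:~R * (k%:R / Q%:R : R)))).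
rewrite (eq_bigr (fun i => if (Q%:Z %| v i)%Z then Q%:R else 0)); last first.
  by move=> i _; rewrite sum_root_unity.
case: ifPn => [/forallP H|].
  by rewrite (eq_bigr (fun=> Q%:R)) ?prodr_const ?card_ord// => i _; rewrite H.
rewrite negb_forall => /existsP[i /negbTE Hi].
by rewrite (bigD1 i)//= Hi mul0r.
Qed.

Lemma orthogonality_count (W : finType) (v : W -> freq) :
  \sum_t \sum_w ch (v w) t
  = Q%:R ^+ 3 * #|[pred w | [forall i, (Q%:Z %| v w i)%Z]]|%:R.
Proof.
rewrite exchange_big /= (eq_bigr _ (fun w _ => orthogonality (v w))).
by rewrite -big_mkcond sumr_const /= mulr_natr.
Qed.

Lemma sum_pow (I : finType) (u : I -> freq) k t :
  (\sum_z ch (u z) t) ^+ k = \sum_(x : {ffun 'I_k -> I}) ch (\sum_l u (x l)) t.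
Proof.
rewrite -[k in LHS]card_ord -prodr_const bigA_distr_bigA.
by apply: eq_bigr => x _; rewrite ch_sum.
Qed.

Lemma nm_even (z : R[i]) k : ((nm z) ^+ (2 * k))%:C%C = z ^+ k * (z^*%C) ^+ k.
Proof. by rewrite exprM rmorphXn /= nm_sqr exprMn. Qed.

Lemma mean_value_count (I : finType) (u : I -> freq) k :
  \sum_t (nm (\sum_z ch (u z) t)) ^+ (2 * k) = Q%:R ^+ 3 *
   #|[pred xy : {ffun 'I_k -> I} * {ffun 'I_k -> I} |
      [forall i, (Q%:Z %| (\sum_l u (xy.1 l) - \sum_l u (xy.2 l)) i)%Z]]|%:R.
Proof.
apply: (@complexI R); rewrite rmorph_sum /= rmorphM rmorphXn !rmorph_nat.
rewrite -(orthogonality_count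
  (fun xy : {ffun 'I_k -> I} * {ffun 'I_k -> I} => \sum_l u (xy.1 l) - \sum_l u (xy.2 l))).
apply: eq_bigr => t _; rewrite nm_even rmorph_sum.
rewrite [X in _ * X ^+ _](eq_bigr (fun z => ch (- u z) t)); last first.
  by move=> z _; rewrite chN.
rewrite (sum_pow u) (sum_pow (fun z => - u z)) mulr_sumr.
rewrite (eq_bigr (fun y : {ffun 'I_k -> I} => \sum_(x : {ffun 'I_k -> I})
   ch (\sum_l u (x l)) t * ch (\sum_l - u (y l)) t)); last first.
  by move=> y _; rewrite mulr_suml.
rewrite exchange_big pair_bigA /=; apply: eq_bigr => -[x y] _ /=.
by rewrite chD sumrN.
Qed.

Section Spectrum.
Variable P : freq -> Prop.
Hypothesis PB : forall u v, P u -> P v -> P (u - v).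
Hypothesis PQ : forall v, (forall i, (Q%:Z %| v i)%Z) -> P v.

(** Trigonometric polynomials with frequencies in the subgroup [P] of Z^3, which contains Q Z^3. A
    character outside [P] is orthogonal to all of them, so such a factor imposes on the rest of a
    mixed moment every congruence that defines [P]. *)
Definition spectral (G : grid -> R[i]) : Prop :=
  exists2 l : seq freq, (forall v, v \in l -> P v) &
    forall t, G t = \sum_(v <- l) ch v t.

Lemma spectral1 : spectral (fun=> 1).
Proof.
exists [:: 0]; last by move=> t; rewrite big_seq1 ch0.
by move=> v; rewrite inE => /eqP ->; apply: PQ => i; rewrite ffunE dvdz0.
Qed.

Lemma spectralM F G : spectral F -> spectral G -> spectral (fun t => F t * G t).
Proof.
have P0 : P 0 by apply: PQ => i; rewrite ffunE dvdz0.
have PD u v : P u -> P v -> P (u + v).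
  move=> Pu Pv; rewrite -[v]opprK; apply: PB => //.
  by rewrite -[- v]add0r; exact: PB.
move=> [l lP lE] [m mP mE]; exists [seq u + v | u <- l, v <- m].
  by move=> _ /allpairsP[[u v] /= [/lP Pu /mP Pv ->]]; exact: PD.
move=> t; rewrite lE mE big_allpairs_dep mulr_suml.
apply: eq_bigr => u _; rewrite mulr_sumr.
by apply: eq_bigr => v _; rewrite chD.
Qed.

Lemma spectralX F k : spectral F -> spectral (fun t => F t ^+ k).
Proof.
move=> SF; elim: k => [|k IHk]; first exact: spectral1.
have := spectralM SF IHk; congr spectral; apply/funext => t; by rewrite exprS.
Qed.

Lemma spectral_nm (I : finType) (u : I -> freq) k :
  (forall x y, P (u x - u y)) ->
  spectral (fun t => ((nm (\sum_z ch (u z) t)) ^+ (2 * k))%:C%C).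
Proof.
move=> Pu; have : spectral (fun t => (\sum_z ch (u z) t) * (\sum_z ch (u z) t)^*%C).
  exists [seq u x - u y | x <- enum I, y <- enum I].
    by move=> _ /allpairsP[[x y] /= [_ _ ->]].
  move=> t; rewrite big_allpairs_dep mulr_suml big_enum /=; apply: eq_bigr => x _.
  rewrite rmorph_sum mulr_sumr big_enum; apply: eq_bigr => y _.
  by rewrite chD chN.
move=> /(spectralX k); congr spectral; apply/funext => t.
by rewrite nm_even exprMn.
Qed.

Lemma spectral_orth u G : ~ P u -> spectral G -> \sum_t ch (- u) t * G t = 0.
Proof.
move=> nPu [l lP lE]; under eq_bigr do rewrite lE mulr_sumr.
rewrite exchange_big big_seq big1// => v /lP Pv /=.
under eq_bigr do rewrite -chD.
rewrite orthogonality; case: ifPn => // /forallP /PQ.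
move=> /(PB Pv) h; case: nPu; move: h; congr P.
by apply/ffunP => i; rewrite !ffunE; ring.
Qed.

End Spectrum.

End Grid.

(** * Vinogradov's cubic mean value by efficient congruencing *)

Section FiniteMoments.
Variable R : realFieldType.

(** Lagrange's identity: twice the difference of the two sides is a sum of squares with non-negative
    weights. *)
Lemma weighted_cauchy_schwarz (T : finType) (w u v : T -> R) :
  (forall t, 0 <= w t) ->
  (\sum_t w t * (u t * v t)) ^+ 2 <=
  (\sum_t w t * u t ^+ 2) * (\sum_t w t * v t ^+ 2).
Proof.
move=> w0.
have H : 0 <= \sum_s \sum_t w s * w t * (u s * v t - u t * v s) ^+ 2.
  apply: sumr_ge0 => s _; apply: sumr_ge0 => t _.
  by rewrite mulr_ge0 ?sqr_ge0// mulr_ge0.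
have E : \sum_s \sum_t w s * w t * (u s * v t - u t * v s) ^+ 2 =
  ((\sum_t w t * u t ^+ 2) * (\sum_t w t * v t ^+ 2)
   - (\sum_t w t * (u t * v t)) ^+ 2) *+ 2.
  rewrite expr2 !big_distrlr /= -sumrB mulr2n.
  rewrite [X in _ = X + _](eq_bigr (fun s => \sum_t
    (w s * u s ^+ 2 * (w t * v t ^+ 2) - w s * (u s * v s) * (w t * (u t * v t)))));
    last by move=> s _; rewrite sumrB.
  rewrite [X in _ = _ + X](eq_bigr (fun s => \sum_t
    (w s * u s ^+ 2 * (w t * v t ^+ 2) - w s * (u s * v s) * (w t * (u t * v t)))));
    last by move=> s _; rewrite sumrB.
  rewrite [X in _ = _ + X]exchange_big /= -big_split /=; apply: eq_bigr => s _.
  rewrite -big_split /=; apply: eq_bigr => t _; ring.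
by rewrite -subr_ge0; move: H; rewrite E pmulrn_lge0.
Qed.

(** The tangent to z^6 at the mean value y lies below the curve: the difference is (z - y)^2 times a
    polynomial with positive coefficients. *)
Lemma power_mean6 (T : finType) (x : T -> R) : (forall t, 0 <= x t) ->
  (\sum_t x t) ^+ 6 <= #|T|%:R ^+ 5 * \sum_t x t ^+ 6.
Proof.
move=> x0; have [T0|Tn0] := eqVneq #|T| 0%N.
  rewrite !big1 ?mulr0 ?expr0n// => t _; have := fintype0 t T0; by [].
have n0 : 0 < #|T|%:R :> R by rewrite ltr0n lt0n.
set n : R := #|T|%:R in n0 *; set S := \sum_t x t.
pose y := S / n.
have y0 : 0 <= y by rewrite divr_ge0 ?sumr_ge0// ltW.
have H t : 6 * (x t * y ^+ 5) - 5 * y ^+ 6 <= x t ^+ 6.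
  have := x0 t; move: (x t) => z z0; rewrite -subr_ge0.
  have -> : z ^+ 6 - (6 * (z * y ^+ 5) - 5 * y ^+ 6) = (z - y) ^+ 2 *
    (z ^+ 4 + 2 * z ^+ 3 * y + 3 * z ^+ 2 * y ^+ 2 + 4 * z * y ^+ 3 + 5 * y ^+ 4).
    by ring.
  rewrite mulr_ge0 ?sqr_ge0//.
  have h j k : 0 <= z ^+ j * y ^+ k by rewrite mulr_ge0 ?exprn_ge0.
  by have := h 4 0; have := h 3 1; have := h 2 2; have := h 1 3; have := h 0 4; lra.
have : \sum_t (6 * (x t * y ^+ 5) - 5 * y ^+ 6) <= \sum_t x t ^+ 6 by exact: ler_sum.
rewrite sumrB -mulr_sumr -mulr_suml sumr_const -/S -mulr_natl -/n.
have SE : S = n * y by rewrite /y mulrC divfK// gt_eqF.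
rewrite SE => h; have : n ^+ 5 * (n * y ^+ 6) <= n ^+ 5 * \sum_t x t ^+ 6.
  apply: ler_wpM2l; first by rewrite exprn_ge0// ltW.
  by apply: le_trans h; rewrite le_eqVlt; apply/orP; left; apply/eqP; ring.
by move=> h'; apply: le_trans h'; rewrite le_eqVlt; apply/orP; left; apply/eqP; ring.
Qed.

Section Moments.
Variables (T : finType) (u v : T -> R).
Hypotheses (u0 : forall t, 0 <= u t) (v0 : forall t, 0 <= v t).

(** The total degree is 6 because [u] and [v] will be squared moduli of exponential sums; these are
    mixed twelfth moments. *)
Definition moment k : R := \sum_t u t ^+ k * v t ^+ (6 - k).

Lemma moment_ge0 k : 0 <= moment k.
Proof. by apply: sumr_ge0 => t _; rewrite mulr_ge0 ?exprn_ge0. Qed.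

Lemma moment_log_convex k : (k < 5)%N ->
  moment k.+1 ^+ 2 <= moment k * moment k.+2.
Proof.
move=> k5; rewrite /moment.
have := @weighted_cauchy_schwarz T (fun t => u t ^+ k * v t ^+ (4 - k)) v u.
have E1 : (6 - k = (4 - k) + 2)%N by lia.
have E2 : (6 - k.+1 = (4 - k).+1)%N by lia.
have E3 : (6 - k.+2 = 4 - k)%N by lia.
rewrite E1 E2 E3 => h.
apply: le_trans (le_trans (h _) _).
- rewrite le_eqVlt; apply/orP; left; apply/eqP; congr (_ ^+ 2).
  by apply: eq_bigr => t _; rewrite !exprS; ring.
- by move=> t; rewrite mulr_ge0 ?exprn_ge0.
- rewrite le_eqVlt; apply/orP; left; apply/eqP; congr (_ * _).
    by apply: eq_bigr => t _; rewrite exprD; ring.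
  by apply: eq_bigr => t _; rewrite !exprS; ring.
Qed.

End Moments.

Lemma moment_rev (T : finType) (u v : T -> R) k : (k <= 6)%N ->
  moment u v k = moment v u (6 - k).
Proof.
move=> k6; rewrite /moment subKn//; apply: eq_bigr => t _; exact: mulrC.
Qed.

Section MomentBounds.
Variables (T : finType) (u v : T -> R).
Hypotheses (u0 : forall t, 0 <= u t) (v0 : forall t, 0 <= v t).
Local Notation m := (moment u v).

Let cancel_pow (x y : R) n k : 0 <= x -> 0 <= y -> (0 < n)%N ->
  x ^+ (n + k) <= y * x ^+ k -> x ^+ n <= y.
Proof.
move=> x0 y0 n0; have [->|xn0] := eqVneq x 0; first by move=> _; rewrite expr0n gtn_eqF.
by rewrite exprD ler_pM2r// exprn_gt0// lt_def xn0.
Qed.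

(** Hölder's inequality for 2 = 2/3 + 4/3. Log-convexity bounds m(2)^4 by m(1)^2 m(2) m(4), and one
    factor m(2) is cancelled. The interpolations 1 = 4/4 and 2 = 6/3 below come about in the same
    manner, so fractional exponents never appear. *)
Lemma moment_2_1_4 : m 2 ^+ 3 <= m 1 ^+ 2 * m 4.
Proof.
have h1 := moment_log_convex u0 v0 (isT : (1 < 5)%N).
have h2 := moment_log_convex u0 v0 (isT : (2 < 5)%N).
have g k := moment_ge0 u0 v0 k.
apply: (@cancel_pow _ _ _ 1) => //; first by rewrite mulr_ge0 ?exprn_ge0.
apply: le_trans (_ : (m 1 * m 3) ^+ 2 <= _).
  by rewrite (exprM (m 2) 2 2) lerXn2r// nnegrE ?mulr_ge0 ?exprn_ge0.
by rewrite exprMn expr1 -mulrA ler_wpM2l ?exprn_ge0// mulrC.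
Qed.

Lemma moment_1_0_4 : m 1 ^+ 4 <= m 0 ^+ 3 * m 4.
Proof.
have h1 := moment_log_convex u0 v0 (isT : (0 < 5)%N).
have h2 := moment_2_1_4.
have g k := moment_ge0 u0 v0 k.
suff : (m 1 ^+ 4) ^+ 2 <= (m 0 ^+ 3 * m 4) ^+ 2.
  by rewrite ler_pXn2r// ?nnegrE ?mulr_ge0 ?exprn_ge0//.
rewrite -exprM; apply: (@cancel_pow _ _ _ 4) => //; first by rewrite exprn_ge0// mulr_ge0 ?exprn_ge0.
apply: le_trans (_ : (m 0 * m 2) ^+ 6 <= _).
  by rewrite (exprM (m 1) 2 6) lerXn2r// nnegrE ?mulr_ge0 ?exprn_ge0.
rewrite exprMn (exprM (m 2) 3 2); apply: le_trans (_ : m 0 ^+ 6 * (m 1 ^+ 2 * m 4) ^+ 2 <= _).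
  by rewrite ler_wpM2l ?exprn_ge0// lerXn2r// nnegrE ?mulr_ge0 ?exprn_ge0.
by rewrite le_eqVlt; apply/orP; left; apply/eqP; ring.
Qed.

End MomentBounds.

Lemma moment_2_0_6 (T : finType) (u v : T -> R) :
  (forall t, 0 <= u t) -> (forall t, 0 <= v t) ->
  moment u v 2 ^+ 3 <= moment u v 0 ^+ 2 * moment u v 6.
Proof.
move=> u0 v0; set m := moment u v.
have g k := moment_ge0 u0 v0 k; rewrite -/m in g.
have cancel1 (x y : R) : 0 <= x -> 0 <= y -> x ^+ 4 <= y * x -> x ^+ 3 <= y.
  move=> x0 y0; have [->|xn0] := eqVneq x 0; first by move=> _; rewrite expr0n.
  by rewrite exprSr ler_pM2r// lt_def xn0.
have sq (x y : R) : 0 <= x -> 0 <= y -> (x ^+ 2 <= y ^+ 2) = (x <= y).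
  by move=> x0 y0; rewrite ler_sqr.
have h4 : m 4 ^+ 2 <= m 2 * m 6.
  have := moment_2_1_4 v0 u0; have := moment_1_0_4 v0 u0.
  rewrite !(moment_rev v u) //= -/m => a1 a2.
  have : (m 4 ^+ 3) ^+ 2 <= (m 5 ^+ 2 * m 2) ^+ 2 by rewrite sq ?mulr_ge0 ?exprn_ge0.
  have -> : (m 5 ^+ 2 * m 2) ^+ 2 = m 5 ^+ 4 * m 2 ^+ 2 by ring.
  rewrite -exprM => a3; have : m 4 ^+ 6 <= (m 6 ^+ 3 * m 2) * m 2 ^+ 2.
    by apply: le_trans a3 _; rewrite ler_wpM2r ?exprn_ge0.
  have -> : m 6 ^+ 3 * m 2 * m 2 ^+ 2 = (m 2 * m 6) ^+ 3 by ring.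
  rewrite (exprM _ 2 3) ler_pXn2r ?nnegrE ?mulr_ge0 ?exprn_ge0//.
have h2 : m 2 ^+ 2 <= m 4 * m 0.
  have := moment_2_1_4 u0 v0; have := moment_1_0_4 u0 v0; rewrite -/m => a1 a2.
  have : (m 2 ^+ 3) ^+ 2 <= (m 1 ^+ 2 * m 4) ^+ 2 by rewrite sq ?mulr_ge0 ?exprn_ge0.
  have -> : (m 1 ^+ 2 * m 4) ^+ 2 = m 1 ^+ 4 * m 4 ^+ 2 by ring.
  rewrite -exprM => a3; have : m 2 ^+ 6 <= (m 0 ^+ 3 * m 4) * m 4 ^+ 2.
    by apply: le_trans a3 _; rewrite ler_wpM2r ?exprn_ge0.
  have -> : m 0 ^+ 3 * m 4 * m 4 ^+ 2 = (m 4 * m 0) ^+ 3 by ring.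
  rewrite (exprM _ 2 3) ler_pXn2r ?nnegrE ?mulr_ge0 ?exprn_ge0//.
apply: cancel1; rewrite ?mulr_ge0 ?exprn_ge0//.
apply: le_trans (_ : (m 4 * m 0) ^+ 2 <= _).
  by rewrite (exprM _ 2 2) sq ?mulr_ge0 ?exprn_ge0.
have -> : (m 4 * m 0) ^+ 2 = m 0 ^+ 2 * m 4 ^+ 2 by ring.
by rewrite -mulrA ler_wpM2l ?exprn_ge0// [m 6 * _]mulrC.
Qed.

End FiniteMoments.

(** * Power sums modulo powers of p *)

Section PrimePowerCongruences.
Variable p : nat.
Hypotheses (p_pr : prime p) (p5 : (5 <= p)%N).
Implicit Types x y u : int.

Let coprime_pX k x : ~~ (p%:Z %| x)%Z -> coprimez (p ^ k)%N%:Z x.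
Proof.
by move=> H; rewrite coprimezE /= coprimeXl// prime_coprime.
Qed.

Let prime_dvdM x y : (p%:Z %| x * y)%Z = (p%:Z %| x)%Z || (p%:Z %| y)%Z.
Proof. by rewrite !dvdzE abszM Euclid_dvdM. Qed.

Let ndvd_small k : (0 < k < 5)%N -> ~~ (p%:Z %| k%:Z)%Z.
Proof.
move=> /andP[k0 k5]; rewrite dvdzE /=; by apply/negP => /dvdn_leq - /(_ k0); lia.
Qed.

Lemma dvdz_pX_cancel k x y : ~~ (p%:Z %| x)%Z ->
  ((p ^ k)%N%:Z %| x * y)%Z -> ((p ^ k)%N%:Z %| y)%Z.
Proof. by move=> nx; rewrite Gauss_dvdzr// coprime_pX. Qed.

(** The cofactor x^2 + xy + y^2 of x - y is congruent to 3 x^2 modulo p, hence a unit. *)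
Lemma cube_congruence k x y : ~~ (p%:Z %| x)%Z -> (p%:Z %| x - y)%Z ->
  ((p ^ k)%N%:Z %| x ^+ 3 - y ^+ 3)%Z -> ((p ^ k)%N%:Z %| x - y)%Z.
Proof.
move=> nx xy; have -> : x ^+ 3 - y ^+ 3 = (x ^+ 2 + x * y + y ^+ 2) * (x - y) by ring.
apply: dvdz_pX_cancel; apply/negP => h.
have : (p%:Z %| 3%:Z * (x * x))%Z.
  have -> : 3%:Z * (x * x) = (x ^+ 2 + x * y + y ^+ 2) + (2 * x + y) * (x - y) by ring.
  by rewrite rpredD// dvdz_mull.
by rewrite !prime_dvdM (negPf nx) orbF (negPf (ndvd_small _)).
Qed.

(** The divisibility of d1 and d2 rises by one power of p at a time: 2 d3 is an integral combination
    of d1 and d2, so the terms carrying p^a are divisible by one power more than is known so far,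
    and 2, 3 and nu are units. Once d1 and d2 vanish modulo p^n, the pairs (w1, w2) and (w3, w4)
    have the same sum and sum of squares, whence the product. *)
Lemma pair_congruence a n (w1 w2 w3 w4 nu : int) : (0 < a)%N ->
  ~~ (p%:Z %| nu)%Z ->
  let d1 := w1 + w2 - w3 - w4 in
  let d2 := w1 ^+ 2 + w2 ^+ 2 - w3 ^+ 2 - w4 ^+ 2 in
  let d3 := w1 ^+ 3 + w2 ^+ 3 - w3 ^+ 3 - w4 ^+ 3 in
  ((p ^ n)%N%:Z %| 2 * nu * d1 + (p ^ a)%N%:Z * d2)%Z ->
  ((p ^ n)%N%:Z %| 3 * nu * d2 + 2 * (p ^ a)%N%:Z * d3)%Z ->
  ((p ^ n)%N%:Z %| d1)%Z /\ ((p ^ n)%N%:Z %| (w1 - w3) * (w1 - w4))%Z.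
Proof.
move=> a0 nnu d1 d2 d3 h1 h2.
have two : ~~ (p%:Z %| 2)%Z := ndvd_small (isT : (0 < 2 < 5)%N).
have three : ~~ (p%:Z %| 3)%Z := ndvd_small (isT : (0 < 3 < 5)%N).
(* For pairs, the third power sum is a polynomial in the first two; this is the difference of the
   two instances. *)
have [al [be Hd3]] : exists al be : int, 2 * d3 = al * d1 + be * d2.
  exists (3 * (w1 ^+ 2 + w2 ^+ 2)
    - ((w1 + w2) ^+ 2 + (w1 + w2) * (w3 + w4) + (w3 + w4) ^+ 2)), (3 * (w3 + w4)).
  by rewrite /d1 /d2 /d3; ring.
have K : forall k, (k <= n)%N -> ((p ^ k)%N%:Z %| d1)%Z && ((p ^ k)%N%:Z %| d2)%Z.
  elim=> [_|k IHk kn]; first by rewrite expn0 !dvd1z.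
  have /andP[e1 e2] := IHk (ltnW kn).
  have pk x : ((p ^ n)%N%:Z %| x)%Z -> ((p ^ k.+1)%N%:Z %| x)%Z.
    by apply: dvdz_trans; rewrite dvdzE /= dvdn_exp2l.
  have pa x : ((p ^ k)%N%:Z %| x)%Z -> ((p ^ k.+1)%N%:Z %| (p ^ a)%N%:Z * x)%Z.
    by move=> h; rewrite expnS PoszM dvdz_mul// dvdzE /= dvdn_exp.
  have f2 : ((p ^ k.+1)%N%:Z %| d2)%Z.
    apply: (dvdz_pX_cancel nnu); apply: (dvdz_pX_cancel three).
    have -> : 3 * (nu * d2) = (3 * nu * d2 + 2 * (p ^ a)%N%:Z * d3)
      - (p ^ a)%N%:Z * (2 * d3) by ring.
    by apply: rpredB; [exact: pk|apply: pa; rewrite Hd3 rpredD// dvdz_mull].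
  rewrite f2 andbT; apply: (dvdz_pX_cancel nnu); apply: (dvdz_pX_cancel two).
  have -> : 2 * (nu * d1) = (2 * nu * d1 + (p ^ a)%N%:Z * d2) - (p ^ a)%N%:Z * d2 by ring.
  by apply: rpredB; [exact: pk|exact: pa].
have /andP[g1 g2] := K n (leqnn n); split => //.
apply: (dvdz_pX_cancel two).
have -> : 2 * ((w1 - w3) * (w1 - w4)) = d1 * (2 * w1 - (w3 + w4) - (w1 + w2)) + d2.
  by rewrite /d1 /d2; ring.
by rewrite rpredD// dvdz_mulr.
Qed.

End PrimePowerCongruences.

Local Notation dvi d m := (in_mem (m)%R (mem (dvdz (d)%R))).
Local Notation o0 := (ord0 : 'I_3).
Local Notation o1 := (lift ord0 ord0 : 'I_3).
Local Notation o2 := (lift ord0 (lift ord0 ord0) : 'I_3).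

Lemma dvdz_congr (d x y : int) : x = y -> dvi d x -> dvi d y.
Proof. by move=> ->. Qed.

Lemma dvdz_lt_eq (m i j : nat) : (i < m)%N -> (j < m)%N -> dvi m%:Z (i%:Z - j%:Z) -> i = j.
Proof.
move=> im jm /dvdzP[k kE]; have k0 : k = 0 by nia.
by move: kE; rewrite k0 mul0r; lia.
Qed.

Lemma sum_ord_mul (V : nmodType) m n (F : nat -> V) :
  \sum_(z < m * n) F z = \sum_(w < m) \sum_(z < n) F (w + m * z)%N.
Proof.
rewrite exchange_big /= -(big_mkord xpredT F).
elim: n => [|n IHn]; first by rewrite muln0 big_ord0 big_geq.
rewrite mulnS addnC (big_cat_nat (n := (m * n)%N)) ?leq_addr//= IHn big_ord_recr /=.
congr (_ + _); rewrite -[X in \sum_(X <= _ < _) _]add0n big_addn addKn big_mkord.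
by apply: eq_bigr => i _; rewrite addnC.
Qed.

Lemma card_residue_le (N m n : nat) (c : int) : (0 < m)%N -> N = (m * n)%N ->
  (\sum_(z < N) dvi m%:Z (c - z%:Z) <= n)%N.
Proof.
move=> m0 ->; rewrite (sum_ord_mul m n (fun z => nat_of_bool (dvi m%:Z (c - z%:Z)))).
rewrite exchange_big /=.
rewrite -[leqRHS]card_ord -sum1_card; apply: leq_sum => z _.
 rewrite (eq_bigr (fun i : 'I_m => nat_of_bool (dvi m%:Z (c - i%:Z)))); last first.
  move=> w _; congr nat_of_bool; rewrite PoszD PoszM opprD addrA.
  by rewrite rpredBr// dvdz_mulr.
rewrite -[X in (X <= _)%N]/(\sum_(i < m) nat_of_bool (dvi m%:Z (c - i%:Z)))%N -big_mkcond sum1dep_card.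
apply/card_le1_eqP => i j; rewrite !inE => hi hj.
apply/val_inj/(dvdz_lt_eq (ltn_ord _) (ltn_ord _)).
by apply: dvdz_congr (rpredB hi hj); ring.
Qed.

Lemma prime_power_split p n x y : prime p -> (p ^ n %| x * y)%N ->
  exists2 e, (e <= n)%N & (p ^ e %| x)%N && (p ^ (n - e) %| y)%N.
Proof.
move=> p_pr h; have [x0|x0] := posnP x.
  by exists n => //; rewrite x0 dvdn0 subnn dvd1n.
have [y0|y0] := posnP y.
  by exists 0%N => //; rewrite y0 dvdn0 dvd1n.
have [nl|/ltnW nl] := leqP n (logn p x).
  by exists n => //; rewrite pfactor_dvdn// nl subnn dvd1n.
exists (logn p x); rewrite // pfactor_dvdnn /=.
by move: h; rewrite !pfactor_dvdn ?muln_gt0 ?x0// lognM// leq_subLR.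
Qed.

Lemma PoszX m n : (m ^ n)%N%:Z = m%:Z ^+ n.
Proof. by elim: n => // n IHn; rewrite expnS exprS PoszM IHn. Qed.

(** The power p^n is shared between the two factors as p^e and p^(n-e). Each of the n+1 ways leaves
    p^(n-e) choices of w and p^e choices of z. *)
Lemma card_mul_divisible (p n : nat) (c : int) : prime p ->
  (\sum_(w < p ^ n) \sum_(z < p ^ n)
     dvi (p ^ n)%N%:Z ((c - w%:Z) * (c - z%:Z)) <= n.+1 * p ^ n)%N.
Proof.
move=> p_pr; have p0 k : (0 < p ^ k)%N by rewrite expn_gt0 prime_gt0.
apply: (@leq_trans (\sum_(w < p ^ n) \sum_(z < p ^ n) \sum_(e < n.+1)
   dvi (p ^ e)%N%:Z (c - w%:Z) * dvi (p ^ (n - e))%N%:Z (c - z%:Z))%N).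
  apply: leq_sum => w _; apply: leq_sum => z _.
  case: (boolP (_ \in _)) => // h.
  suff [e1 en /andP[ew ez]] : exists2 e1, (e1 <= n)%N &
      dvi (p ^ e1)%N%:Z (c - w%:Z) && dvi (p ^ (n - e1))%N%:Z (c - z%:Z).
    rewrite (bigD1 (Ordinal (en : (e1 < n.+1)%N)))//= ew ez.
    exact: leq_addr.
  by apply: prime_power_split => //; move: h; rewrite dvdzE abszM.
rewrite (eq_bigr (fun w : 'I_(p ^ n) => \sum_(e < n.+1) \sum_(z < p ^ n)
   dvi (p ^ e)%N%:Z (c - w%:Z) * dvi (p ^ (n - e))%N%:Z (c - z%:Z))%N); last first.
  by move=> w _; rewrite exchange_big.
rewrite exchange_big /=.
rewrite -[X in (_ <= X * _)%N](card_ord n.+1) -sum_nat_const; apply: leq_sum => -[e1 /= en] _.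
rewrite (eq_bigr (fun w : 'I_(p ^ n) => dvi (p ^ e1)%N%:Z (c - w%:Z) *
   \sum_(z < p ^ n) dvi (p ^ (n - e1))%N%:Z (c - z%:Z))%N); last first.
  by move=> w _; rewrite big_distrr.
rewrite -big_distrl /=.
have e1n : (e1 <= n)%N by [].
have E1 : (p ^ n = p ^ e1 * p ^ (n - e1))%N by rewrite -expnD subnKC.
have E2 : (p ^ n = p ^ (n - e1) * p ^ e1)%N by rewrite mulnC.
rewrite [X in (_ <= X)%N]E2 leq_mul//.
  exact: card_residue_le.
exact: card_residue_le.
Qed.

(** * Exponential sums over residue classes modulo p^a *)

Section Vinogradov.
Variables (R : realType) (p H M : nat).
Hypothesis p_pr : prime p.

Local Notation freq := {ffun 'I_3 -> int}.
Local Notation Q := (p ^ M)%N.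
Local Notation grid := {ffun 'I_3 -> 'I_Q}.

Let p0 k : (0 < p ^ k)%N. Proof. by rewrite expn_gt0 prime_gt0. Qed.

Definition mono (x : int) : freq := [ffun i : 'I_3 => x ^+ i.+1].

Definition apt (a : nat) (xi : int) (z : nat) : int := xi + (p ^ a)%N%:Z * z%:Z.

Definition fsum (a : nat) (xi : int) (t : grid) : R[i] :=
  \sum_(z < p ^ (H - a)) ch R (mono (apt a xi z)) t.

Lemma apt_add a c xi w z :
  apt a xi (w + p ^ c * z) = apt (a + c) (apt a xi w) z.
Proof. by rewrite /apt expnD !PoszD !PoszM; ring. Qed.

Lemma fsum_split a c xi t : (a + c <= H)%N ->
  fsum a xi t = \sum_(w < p ^ c) fsum (a + c) (apt a xi w) t.
Proof.
move=> acH; rewrite /fsum.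
have -> : (p ^ (H - a) = p ^ c * p ^ (H - (a + c)))%N.
  by rewrite -expnD; congr expn; clear -acH; lia.
rewrite (sum_ord_mul _ _ (fun z => ch R (mono (apt a xi z)) t)).
by apply: eq_bigr => w _; apply: eq_bigr => z _; rewrite apt_add.
Qed.

Definition usum a xi t : R := nm (fsum a xi t) ^+ 2.

Lemma usum_ge0 a xi t : 0 <= usum a xi t. Proof. exact: sqr_ge0. Qed.

Lemma usumE a xi t : (usum a xi t)%:C%C = fsum a xi t * (fsum a xi t)^*%C.
Proof. exact: nm_sqr. Qed.

(** The mixed mean of efficient congruencing: |f_a|^(2m) |f_b|^(12-2m) summed over the grid, with
    f_a over the class of [xi] modulo p^a and f_b over the class of [eta] modulo p^b. *)
Definition Imom m a xi b eta : R := moment (usum a xi) (usum b eta) m.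

Section Support.
Variables (b : nat) (eta : int).
Hypothesis bM : (3 * b <= M)%N.

(** After translation of [eta] to the origin the conditions read: the coordinate of degree i is
    divisible by p^(ib). By the binomial theorem this subgroup contains every frequency of
    |f_b|^2. *)
Definition csupp (v : freq) : Prop :=
  [/\ dvi (p ^ b)%N%:Z (v o0),
      dvi (p ^ (2 * b))%N%:Z (v o1 - 2 * eta * v o0) &
      dvi (p ^ (3 * b))%N%:Z (v o2 - 3 * eta * v o1 + 3 * eta ^+ 2 * v o0)].

Lemma csuppB u v : csupp u -> csupp v -> csupp (u - v).
Proof.
move=> [u0 u1 u2] [v0 v1 v2]; split; rewrite !ffunE.
- exact: rpredB.
- by apply: dvdz_congr (rpredB u1 v1); ring.
- by apply: dvdz_congr (rpredB u2 v2); ring.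
Qed.

Lemma csupp_dvd (v : freq) : (forall i, dvi Q%:Z (v i)) -> csupp v.
Proof.
move=> vQ; have H' k n : (k <= M)%N -> dvi Q%:Z n -> dvi (p ^ k)%N%:Z n.
  by move=> kM; apply: dvdz_trans; rewrite dvdzE /= dvdn_exp2l.
split; apply: H'; rewrite ?(leq_trans _ bM)//; try (clear -bM; lia).
- by rewrite rpredB// dvdz_mull.
- by rewrite rpredD// ?rpredB// dvdz_mull.
Qed.

Lemma csupp_mono (x y : int) :
  dvi (p ^ b)%N%:Z (x - eta) -> dvi (p ^ b)%N%:Z (y - eta) ->
  csupp (mono x - mono y).
Proof.
move=> /dvdzP[r Hx] /dvdzP[s Hy].
have -> : x = eta + r * (p ^ b)%N%:Z by rewrite -Hx; ring.
have -> : y = eta + s * (p ^ b)%N%:Z by rewrite -Hy; ring.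
rewrite /csupp !ffunE /= !(mulnC _ b) !(expnM p b) !(PoszX (p ^ b)).
move: (p ^ b)%N%:Z => P.
split; apply/dvdzP.
- by exists (r - s); rewrite !expr1; ring.
- by exists (r ^+ 2 - s ^+ 2); ring.
- by exists (r ^+ 3 - s ^+ 3); ring.
Qed.

End Support.

End Vinogradov.

Lemma sum_le_max (R : realFieldType) (T : finType) (F : T -> R) (x0 : T) :
  exists x, \sum_t F t <= #|T|%:R * F x.
Proof.
case: (@arg_maxP _ _ _ x0 xpredT F isT) => x _ xM; exists x.
rewrite mulr_natl -sumr_const; apply: ler_sum => t _; exact: xM.
Qed.

Lemma mulr_sum_pair (V : pzRingType) (I J : finType) (F : I -> V) (G : J -> V) :
  (\sum_i F i) * (\sum_j G j) = \sum_(k : I * J) F k.1 * G k.2.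
Proof. by rewrite big_distrlr pair_bigA. Qed.

(** * The two lifting steps *)

Section Vinogradov.
Variables (R : realType) (p H M : nat).
Hypotheses (p_pr : prime p) (p5 : (5 <= p)%N).
Hypothesis HM : (3 * H <= M)%N.

Local Notation freq := {ffun 'I_3 -> int}.
Local Notation Q := (p ^ M)%N.
Local Notation grid := {ffun 'I_3 -> 'I_Q}.
Local Notation fsum := (@fsum R p H M).
Local Notation usum := (@usum R p H M).
Local Notation Imom := (@Imom R p H M).
Local Notation apt := (apt p).

Let p0 k : (0 < p ^ k)%N. Proof. by rewrite expn_gt0 prime_gt0. Qed.

Lemma sum_ch_vanish (P : freq -> Prop) (I : finType) (v : I -> freq) (G : grid -> R[i]) :
  (forall u v, P u -> P v -> P (u - v)) ->
  (forall v : freq, (forall i, dvi Q%:Z (v i)) -> P v) ->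
  spectral P G -> (forall i, ~ P (- v i)) ->
  \sum_t (\sum_i ch R (v i) t) * G t = 0.
Proof.
move=> PB PQ SG nP; under eq_bigr do rewrite mulr_suml.
rewrite exchange_big big1// => i _.
by have := spectral_orth (p0 M) PB PQ (nP i) SG; rewrite opprK.
Qed.

Lemma spectral_usum b (eta : int) k : (3 * b <= M)%N ->
  spectral (csupp p b eta) (fun t => (usum b eta t ^+ k)%:C%C).
Proof.
move=> bM.
have := @spectral_nm R Q (csupp p b eta) (@csuppB p b eta)
   (csupp_dvd eta bM) _ (fun z : 'I_(p ^ (H - b)) => mono (apt b eta z)) k.
have h (z : 'I_(p ^ (H - b))) : dvi (p ^ b)%N%:Z (apt b eta z - eta).
  by rewrite /apt addrC addKr dvdz_mulr.
move=> /(_ (fun x y => csupp_mono (h x) (h y))); congr spectral.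
by apply/funext => t; rewrite exprM.
Qed.

Let ndvd_apt a (xi eta : int) w : (0 < a)%N -> ~~ dvi p%:Z (xi - eta) ->
  ~~ dvi p%:Z (apt a xi w - eta).
Proof.
move=> a0; apply: contra => h.
have ha : dvi p%:Z ((p ^ a)%N%:Z * w%:Z).
  by rewrite dvdz_mulr// dvdzE /= dvdn_exp.
by refine (@dvdz_congr _ _ _ _ (rpredB h ha)); rewrite /apt; ring.
Qed.

(** Split f_a into classes modulo p^(3b). The factor |f_b|^10 has all its frequencies in [csupp], so
    a product of two different classes contributes only if (x - eta)^3 and (y - eta)^3 agree modulo
    p^(3b) for some x, y in them. As xi - eta is a unit this forces x and y to agree modulo p^(3b).
    Only the diagonal survives, and it is bounded by its largest term. *)
Lemma Imom1_lift a b (xi eta : int) : (0 < a)%N -> (a <= 3 * b)%N -> (3 * b <= H)%N ->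
  ~~ dvi p%:Z (xi - eta) -> exists w,
  Imom 1 a xi b eta <= (p ^ (3 * b - a))%:R * Imom 1 (3 * b) (apt a xi w) b eta.
Proof.
move=> a0 ab bH ndv; have bM : (3 * b <= M)%N by lia.
have b3 : (0 < 3 * b)%N by exact: leq_trans a0 ab.
pose W := 'I_(p ^ (3 * b - a)).
pose F (w : W) t := fsum (3 * b) (apt a xi w) t.
have E : Imom 1 a xi b eta = \sum_(w : W) Imom 1 (3 * b) (apt a xi w) b eta.
  apply: (@complexI R); rewrite /Imom /moment !rmorph_sum /=.
  under [RHS]eq_bigr do rewrite rmorph_sum /=.
  rewrite [RHS]exchange_big /=.
  transitivity (\sum_t \sum_(w : W) \sum_(w' : W)
      F w t * (F w' t)^*%C * (usum b eta t ^+ 5)%:C%C).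
    apply: eq_bigr => t _; rewrite expr1 rmorphM /= usumE.
    have -> : fsum a xi t = \sum_(w : W) F w t.
      by rewrite (@fsum_split R p H M a (3 * b - a)) subnKC.
    rewrite rmorph_sum big_distrlr mulr_suml /=.
    by apply: eq_bigr => w _; rewrite mulr_suml.
  rewrite exchange_big [RHS]exchange_big /=; apply: eq_bigr => w _.
  rewrite exchange_big (bigD1 w)//= [X in _ + X]big1 ?addr0.
    apply: eq_bigr => t _; rewrite expr1 [RHS]rmorphM; congr (_ * _).
    by rewrite /= usumE.
  move=> w' ww'.
  pose I := 'I_(p ^ (H - 3 * b)).
  pose x (w : W) (z : I) := apt (3 * b) (apt a xi w) z.
  pose v (k : I * I) : freq := mono (x w k.1) - mono (x w' k.2).
  rewrite (eq_bigr (fun t => (\sum_k ch R (v k) t) * (usum b eta t ^+ 5)%:C%C)).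
    apply: (@sum_ch_vanish (csupp p b eta)).
    - exact: csuppB.
    - exact: csupp_dvd.
    - exact: spectral_usum.
    move=> [z z']; rewrite /v /= opprB => -[h1 h2 h3].
    have nx : ~~ dvi p%:Z (x w' z' - eta).
      by apply: ndvd_apt => //; exact: ndvd_apt.
    have cub : dvi (p ^ (3 * b))%N%:Z ((x w' z' - eta) ^+ 3 - (x w z - eta) ^+ 3).
      by refine (@dvdz_congr _ _ _ _ h3); rewrite !ffunE /=; ring.
    have xx : dvi p%:Z (x w' z' - eta - (x w z - eta)).
      have pa : dvi p%:Z (p ^ a)%N%:Z by rewrite dvdzE /= dvdn_exp.
      have pb : dvi p%:Z (p ^ (3 * b))%N%:Z by rewrite dvdzE /= dvdn_exp.
      have -> : x w' z' - eta - (x w z - eta) = (p ^ a)%N%:Z * (w'%:Z - w%:Z)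
          + (p ^ (3 * b))%N%:Z * (z'%:Z - z%:Z) by rewrite /x /apt; ring.
      by rewrite rpredD// dvdz_mulr.
    have hz : dvi (p ^ (3 * b))%N%:Z ((p ^ (3 * b))%N%:Z * (z'%:Z - z%:Z)).
      exact: dvdz_mulr.
    have : dvi (p ^ a * p ^ (3 * b - a))%N%:Z ((p ^ a)%N%:Z * (w'%:Z - w%:Z)).
      rewrite -expnD subnKC//.
      refine (@dvdz_congr _ _ _ _ (rpredB (cube_congruence p_pr p5 nx xx cub) hz)).
      by rewrite /x /apt; ring.
    rewrite PoszM dvdz_mul2l; last by rewrite -lt0n p0.
    by move/(dvdz_lt_eq (ltn_ord _) (ltn_ord _))/val_inj => ww; rewrite ww eqxx in ww'.
  move=> t _; congr (_ * _); rewrite /F /fsum rmorph_sum mulr_sum_pair.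
  by apply: eq_bigr => -[z z'] _; rewrite /v chD chN.
have w0 : W by exists 0%N; exact: p0.
have [w hw] := sum_le_max (fun w : W => Imom 1 (3 * b) (apt a xi w) b eta) w0.
by exists w; rewrite E; move: hw; rewrite card_ord.
Qed.

Let related n := [pred k : ('I_(p ^ n) * 'I_(p ^ n)) * ('I_(p ^ n) * 'I_(p ^ n)) |
  dvi (p ^ n)%N%:Z ((k.1.1)%:Z + (k.1.2)%:Z - (k.2.1)%:Z - (k.2.2)%:Z) &&
  dvi (p ^ n)%N%:Z (((k.1.1)%:Z - (k.2.1)%:Z) * ((k.1.1)%:Z - (k.2.2)%:Z))].

(** The linear congruence determines w2 from the other three, and these are counted by
    [card_mul_divisible] for each value of w1. *)
Lemma card_related n : (#|related n| <= n.+1 * p ^ (2 * n))%N.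
Proof.
pose g (k : ('I_(p ^ n) * 'I_(p ^ n)) * ('I_(p ^ n) * 'I_(p ^ n))) := (k.1.1, k.2).
have ginj : {in related n &, injective g}.
  move=> [[w1 w2] [w3 w4]] [[u1 u2] [u3 u4]].
  rewrite !inE /related /= => /andP[h _] /andP[h' _] [e1 e3 e4]; subst u1 u3 u4.
  congr (_, _, _); apply/val_inj/(dvdz_lt_eq (ltn_ord _) (ltn_ord _)).
  by refine (@dvdz_congr _ _ _ _ (rpredB h h')); ring.
rewrite -(card_in_imset ginj).
pose S := [pred k : 'I_(p ^ n) * ('I_(p ^ n) * 'I_(p ^ n)) |
   dvi (p ^ n)%N%:Z (((k.1)%:Z - (k.2.1)%:Z) * ((k.1)%:Z - (k.2.2)%:Z))].
apply: (@leq_trans #|S|).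
  apply/subset_leq_card/fintype.subsetP => y /imsetP[[[w1 w2] [w3 w4]]].
  by rewrite !inE /related /= => /andP[_ h] ->.
rewrite -sum1_card big_mkcond -(pair_bigA _ (fun i k => if (i, k) \in S then 1 else 0)%N) /=.
have -> : (n.+1 * p ^ (2 * n) = #|'I_(p ^ n)| * (n.+1 * p ^ n))%N.
  by rewrite card_ord mul2n -addnn expnD mulnA mulnC.
rewrite -sum_nat_const; apply: leq_sum => c _.
rewrite -(pair_bigA _ (fun i k => if (c, (i, k)) \in S then 1 else 0)%N) /=.
apply: leq_trans (card_mul_divisible n c p_pr).
apply: leq_sum => i _; apply: leq_sum => j _; rewrite inE /=.
by case: ifP.
Qed.

Lemma amgm4 (a b c d : R) : 4 * (a * b * c * d) <= a ^+ 4 + b ^+ 4 + c ^+ 4 + d ^+ 4.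
Proof.
have h1 := sqr_ge0 (a ^+ 2 - b ^+ 2); have h2 := sqr_ge0 (c ^+ 2 - d ^+ 2).
have h3 := sqr_ge0 (a * b - c * d).
rewrite -subr_ge0.
have -> : a ^+ 4 + b ^+ 4 + c ^+ 4 + d ^+ 4 - 4 * (a * b * c * d) =
  (a ^+ 2 - b ^+ 2) ^+ 2 + (c ^+ 2 - d ^+ 2) ^+ 2 + 2 * (a * b - c * d) ^+ 2 by ring.
by lra.
Qed.

(** Split f_a into classes modulo p^(2b-a). A quadruple of classes can contribute only if the
    quadratic and cubic conditions of [csupp] hold, and these make its offsets [related] modulo p^n
    with n = 2(b-a). By the inequality of the means each remaining quadruple is at most the largest
    pure term, and [card_related] counts them. *)
Lemma Imom2_lift a b (xi eta : int) : (0 < a)%N -> (a <= b)%N -> (2 * b - a <= H)%N ->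
  (3 * b <= M)%N -> ~~ dvi p%:Z (xi - eta) -> exists w,
  Imom 2 a xi b eta <=
  ((2 * (b - a)).+1 * p ^ (4 * (b - a)))%:R * Imom 2 (2 * b - a) (apt a xi w) b eta.
Proof.
move=> a0 ab bH bM ndv.
pose n := (2 * (b - a))%N; pose W := 'I_(p ^ n).
have [an na2b n2a2b] : [/\ a + n = 2 * b - a, n + a <= 2 * b & n + 2 * a <= 2 * b]%N.
  by rewrite /n; clear -a0 ab; split; lia.
have b23 : (2 * b <= 3 * b)%N by rewrite leq_mul2r orbT.
pose F (w : W) t := fsum (2 * b - a) (apt a xi w) t.
pose G t := (usum b eta t ^+ 4)%:C%C.
pose term (k : (W * W) * (W * W)) t :=
  (F k.1.1 t * F k.1.2 t) * ((F k.2.1 t)^*%C * (F k.2.2 t)^*%C) * G t.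
have E : (Imom 2 a xi b eta)%:C%C = \sum_k \sum_t term k t.
  rewrite exchange_big /Imom /moment rmorph_sum /=; apply: eq_bigr => t _.
  rewrite -mulr_suml rmorphM /=; congr (_ * _).
  rewrite rmorphXn /= usumE.
  have -> : fsum a xi t = \sum_(w : W) F w t.
    by rewrite (@fsum_split R p H M a n) an.
  rewrite rmorph_sum exprMn !expr2 mulr_sum_pair [X in _ * X = _]mulr_sum_pair.
  by rewrite mulr_sum_pair.
have V k : ~~ related n k -> \sum_t term k t = 0.
  case: k => -[w1 w2] [w3 w4] nrel.
  pose I := 'I_(p ^ (H - (2 * b - a))).
  pose x (w : W) (z : I) := apt (2 * b - a) (apt a xi w) z.
  pose v (k : (I * I) * (I * I)) : freq :=
    (mono (x w1 k.1.1) + mono (x w2 k.1.2)) + (- mono (x w3 k.2.1) - mono (x w4 k.2.2)).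
  rewrite (eq_bigr (fun t => (\sum_k ch R (v k) t) * G t)).
    apply: (@sum_ch_vanish (csupp p b eta)).
    - exact: csuppB.
    - exact: csupp_dvd.
    - exact: spectral_usum.
    move=> [[z1 z2] [z3 z4]]; rewrite /v /= => -[h1 h2 h3].
    move: nrel => /negP; apply.
    pose r (w : W) (z : I) : int := w%:Z + (p ^ n)%N%:Z * z%:Z.
    pose nu := xi - eta.
    have xE w z : x w z = eta + nu + (p ^ a)%N%:Z * r w z.
      have pE : (p ^ (2 * b - a))%N%:Z = (p ^ a)%N%:Z * (p ^ n)%N%:Z by rewrite -an expnD.
      by rewrite /x /apt /r /nu pE; ring.
    have h2' : dvi (p ^ n)%N%:Z (2 * nu * (r w1 z1 + r w2 z2 - r w3 z3 - r w4 z4)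
        + (p ^ a)%N%:Z * (r w1 z1 ^+ 2 + r w2 z2 ^+ 2 - r w3 z3 ^+ 2 - r w4 z4 ^+ 2)).
      have : dvi (p ^ (n + a))%N%:Z ((2 * nu * (r w1 z1 + r w2 z2 - r w3 z3 - r w4 z4)
        + (p ^ a)%N%:Z * (r w1 z1 ^+ 2 + r w2 z2 ^+ 2 - r w3 z3 ^+ 2 - r w4 z4 ^+ 2))
        * (p ^ a)%N%:Z).
        apply: (@dvdz_trans (p ^ (2 * b))%N%:Z).
          by rewrite dvdzE /= dvdn_exp2l.
        refine (@dvdz_congr _ _ _ _ (dvdz_mull (-1) h2)).
        rewrite !ffunE /= !xE.
        move: (r w1 z1) (r w2 z2) (r w3 z3) (r w4 z4) (p ^ a)%N%:Z => *; ring.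
      by rewrite expnD PoszM dvdz_mul2r// -lt0n p0.
    have h3' : dvi (p ^ n)%N%:Z (3 * nu * (r w1 z1 ^+ 2 + r w2 z2 ^+ 2 - r w3 z3 ^+ 2 - r w4 z4 ^+ 2)
        + 2 * (p ^ a)%N%:Z * (r w1 z1 ^+ 3 + r w2 z2 ^+ 3 - r w3 z3 ^+ 3 - r w4 z4 ^+ 3)).
      have : dvi (p ^ (n + 2 * a))%N%:Z ((3 * nu * (r w1 z1 ^+ 2 + r w2 z2 ^+ 2 - r w3 z3 ^+ 2 - r w4 z4 ^+ 2)
        + 2 * (p ^ a)%N%:Z * (r w1 z1 ^+ 3 + r w2 z2 ^+ 3 - r w3 z3 ^+ 3 - r w4 z4 ^+ 3))
        * (p ^ (2 * a))%N%:Z).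
        (* Twice the cubic relation minus 3 nu times the quadratic one eliminates the linear term
           and is divisible by p^(2a). The quadratic relation limits the modulus to p^(2b), of which
           p^n remains after division. *)
        have h3b := dvdz_trans (_ : dvi (p ^ (2 * b))%N%:Z (p ^ (3 * b))%N%:Z) h3.
        have {}h3b := h3b (ltac:(by rewrite dvdzE /= dvdn_exp2l)).
        apply: (@dvdz_trans (p ^ (2 * b))%N%:Z).
          by rewrite dvdzE /= dvdn_exp2l.
        refine (@dvdz_congr _ _ _ _ (rpredB (dvdz_mull (- 2) h3b) (dvdz_mull (- 3 * nu) h2))).
        have -> : (p ^ (2 * a))%N%:Z = (p ^ a)%N%:Z ^+ 2 by rewrite -PoszX -expnM mulnC.
        rewrite !ffunE /= !xE.
        move: (r w1 z1) (r w2 z2) (r w3 z3) (r w4 z4) (p ^ a)%N%:Z => *; ring.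
      by rewrite expnD PoszM dvdz_mul2r// -lt0n p0.
    have [] := pair_congruence p_pr p5 a0 ndv h2' h3'.
    rewrite /related /= => g1 g2; apply/andP; split.
      have hz : dvi (p ^ n)%N%:Z ((p ^ n)%N%:Z * (z1%:Z + z2%:Z - z3%:Z - z4%:Z)).
        exact: dvdz_mulr.
      by refine (@dvdz_congr _ _ _ _ (rpredB g1 hz)); rewrite /r; ring.
    have hz : dvi (p ^ n)%N%:Z ((p ^ n)%N%:Z * ((z1%:Z - z3%:Z) * (r w1 z1 - r w4 z4)
        + (w1%:Z - w3%:Z) * (z1%:Z - z4%:Z))).
      exact: dvdz_mulr.
    by refine (@dvdz_congr _ _ _ _ (rpredB g2 hz)); rewrite /r; ring.
  move=> t _; congr (_ * _); rewrite /F /fsum /= !rmorph_sum !mulr_sum_pair.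
  apply: eq_bigr => -[[z1 z2] [z3 z4]] _ /=; by rewrite /v /= !chD !chN.
have w0 : W by exists 0%N; exact: p0.
case: (@arg_maxP _ _ _ w0 xpredT (fun w : W => Imom 2 (2 * b - a) (apt a xi w) b eta) isT).
move=> w _ wM; exists w; set Y := Imom 2 (2 * b - a) _ b eta in wM *.
have Y0 : 0 <= Y by apply: moment_ge0 => t; exact: usum_ge0.
have K k : nm (\sum_t term k t) <= Y.
  case: k => -[w1 w2] [w3 w4]; apply: le_trans (nm_sum _ _ _) _.
  have B t : nm (term (w1, w2, (w3, w4)) t) <= 4^-1 *
    (usum (2 * b - a) (apt a xi w1) t ^+ 2 * usum b eta t ^+ 4
     + usum (2 * b - a) (apt a xi w2) t ^+ 2 * usum b eta t ^+ 4
     + usum (2 * b - a) (apt a xi w3) t ^+ 2 * usum b eta t ^+ 4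
     + usum (2 * b - a) (apt a xi w4) t ^+ 2 * usum b eta t ^+ 4).
    rewrite /term /= !nmM !nm_conj nm_real ger0_norm; last exact/exprn_ge0/usum_ge0.
    have g0 : 0 <= usum b eta t ^+ 4 by exact/exprn_ge0/usum_ge0.
    move: (usum b eta t ^+ 4) g0 => g g0; rewrite /usum -!exprM /= -/(F w1 t) -/(F w2 t) -/(F w3 t) -/(F w4 t).
    by have := ler_wpM2r g0 (amgm4 (nm (F w1 t)) (nm (F w2 t)) (nm (F w3 t)) (nm (F w4 t))); lra.
  apply: le_trans (ler_sum _ (fun t _ => B t)) _.
  rewrite -mulr_sumr !big_split /=.
  have := wM w1 isT; have := wM w2 isT; have := wM w3 isT; have := wM w4 isT.
  rewrite /Imom /moment /=; lra.
have -> : Imom 2 a xi b eta = nm ((Imom 2 a xi b eta)%:C%C).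
  by rewrite nm_real ger0_norm// moment_ge0// => t; exact: usum_ge0.
rewrite E (bigID (related n))/= [X in _ + X]big1 ?addr0; last by move=> k; exact: V.
apply: le_trans (nm_sum _ _ _) _.
apply: le_trans (ler_sum _ (fun k _ => K k)) _.
apply: (@le_trans _ _ (#|related n|%:R * Y)); first by rewrite mulr_natl -sumr_const.
apply: ler_wpM2r => //; rewrite ler_nat.
apply: leq_trans (card_related n) _; by rewrite /n mulnA.
Qed.

End Vinogradov.

(** * The Vinogradov system in twelve variables *)

Definition vinogradov_system N (xy : {ffun 'I_6 -> 'I_N} * {ffun 'I_6 -> 'I_N}) : bool :=
  [forall i : 'I_3, \sum_l (xy.1 l : nat)%:Z ^+ i.+1 == \sum_l (xy.2 l : nat)%:Z ^+ i.+1].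

Definition vinogradov_count N : nat := #|[pred xy | @vinogradov_system N xy]|.

Lemma forall_ord3 (P : pred 'I_3) : [forall i, P i] = [&& P o0, P o1 & P o2].
Proof.
apply/forallP/and3P => [H|[h0 h1 h2] i]; first by split; exact: H.
case: (unliftP o0 i) => [j ->|->//]; case: (unliftP ord0 j) => [k ->|->//].
case: (unliftP ord0 k) => [[]//|->]; apply: etrans h2; congr P; exact/val_inj.
Qed.

Lemma dvdz_small (q n : int) : dvi q n -> (`|n| < `|q|)%N -> n = 0.
Proof.
move=> /dvdzP[k ->]; rewrite abszM => h.
have k0 : `|k|%N = 0%N by nia.
by move/eqP: k0; rewrite absz_eq0 => /eqP ->; rewrite mul0r.
Qed.

(** Translation-dilation invariance. The differences of power sums, multiplied by c^j, are smaller
    than Q, so that the congruences become equalities in the order of the degrees: each degree in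
    turn is freed of the lower ones by the binomial theorem. *)
Lemma affine_system (Q N c : nat) (xi : int)
    (xy : {ffun 'I_6 -> 'I_N} * {ffun 'I_6 -> 'I_N}) :
  (0 < c)%N -> (6 * (c * N) ^ 3 < Q)%N ->
  [forall i, dvi Q%:Z ((\sum_l mono (xi + c%:Z * (xy.1 l : nat)%:Z)
     - \sum_l mono (xi + c%:Z * (xy.2 l : nat)%:Z)) i)] = vinogradov_system xy.
Proof.
case: xy => x y c0 NQ /=.
pose s j : int := \sum_l (x l : nat)%:Z ^+ j - \sum_l (y l : nat)%:Z ^+ j.
have sP j : (`|s j| <= 6 * N ^ j)%N.
  have b (z : {ffun 'I_6 -> 'I_N}) : 0 <= \sum_l (z l : nat)%:Z ^+ j <= (6 * N ^ j)%N%:Z.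
    apply/andP; split; first by apply: sumr_ge0 => l _; exact: exprn_ge0.
    apply: (@le_trans _ _ (\sum_(l < 6) (N ^ j)%N%:Z)).
      apply: ler_sum => l _; rewrite PoszX; apply: lerXn2r; rewrite ?nnegrE//.
      by rewrite lez_nat ltnW.
    by rewrite sumr_const card_ord PoszM -mulr_natl.
  move: (b x) (b y); rewrite /s; move: (\sum_l _) (\sum_l _) (6 * _)%N => u v w; lia.
have bound j : (j < 4)%N -> (`|((c ^ j)%N%:Z * s j)%R| < Q)%N.
  move=> j4; apply: leq_ltn_trans NQ; rewrite abszM /= mulnC.
  apply: (leq_trans (leq_mul (sP j) (leqnn _))); rewrite -mulnA -expnMn leq_mul2l /=.
  have N0 : (0 < N)%N by apply: leq_ltn_trans (ltn_ord (x ord0)).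
  by rewrite mulnC leq_pexp2l// muln_gt0 c0.
have E (i : 'I_3) : (\sum_l mono (xi + c%:Z * (x l : nat)%:Z)
     - \sum_l mono (xi + c%:Z * (y l : nat)%:Z)) i =
  \sum_l (xi + c%:Z * (x l : nat)%:Z) ^+ i.+1 - \sum_l (xi + c%:Z * (y l : nat)%:Z) ^+ i.+1.
  by rewrite !ffunE !sum_ffunE; congr (_ - _); apply: eq_bigr => l _; rewrite ffunE.
have P1 (z : {ffun 'I_6 -> 'I_N}) : \sum_l (xi + c%:Z * (z l : nat)%:Z) ^+ 1 =
  6 * xi + c%:Z * \sum_l (z l : nat)%:Z ^+ 1.
  rewrite (eq_bigr (fun l => xi + c%:Z * (z l : nat)%:Z ^+ 1)) => [|l _]; last by rewrite !expr1.
  by rewrite big_split -mulr_sumr sumr_const card_ord /=; ring.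
have P2 (z : {ffun 'I_6 -> 'I_N}) : \sum_l (xi + c%:Z * (z l : nat)%:Z) ^+ 2 =
  6 * xi ^+ 2 + 2 * xi * c%:Z * (\sum_l (z l : nat)%:Z ^+ 1)
   + (c ^ 2)%N%:Z * \sum_l (z l : nat)%:Z ^+ 2.
  rewrite (eq_bigr (fun l => xi ^+ 2 + 2 * xi * c%:Z * (z l : nat)%:Z ^+ 1
     + (c ^ 2)%N%:Z * (z l : nat)%:Z ^+ 2)) => [|l _]; last by rewrite PoszX; ring.
  by rewrite !big_split -!mulr_sumr sumr_const card_ord /=; ring.
have P3 (z : {ffun 'I_6 -> 'I_N}) : \sum_l (xi + c%:Z * (z l : nat)%:Z) ^+ 3 =
  6 * xi ^+ 3 + 3 * xi ^+ 2 * c%:Z * (\sum_l (z l : nat)%:Z ^+ 1)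
   + 3 * xi * (c ^ 2)%N%:Z * (\sum_l (z l : nat)%:Z ^+ 2)
   + (c ^ 3)%N%:Z * \sum_l (z l : nat)%:Z ^+ 3.
  rewrite (eq_bigr (fun l => xi ^+ 3 + 3 * xi ^+ 2 * c%:Z * (z l : nat)%:Z ^+ 1
     + 3 * xi * (c ^ 2)%N%:Z * (z l : nat)%:Z ^+ 2
     + (c ^ 3)%N%:Z * (z l : nat)%:Z ^+ 3)) => [|l _]; last by rewrite !PoszX; ring.
  by rewrite !big_split -!mulr_sumr sumr_const card_ord /=; ring.
rewrite /vinogradov_system !forall_ord3 !E /= !P1 !P2 !P3.
have E1 : 6 * xi + c%:Z * \sum_l (x l : nat)%:Z ^+ 1
   - (6 * xi + c%:Z * \sum_l (y l : nat)%:Z ^+ 1) = (c ^ 1)%N%:Z * s 1%N.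
  by rewrite /s expn1; ring.
have eqs j : (\sum_l (x l : nat)%:Z ^+ j == \sum_l (y l : nat)%:Z ^+ j) = (s j == 0).
  by rewrite /s subr_eq0.
rewrite E1 !eqs -[(bump 0 0).+1]/2%N -[(bump 0 (bump 0 0)).+1]/3%N.
have cj j : (c ^ j)%N%:Z != 0 by rewrite -lt0n expn_gt0 c0.
apply/and3P/and3P.
  move=> [h1 h2 h3].
  have s1 : s 1%N = 0.
    have /eqP := dvdz_small h1 (bound 1%N isT).
    by rewrite mulf_eq0 (negPf (cj 1%N)) => /eqP.
  have s1' : \sum_l (x l : nat)%:Z ^+ 1 = \sum_l (y l : nat)%:Z ^+ 1.
    by apply/eqP; rewrite -subr_eq0 -/(s 1%N) s1.
  have s2 : s 2 = 0.
    have h2' : dvi Q%:Z ((c ^ 2)%N%:Z * s 2).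
      by refine (@dvdz_congr _ _ _ _ h2); rewrite s1' /s; ring.
    have /eqP := dvdz_small h2' (bound 2 isT).
    by rewrite mulf_eq0 (negPf (cj 2)) => /eqP.
  have s2' : \sum_l (x l : nat)%:Z ^+ 2 = \sum_l (y l : nat)%:Z ^+ 2.
    by apply/eqP; rewrite -subr_eq0 -/(s 2) s2.
  have s3 : s 3 = 0.
    have h3' : dvi Q%:Z ((c ^ 3)%N%:Z * s 3).
      by refine (@dvdz_congr _ _ _ _ h3); rewrite s1' s2' /s; ring.
    have /eqP := dvdz_small h3' (bound 3 isT).
    by rewrite mulf_eq0 (negPf (cj 3)) => /eqP.
  by rewrite s1 s2 s3.
move=> [/eqP s1 /eqP s2 /eqP s3]; rewrite s1 mulr0 dvdz0; split => //.
- rewrite (_ : _ - _ = 2 * xi * c%:Z * s 1%N + (c ^ 2)%N%:Z * s 2); last by rewrite /s; ring.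
  by rewrite s1 s2 !mulr0 addr0 dvdz0.
- rewrite (_ : _ - _ = 3 * xi ^+ 2 * c%:Z * s 1%N + 3 * xi * (c ^ 2)%N%:Z * s 2
    + (c ^ 3)%N%:Z * s 3); last by rewrite /s; ring.
  by rewrite s1 s2 s3 !mulr0 !addr0 dvdz0.
Qed.

Lemma affine_mean_value (R : realType) (Q N c : nat) (xi : int) :
  (0 < c)%N -> (6 * (c * N) ^ 3 < Q)%N ->
  \sum_(t : {ffun 'I_3 -> 'I_Q})
    nm (\sum_(z < N) ch R (mono (xi + c%:Z * z%:Z)) t) ^+ 12 =
  Q%:R ^+ 3 * (vinogradov_count N)%:R.
Proof.
move=> c0 NQ; have Q0 : (0 < Q)%N by exact: leq_ltn_trans NQ.
rewrite -[12%N]/(2 * 6)%N (mean_value_count R Q0 (fun z : 'I_N => mono (xi + c%:Z * z%:Z))).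
congr (_ * _%:R); apply: eq_card => xy; rewrite !inE.
exact: affine_system.
Qed.

Lemma vinogradov_count_trivial N : (vinogradov_count N <= N ^ 12)%N.
Proof.
apply: leq_trans (max_card _) _.
by rewrite card_prod !card_ffun !card_ord -expnD.
Qed.

Ltac nneg := repeat first [ assumption | by [] | by apply: ltW | apply: divr_ge0
  | apply: mulr_ge0 | apply: exprn_ge0 | apply: addr_ge0 ].

(** * The recursion over the scales *)

Section Recursion.
Variables (R : realType) (p H : nat).
Hypotheses (p_pr : prime p) (p5 : (5 <= p)%N).
Local Notation M := (3 * H + 2)%N.
Local Notation Q := (p ^ M)%N.
Local Notation Imom := (@Imom R p H M).
Local Notation apt := (apt p).
Local Notation J := vinogradov_count.

Variable C : R.
Hypothesis C0 : 0 <= C.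
Hypothesis IH : forall h, (h < H)%N -> (J (p ^ h))%:R <= C * p%:R ^+ (6 * h) * 64 ^+ h.

Let P : R := p%:R.
Let P0 : 0 < P. Proof. by rewrite ltr0n prime_gt0. Qed.
Let P1 : 1 <= P. Proof. by rewrite ler1n prime_gt0. Qed.
Let HM : (3 * H <= M)%N. Proof. by rewrite leq_addr. Qed.

Definition vbound : R := Q%:R ^+ 3 * C * P ^+ (6 * H) * 64 ^+ H.
Local Notation B := vbound.

Lemma vbound_ge0 : 0 <= B.
Proof. by rewrite !mulr_ge0 ?exprn_ge0. Qed.

(** The summand 2 in [M] is there for this inequality: p^2 exceeds 6. *)
Lemma modulus_large a : (a <= H)%N -> (6 * (p ^ a * p ^ (H - a)) ^ 3 < Q)%N.
Proof.
move=> aH; rewrite -expnD subnKC// -expnM mulnC expnD (mulnC H).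
have : (6 < p ^ 2)%N by apply: leq_trans (_ : 5 ^ 2 <= _)%N; rewrite ?leq_exp2r.
by rewrite ltn_pmul2l// expn_gt0 prime_gt0.
Qed.

Lemma usum6 a xi : (a <= H)%N ->
  \sum_t @usum R p H M a xi t ^+ 6 = Q%:R ^+ 3 * (J (p ^ (H - a)))%:R.
Proof.
move=> aH; rewrite -(affine_mean_value R xi _ (modulus_large aH)) ?expn_gt0 ?prime_gt0//.
by apply: eq_bigr => t _; rewrite /usum -exprM.
Qed.

(** The induction hypothesis at H - a saves 64^a = 2^(6a) over what scaling predicts. Every gain in
    the recursion stems from this factor. *)
Lemma usum6_bound a xi : (0 < a <= H)%N ->
  \sum_t @usum R p H M a xi t ^+ 6 <= B / (P ^+ (6 * a) * 2 ^+ (6 * a)).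
Proof.
move=> /andP[a0 aH]; rewrite usum6//.
have Ha : (H - a < H)%N by rewrite ltn_subrL a0 (leq_trans a0 aH).
have := IH Ha; rewrite -/P => h.
rewrite ler_pdivlMr ?mulr_gt0 ?exprn_gt0// /vbound.
have E1 : P ^+ (6 * H) = P ^+ (6 * (H - a)) * P ^+ (6 * a).
  by rewrite -exprD -mulnDr subnK.
have E2 : (64 : R) ^+ H = 64 ^+ (H - a) * 2 ^+ (6 * a).
  by rewrite (exprM 2 6 a) (_ : (2 : R) ^+ 6 = 64) -?exprD ?subnK//; ring.
rewrite E1 E2.
have -> : Q%:R ^+ 3 * C * (P ^+ (6 * (H - a)) * P ^+ (6 * a)) * (64 ^+ (H - a) * 2 ^+ (6 * a))
 = Q%:R ^+ 3 * (C * P ^+ (6 * (H - a)) * 64 ^+ (H - a)) * (P ^+ (6 * a) * 2 ^+ (6 * a)) by ring.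
by rewrite ler_pM2r ?mulr_gt0 ?exprn_gt0// ler_wpM2l ?exprn_ge0.
Qed.

Lemma Imom_ge0 m a xi b eta : 0 <= Imom m a xi b eta.
Proof. by apply: moment_ge0 => t; exact: usum_ge0. Qed.

Lemma Imom0_bound a xi b eta : (0 < b <= H)%N ->
  Imom 0 a xi b eta <= B / (P ^+ (6 * b) * 2 ^+ (6 * b)).
Proof.
move=> bH; apply: le_trans (usum6_bound eta bH).
by apply: ler_sum => t _; rewrite mul1r.
Qed.

Lemma Imom_rev m a xi b eta : (m <= 6)%N -> Imom m a xi b eta = Imom (6 - m) b eta a xi.
Proof. exact: moment_rev. Qed.

Lemma Imom2_base a xi b eta : (0 < a)%N -> (a <= b)%N -> (b <= H)%N ->
  Imom 2 a xi b eta <= B / P ^+ (2 * a + 4 * b).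
Proof.
move=> a0 ab bH.
have h : Imom 2 a xi b eta ^+ 3 <= Imom 0 a xi b eta ^+ 2 * Imom 6 a xi b eta.
  by apply: moment_2_0_6 => t; exact: usum_ge0.
have weak k : B / (P ^+ k * 2 ^+ k) <= B / P ^+ k.
  rewrite ler_wpM2l ?vbound_ge0// lef_pV2 ?posrE ?mulr_gt0 ?exprn_gt0//.
  by rewrite ler_peMr ?exprn_ge0 ?exprn_ege1 ?ler1n// ltW.
have b0 : (0 < b)%N by exact: leq_trans ab.
have h0 : Imom 0 a xi b eta <= B / P ^+ (6 * b).
  by apply: le_trans (weak _); apply: Imom0_bound; rewrite b0.
have h6 : Imom 6 a xi b eta <= B / P ^+ (6 * a).
  apply: le_trans (weak _); rewrite Imom_rev// subnn; apply: Imom0_bound.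
  by rewrite a0 (leq_trans ab).
have B0 := vbound_ge0; rewrite -(@ler_pXn2r _ 3)// ?nnegrE ?Imom_ge0//; last by nneg.
apply: le_trans h _.
have -> : (B / P ^+ (2 * a + 4 * b)) ^+ 3 = (B / P ^+ (6 * b)) ^+ 2 * (B / P ^+ (6 * a)).
  have -> : P ^+ (2 * a + 4 * b) = (P ^+ a) ^+ 2 * (P ^+ b) ^+ 4.
    by rewrite exprD -!exprM !(mulnC _ a) !(mulnC _ b).
  rewrite !(mulnC 6%N) !exprM; field.
  by rewrite !expf_neq0// gt_eqF.
apply: ler_pM; rewrite ?exprn_ge0 ?Imom_ge0//.
by apply: lerXn2r; rewrite ?nnegrE ?Imom_ge0//; nneg.
Qed.

(** One round, with the powers as indeterminates: al = p^a, de = p^d with d = b - a, s = 2^(na), t =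
    2^(nd), sg = 2^a, ta = 2^d. The letters stand for X = I_2(a,b), Z = I_2(2b-a,b), V =
    I_1(2b-a,b), W = I_2(b,2b-a), T = I_1(3b,b), E = I_0(3b,b), F = I_2(b,3b). Twelfth powers clear
    the exponents 1/3 and 1/4. The polynomial factors combine to b^24, the same power as in (108
    b^2)^12, and the constant 108 is consistent because 2^20 3^4 108^6 <= 108^12. *)
Lemma congruencing_algebra (a d s t sg ta al de X Z V W T E F : R) :
  1 <= a -> 0 <= d -> 0 < al -> 0 < de -> 0 < s -> 0 < t -> 1 <= sg -> 0 < ta ->
  0 <= X -> 0 <= Z -> 0 <= V -> 0 <= W -> 0 <= T -> 0 <= E -> 0 <= F ->
  X <= (2 * d + 1) * de ^+ 4 * Z -> Z ^+ 3 <= V ^+ 2 * W -> V <= al ^+ 2 * de * T ->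
  T ^+ 4 <= E ^+ 3 * F ->
  E <= B / (al ^+ 6 * de ^+ 6 * sg ^+ 6 * ta ^+ 6) ->
  F <= 108 * (3 * (a + d)) ^+ 2 * B / (al ^+ 14 * de ^+ 14 * s ^+ 8 * t ^+ 8) ->
  W <= 108 * (a + 2 * d) ^+ 2 * B / (al ^+ 6 * de ^+ 10 * s ^+ 2 * t ^+ 5) ->
  X <= 108 * (a + d) ^+ 2 * B / (al ^+ 6 * de ^+ 4 * s ^+ 2 * t ^+ 3 * sg ^+ 2 * ta ^+ 3).
Proof.
move=> a1 d0 al0 de0 s0 t0 sg1 ta0 X0 Z0 V0 W0 T0 E0 F0 hX hZ hV hT hE hF hW.
have B0 := vbound_ge0.
have sg0 : 0 < sg by apply: lt_le_trans sg1.
have a0 : 0 < a by apply: lt_le_trans a1.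
set b := a + d; have b0 : 0 < b by rewrite ltr_wpDr.
have pw (x y : R) n : 0 <= x -> x <= y -> x ^+ n <= y ^+ n.
  by move=> x0 xy; rewrite lerXn2r ?nnegrE// (le_trans x0).
set G := B ^+ 12 / (al ^+ 72 * de ^+ 48 * s ^+ 24 * t ^+ 36 * sg ^+ 24 * ta ^+ 36).
have G0 : 0 <= G by rewrite divr_ge0 ?exprn_ge0// !mulr_ge0 ?exprn_ge0 ?ltW.
set e := B / _ in hE; set f := _ / _ in hF; set w := _ / _ in hW.
have step1 : X ^+ 12 <= ((2 * d + 1) * de ^+ 4) ^+ 12 * ((al ^+ 2 * de) ^+ 8 *
    (e ^+ 6 * f ^+ 2) * w ^+ 4).
  apply: le_trans (pw _ _ 12 X0 hX) _; rewrite exprMn ler_wpM2l//.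
    by nneg.
  rewrite (exprM Z 3 4); apply: le_trans (pw _ _ 4 (exprn_ge0 _ Z0) hZ) _.
  rewrite exprMn -exprM; apply: ler_pM; rewrite ?exprn_ge0// ?pw//.
  apply: le_trans (pw _ _ 8 V0 hV) _; rewrite exprMn ler_wpM2l//.
    by nneg.
  rewrite (exprM T 4 2); apply: le_trans (pw _ _ 2 (exprn_ge0 _ T0) hT) _.
  by rewrite exprMn -exprM; apply: ler_pM; rewrite ?exprn_ge0// ?pw.
rewrite -(@ler_pXn2r _ 12)// ?nnegrE//; last first.
  by nneg.
apply: le_trans step1 _.
have -> : ((2 * d + 1) * de ^+ 4) ^+ 12 * ((al ^+ 2 * de) ^+ 8 * (e ^+ 6 * f ^+ 2) * w ^+ 4)
  = ((2 * d + 1) ^+ 12 * (108 * (3 * b) ^+ 2) ^+ 2 * (108 * (a + 2 * d) ^+ 2) ^+ 4) *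
     (sg ^+ 12)^-1 * G.
  rewrite /e /f /w /G -/b; field.
  by rewrite !gt_eqF.
have -> : (108 * b ^+ 2 * B / (al ^+ 6 * de ^+ 4 * s ^+ 2 * t ^+ 3 * sg ^+ 2 * ta ^+ 3)) ^+ 12
  = (108 * b ^+ 2) ^+ 12 * G.
  rewrite /G; field.
  by rewrite !gt_eqF.
apply: ler_wpM2r => //.
apply: (@le_trans _ _ ((2 * d + 1) ^+ 12 * (108 * (3 * b) ^+ 2) ^+ 2 * (108 * (a + 2 * d) ^+ 2) ^+ 4)).
  apply: ler_piMr; last by rewrite invf_le1 ?exprn_ege1 ?exprn_gt0.
  by nneg.
apply: (@le_trans _ _ ((2 * b) ^+ 12 * (108 * (3 * b) ^+ 2) ^+ 2 * (108 * (2 * b) ^+ 2) ^+ 4)).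
  have h1 : 2 * d + 1 <= 2 * b by rewrite /b; lra.
  have h2 : a + 2 * d <= 2 * b by rewrite /b; lra.
  apply: ler_pM; [nneg|nneg| |].
    by apply: ler_wpM2r; [nneg|apply: (pw _ _ 12) => //; nneg].
  apply: (pw _ _ 4); first by nneg.
  by apply: ler_wpM2l => //; apply: (pw _ _ 2) => //; nneg.
have -> : (2 * b) ^+ 12 * (108 * (3 * b) ^+ 2) ^+ 2 * (108 * (2 * b) ^+ 2) ^+ 4 =
  (2 ^+ 20 * 3 ^+ 4 * 108 ^+ 6) * b ^+ 24 by ring.
have -> : (108 * b ^+ 2) ^+ 12 = 108 ^+ 12 * b ^+ 24 by ring.
by apply: ler_wpM2r; [rewrite exprn_ge0// ltW|lra].
Qed.

(** One round lifts [a] to 2b - a, interpolates, lifts to 3b, interpolates again, and ends with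
    I_2(b, 2b-a) and I_2(b, 3b), to which the induction applies. The fresh gain of a round is the
    factor 2^(6b) saved in I_0(3b, b); over n rounds the gains accumulate to 2^(n(3b-a)). Since the
    larger exponent at most triples in a round, 3^n b <= H leaves room for all of them. *)
Lemma Imom2_bound n a b xi eta : (0 < a)%N -> (a <= b)%N -> (3 ^ n * b <= H)%N ->
  ~~ dvi p%:Z (xi - eta) ->
  Imom 2 a xi b eta <=
  108 * b%:R ^+ 2 * B / (P ^+ (2 * a + 4 * b) * 2 ^+ (n * (3 * b - a))).
Proof.
have B0 := vbound_ge0.
elim: n a b xi eta => [|n IHn] a b xi eta a0 ab bH ndv.
  rewrite mul0n expr0 mulr1; rewrite expn0 mul1n in bH.
  apply: le_trans (Imom2_base xi eta a0 ab bH) _.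
  apply: ler_wpM2r; first by rewrite invr_ge0 exprn_ge0// ltW.
  apply: ler_peMl => //.
  have : 1 <= b%:R :> R by rewrite ler1n (leq_trans a0).
  by move=> b1; have : 1 <= b%:R ^+ 2 :> R by [rewrite exprn_ege1]; lra.
have [d bE] : exists d, b = (a + d)%N by exists (b - a)%N; rewrite subnKC.
have bH' : (3 ^ n * (3 * b) <= H)%N by rewrite mulnA -expnSr.
have b3H : (3 * b <= H)%N.
  by apply: leq_trans bH'; rewrite leq_pmull// expn_gt0.
have bH3 : (3 ^ n * b <= H)%N.
  by apply: leq_trans bH'; rewrite leq_mul2l; apply/orP; right; lia.
have [[b0 e1 e2] [e3 e4 e5]] : [/\ (0 < b)%N, (2 * b - a = a + 2 * d)%N & (2 * b - a <= 3 * b)%N] /\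
   [/\ (b <= 3 * b)%N, (b <= 2 * b - a)%N & (0 < 2 * b - a)%N].
  by rewrite bE; clear -a0; split; split; lia.
have bM : (3 * b <= M)%N by apply: leq_trans HM; apply: leq_trans b3H _; rewrite leq_pmull.
have [w1 hX] := Imom2_lift R p_pr p5 a0 ab (leq_trans e2 b3H) bM ndv.
have ndva a' x w : (0 < a')%N -> ~~ dvi p%:Z (x - eta) -> ~~ dvi p%:Z (apt a' x w - eta).
  move=> a'0; apply: contra => h.
  have ha : dvi p%:Z ((p ^ a')%N%:Z * w%:Z) by rewrite dvdz_mulr// dvdzE /= dvdn_exp.
  by refine (@dvdz_congr _ _ _ _ (rpredB h ha)); rewrite /apt; ring.
have ndv1 := ndva a xi w1 a0 ndv.
have [w2 hV] := Imom1_lift R p_pr p5 HM e5 e2 b3H ndv1.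
have ndv2 := ndva _ _ w2 e5 ndv1.
have sym x : ~~ dvi p%:Z (x - eta) -> ~~ dvi p%:Z (eta - x).
  apply: contra => h; refine (@dvdz_congr _ _ _ _ (dvdz_mull (-1) h)); ring.
set x1 := apt a xi w1 in hX hV ndv1 ndv2 *.
set x2 := apt (2 * b - a) x1 w2 in hV ndv2.
have hZ : Imom 2 (2 * b - a) x1 b eta ^+ 3 <=
    Imom 1 (2 * b - a) x1 b eta ^+ 2 * Imom 2 b eta (2 * b - a) x1.
  rewrite (Imom_rev b eta) //; by apply: moment_2_1_4 => t; exact: usum_ge0.
have hT : Imom 1 (3 * b) x2 b eta ^+ 4 <=
    Imom 0 (3 * b) x2 b eta ^+ 3 * Imom 2 b eta (3 * b) x2.
  rewrite (Imom_rev b eta) //; by apply: moment_1_0_4 => t; exact: usum_ge0.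
have hE : Imom 0 (3 * b) x2 b eta <= B / (P ^+ (6 * b) * 2 ^+ (6 * b)).
  by apply: Imom0_bound; rewrite b0 (leq_trans e3).
have hF := IHn b (3 * b)%N eta x2 b0 e3 bH' (sym _ ndv2).
have b2H : (3 ^ n * (2 * b - a) <= H)%N.
  by apply: leq_trans bH'; rewrite leq_mul2l e2 orbT.
have hW := IHn b (2 * b - a)%N eta x1 b0 e4 b2H (sym _ ndv1).
pose al := P ^+ a; pose de := P ^+ d.
pose s : R := 2 ^+ (n * a); pose t : R := 2 ^+ (n * d).
pose sg : R := 2 ^+ a; pose ta : R := 2 ^+ d.
have pX (x : R) i j : x ^+ (i * a + j * d) = (x ^+ a) ^+ i * (x ^+ d) ^+ j.
  by rewrite exprD -!exprM !(mulnC a) !(mulnC d).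
have pXn i j : (2 : R) ^+ (n * (i * a + j * d)) = s ^+ i * t ^+ j.
  rewrite /s /t -!exprM -exprD; congr (_ ^+ _); ring.
have -> : P ^+ (2 * a + 4 * b) * 2 ^+ (n.+1 * (3 * b - a)) =
  al ^+ 6 * de ^+ 4 * s ^+ 2 * t ^+ 3 * sg ^+ 2 * ta ^+ 3.
  have -> : (2 * a + 4 * b = 6 * a + 4 * d)%N by rewrite bE; ring.
  have -> : (3 * b - a = 2 * a + 3 * d)%N by rewrite bE; clear; lia.
  rewrite (_ : 2 ^+ (n.+1 * _) = 2 ^+ (2 * a + 3 * d) * 2 ^+ (n * (2 * a + 3 * d))); last first.
    by rewrite -exprD -mulSn.
  by rewrite pXn !pX /al /de /sg /ta; ring.
have -> : b%:R = a%:R + d%:R :> R by rewrite bE natrD.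
apply: (@congruencing_algebra a%:R d%:R s t sg ta al de (Imom 2 a xi b eta) _ _ _ _ _ _ _ _ _ _ _ _ _ _ _ _ _ _ _ _ _ _ hZ _ hT); rewrite ?Imom_ge0 ?exprn_gt0 ?exprn_ege1 ?ler1n ?ler0n//.
- move: hX; congr (_ <= _ * _).
  rewrite natrM natrX -/P; congr (_ * _); first by rewrite bE addKn -natr1 natrM.
  by rewrite bE addKn /de -exprM mulnC.
- move: hV; congr (_ <= _ * _); rewrite natrX -/P /al /de -exprM -exprD; congr (_ ^+ _).
  by rewrite bE; clear; lia.
- move: hE; congr (_ <= B / _).
  have -> : (6 * b = 6 * a + 6 * d)%N by rewrite bE; ring.
  by rewrite !pX /al /de /sg /ta; ring.
- move: hF; rewrite natrM; congr (_ <= _ * _ / _).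
    by rewrite bE natrD.
  have -> : (2 * b + 4 * (3 * b) = 14 * a + 14 * d)%N by rewrite bE; ring.
  have -> : (3 * (3 * b) - b = 8 * a + 8 * d)%N by rewrite bE; clear; lia.
  by rewrite pXn pX /al /de; ring.
- move: hW; rewrite e1 natrD natrM; congr (_ <= _ / _).
  have -> : (2 * b + 4 * (a + 2 * d) = 6 * a + 10 * d)%N by rewrite bE; ring.
  have -> : (3 * (a + 2 * d) - b = 2 * a + 5 * d)%N by rewrite bE; clear; lia.
  by rewrite pXn pX /al /de; ring.
Qed.

End Recursion.

(** Split the full sum into classes modulo p. The diagonal costs 32 p^6 against the saving 64 p^6 of
    the induction hypothesis and fills half of the bound. The products of two different classes cost
    32 p^12 and are bounded after n rounds by 108 / (p^6 4^n); the condition on n, with 27 . 256 = 2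
    . 32 . 108, makes them fit into the other half. *)
Lemma vinogradov_step (R : realType) (p H n : nat) (C : R) :
  prime p -> (5 <= p)%N -> 0 <= C -> (3 ^ n <= H)%N -> (27 * 256 * p ^ 6 <= 4 ^ n)%N ->
  (forall h, (h < H)%N ->
     (vinogradov_count (p ^ h))%:R <= C * p%:R ^+ (6 * h) * 64 ^+ h) ->
  (vinogradov_count (p ^ H))%:R <= C * p%:R ^+ (6 * H) * 64 ^+ H.
Proof.
move=> p_pr p5 C0 nH pn IH.
pose M := (3 * H + 2)%N; pose Q := (p ^ M)%N.
have Q0 : 0 < Q%:R :> R by rewrite ltr0n expn_gt0 prime_gt0.
have P0 : 0 < p%:R :> R by rewrite ltr0n prime_gt0.
set P : R := p%:R in P0 *.
pose B := vbound p H C.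
have B0 : 0 <= B by exact: vbound_ge0.
have H0 : (0 < H)%N by apply: leq_trans nH; rewrite expn_gt0.
suff main : \sum_t @usum R p H M 0 0 t ^+ 6 <= B.
  move: main; rewrite usum6// subn0 /B /vbound -!mulrA -/P => h.
  by rewrite -(ler_pM2l (_ : 0 < Q%:R ^+ 3)) ?exprn_gt0// -!mulrA.
pose F (w : 'I_p) t := @fsum R p H M 1 (apt p 0 0 w) t.
pose U (w : 'I_p) t := @usum R p H M 1 (apt p 0 0 w) t.
pose y (k : 'I_p * 'I_p) t := if k.1 != k.2 then nm (F k.1 t) * nm (F k.2 t) else 0.
have y0 k t : 0 <= y k t by rewrite /y; case: ifP => // _; rewrite mulr_ge0 ?nm_ge0.
have U0 w t : 0 <= U w t by exact: usum_ge0.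
have split t : @usum R p H M 0 0 t <= \sum_w U w t + \sum_k y k t.
  have -> : @usum R p H M 0 0 t = nm (\sum_w F w t) ^+ 2.
    rewrite /usum (@fsum_split R p H M 0 1) ?add0n//.
  apply: (@le_trans _ _ ((\sum_w nm (F w t)) ^+ 2)).
    rewrite lerXn2r ?nnegrE ?nm_ge0 ?nm_sum// sumr_ge0// => w _; exact: nm_ge0.
  rewrite expr2 mulr_sum_pair -(pair_bigA _ (fun i j => y (i, j) t)) -big_split.
  rewrite -(pair_bigA _ (fun i j => nm (F i t) * nm (F j t))) /=.
  apply: ler_sum => w _; rewrite (bigD1 w)//= lerD ?expr2//.
  rewrite [X in _ <= X](bigD1 w)//= {1}/y /= eqxx add0r.
  apply: ler_sum => w' ww'; by rewrite /y /= eq_sym ww'.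
have six (a b : R) : 0 <= a -> 0 <= b -> (a + b) ^+ 6 <= 32 * (a ^+ 6 + b ^+ 6).
  move=> a0 b0; have := @power_mean6 R bool (fun t => if t then a else b).
  rewrite !big_bool /= card_bool => h.
  by apply: le_trans (h _) _; [case|rewrite (_ : 2%:R ^+ 5 = 32) //; ring].
pose Y := 108 * B / (P ^+ 6 * 2 ^+ (n * 2)).
have Y0 : 0 <= Y by rewrite /Y; nneg.
have hU w : \sum_t U w t ^+ 6 <= B / (P ^+ 6 * 64).
  have := usum6_bound p_pr p5 IH (apt p 0 0 w) (_ : 0 < 1 <= H)%N.
  move=> /(_ H0); rewrite muln1 -/P; congr (_ <= _ / (_ * _)); ring.
have hy k : \sum_t y k t ^+ 6 <= Y.
  rewrite /y; case: k => w w' /=; case: (boolP (w == w')) => [_|ww'] /=.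
    by rewrite big1// => t _; rewrite expr0n.
  have ndv (a b : 'I_p) : a != b -> ~~ dvi p%:Z (apt p 0 0 a - apt p 0 0 b).
    move=> ab; rewrite /apt expn0 !add0r !mul1r; apply/negP.
    by move=> /(dvdz_lt_eq (ltn_ord _) (ltn_ord _))/val_inj ab'; rewrite ab' eqxx in ab.
  have bnd (a b : 'I_p) : a != b -> moment (U a) (U b) 2 <= Y.
    move=> ab; have := Imom2_bound p_pr p5 C0 IH (n := n) (isT : (0 < 1)%N) (leqnn 1) _ (ndv _ _ ab).
    rewrite muln1 => /(_ nH); rewrite expr1n mulr1 -/B; congr (_ <= _).
  have b1 := bnd _ _ ww'; have := bnd w' w; rewrite eq_sym ww' => /(_ isT) b2.
  have -> : \sum_t (nm (F w t) * nm (F w' t)) ^+ 6 = moment (U w) (U w') 3.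
    apply: eq_bigr => t _; rewrite /U /usum -!exprM exprMn //.
  (* The product of the two sixth powers is the moment of index 3, which lies between those of index
     2 and 4; index 4 is index 2 with the classes exchanged. *)
  have b3 := moment_log_convex (U0 w) (U0 w') (isT : (2 < 5)%N).
  rewrite -(@ler_pXn2r _ 2)// ?nnegrE ?moment_ge0//.
  apply: le_trans b3 _; rewrite expr2; apply: ler_pM; rewrite ?moment_ge0//.
  by rewrite moment_rev.
have key t : @usum R p H M 0 0 t ^+ 6 <= 32 * (P ^+ 5 * \sum_w U w t ^+ 6 +
    P ^+ 10 * \sum_k y k t ^+ 6).
  apply: (@le_trans _ _ ((\sum_w U w t + \sum_k y k t) ^+ 6)).
    rewrite lerXn2r ?nnegrE ?usum_ge0// addr_ge0 ?sumr_ge0//.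
  apply: le_trans (six _ _ (sumr_ge0 _ (fun w _ => U0 w t)) (sumr_ge0 _ (fun k _ => y0 k t))) _.
  rewrite ler_wpM2l// lerD//.
    by apply: le_trans (power_mean6 _) _ => //; rewrite card_ord.
  apply: le_trans (power_mean6 _) _ => //.
  by rewrite card_prod !card_ord natrM -/P -expr2 -exprM.
apply: le_trans (ler_sum _ (fun t _ => key t)) _.
rewrite -mulr_sumr big_split -!mulr_sumr /=.
rewrite [X in P ^+ 5 * X]exchange_big [X in P ^+ 10 * X]exchange_big /=.
have s1 : \sum_w \sum_t U w t ^+ 6 <= P * (B / (P ^+ 6 * 64)).
  apply: le_trans (ler_sum _ (fun w _ => hU w)) _.
  by rewrite sumr_const card_ord /P mulr_natl.
have s2 : \sum_k \sum_t y k t ^+ 6 <= P ^+ 2 * Y.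
  apply: le_trans (ler_sum _ (fun k _ => hy k)) _.
  by rewrite sumr_const card_prod !card_ord /P -natrX mulr_natl mulnn.
apply: (@le_trans _ _ (32 * (P ^+ 5 * (P * (B / (P ^+ 6 * 64))) + P ^+ 10 * (P ^+ 2 * Y)))).
  by rewrite ler_wpM2l// lerD// ler_wpM2l ?exprn_ge0// ltW.
have E4 : (2 : R) ^+ (n * 2) = 4 ^+ n by rewrite mulnC exprM; congr (_ ^+ _); ring.
have pn' : 6912 * P ^+ 6 / 4 ^+ n <= 1.
  rewrite ler_pdivrMr ?exprn_gt0// mul1r.
  move: pn; rewrite -(ler_nat R) !natrM !natrX; congr (_ <= _).
have -> : 32 * (P ^+ 5 * (P * (B / (P ^+ 6 * 64))) + P ^+ 10 * (P ^+ 2 * Y)) =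
   B * (1 / 2 + (6912 * P ^+ 6 / 4 ^+ n) / 2).
  rewrite /Y E4; field; by rewrite !gt_eqF// exprn_gt0.
by rewrite ler_piMr//; lra.
Qed.

(** The factor 64^H is the power log 64 / log p of the length p^H, hence an arbitrarily small power
    once p is large. *)
Theorem vinogradov_mean_value (R : realType) (p : nat) : prime p -> (5 <= p)%N ->
  exists2 C : R, 0 <= C &
    forall H, (vinogradov_count (p ^ H))%:R <= C * p%:R ^+ (6 * H) * 64 ^+ H.
Proof.
move=> p_pr p5; pose n := (27 * 256 * p ^ 6)%N.
have P1 : 1 <= p%:R :> R by rewrite ler1n prime_gt0.
(* Below H = 3^n there is no room for n rounds, and the constant swallows the trivial bound
   p^(12H). *)
exists (p%:R ^+ (12 * 3 ^ n)); first by rewrite exprn_ge0.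
move=> H; have [m] := ubnP H; elim: m H => // m IHm H Hm.
have [nH|Hn] := leqP (3 ^ n) H.
  apply: (@vinogradov_step R p H n) => //; first by rewrite exprn_ge0.
    by rewrite ltnW// ltn_expl.
  by move=> h hH; apply: IHm; apply: leq_trans hH _.
apply: (@le_trans _ _ (p%:R ^+ (12 * 3 ^ n))); last first.
  by rewrite -mulrA ler_peMr ?exprn_ge0// mulr_ege1 ?exprn_ege1// ler1n.
rewrite -natrX ler_nat; apply: leq_trans (vinogradov_count_trivial _) _.
by rewrite -expnM leq_pexp2l ?prime_gt0// mulnC leq_mul2l ltnW// orbT.
Qed.

(** * An inverse Weyl inequality *)

Section NearInteger.
Variable R : realType.
Implicit Types (x y d : R).

Definition nint x d := exists a : int, `|x - a%:~R| <= d.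

Lemma nint_le x d d' : d <= d' -> nint x d -> nint x d'.
Proof. by move=> dd' [a h]; exists a; exact: le_trans dd'. Qed.

Lemma nintB x y d d' : nint x d -> nint y d' -> nint (x - y) (d + d').
Proof.
move=> [a ha] [b hb]; exists (a - b); rewrite intrB.
have -> : x - y - (a%:~R - b%:~R) = (x - a%:~R) - (y - b%:~R) by ring.
by apply: le_trans (ler_normB _ _) _; exact: lerD.
Qed.

Lemma nintMn x d n : nint x d -> nint (n%:R * x) (n%:R * d).
Proof.
move=> [a ha]; exists (n%:Z * a); rewrite intrM -pmulrn -mulrBr normrM.
by rewrite ger0_norm// ler_wpM2l.
Qed.

Lemma nint_small x d : nint x d -> d < 1 / 2 -> `|x| <= 1 / 2 -> `|x| <= d.
Proof.
move=> [a ha] d2 x2; suff a0 : a = 0 by move: ha; rewrite a0 subr0.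
have h : `|a%:~R : R| < 1.
  have -> : a%:~R = x - (x - a%:~R) :> R by ring.
  by apply: le_lt_trans (ler_normB _ _) _; lra.
move: h; rewrite -intr_norm (_ : 1 = 1%:~R) // ltr_int; lia.
Qed.

End NearInteger.

Section Differencing.
Variable R : realType.

Definition diff_corr (F : nat -> R[i]) N h := \sum_(x < N - h) F (x + h)%N * (F x)^*%C.

(** The pairs of indices are sorted by their difference h >= 0; the difference 0 occurs in both
    conjugate halves and is subtracted once. *)
Lemma differencing_identity (F : nat -> R[i]) N :
  (\sum_(x < N) F x) * (\sum_(x < N) F x)^*%C =
  \sum_(h < N) diff_corr F N h + (\sum_(h < N) diff_corr F N h)^*%C
   - \sum_(x < N) F x * (F x)^*%C.
Proof.
elim: N => [|N IHN]; first by rewrite !big_ord0 mul0r rmorph0 addr0 subr0.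
have D : \sum_(h < N.+1) diff_corr F N.+1 h =
   \sum_(h < N) diff_corr F N h + F N * (\sum_(x < N) F x)^*%C + F N * (F N)^*%C.
  rewrite (eq_bigr (fun h : 'I_N.+1 => diff_corr F N h + F N * (F (N - h)%N)^*%C)); last first.
    move=> h _; have hN : (h <= N)%N by rewrite -ltnS.
    by rewrite /diff_corr subSn// big_ord_recr /= subnK.
  rewrite big_split big_ord_recr /= {2}/diff_corr subnn big_ord0 addr0.
  rewrite -mulr_sumr -addrA; congr (_ + _).
  rewrite (reindex_inj rev_ord_inj) /= -mulrDr; congr (_ * _).
  rewrite big_ord_recr /= subSS subnn subn0 rmorph_sum; congr (_ + _).
  apply: eq_bigr => i _; rewrite subSS subKn//; exact: ltnW.
rewrite D !big_ord_recr /=.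
move: IHN; set S := \sum_(x < N) F x; set T := \sum_(h < N) _; set V := \sum_(x < N) _.
move=> IHN; rewrite !(rmorphD, rmorphM) /= !conjcK.
have -> : (S + F N) * (S^* + (F N)^*)%C = S * S^*%C + F N * S^*%C + S * (F N)^*%C + F N * (F N)^*%C by ring.
rewrite IHN; ring.
Qed.

Lemma differencing (F : nat -> R[i]) N :
  nm (\sum_(x < N) F x) ^+ 2 <= 2 * \sum_(h < N) nm (diff_corr F N h).
Proof.
have E := differencing_identity F N.
set S := \sum_(x < N) F x in E *; set T := \sum_(h < N) _ in E.
have V : exists2 v : R, 0 <= v & \sum_(x < N) F x * (F x)^*%C = v%:C%C.
  exists (\sum_(x < N) nm (F x) ^+ 2); first by apply: sumr_ge0 => x _; exact: sqr_ge0.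
  by rewrite rmorph_sum; apply: eq_bigr => x _; rewrite -nm_sqr.
case: V => v v0 vE; rewrite vE -nm_sqr addcJ in E.
have {}E : nm S ^+ 2 = 2 * complex.Re T - v.
  move/(congr1 (@complex.Re R)): E; rewrite /=.
  by case: (T) => a b /=; rewrite !(mul0r, subr0, mulr0, addr0).
rewrite E; apply: (@le_trans _ _ (2 * complex.Re T)); first by lra.
rewrite ler_wpM2l//; apply: le_trans (Re_le_nm _) _; exact: nm_sum.
Qed.

Lemma many_large (N : nat) (a : nat -> R) (A c : R) : 0 < A -> 0 <= c ->
  (forall h, (h < N)%N -> a h <= A) ->
  2 * c * N%:R * A <= \sum_(h < N) a h ->
  c * N%:R <= #|[set h : 'I_N | c * A <= a h]|%:R.
Proof.
move=> A0 c0 aA H; set S := [set h : 'I_N | _].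
have : \sum_(h < N) a h <= #|S|%:R * A + N%:R * (c * A).
  rewrite (bigID (mem S)) /=; apply: lerD.
    rewrite mulr_natl -sumr_const; apply: ler_sum => h _; exact: aA.
  apply: (@le_trans _ _ (\sum_(h < N) (c * A))); last first.
    by rewrite sumr_const card_ord mulr_natl.
  rewrite [X in _ <= X](bigID (mem S)) /= ler_wpDl ?sumr_ge0// => [h _|].
    by rewrite mulr_ge0// ltW.
  by apply: ler_sum => h; rewrite inE -ltNge => /ltW.
move=> h; have {}h := le_trans H h.
by rewrite -(ler_pM2r A0); lra.
Qed.

End Differencing.

Lemma card_le_fibers (T U : finType) (S : {set T}) (f : T -> U) m :
  (forall c, #|[set h in S | f h == c]| <= m)%N -> (#|S| <= #|U| * m)%N.
Proof.
move=> H; rewrite -sum1_card (partition_big f xpredT) //= -sum_nat_const.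
apply: leq_sum => c _; rewrite sum1dep_card; apply: leq_trans (H c).
by apply: subset_leq_card; apply/fintype.subsetP => h; rewrite !inE.
Qed.

Lemma card_progression N q T (A : {set 'I_N}) : (0 < q)%N ->
  (forall h h' : 'I_N, h \in A -> h' \in A -> h = h' %[mod q]) ->
  (forall h h' : 'I_N, h \in A -> h' \in A -> (h <= h')%N -> (h' - h <= q * T)%N) ->
  (#|A| <= T.+1)%N.
Proof.
move=> q0 Amod Adist; have [->|/set0Pn[h1 h1A]] := eqVneq A finset.set0; first by rewrite cards0.
case: (@arg_minnP _ h1 (mem A) (fun h => h : nat) h1A) => h0 h0A h0min.
pose f (h : 'I_N) : 'I_T.+1 := inord ((h - h0) %/ q).
have dv h : h \in A -> (q %| h - h0)%N.
  by move=> hA; rewrite -eqn_mod_dvd ?h0min//; apply/eqP; exact: Amod.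
have fE h : h \in A -> (f h * q = h - h0)%N.
  move=> hA; rewrite inordK ?divnK ?dv// ltnS.
  by rewrite -(@leq_pmul2l q)// mulnC divnK ?dv// Adist// h0min.
rewrite -[T.+1]card_ord -(card_in_imset (f := f) (D := A)) ?max_card// => x y xA yA fxy.
have := fE x xA; rewrite fxy fE// => e.
by apply/val_inj => /=; rewrite -(subnK (h0min x xA)) -e subnK// h0min.
Qed.

Section Spacing.
Variable R : realType.

(** Two good h in one short block yield a denominator q with q th = a + ep and ep of size de. To
    improve on ep, the good h are counted: among numbers in one class modulo q within a window of
    length about q / |ep|, the multiples of ep sweep out a fixed part of the circle at constant
    speed, so at most about de / |ep| of them are good. Compared with the assumed N / K good h, this
    bounds |ep| by K^2 de / N. *)
Lemma spacing (K N : nat) (th de : R) : (0 < K)%N -> 0 < de -> 64 * K%:R * de < 1 ->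
  (2 * K < N)%N ->
  (N%:R / K%:R : R) <= #|[set h : 'I_N | `[< nint (h%:R * th) de >]]|%:R ->
  exists2 q, (0 < q <= 2 * K)%N & nint (q%:R * th) (16 * K%:R ^+ 2 * de / N%:R).
Proof.
move=> K0 de0 deK KN; set S := [set h : 'I_N | _] => HS.
have K0' : 0 < K%:R :> R by rewrite ltr0n.
have N0 : 0 < N%:R :> R by rewrite ltr0n (leq_ltn_trans _ KN).
have SP h : h \in S -> nint (h%:R * th) de by rewrite inE => /asboolP.
have nintBS (h h' : 'I_N) : h \in S -> h' \in S -> (h <= h')%N ->
    nint ((h' - h)%:R * th) (2 * de).
  move=> /SP hS /SP h'S hh'; rewrite natrB// mulrBl.
  by have := nintB h'S hS; congr (nint _ _); ring.
(* There are more good h than blocks of length 2K, so two of them share a block. *)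
have [q /andP[q0 qK] [a qa]] : exists2 q, (0 < q <= 2 * K)%N & nint (q%:R * th) (2 * de).
  pose f (h : 'I_N) : 'I_(N %/ (2 * K)).+1 := inord (h %/ (2 * K)).
  have : ~~ dinjectiveb f (mem S).
    apply/negP => /dinjectiveP fi.
    have := max_card (mem (f @: S)); rewrite (card_in_imset fi) card_ord => h.
    have : (#|S|%:R : R) <= N%:R / (2 * K%:R) + 1.
      apply: (@le_trans _ _ (N %/ (2 * K)).+1%:R); first by rewrite ler_nat.
      rewrite -natr1 lerD2r ler_pdivlMr ?mulr_gt0// -natrM -natrM ler_nat.
      by rewrite leq_trunc_div.
    move=> h'; have := le_trans HS h'.
    rewrite invfM; have : 1 < N%:R / (2 * K%:R) :> R.
      by rewrite ltr_pdivlMr ?mulr_gt0// mul1r -natrM ltr_nat.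
    by rewrite invfM; move: (K%:R^-1) => k; lra.
  move=> /dinjectivePn[x xS [y]]; rewrite inE => /andP[yx yS] fxy.
  have {fxy} fxy : (x %/ (2 * K) = y %/ (2 * K))%N.
    have lt (h : 'I_N) : (h %/ (2 * K) < (N %/ (2 * K)).+1)%N.
      by rewrite ltnS leq_div2r// ltnW.
    by move/(congr1 val): fxy; rewrite /= !inordK ?lt.
  wlog xy : x y xS yS yx fxy / (x < y)%N.
    move=> W; have [xy|xy|e] := ltngtP x y; first exact: (W x y).
      by apply: (W y x) => //; rewrite eq_sym.
    by move: yx; rewrite (_ : y = x) ?eqxx//; apply/val_inj.
  exists (y - x)%N; last by apply: nintBS => //; exact: ltnW.
  rewrite subn_gt0 xy /= leq_subLR.
  rewrite {1}(divn_eq y (2 * K)) -fxy {2}(divn_eq x (2 * K)).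
  have := ltn_pmod y (_ : 0 < 2 * K)%N; rewrite muln_gt0 K0 => /(_ isT).
  lia.
exists q; first by rewrite q0.
pose ep := q%:R * th - a%:~R.
have [e0|en0] := eqVneq ep 0.
  exists a; rewrite -/ep e0 normr0 !mulr_ge0// ?invr_ge0 ltW//.
exists a; rewrite -/ep; set et := `|ep|.
have et0 : 0 < et by rewrite normr_gt0.
have et2 : et <= 2 * de by [].
have K1 : 1 <= K%:R :> R by rewrite ler1n.
have de64 : de < 1 / 64 by rewrite ltr_pdivlMr//; nra.
(* [Y] steps of length |ep| cover at most 1/4, so there j ep cannot wrap around: being near an
   integer means being near 0, hence j |ep| <= 2 de. *)
pose Y := Num.truncn (1 / (4 * et)).
have h4 : 0 <= 1 / (4 * et) by rewrite divr_ge0// mulr_ge0// ltW.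
have /andP[Y1 Y2] := truncn_itv h4; rewrite -/Y in Y1 Y2.
have Y3 : Y%:R * et <= 1 / 4.
  by move: Y1; rewrite ler_pdivlMr ?mulr_gt0//; lra.
have Y4 : 1 / 8 <= Y%:R * et.
  move: Y2; rewrite -natr1 ltr_pdivrMr ?mulr_gt0//; lra.
have Y0 : (0 < Y)%N by rewrite lt0n; apply/eqP => Y0; move: Y4; rewrite Y0 mul0r; lra.
pose T := Num.truncn (2 * de / et).
have h5 : 0 <= 2 * de / et by rewrite divr_ge0 ?mulr_ge0 ?ltW.
have /andP[T1 T2] := truncn_itv h5; rewrite -/T in T1 T2.
have lt (h : 'I_N) : (h %/ (q * Y) < (N %/ (q * Y)).+1)%N.
  by rewrite ltnS leq_div2r// ltnW.
pose f (h : 'I_N) : 'I_(N %/ (q * Y)).+1 * 'I_q := (inord (h %/ (q * Y)), Ordinal (ltn_pmod h q0)).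
have cardS : (#|S| <= (N %/ (q * Y)).+1 * q * T.+1)%N.
  have := @card_le_fibers _ _ S f T.+1; rewrite card_prod !card_ord; apply.
  move=> [c r].
  have congr_class (h h' : 'I_N) : h \in [set h in S | f h == (c, r)] ->
      h' \in [set h in S | f h == (c, r)] ->
      (h %/ (q * Y) = h' %/ (q * Y))%N /\ h = h' %[mod q].
    rewrite !inE => /andP[_ /eqP e1] /andP[_ /eqP e2]; move: e1; rewrite -e2.
    by case=> /(congr1 val); rewrite /= !inordK ?lt.
  apply: (card_progression q0) => h h' hA h'A; first by case: (congr_class _ _ hA h'A).
  move=> hh'; have [cw cm] := congr_class _ _ hA h'A.
  have {hA} hS : h \in S by move: hA; rewrite inE => /andP[].
  have {h'A} h'S : h' \in S by move: h'A; rewrite inE => /andP[].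
  have /dvdnP[j jE] : (q %| h' - h)%N by rewrite -eqn_mod_dvd//; apply/eqP.
  have jY : (j < Y)%N.
    have : (h' - h < q * Y)%N.
      rewrite ltn_subLR// {1}(divn_eq h' (q * Y)) -cw {2}(divn_eq h (q * Y)).
      have := ltn_pmod h' (_ : 0 < q * Y)%N; rewrite muln_gt0 q0 Y0 => /(_ isT).
      by clear; lia.
    by rewrite jE mulnC ltn_pmul2l.
  have [b] := nintBS _ _ hS h'S hh'; rewrite jE => hb.
  have nj : nint (j%:R * ep) (2 * de).
    exists (b - j%:Z * a); move: hb; congr (`|_| <= _).
    by rewrite intrB intrM natrM /ep -pmulrn; ring.
  have jle : `|j%:R * ep| <= 1 / 2.
    rewrite normrM ger0_norm// -/et; apply: (@le_trans _ _ (Y%:R * et)); last by lra.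
    by rewrite ler_pM2r// ler_nat ltnW.
  have := nint_small nj _ jle; have h2 : 2 * de < 1 / 2 by lra.
  move=> /(_ h2); rewrite normrM ger0_norm// -/et -ler_pdivlMr// => jT.
  rewrite mulnC leq_mul2l -ltnS -(ltr_nat R) (le_lt_trans jT T2) orbT //.
have cardR : #|S|%:R <= (8 * et * N%:R + 2 * K%:R) * (4 * de / et) :> R.
  apply: (@le_trans _ _ ((N %/ (q * Y)).+1 * q * T.+1)%:R); first by rewrite ler_nat.
  rewrite natrM; apply: ler_pM => //; last first.
    rewrite -natr1; apply: (@le_trans _ _ (2 * de / et + 1)); first by rewrite lerD2r.
    have : 1 <= 2 * de / et by rewrite ler_pdivlMr// mul1r.
    by rewrite -!mulrA; lra.
  rewrite mulSn natrD addrC; apply: lerD; last by rewrite -natrM ler_nat.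
  have Y0' : 0 < Y%:R :> R by rewrite ltr0n.
  have : (N %/ (q * Y) * q * Y)%:R <= N%:R :> R by rewrite ler_nat -mulnA leq_trunc_div.
  rewrite natrM => h6.
  have h7 : (N %/ (q * Y) * q)%:R * (1 / 8) <= (N %/ (q * Y) * q)%:R * (Y%:R * et) :> R.
    by rewrite ler_wpM2l.
  have h8 : (N %/ (q * Y) * q)%:R * Y%:R * et <= N%:R * et :> R by rewrite ler_pM2r.
  by rewrite mulrA in h7; lra.
have := le_trans HS cardR; rewrite ler_pdivrMr// => h9.
rewrite ler_pdivlMr//.
have h10 : N%:R * et <= ((8 * et * N%:R + 2 * K%:R) * (4 * de)) * K%:R.
  apply: le_trans (ler_wpM2r (ltW et0) h9) _.
  rewrite le_eqVlt; apply/orP; left; apply/eqP; field; by rewrite gt_eqF.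
have h11 : 64 * K%:R * de * (et * N%:R) <= 1 * (et * N%:R).
  by apply: ler_wpM2r; rewrite ?mulr_ge0// ltW.
move: h10 h11; rewrite expr2; lra.
Qed.

End Spacing.

Section InverseWeyl.
Variable R : realType.
Implicit Types (K N q : nat).

Lemma natpow_ge (K n : nat) : (2 <= K)%N -> 2 ^+ n <= K%:R ^+ n :> R.
Proof. by move=> K2; rewrite lerXn2r ?nnegrE ?ler_nat. Qed.

Lemma natpow_le (K m n : nat) : (2 <= K)%N -> (m <= n)%N -> K%:R ^+ m <= K%:R ^+ n :> R.
Proof. by move=> K2 mn; rewrite ler_weXn2l// ler1n ltnW. Qed.

(** As K >= 2, numerical constants are absorbed into powers of K, and only exponents need to be
    tracked below. *)
Lemma natpow_absorb (c : R) (K j m n : nat) : (2 <= K)%N -> c <= 2 ^+ j -> (j + m <= n)%N ->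
  c * K%:R ^+ m <= K%:R ^+ n.
Proof.
move=> K2 cj jmn; apply: le_trans (natpow_le K2 jmn); rewrite exprD.
by apply: ler_wpM2r; rewrite ?exprn_ge0//; apply: le_trans cj (natpow_ge _ K2).
Qed.

Lemma nm_phase_sum (M : nat) (f g : nat -> R) c :
  (forall x, (x < M)%N -> f x = g x + c) ->
  nm (\sum_(x < M) e (f x)) = nm (\sum_(x < M) e (g x)).
Proof.
move=> fg; rewrite (eq_bigr (fun x : 'I_M => e (g x) * e c)); last first.
  by move=> x _; rewrite fg// eD.
by rewrite -mulr_suml nmM nm_e mulr1.
Qed.

Lemma nm_esum_le (M : nat) (f : nat -> R) : nm (\sum_(x < M) e (f x)) <= M%:R.
Proof.
apply: le_trans (nm_sum _ _ _) _.
by rewrite (eq_bigr (fun=> 1)) ?sumr_const ?card_ord// => x _; rewrite nm_e.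
Qed.

Lemma weyl_step (f : nat -> R) K N : (0 < K)%N -> (0 < N)%N ->
  N%:R / K%:R <= nm (\sum_(x < N) e (f x)) ->
  (N%:R / (4 * K ^ 2)%:R : R) <= #|[set h : 'I_N | N%:R / (4 * K ^ 2)%:R <=
     nm (\sum_(x < N - h) e (f (x + h)%N - f x))]|%:R.
Proof.
move=> K0 N0 H; pose a h := nm (\sum_(x < N - h) e (f (x + h)%N - f x)).
have K0' : 0 < K%:R :> R by rewrite ltr0n.
have N0' : 0 < N%:R :> R by rewrite ltr0n.
have aN h : (h < N)%N -> a h <= N%:R.
  by move=> _; apply: le_trans (nm_esum_le _ (fun x => f (x + h)%N - f x)) _; rewrite ler_nat leq_subr.
have D := differencing (fun x => e (f x)) N.
rewrite (eq_bigr (fun h : 'I_N => a h)) in D; last first.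
  move=> h _; congr nm; apply: eq_bigr => x _; by rewrite -eN -eD.
have cE : ((4 * K ^ 2)%:R : R)^-1 = 1 / (4 * K%:R ^+ 2) by rewrite natrM natrX div1r.
have := @many_large R N a N%:R (1 / (4 * K%:R ^+ 2)) N0' _ aN.
rewrite cE ![_ * N%:R]mulrC; apply.
  by rewrite divr_ge0 ?mulr_ge0 ?exprn_ge0 ?ltW.
have h2 : (N%:R / K%:R) ^+ 2 <= nm (\sum_(x < N) e (f x)) ^+ 2.
  by rewrite lerXn2r ?nnegrE ?nm_ge0// divr_ge0.
have := le_trans h2 D.
have -> : (N%:R / K%:R) ^+ 2 = 2 * (2 * (1 / (4 * K%:R ^+ 2)) * N%:R * N%:R) :> R.
  by field; rewrite gt_eqF.
by rewrite ler_pM2l//; congr (_ <= _); ring.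
Qed.

Lemma weyl_step_length (f : nat -> R) (A : R) N h : 0 < A -> N%:R / A <= nm (\sum_(x < N - h) e (f x)) ->
  N%:R / A <= (N - h)%:R.
Proof. by move=> A0 h1; apply: le_trans h1 (nm_esum_le _ f). Qed.

(** Differencing leaves geometric sums with phases 2 h th; those that are large put 2 h th near an
    integer for many h, and [spacing] extracts the denominator. *)
Lemma weyl_quadratic : exists D, forall K N (th ga : R), (2 <= K)%N -> (K ^ D <= N)%N ->
  N%:R / K%:R <= nm (\sum_(x < N) e (th * x%:R ^+ 2 + ga * x%:R)) ->
  exists2 q, (0 < q <= K ^ D)%N & nint (q%:R * th) (K%:R ^+ D / N%:R ^+ 2).
Proof.
exists 22%N => K N th ga K2 KN H.
have K0 : (0 < K)%N by apply: leq_trans K2.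
have N0 : (0 < N)%N by apply: leq_trans KN; rewrite expn_gt0 K0.
have K0' : 0 < K%:R :> R by rewrite ltr0n.
have N0' : 0 < N%:R :> R by rewrite ltr0n.
have KN' : K%:R ^+ 22 <= N%:R :> R by rewrite -natrX ler_nat.
pose f (x : nat) : R := th * x%:R ^+ 2 + ga * x%:R.
have := weyl_step (f := f) K0 N0 H.
set L := (4 * K ^ 2)%N.
have L0 : (0 < L)%N by rewrite muln_gt0 expn_gt0 K0.
have L0' : 0 < L%:R :> R by rewrite ltr0n.
have LE : L%:R = 4 * K%:R ^+ 2 :> R by rewrite natrM natrX.
move=> HS; pose de : R := 2 * L%:R ^+ 2 / N%:R.
have de0 : 0 < de by rewrite divr_gt0 ?mulr_gt0 ?exprn_gt0.
have HS' : N%:R / L%:R <= #|[set h : 'I_N | `[< nint (h%:R * (2 * th)) de >]]|%:R :> R.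
  apply: le_trans HS _; rewrite ler_nat; apply: subset_leq_card.
  apply/fintype.subsetP => h; rewrite !inE => ah; apply/asboolP.
  have Mle := weyl_step_length (f := fun x => f (x + h)%N - f x) L0' ah.
  have M0 : 0 < (N - h)%:R :> R by apply: lt_le_trans Mle; rewrite divr_gt0.
  have : (N - h)%:R / L%:R <= nm (\sum_(x < N - h) e (h%:R * (2 * th) * x%:R)).
    rewrite -(@nm_phase_sum _ (fun x => f (x + h)%N - f x)
       (fun x => h%:R * (2 * th) * x%:R) (th * h%:R ^+ 2 + ga * h%:R)); last first.
      by move=> x _; rewrite /f natrD; ring.
    apply: le_trans ah; by rewrite ler_pM2r ?invr_gt0// ler_nat leq_subr.
  move=> /(geom_bound L0') h1; have := h1 _; rewrite -(ltr0n R) => /(_ M0).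
  move=> h2; apply/asboolP; apply: nint_le h2; rewrite /de ler_pdivrMr// mulrAC ler_pdivlMr//.
  move: Mle; rewrite ler_pdivrMr// => Mle.
  have -> : 2 * L%:R ^+ 2 * (N - h)%:R = 2 * L%:R * ((N - h)%:R * L%:R) :> R by ring.
  by rewrite ler_wpM2l// mulr_ge0// ltW.
have c1 : 64 * L%:R * de < 1.
  rewrite /de mulrA ltr_pdivrMr// mul1r LE; apply: lt_le_trans KN'.
  apply: (@lt_le_trans _ _ (2 ^+ 14 * K%:R ^+ 6)); last exact: natpow_absorb.
  have -> : 64 * (4 * K%:R ^+ 2) * (2 * (4 * K%:R ^+ 2) ^+ 2) = 2 ^+ 13 * K%:R ^+ 6 :> R by ring.
  by rewrite ltr_pM2r ?exprn_gt0// ltr_eXn2l// ltr1n.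
have c2 : (2 * L < N)%N.
  rewrite -(ltr_nat R) natrM LE; apply: lt_le_trans KN'.
  apply: (@lt_le_trans _ _ (2 ^+ 4 * K%:R ^+ 2)); last exact: natpow_absorb.
  have -> : 2 * (4 * K%:R ^+ 2) = 2 ^+ 3 * K%:R ^+ 2 :> R by ring.
  by rewrite ltr_pM2r ?exprn_gt0// ltr_eXn2l// ltr1n.
have [q /andP[q0 qL] hq] := spacing L0 de0 c1 c2 HS'.
exists (q * 2)%N.
  rewrite muln_gt0 q0 /= -(ler_nat R) natrM natrX.
  apply: (@le_trans _ _ ((2 * L)%:R * 2)); first by rewrite ler_pM2r// ler_nat.
  rewrite natrM LE; have -> : 2 * (4 * K%:R ^+ 2) * 2 = 2 ^+ 4 * K%:R ^+ 2 :> R by ring.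
  exact: natpow_absorb.
have -> : (q * 2)%:R * th = q%:R * (2 * th) by rewrite natrM; ring.
apply: nint_le hq.
have -> : 16 * L%:R ^+ 2 * de / N%:R = (2 ^+ 13 * K%:R ^+ 8) / N%:R ^+ 2.
  by rewrite /de LE; field; rewrite gt_eqF.
by rewrite ler_wpM2r ?invr_ge0 ?exprn_ge0//; apply: natpow_absorb.
Qed.

Lemma pigeonhole_fiber (T : finType) (m : nat) (G : {set T}) (qf : T -> nat) :
  (forall h, h \in G -> (qf h <= m)%N) ->
  exists c, (#|G| <= m.+1 * #|[set h in G | qf h == c]|)%N.
Proof.
move=> qm; pose F (c : 'I_m.+1) := #|[set h in G | qf h == c]|.
case: (@arg_maxnP _ ord0 xpredT F isT) => c _ cM; exists (c : nat).
rewrite -[X in (_ <= X * _)%N]card_ord.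
pose f h : 'I_m.+1 := inord (qf h).
apply: (card_le_fibers (f := f)) => c'.
apply: leq_trans (cM c' isT); apply: subset_leq_card; apply/fintype.subsetP => h.
rewrite !inE => /andP[hG /eqP <-]; by rewrite hG /f inordK ?eqxx// ltnS qm.
Qed.

(** Differencing leaves quadratic sums with leading coefficient 3 h th. For many h the quadratic
    case supplies a denominator; one that serves a large share of the h is fixed, and [spacing] is
    applied to 3 c th. *)
Lemma weyl_cubic : exists D, forall K N (th be ga : R), (2 <= K)%N -> (K ^ D <= N)%N ->
  N%:R / K%:R <= nm (\sum_(x < N) e (th * x%:R ^+ 3 + be * x%:R ^+ 2 + ga * x%:R)) ->
  exists2 q, (0 < q <= K ^ D)%N & nint (q%:R * th) (K%:R ^+ D / N%:R ^+ 3).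
Proof.
have [D2 HQ] := weyl_quadratic.
exists (12 * D2 + 40)%N => K N th be ga K2 KN H; set D := (12 * D2 + 40)%N in KN *.
have K0 : (0 < K)%N by apply: leq_trans K2.
have N0 : (0 < N)%N by apply: leq_trans KN; rewrite expn_gt0 K0.
have K0' : 0 < K%:R :> R by rewrite ltr0n.
have N0' : 0 < N%:R :> R by rewrite ltr0n.
have KN' : K%:R ^+ D <= N%:R :> R by rewrite -natrX ler_nat.
pose f (x : nat) : R := th * x%:R ^+ 3 + be * x%:R ^+ 2 + ga * x%:R.
have := weyl_step (f := f) K0 N0 H.
set L := (4 * K ^ 2)%N.
have L0 : (0 < L)%N by rewrite muln_gt0 expn_gt0 K0.
have L0' : 0 < L%:R :> R by rewrite ltr0n.
have LE : L%:R = 4 * K%:R ^+ 2 :> R by rewrite natrM natrX.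
have LK : (L <= K ^ 4)%N by rewrite (expnD K 2 2) leq_mul2r; apply/orP; right; rewrite (leq_exp2r 2 K (e := 2)).
set G := [set h : 'I_N | _] => HS.
have K4 : (2 <= K ^ 4)%N by apply: leq_trans K2 _; rewrite -{1}(expn1 K) leq_pexp2l.
have ex (h : 'I_N) : exists q, h \in G -> (0 < q <= K ^ (4 * D2))%N /\
    nint (h%:R * (3 * q%:R * th)) (K%:R ^+ (4 * D2 + 8) / N%:R ^+ 2).
  have [|] := boolP (h \in G); last by exists 0%N.
  rewrite inE => ah.
  have Mle := weyl_step_length (f := fun x => f (x + h)%N - f x) L0' ah.
  have M0 : 0 < (N - h)%:R :> R by apply: lt_le_trans Mle; rewrite divr_gt0.
  have Mle4 : N%:R / K%:R ^+ 4 <= (N - h)%:R :> R.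
    apply: le_trans Mle; rewrite ler_wpM2l// lef_pV2 ?posrE ?exprn_gt0//.
    by rewrite -natrX ler_nat.
  have : (N - h)%:R / (K ^ 4)%:R <=
      nm (\sum_(x < N - h) e (3 * th * h%:R * x%:R ^+ 2 + (3 * th * h%:R ^+ 2 + 2 * be * h%:R) * x%:R)).
    rewrite -(@nm_phase_sum _ (fun x => f (x + h)%N - f x)
       (fun x => 3 * th * h%:R * x%:R ^+ 2 + (3 * th * h%:R ^+ 2 + 2 * be * h%:R) * x%:R)
       (th * h%:R ^+ 3 + be * h%:R ^+ 2 + ga * h%:R)); last first.
      by move=> x _; rewrite /f natrD; ring.
    apply: le_trans ah; rewrite ler_pM ?invr_ge0// ?ler_nat ?leq_subr//.
    by rewrite lef_pV2 ?posrE ?ltr0n ?expn_gt0 ?K0// ler_nat.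
  move=> /HQ; case=> //.
    rewrite -expnM -(ler_nat R) natrX.
    apply: le_trans Mle4; rewrite ler_pdivlMr ?exprn_gt0// -exprD.
    by apply: le_trans KN'; apply: natpow_le => //; rewrite /D; clear; lia.
  rewrite -expnM => q qle hq; exists q => _; split => //.
  move: hq; have -> : q%:R * (3 * th * h%:R) = h%:R * (3 * q%:R * th) by ring.
  apply: nint_le; rewrite natrX -exprM.
  rewrite ler_pdivrMr ?exprn_gt0// mulrAC ler_pdivlMr ?exprn_gt0// exprD -mulrA.
  rewrite ler_wpM2l ?exprn_ge0//.
  move: Mle4; rewrite ler_pdivrMr ?exprn_gt0// => h1.
  have -> : K%:R ^+ 8 * (N - h)%:R ^+ 2 = ((N - h)%:R * K%:R ^+ 4) ^+ 2 :> R by ring.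
  by rewrite lerXn2r ?nnegrE ?mulr_ge0 ?exprn_ge0.
have [qf Hqf] := choice ex.
(* The denominator depends on h. The commonest one, [c], is kept at the cost of a power of K in the
   number of h. *)
have [c Hc] := @pigeonhole_fiber _ (K ^ (4 * D2)) G qf (fun h hG => (elimT andP (Hqf h hG).1).2).
pose K' := (K ^ (4 * D2 + 5))%N; pose de : R := K%:R ^+ (4 * D2 + 8) / N%:R ^+ 2.
have K'0 : (0 < K')%N by rewrite expn_gt0 K0.
have de0 : 0 < de by rewrite divr_gt0 ?exprn_gt0.
have HS' : N%:R / K'%:R <= #|[set h : 'I_N | `[< nint (h%:R * (3 * c%:R * th)) de >]]|%:R :> R.
  apply: (@le_trans _ _ #|[set h in G | qf h == c]|%:R); last first.
    rewrite ler_nat; apply: subset_leq_card; apply/fintype.subsetP => h.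
    rewrite inE => /andP[hG /eqP <-]; rewrite inE; apply/asboolP.
    by have [] := Hqf h hG.
  move: Hc; rewrite -(ler_nat R) natrM => h1; have := le_trans HS h1.
  rewrite !ler_pdivrMr ?ltr0n// => h2; apply: le_trans h2 _.
  rewrite -mulrA mulrC -mulrA ler_wpM2l// -natrM ler_nat /K' mulnC.
  rewrite (_ : (4 * D2 + 5 = 1 + 4 * D2 + 4)%N); last by clear; lia.
  rewrite expnD leq_mul// expnD expn1.
  apply: (@leq_trans (2 * K ^ (4 * D2))); last by rewrite leq_mul2r K2 orbT.
  by rewrite mul2n -addnn -addn1 leq_add2l expn_gt0 K0.
have c1 : 64 * K'%:R * de < 1.
  rewrite /de mulrA ltr_pdivrMr ?exprn_gt0// mul1r natrX -mulrA -exprD expr2.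
  apply: (@lt_le_trans _ _ (K%:R ^+ D)); last first.
    by apply: le_trans KN' _; rewrite ler_peMl// ?ler1n.
  apply: (@lt_le_trans _ _ (2 ^+ 7 * K%:R ^+ (4 * D2 + 5 + (4 * D2 + 8)))).
    by rewrite ltr_pM2r ?exprn_gt0//; lra.
  by apply: natpow_absorb => //; rewrite /D; clear; lia.
have c2 : (2 * K' < N)%N.
  rewrite -(ltr_nat R) natrM natrX; apply: lt_le_trans KN'.
  apply: (@lt_le_trans _ _ (2 ^+ 2 * K%:R ^+ (4 * D2 + 5))).
    by rewrite ltr_pM2r ?exprn_gt0//; lra.
  by apply: natpow_absorb => //; rewrite /D; clear; lia.
have [q /andP[q0 qK] hq] := spacing K'0 de0 c1 c2 HS'.
have fib0 : (0 < #|[set h in G | qf h == c]|)%N.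
  rewrite -(ltr0n R); apply: lt_le_trans (_ : 0 < #|G|%:R / (K ^ (4 * D2)).+1%:R) _.
    by rewrite divr_gt0 ?ltr0n// -(ltr0n R); apply: lt_le_trans HS; rewrite divr_gt0.
  by rewrite ler_pdivrMr ?ltr0n// -natrM ler_nat mulnC.
have [h] := card_gt0P fib0; rewrite inE => /andP[hG /eqP qh].
have [/andP[c0 cK] _] := Hqf h hG; rewrite qh in c0 cK.
exists (q * (3 * c))%N.
  rewrite !muln_gt0 q0 c0 /= -(ler_nat R) !natrM natrX.
  apply: (@le_trans _ _ ((2 * K%:R ^+ (4 * D2 + 5)) * (3 * K%:R ^+ (4 * D2)))).
    apply: ler_pM; rewrite ?mulr_ge0//; first by rewrite -natrX -natrM ler_nat.
    by rewrite ler_wpM2l// -natrX ler_nat.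
  have -> : 2 * K%:R ^+ (4 * D2 + 5) * (3 * K%:R ^+ (4 * D2)) = 6 * K%:R ^+ (4 * D2 + 5 + 4 * D2) :> R.
    by rewrite !exprD; ring.
  by apply: (@natpow_absorb _ _ 3) => //; [lra|rewrite /D; clear; lia].
have -> : (q * (3 * c))%:R * th = q%:R * (3 * c%:R * th) by rewrite !natrM; ring.
apply: nint_le hq.
have -> : 16 * K'%:R ^+ 2 * de / N%:R = (16 * K%:R ^+ ((4 * D2 + 5) * 2 + (4 * D2 + 8))) / N%:R ^+ 3 :> R.
  rewrite /de natrX [in RHS]exprD [in RHS]exprM.
  by move: (K%:R ^+ (4 * D2 + 5)) (K%:R ^+ (4 * D2 + 8)) => u v; field; rewrite gt_eqF.
rewrite ler_wpM2r ?invr_ge0 ?exprn_ge0//; apply: (@natpow_absorb _ _ 4) => //; first by lra.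
by rewrite /D; clear; lia.
Qed.

End InverseWeyl.

(** * Removal of slowly varying phases along progressions *)

Section Blocks.
Variable R : realType.
Implicit Types (K N q Y : nat).

Lemma shifted_sum (F : nat -> R[i]) (N m s : nat) : (s + m <= N)%N ->
  (forall x, nm (F x) <= 1) ->
  nm (\sum_(x < N) F x - \sum_(x < m) F (s + x)%N) <= (N - m)%:R.
Proof.
move=> smN F1; have mN : (m <= N)%N by apply: leq_trans smN; rewrite leq_addl.
have B a b : (a <= b)%N -> nm (\sum_(a <= x < b) F x) <= (b - a)%:R.
  move=> ab; apply: le_trans (nm_sum _ _ _) _.
  apply: le_trans (ler_sum _ (fun x _ => F1 x)) _.
  by rewrite big_const_nat iter_addr addr0.
have -> : \sum_(x < m) F (s + x)%N = \sum_(s <= x < s + m) F x.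
  rewrite -{2}[s]add0n big_addn addKn big_mkord; by apply: eq_bigr => x _; rewrite addnC.
rewrite -(big_mkord xpredT F) (big_cat_nat (n := s)) //=; last first.
  by apply: leq_trans smN; rewrite leq_addr.
rewrite [X in _ + X - _](big_cat_nat (n := (s + m)%N)) ?leq_addr//=.
have -> (a b c : R[i]) : a + (b + c) - b = a + c by ring.
apply: le_trans (nmD _ _) _; apply: le_trans (lerD (B _ _ (leq0n s)) (B _ _ smN)) _.
by rewrite -natrD ler_nat; clear -smN; lia.
Qed.

(** Average over the starting points x0: shifting the full sum by q y changes it by at most the
    length q Y of the block, which is small against N / kap, so the blocks cannot all be small. *)
Lemma large_block (F : nat -> R[i]) (kap : R) N q Y : 0 < kap -> (0 < Y)%N -> (0 < N)%N ->
  (forall x, nm (F x) <= 1) ->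
  (q * Y)%:R <= N%:R / (4 * kap) -> 1 <= kap ->
  N%:R / kap <= nm (\sum_(x < N) F x) ->
  exists2 x0, (x0 + q * Y <= N)%N & Y%:R / (2 * kap) <= nm (\sum_(y < Y) F (x0 + q * y)%N).
Proof.
move=> kap0 Y0 N0 F1 qY kap1 H.
have N0' : 0 < N%:R :> R by rewrite ltr0n.
have Y0' : 0 < Y%:R :> R by rewrite ltr0n.
have qYN : (q * Y < N)%N.
  rewrite -(ltr_nat R); apply: le_lt_trans qY _.
  by rewrite ltr_pdivrMr ?mulr_gt0// ltr_pMr//; lra.
pose m := (N - q * Y)%N.
apply: contrapT => nex.
have small (x0 : 'I_m) : nm (\sum_(y < Y) F (x0 + q * y)%N) <= Y%:R / (2 * kap).
  rewrite leNgt; apply/negP => /ltW h; apply: nex; exists (x0 : nat) => //.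
  by have := ltn_ord x0; rewrite /m; clear; lia.
have U : nm (\sum_(x0 < m) \sum_(y < Y) F (x0 + q * y)%N) <= m%:R * (Y%:R / (2 * kap)).
  apply: le_trans (nm_sum _ _ _) _; apply: le_trans (ler_sum _ (fun x _ => small x)) _.
  by rewrite sumr_const card_ord [leRHS]mulr_natl.
rewrite exchange_big /= in U.
have V : nm (\sum_(y < Y) (\sum_(x < N) F x - \sum_(x0 < m) F (x0 + q * y)%N)) <= Y%:R * (q * Y)%:R.
  apply: le_trans (nm_sum _ _ _) _.
  apply: (@le_trans _ _ (\sum_(y < Y) (q * Y)%:R)); last by rewrite sumr_const card_ord mulr_natl.
  apply: ler_sum => y _.
  rewrite (eq_bigr (fun x0 : 'I_m => F (q * y + x0)%N)) => [|x _]; last by rewrite addnC.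
  have -> : (q * Y = N - m)%N by rewrite /m subKn// ltnW.
  apply: shifted_sum => //; have := leq_mul (leqnn q) (ltnW (ltn_ord y)); move: qYN.
  by rewrite /m; move: (q * Y)%N (q * y)%N => u v; clear; lia.
rewrite sumrB sumr_const card_ord -[X in nm (X - _)]mulr_natl in V.
have W : Y%:R * nm (\sum_(x < N) F x) - Y%:R * (q * Y)%:R <= m%:R * (Y%:R / (2 * kap)).
  apply: le_trans U; rewrite lerBlDr addrC -lerBlDr; apply: le_trans V.
  by apply: le_trans (nm_subr _ _); rewrite nmM nm_nat.
have {W} : Y%:R * (N%:R / kap - N%:R / (4 * kap)) <= N%:R * (Y%:R / (2 * kap)).
  apply: (@le_trans _ _ (m%:R * (Y%:R / (2 * kap)))).
    apply: le_trans W; rewrite -[X in _ <= X]mulrBr ler_pM2l// lerB//.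
  by apply: ler_wpM2r; [rewrite divr_ge0 ?mulr_ge0 ?ltW|rewrite ler_nat leq_subr].
have -> : Y%:R * (N%:R / kap - N%:R / (4 * kap)) = (3 / 4) * (N%:R * Y%:R / kap).
  by field; rewrite gt_eqF.
have -> : N%:R * (Y%:R / (2 * kap)) = (1 / 2) * (N%:R * Y%:R / kap).
  by field; rewrite gt_eqF.
rewrite ler_pM2r; last by rewrite divr_gt0 ?mulr_gt0.
lra.
Qed.

Lemma strip_factor (A G : nat -> R[i]) (kap eta : R) N q Y : 1 <= kap -> (0 < Y)%N -> (0 < N)%N ->
  (forall x, nm (A x) = 1) -> (forall x, nm (G x) = 1) ->
  (q * Y)%:R <= N%:R / (4 * kap) ->
  (forall x0 y, (x0 + q * Y <= N)%N -> (y < Y)%N -> nm (A (x0 + q * y)%N - A x0) <= eta) ->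
  eta <= 1 / (4 * kap) ->
  N%:R / kap <= nm (\sum_(x < N) A x * G x) ->
  exists2 x0, (x0 + q * Y <= N)%N & Y%:R / (4 * kap) <= nm (\sum_(y < Y) G (x0 + q * y)%N).
Proof.
move=> kap1 Y0 N0 A1 G1 qY dev eta1 H; have kap0 : 0 < kap by lra.
have AG x : nm (A x * G x) <= 1 by rewrite nmM A1 G1 mulr1.
have [x0 x0N h] := large_block kap0 Y0 N0 AG qY kap1 H; exists x0 => //.
have E : nm (\sum_(y < Y) A (x0 + q * y)%N * G (x0 + q * y)%N - A x0 * \sum_(y < Y) G (x0 + q * y)%N)
    <= Y%:R * eta.
  rewrite mulr_sumr -sumrB; apply: le_trans (nm_sum _ _ _) _.
  apply: (@le_trans _ _ (\sum_(y < Y) eta)); last by rewrite sumr_const card_ord mulr_natl.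
  by apply: ler_sum => y _; rewrite -mulrBl nmM G1 mulr1; apply: dev.
have E' := le_trans (nm_subr _ _) E; rewrite nmM A1 mul1r in E'.
have Y0' : 0 < Y%:R :> R by rewrite ltr0n.
have : Y%:R * eta <= Y%:R * (1 / (4 * kap)) by rewrite ler_pM2l.
move: h E'; rewrite invfM [in _ / (4 * _)]invfM => h E'.
by rewrite mul1r invfM; move: h E'; move: (kap^-1) (nm _) (nm _) => u v w; lra.
Qed.

(** The difference (x0 + q y)^j - x0^j is q W with W of size at most 3 Y N^(j-1). Since q th is an
    integer plus an error, only the error times W moves the phase. *)
Lemma slow_phase (th E : R) (N q Y j x0 y : nat) : (0 < q)%N -> (0 < N)%N -> (0 < j <= 3)%N ->
  0 <= E -> nint (q%:R * th) (E / N%:R ^+ j) -> (x0 + q * Y <= N)%N -> (y < Y)%N ->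
  nm (e (th * (x0 + q * y)%N%:R ^+ j) - e (th * x0%:R ^+ j)) <= 24 * E * Y%:R / N%:R.
Proof.
move=> q0 N0 /andP[j0 j3] E0 [a ha] xN yY.
have q0' : 0 < q%:R :> R by rewrite ltr0n.
have N0' : 0 < N%:R :> R by rewrite ltr0n.
have [W WE WN] : exists2 W : nat, ((x0 + q * y) ^ j = x0 ^ j + q * W)%N & (W <= 3 * (Y * N ^ j.-1))%N.
  set z := (q * y)%N.
  have zN : (x0 + z <= N)%N.
    by apply: leq_trans xN; rewrite leq_add2l leq_mul2l ltnW ?orbT.
  have x0N : (x0 <= N)%N by apply: leq_trans zN; rewrite leq_addr.
  have [W' WE' WN'] : exists2 W', ((x0 + z) ^ j = x0 ^ j + z * W')%N & (W' <= 3 * N ^ j.-1)%N.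
    case: j j0 j3 {ha} => [//|[|[|[|//]]]] _ _ /=.
    - by exists 1%N; rewrite ?expn0// !expn1 muln1.
    - exists (2 * x0 + z)%N; first by ring.
      by rewrite expn1; clear -zN x0N; lia.
    - exists (3 * x0 ^ 2 + 3 * x0 * z + z ^ 2)%N; first by ring.
      apply: leq_trans (_ : 3 * (x0 + z) ^ 2 <= _)%N; last by rewrite leq_mul2l /= leq_exp2r.
      by rewrite sqrnD; clear; nia.
  exists (y * W')%N; first by rewrite WE' mulnA.
  by rewrite mulnCA leq_mul// ltnW.
set rho := q%:R * th - a%:~R in ha.
have thE : th = (a%:~R + rho) / q%:R by rewrite /rho addrC subrK mulrAC divff ?gt_eqF// mul1r.
have -> : e (th * (x0 + q * y)%N%:R ^+ j) = e (th * x0%:R ^+ j) * e (rho * W%:R).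
  rewrite -natrX WE natrD natrX natrM -eD.
  rewrite -[RHS](eDint _ (a * W%:Z)) intrM -pmulrn; congr e.
  by rewrite thE; field; rewrite gt_eqF.
have -> : e (th * x0%:R ^+ j) * e (rho * W%:R) - e (th * x0%:R ^+ j) =
   e (th * x0%:R ^+ j) * (e (rho * W%:R) - e 0) by rewrite e0; ring.
rewrite nmM nm_e mul1r; apply: le_trans (e_lip _ _) _; rewrite subr0 normrM (ger0_norm (ler0n _ _)).
have WN' : W%:R <= 3 * (Y%:R * N%:R ^+ j.-1) :> R by rewrite -natrX -!natrM ler_nat.
apply: (@le_trans _ _ (8 * (E / N%:R ^+ j * (3 * (Y%:R * N%:R ^+ j.-1))))).
  by rewrite ler_wpM2l// ler_pM.
rewrite -{1}(prednK j0) exprS le_eqVlt; apply/orP; left; apply/eqP.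
by field; rewrite !gt_eqF// exprn_gt0.
Qed.

End Blocks.

Section Inverse.
Variable R : realType.

(** The leading coefficient comes from [weyl_cubic]. Along progressions to its denominator q3 the
    cubic phase is nearly constant; with it stripped off, the quadratic case gives a denominator for
    the second coefficient times q3^2. Along progressions to the common denominator both phases are
    constant, and a geometric sum remains for the linear coefficient. *)
Theorem weyl_inverse : exists D, forall (K N : nat) (th1 th2 th3 : R), (2 <= K)%N -> (K ^ D <= N)%N ->
  N%:R / K%:R <= nm (\sum_(x < N) e (th3 * x%:R ^+ 3 + th2 * x%:R ^+ 2 + th1 * x%:R)) ->
  exists q, [/\ (0 < q <= K ^ D)%N, nint (q%:R * th1) (K%:R ^+ D / N%:R),
    nint (q%:R * th2) (K%:R ^+ D / N%:R ^+ 2) & nint (q%:R * th3) (K%:R ^+ D / N%:R ^+ 3)].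
Proof.
have [D2 HQ] := weyl_quadratic R; have [D3 HC] := weyl_cubic R.
pose D4 := (3 * D2 + 2 * D3 + 20)%N.
exists (2 * D4 + 30 + 3 * D2)%N => K N th1 th2 th3 K2 KN H.
set D := (2 * D4 + 30 + 3 * D2)%N in KN *.
have K0 : (0 < K)%N by apply: leq_trans K2.
have N0 : (0 < N)%N by apply: leq_trans KN; rewrite expn_gt0 K0.
have K0' : 0 < K%:R :> R by rewrite ltr0n.
have K1' : 1 <= K%:R :> R by rewrite ler1n.
have N0' : 0 < N%:R :> R by rewrite ltr0n.
have KN' : K%:R ^+ D <= N%:R :> R by rewrite -natrX ler_nat.
have Kp n : 0 < K%:R ^+ n :> R by rewrite exprn_gt0.
have [] := HC K N th3 th2 th1 K2 _ H.
  by apply: leq_trans KN; rewrite leq_pexp2l// /D /D4; clear; lia.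
move=> q3 /andP[q30 q3K] h3.
(* [Y d] is the length of the blocks on which a phase with denominator and
   error at most [K ^ d] is nearly constant. *)
pose Y d := (N %/ K ^ (d + 9))%N.
have Yup d : (Y d)%:R <= N%:R / K%:R ^+ (d + 9) :> R.
  by rewrite ler_pdivlMr// -natrX -natrM ler_nat leq_trunc_div.
have Ylow d c : (d + 9 + c <= D)%N -> (K ^ c <= Y d)%N.
  move=> dc; rewrite leq_divRL ?expn_gt0 ?K0// -expnD; apply: leq_trans KN.
  by rewrite leq_pexp2l// addnC.
have Ylow' d : (d + 9 <= D)%N -> N%:R <= (Y d)%:R * K%:R ^+ (d + 10) :> R.
  move=> dD; have Y0 : (0 < Y d)%N by apply: (Ylow d 0%N); rewrite addn0.
  rewrite -natrX -natrM ler_nat (addnS d 9) expnS mulnA.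
  apply: (@leq_trans ((Y d).+1 * K ^ (d + 9))).
    by rewrite ltnW// -ltn_divLR// expn_gt0 K0.
  by rewrite leq_mul2r (leq_trans (_ : _ <= Y d * 2)%N) ?orbT ?leq_mul// muln2 -addnn -addn1 leq_add2l.
have numer (c : R) j d : c <= 2 ^+ j -> (j + 1 <= 9)%N ->
    c * (K%:R ^+ d * (Y d)%:R * K%:R) <= N%:R.
  move=> cj j8.
  have -> : c * (K%:R ^+ d * (Y d)%:R * K%:R) = (c * K%:R ^+ (d + 1)) * (Y d)%:R by rewrite exprD expr1; ring.
  apply: (@le_trans _ _ (K%:R ^+ (d + 9) * (Y d)%:R)).
    by apply: ler_wpM2r => //; apply: (natpow_absorb K2 cj); lia.
  by rewrite mulrC -ler_pdivlMr.
have stepsmall q d : (q <= K ^ d)%N -> (q * Y d)%:R <= N%:R / (4 * K%:R) :> R.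
  move=> qK; rewrite ler_pdivlMr ?mulr_gt0//; apply: le_trans (numer 4 2%N d _ isT); last by lra.
  rewrite natrM; have -> : 4 * (K%:R ^+ d * (Y d)%:R * K%:R) = K%:R ^+ d * (Y d)%:R * (4 * K%:R) :> R by ring.
  by rewrite !ler_wpM2r ?mulr_ge0// -natrX ler_nat.
have dev (c : R) d : c <= 48 -> c * K%:R ^+ d * (Y d)%:R / N%:R <= 1 / (4 * K%:R).
  move=> c48; rewrite ler_pdivrMr// [leRHS]mulrAC mul1r ler_pdivlMr ?mulr_gt0//.
  apply: le_trans (numer 192 8%N d _ isT); last by lra.
  have -> : c * K%:R ^+ d * (Y d)%:R * (4 * K%:R) = (4 * c) * (K%:R ^+ d * (Y d)%:R * K%:R) by ring.
  by apply: ler_wpM2r; [rewrite !mulr_ge0 ?exprn_ge0|lra].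
have Y0 d : (d + 9 <= D)%N -> (0 < Y d)%N.
  by move=> dD; apply: (Ylow d 0%N); rewrite addn0.
have d3D : (D3 + 9 + 3 * D2 <= D)%N by rewrite /D /D4; clear; lia.
have d3D' : (D3 + 9 <= D)%N by apply: leq_trans d3D; rewrite leq_addr.
have d4D : (D4 + 9 <= D)%N by rewrite /D; clear; lia.
have H1 : N%:R / K%:R <= nm (\sum_(x < N)
    e (th3 * x%:R ^+ 3) * e (th2 * x%:R ^+ 2 + th1 * x%:R)).
  apply: le_trans H _; rewrite le_eqVlt; apply/orP; left; apply/eqP; congr nm.
  by apply: eq_bigr => x _; rewrite -eD; congr e; ring.
have [x1 x1N h1] := strip_factor (A := fun x => e (th3 * x%:R ^+ 3))
   (G := fun x => e (th2 * x%:R ^+ 2 + th1 * x%:R)) K1' (Y0 D3 d3D') N0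
   (fun x => nm_e _) (fun x => nm_e _) (stepsmall _ _ q3K)
   (fun x0 y => slow_phase q30 N0 (isT : (0 < 3 <= 3)%N) (ltW (Kp D3)) h3)
   (dev 24 D3 (ltac:(lra))) H1.
set Y1 := Y D3 in h1.
have K3 : (2 <= K ^ 3)%N by apply: leq_trans K2 _; rewrite -{1}(expn1 K) leq_pexp2l.
have h1' : Y1%:R / (K ^ 3)%:R <=
    nm (\sum_(y < Y1) e (th2 * q3%:R ^+ 2 * y%:R ^+ 2 + (2 * th2 * x1%:R + th1) * q3%:R * y%:R)).
  rewrite -(@nm_phase_sum _ Y1 (fun y => th2 * (x1 + q3 * y)%N%:R ^+ 2 + th1 * (x1 + q3 * y)%N%:R)
    (fun y => th2 * q3%:R ^+ 2 * y%:R ^+ 2 + (2 * th2 * x1%:R + th1) * q3%:R * y%:R)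
    (th2 * x1%:R ^+ 2 + th1 * x1%:R)); last by move=> y _; rewrite natrD natrM; ring.
  apply: le_trans h1; rewrite ler_wpM2l// lef_pV2 ?posrE ?mulr_gt0 ?ltr0n ?expn_gt0 ?K0// natrX.
  by rewrite -[X in 4 * X]expr1; apply: (@natpow_absorb _ _ _ 2) => //; lra.
have [] := HQ _ _ _ _ K3 _ h1'; first by rewrite -expnM; apply: Ylow.
move=> q2 /andP[q20 q2K] h2; rewrite -expnM in q2K.
pose q := (q2 * q3 ^ 2)%N.
have q0 : (0 < q)%N by rewrite muln_gt0 q20 expn_gt0 q30.
have qK : (q <= K ^ D4)%N.
  apply: (@leq_trans (K ^ (3 * D2) * (K ^ D3) ^ 2)); first by rewrite leq_mul// leq_exp2r.
  by rewrite -expnM -expnD leq_pexp2l// /D4; clear; lia.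
have g2 : nint (q%:R * th2) (K%:R ^+ D4 / N%:R ^+ 2).
  move: h2; have -> : q2%:R * (th2 * q3%:R ^+ 2) = q%:R * th2 by rewrite natrM natrX; ring.
  have Y10 : 0 < Y1%:R :> R by rewrite ltr0n; exact: Y0.
  apply: nint_le; rewrite ler_pdivrMr ?exprn_gt0// mulrAC ler_pdivlMr ?exprn_gt0//.
  apply: (@le_trans _ _ ((K ^ 3)%:R ^+ D2 * (Y1%:R * K%:R ^+ (D3 + 10)) ^+ 2)).
    rewrite ler_wpM2l ?exprn_ge0// lerXn2r ?nnegrE ?mulr_ge0 ?exprn_ge0//.
    exact: Ylow'.
  have -> : (K ^ 3)%:R ^+ D2 * (Y1%:R * K%:R ^+ (D3 + 10)) ^+ 2 =
      K%:R ^+ (3 * D2 + (D3 + 10) * 2) * Y1%:R ^+ 2 :> R.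
    by rewrite natrX [in RHS]exprD !exprM; ring.
  rewrite ler_wpM2r ?exprn_ge0//.
  by apply: natpow_le => //; rewrite /D4; clear; lia.
have g3 : nint (q%:R * th3) (K%:R ^+ D4 / N%:R ^+ 3).
  have := nintMn (q2 * q3) h3.
  have -> : (q2 * q3)%:R * (q3%:R * th3) = q%:R * th3 by rewrite /q !natrM; ring.
  apply: nint_le; rewrite mulrA ler_wpM2r ?invr_ge0 ?exprn_ge0//.
  apply: (@le_trans _ _ (K%:R ^+ (3 * D2) * K%:R ^+ D3 * K%:R ^+ D3)).
    rewrite ler_wpM2r ?exprn_ge0// natrM -!natrX; apply: ler_pM => //; by rewrite ler_nat.
  by rewrite -!exprD; apply: natpow_le => //; rewrite /D4; clear; lia.
have H2 : N%:R / K%:R <= nm (\sum_(x < N)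
    (e (th3 * x%:R ^+ 3) * e (th2 * x%:R ^+ 2)) * e (th1 * x%:R)).
  apply: le_trans H _; rewrite le_eqVlt; apply/orP; left; apply/eqP; congr nm.
  by apply: eq_bigr => x _; rewrite -!eD; congr e; ring.
have D48 : 48 * K%:R ^+ D4 * (Y D4)%:R / N%:R <= 1 / (4 * K%:R) := dev 48 D4 (lexx _).
have dev2 x0 y : (x0 + q * Y D4 <= N)%N -> (y < Y D4)%N ->
    nm (e (th3 * (x0 + q * y)%N%:R ^+ 3) * e (th2 * (x0 + q * y)%N%:R ^+ 2)
      - e (th3 * x0%:R ^+ 3) * e (th2 * x0%:R ^+ 2)) <= 48 * K%:R ^+ D4 * (Y D4)%:R / N%:R.
  move=> xN yY.
  have s3 := slow_phase q0 N0 (isT : (0 < 3 <= 3)%N) (ltW (Kp D4)) g3 xN yY.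
  have s2 := slow_phase q0 N0 (isT : (0 < 2 <= 3)%N) (ltW (Kp D4)) g2 xN yY.
  have E (a b c d : R[i]) : a * b - c * d = a * (b - d) + (a - c) * d by ring.
  rewrite E; apply: le_trans (nmD _ _) _; rewrite !nmM !nm_e mul1r mulr1.
  by apply: le_trans (lerD s2 s3) _; move: (K%:R ^+ D4) => u; lra.
have A1 (x : nat) : nm (e (th3 * x%:R ^+ 3) * e (th2 * x%:R ^+ 2)) = 1.
  by rewrite nmM !nm_e mulr1.
have [x2 x2N h4] := strip_factor (G := fun x => e (th1 * x%:R)) K1' (Y0 D4 d4D) N0
   A1 (fun x => nm_e _) (stepsmall _ _ qK) dev2 D48 H2.
have Y20 : 0 < (Y D4)%:R :> R by rewrite ltr0n; exact: Y0.
have h5 : (Y D4)%:R / (4 * K%:R) <= nm (\sum_(y < Y D4) e (q%:R * th1 * y%:R)).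
  rewrite -(@nm_phase_sum _ (Y D4) (fun y => th1 * (x2 + q * y)%N%:R)
    (fun y => q%:R * th1 * y%:R) (th1 * x2%:R)) //.
  by move=> y _; rewrite natrD natrM; ring.
have weak j d : (d <= D)%N -> K%:R ^+ d / N%:R ^+ j <= K%:R ^+ D / N%:R ^+ j :> R.
  by move=> dD; rewrite ler_wpM2r ?invr_ge0 ?exprn_ge0//; apply: natpow_le.
have D4D : (D4 <= D)%N by apply: leq_trans d4D; rewrite leq_addr.
exists q; split.
- by rewrite q0 (leq_trans qK)// leq_pexp2l.
- have [] := geom_bound _ (Y0 D4 d4D) h5; first by rewrite mulr_gt0.
  move=> a ha; exists a; apply: le_trans ha _.
  rewrite ler_pdivrMr// mulrAC ler_pdivlMr//.
  apply: le_trans (ler_wpM2l _ (Ylow' D4 d4D)) _; first by rewrite !mulr_ge0.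
  rewrite [leRHS]mulrC mulrCA ler_wpM2l//.
  have -> : 2 * (4 * K%:R) * K%:R ^+ (D4 + 10) = 8 * K%:R ^+ (D4 + 11) :> R.
    by rewrite [in RHS]addnS [in RHS]exprS; ring.
  by apply: (@natpow_absorb _ _ _ 3) => //; [lra|rewrite /D; clear; lia].
- exact: nint_le (weak 2%N D4 D4D) g2.
- exact: nint_le (weak 3%N D4 D4D) g3.
Qed.

End Inverse.

(** * Level sets of cubic exponential sums *)

Section CubicSum.
Variable R : realType.
Implicit Types (al be th : 'I_3 -> R) (a : 'I_3 -> int).

Definition phase al (x : R) : R := \sum_i al i * x ^+ i.+1.

Definition gsum N al : R[i] := \sum_(x < N) e (phase al x%:R).

Lemma phaseE al x :
  phase al x = al ord0 * x + al (lift ord0 ord0) * x ^+ 2 + al (lift ord0 (lift ord0 ord0)) * x ^+ 3.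
Proof. by rewrite /phase !big_ord_recl big_ord0 /= addr0 addrA expr1. Qed.

Lemma phaseD al be x : phase (fun i => al i + be i) x = phase al x + phase be x.
Proof. by rewrite /phase -big_split; apply: eq_bigr => i _; rewrite mulrDl. Qed.

Lemma phase_scale th (c x : R) : phase (fun i => th i * c ^+ i.+1) x = phase th (c * x).
Proof. by apply: eq_bigr => i _; rewrite exprMn mulrA. Qed.

Lemma phase_lip th (E x y : R) : (forall i, `|th i| <= E) -> `|x| <= 1 -> `|y| <= 1 ->
  `|phase th x - phase th y| <= 6 * E * `|x - y|.
Proof.
move=> thE x1 y1; rewrite !phaseE.
set t0 := th _; set t1 := th _; set t2 := th _.
have -> : t0 * x + t1 * x ^+ 2 + t2 * x ^+ 3 - (t0 * y + t1 * y ^+ 2 + t2 * y ^+ 3) =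
  (t0 + t1 * (x + y) + t2 * (x * x + x * y + y * y)) * (x - y) by ring.
rewrite normrM ler_wpM2r//.
have M (u v : R) : `|u| <= 1 -> `|v| <= 1 -> `|u * v| <= 1.
  by move=> u1 v1; rewrite normrM mulr_ile1.
have h1 : `|x + y| <= 2 by apply: le_trans (ler_normD _ _) _; lra.
have h2 : `|x * x + x * y + y * y| <= 3.
  apply: le_trans (ler_normD _ _) _; have := ler_normD (x * x) (x * y).
  by have := M _ _ x1 x1; have := M _ _ x1 y1; have := M _ _ y1 y1; lra.
apply: le_trans (ler_normD _ _) _.
have k1 : `|t1 * (x + y)| <= E * 2 by rewrite normrM; apply: ler_pM => //; exact: thE.
have k2 : `|t2 * (x * x + x * y + y * y)| <= E * 3 by rewrite normrM; apply: ler_pM => //; exact: thE.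
have := ler_normD t0 (t1 * (x + y)); have := thE ord0; rewrite -/t0; lra.
Qed.

Lemma phase_dist th th' (d x : R) : (forall i, `|th i - th' i| <= d) -> `|x| <= 1 ->
  `|phase th x - phase th' x| <= 3 * d.
Proof.
move=> thd x1; rewrite /phase -sumrB; apply: le_trans (ler_norm_sum _ _ _) _.
apply: (@le_trans _ _ (\sum_(i < 3) d)); last by rewrite sumr_const card_ord mulr_natl.
apply: ler_sum => i _; rewrite -mulrBl normrM -[leRHS]mulr1 ler_pM// normrX.
by rewrite exprn_ile1.
Qed.

Lemma e_phase_periodic a (q r z : nat) : (0 < q)%N ->
  e (phase (fun i => (a i)%:~R / q%:R) (r + q * z)%N%:R) =
  e (phase (fun i => (a i)%:~R / q%:R) r%:R) :> R[i].
Proof.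
move=> q0; rewrite /phase !e_sum; apply: eq_bigr => i _.
have [W WE] : exists W, ((r + q * z) ^ i.+1 = r ^ i.+1 + q * W)%N.
  elim: (i.+1) => [|n [W IHn]]; first by exists 0%N; rewrite muln0.
  exists (z * r ^ n + (r + q * z) * W)%N; rewrite expnS IHn expnS; ring.
rewrite -natrX WE natrD natrM natrX mulrDr -[RHS](eDint _ (a i * W%:Z)); congr e; congr (_ + _).
by rewrite intrM -pmulrn mulrA divfK ?pnatr_eq0 -?lt0n.
Qed.

Definition complete_sum q a : R[i] := \sum_(r < q) e (phase (fun i => (a i)%:~R / q%:R) r%:R).

Definition sampled_sum T th : R[i] := \sum_(u < T) e (phase th (u%:R / T%:R)).

(** The usual approximant q^-1 S(q, a) v(beta) on a major arc, normalised by the length, with the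
    oscillatory integral replaced by an average over T sample points. *)
Definition main_coef q T a th : R[i] := (q * T)%:R^-1 * (complete_sum q a * sampled_sum T th).

Lemma nm_sum_le1 T (F : nat -> R[i]) : (forall u, nm (F u) <= 1) -> nm (\sum_(u < T) F u) <= T%:R.
Proof.
move=> F1; apply: le_trans (nm_sum _ _ _) _.
by apply: le_trans (ler_sum _ (fun (u : 'I_T) _ => F1 u)) _; rewrite sumr_const card_ord.
Qed.

Lemma nm_main_coef q T a th : (0 < q)%N -> (0 < T)%N -> nm (main_coef q T a th) <= 1.
Proof.
move=> q0 T0; have qT0 : (0 < q * T)%N by rewrite muln_gt0 q0.
have H : nm (complete_sum q a * sampled_sum T th) <= (q * T)%:R.
  rewrite nmM natrM; apply: ler_pM; rewrite ?nm_ge0//.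
    by apply: (@nm_sum_le1 _ (fun r => e (phase _ r%:R))) => u; rewrite nm_e.
  by apply: (@nm_sum_le1 _ (fun u => e (phase th (u%:R / T%:R)))) => u; rewrite nm_e.
rewrite /main_coef -(@ler_pM2l _ (q * T)%:R) ?ltr0n// mulr1; apply: le_trans H.
rewrite -{1}(nm_nat R (q * T)) -nmM mulrA mulfV ?mul1r//.
by rewrite pnatr_eq0 -lt0n.
Qed.

(** Write x = r + q v + q Y u with r < q, v < Y and u < T. The rational part of the phase depends on
    r alone, and the smooth part differs little from its value at u / T. The terms left over, fewer
    than q T, account for the first error. *)
Lemma major_approx (q T N : nat) a be (E : R) : (0 < q)%N -> (0 < T)%N -> (q * T <= N)%N ->
  (forall i, `|be i * N%:R ^+ i.+1| <= E) ->
  nm (gsum N (fun i => (a i)%:~R / q%:R + be i) -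
      N%:R * main_coef q T a (fun i => be i * N%:R ^+ i.+1))
  <= 2 * (q * T)%:R + 48 * E * ((q * T)%:R + N%:R / T%:R).
Proof.
move=> q0 T0 qTN beE; set th := fun i => be i * N%:R ^+ i.+1.
set al := fun i => _ + be i.
have qT0 : (0 < q * T)%N by rewrite muln_gt0 q0.
have N0 : (0 < N)%N by apply: leq_trans qTN.
have N0' : 0 < N%:R :> R by rewrite ltr0n.
have T0' : 0 < T%:R :> R by rewrite ltr0n.
have E0 : 0 <= E by apply: le_trans (beE ord0).
pose Y := (N %/ (q * T))%N; pose m := (q * Y * T)%N.
have mN : (m <= N)%N by rewrite /m mulnAC mulnC; exact: leq_trunc_div.
have Nm : (N - m <= q * T)%N.
  rewrite leq_subLR /m mulnAC mulnC {1}(divn_eq N (q * T)) leq_add2l.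
  by rewrite ltnW// ltn_pmod.
pose F x : R[i] := e (phase al x%:R).
have F1 x : nm (F x) <= 1 by rewrite nm_e.
have s1 := @shifted_sum R F N m 0 mN F1.
set S := complete_sum q a; set U := sampled_sum T th.
have s3 : nm (Y%:R * (S * U) - N%:R * main_coef q T a th) <= (q * T)%:R.
  have -> : Y%:R * (S * U) - N%:R * main_coef q T a th = - ((N - m)%:R * main_coef q T a th).
    suff -> : Y%:R * (S * U) = m%:R * main_coef q T a th by rewrite natrB// mulrBl opprB.
    have -> : m = (Y * (q * T))%N by rewrite /m; ring.
    by rewrite /main_coef natrM [in RHS]mulrA mulfK// pnatr_eq0 -lt0n.
  rewrite nmN nmM nm_nat; apply: le_trans (ler_wpM2l _ (nm_main_coef _ _ q0 T0)) _ => //.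
  by rewrite mulr1 ler_nat.
have s2 : nm (\sum_(x < m) F x - Y%:R * (S * U)) <= N%:R * (48 * E * ((q * T)%:R / N%:R + 1 / T%:R)).
  have -> : \sum_(x < m) F x = \sum_(r < q) \sum_(v < Y) \sum_(u < T) F (r + q * v + q * Y * u)%N.
    rewrite /m sum_ord_mul (sum_ord_mul q Y (fun w => \sum_(u < T) F (w + q * Y * u)%N)).
    by [].
  have -> : Y%:R * (S * U) = \sum_(r < q) \sum_(v < Y) \sum_(u < T)
      e (phase (fun i => (a i)%:~R / q%:R) r%:R) * e (phase th (u%:R / T%:R)).
    rewrite /S /complete_sum mulr_suml mulr_sumr; apply: eq_bigr => r _.
    by rewrite [RHS]sumr_const card_ord -[RHS]mulr_natl -mulr_sumr.
  rewrite -sumrB; apply: (@le_trans _ _ (\sum_(r < q) \sum_(v < Y) \sum_(u < T)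
      (48 * E * ((q * T)%:R / N%:R + 1 / T%:R)))); last first.
    have : 0 <= 48 * E * ((q * T)%:R / N%:R + 1 / T%:R).
      by rewrite mulr_ge0 ?mulr_ge0// addr_ge0 ?divr_ge0.
    move: (48 * E * _) => X X0.
    rewrite !sumr_const !card_ord -!mulrnA -[leLHS]mulr_natl ler_wpM2r//.
    by rewrite ler_nat (_ : (T * (Y * q))%N = m)//; rewrite /m; ring.
  apply: le_trans (nm_sum _ _ _) _; apply: ler_sum => r _; rewrite -sumrB.
  apply: le_trans (nm_sum _ _ _) _; apply: ler_sum => v _; rewrite -sumrB.
  apply: le_trans (nm_sum _ _ _) _; apply: ler_sum => u _.
  set x := (r + q * v + q * Y * u)%N.
  have xE : x = (r + q * (v + Y * u))%N by rewrite /x mulnDr addnA mulnA.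
  rewrite /F /al phaseD eD {1}xE e_phase_periodic// -mulrBr nmM nm_e mul1r.
  have -> : phase be x%:R = phase th (x%:R / N%:R).
    by rewrite /th phase_scale mulrCA mulfV ?gt_eqF// mulr1.
  apply: le_trans (e_lip _ _) _.
  have wq : (r + q * v <= q * Y)%N.
    by apply: leq_trans (_ : q * v.+1 <= _)%N; [by rewrite mulnS leq_add2r ltnW|by rewrite leq_mul2l ltn_ord orbT].
  have xm : (x <= m)%N.
    rewrite /x /m; apply: leq_trans (_ : q * Y + q * Y * u <= _)%N; first by rewrite leq_add2r.
    by rewrite -mulnS leq_mul2l ltn_ord orbT.
  have x1 : `|x%:R / N%:R : R| <= 1.
    by rewrite ger0_norm ?divr_ge0// ler_pdivrMr// mul1r ler_nat (leq_trans xm).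
  have u1 : `|u%:R / T%:R : R| <= 1.
    by rewrite ger0_norm ?divr_ge0// ler_pdivrMr// mul1r ler_nat ltnW.
  apply: (@le_trans _ _ (8 * (6 * E * `|x%:R / N%:R - u%:R / T%:R|))).
    by rewrite ler_wpM2l//; apply: phase_lip.
  have -> : 8 * (6 * E * `|x%:R / N%:R - u%:R / T%:R|) = 48 * E * `|x%:R / N%:R - u%:R / T%:R : R|.
    by move: (`|_|) => w; ring.
  rewrite ler_wpM2l ?mulr_ge0//.
  have -> : x%:R / N%:R - u%:R / T%:R =
     (r + q * v)%N%:R / N%:R - u%:R * (N - m)%:R / (N%:R * T%:R) :> R.
    rewrite natrB// /x /m natrD !natrM; field; by rewrite !gt_eqF.
  apply: le_trans (ler_normB _ _) _; rewrite addrC; apply: lerD.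
    rewrite ger0_norm ?divr_ge0 ?mulr_ge0// ler_pdivrMr ?mulr_gt0//.
    have -> : (q * T)%:R / N%:R * (N%:R * T%:R) = T%:R * (q * T)%:R :> R by field; rewrite gt_eqF.
    by rewrite ler_pM// ler_nat// ltnW.
  rewrite ger0_norm ?divr_ge0// ler_pdivrMr// mul1r mulrC ler_pdivlMr// -natrM ler_nat.
  by apply: leq_trans mN; rewrite /m leq_mul2r wq orbT.
have -> : gsum N al = \sum_(x < N) F x by [].
have -> : \sum_(x < N) F x - N%:R * main_coef q T a th =
  (\sum_(x < N) F x - \sum_(x < m) F (0 + x)%N) + (\sum_(x < m) F x - Y%:R * (S * U)) +
   (Y%:R * (S * U) - N%:R * main_coef q T a th).
  rewrite (eq_bigr (fun x : 'I_m => F x) (fun _ _ => erefl)); ring.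
apply: le_trans (nmD _ _) _; apply: le_trans (lerD (nmD _ _) s3) _.
apply: le_trans (lerD (lerD s1 s2) (lexx _)) _.
have -> : N%:R * (48 * E * ((q * T)%:R / N%:R + 1 / T%:R)) = 48 * E * ((q * T)%:R + N%:R / T%:R).
  by field; rewrite !gt_eqF.
have : (N - m)%:R <= (q * T)%:R :> R by rewrite ler_nat.
move: (48 * E * _) => w; lra.
Qed.

(** Both normalised sums are near [main_coef] at the same a / q, which depends on the length only
    through the rescaled deviations be_i N^(i+1); these are nearly equal by assumption. *)
Lemma gsum_transfer (q T N P : nat) a be be' (E d : R) : (0 < q)%N -> (0 < T)%N ->
  (q * T <= P)%N -> (P <= N)%N ->
  (forall i, `|be i * N%:R ^+ i.+1| <= E) -> (forall i, `|be' i * P%:R ^+ i.+1| <= E) ->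
  (forall i, `|be i * N%:R ^+ i.+1 - be' i * P%:R ^+ i.+1| <= d) ->
  nm (gsum N (fun i => (a i)%:~R / q%:R + be i)) / N%:R <=
  nm (gsum P (fun i => (a i)%:~R / q%:R + be' i)) / P%:R + 24 * d
    + 2 * (2 * ((q * T)%:R / P%:R) + 48 * E * ((q * T)%:R / P%:R + 1 / T%:R)).
Proof.
move=> q0 T0 qTP PN beE be'E dd.
have qT0 : (0 < q * T)%N by rewrite muln_gt0 q0.
have P0 : (0 < P)%N by apply: leq_trans qTP.
have P0' : 0 < P%:R :> R by rewrite ltr0n.
have N0' : 0 < N%:R :> R by rewrite ltr0n (leq_trans P0).
have T0' : 0 < T%:R :> R by rewrite ltr0n.
have E0 : 0 <= E by apply: le_trans (beE ord0).
set X := 2 * _ + 48 * E * _.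
have main M be0 : (P <= M)%N -> (forall i, `|be0 i * M%:R ^+ i.+1| <= E) ->
    nm (gsum M (fun i => (a i)%:~R / q%:R + be0 i) -
      M%:R * main_coef q T a (fun i => be0 i * M%:R ^+ i.+1)) <= M%:R * X.
  move=> PM h; apply: le_trans (@major_approx q T M a be0 E q0 T0 (leq_trans qTP PM) h) _.
  have M0 : 0 < M%:R :> R by rewrite ltr0n (leq_trans P0).
  have H : (q * T)%:R <= M%:R * ((q * T)%:R / P%:R) :> R.
    by rewrite mulrCA ler_peMr// ler_pdivlMr// mul1r ler_nat.
  have -> : M%:R * X = 2 * (M%:R * ((q * T)%:R / P%:R)) +
     48 * E * (M%:R * ((q * T)%:R / P%:R) + M%:R / T%:R).
    by rewrite /X; field; rewrite !gt_eqF.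
  by rewrite lerD ?ler_wpM2l ?mulr_ge0// lerD2r.
have cdist : nm (main_coef q T a (fun i => be i * N%:R ^+ i.+1) -
    main_coef q T a (fun i => be' i * P%:R ^+ i.+1)) <= 24 * d.
  rewrite /main_coef -mulrBr -mulrBr mulrA nmM -sumrB.
  have h1 : nm ((q * T)%:R^-1 * complete_sum q a) <= T%:R^-1.
    rewrite -(@ler_pM2l _ (q * T)%:R) ?ltr0n// natrM mulfK ?gt_eqF//.
    rewrite -natrM -{1}(nm_nat R (q * T)) -nmM mulrA mulfV ?mul1r ?pnatr_eq0 -?lt0n//.
    by apply: (@nm_sum_le1 _ (fun r => e (phase _ r%:R))) => u; rewrite nm_e.
  have h2 : nm (\sum_(u < T) (e (phase (fun i => be i * N%:R ^+ i.+1) (u%:R / T%:R)) -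
      e (phase (fun i => be' i * P%:R ^+ i.+1) (u%:R / T%:R)))) <= T%:R * (24 * d).
    apply: le_trans (nm_sum _ _ _) _; apply: (@le_trans _ _ (\sum_(u < T) (24 * d))); last first.
      by rewrite sumr_const card_ord [leRHS]mulr_natl.
    apply: ler_sum => u _; apply: le_trans (e_lip _ _) _.
    have : `|u%:R / T%:R : R| <= 1.
      by rewrite ger0_norm ?divr_ge0// ler_pdivrMr// mul1r ler_nat ltnW.
    move=> /(phase_dist dd); move: (`|_|) => w; lra.
  apply: le_trans (ler_pM (nm_ge0 _) (nm_ge0 _) h1 h2) _.
  by rewrite mulKf ?gt_eqF.
have m1 := main _ _ PN beE; have m2 := main _ _ (leqnn P) be'E.
move: m1 m2 cdist; set c := main_coef _ _ _ _; set c' := main_coef _ _ _ _.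
set g := gsum _ _; set g' := gsum _ _ => m1 m2 cd.
have k1 : nm g / N%:R <= nm c + X.
  rewrite ler_pdivrMr// mulrDl; have := le_trans (nm_subr _ _) m1.
  by rewrite nmM nm_nat; lra.
have k2 : nm c' <= nm g' / P%:R + X.
  rewrite -(ler_pM2l P0') mulrDr mulrCA mulfV ?gt_eqF// mulr1.
  have := nm_subr (P%:R * c') g'; rewrite nm_sub nmM nm_nat; lra.
by have := nm_subr c c'; lra.
Qed.

End CubicSum.

(** * Transfer of level sets between two lengths *)

Section LevelSets.
Variable R : realType.

Definition residue_ord (Q : nat) (Q0 : (0 < Q)%N) (s : int) : 'I_Q.
Proof.
refine (@Ordinal Q `|(s %% Q%:Z)%Z|%N _).
abstract (by rewrite -ltz_nat gez0_abs ?modz_ge0 ?ltz_pmod// ?eqz_nat -?lt0n//; rewrite gt_eqF).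
Defined.

Lemma residue_ordE (Q : nat) (Q0 : (0 < Q)%N) (s : int) :
  exists n : int, s = (residue_ord Q0 s)%:Z + n * Q%:Z.
Proof.
exists (s %/ Q%:Z)%Z; rewrite /= gez0_abs; first by rewrite addrC -divz_eq.
by rewrite modz_ge0// eqz_nat -lt0n.
Qed.

Lemma gsum_congr N (al al' : 'I_3 -> R) :
  (forall i, exists n : int, al i = al' i + n%:~R) -> gsum N al = gsum N al'.
Proof.
move=> H; apply: eq_bigr => x _; rewrite /phase !e_sum; apply: eq_bigr => i _.
have [n ->] := H i; rewrite mulrDl -[RHS](eDint _ (n * (x : nat)%:Z ^+ i.+1)).
by rewrite intrM rmorphXn /= -pmulrn.
Qed.

(* The shift that moves a grid point [t / Q] near [a / q] to one near [a / q]
   at [M] times the distance. *)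
Definition dilate (Q M q : nat) (a : int) (t j : nat) : int :=
  (M * t + j)%N%:Z + ((Q%:Z * a * (1 - M%:Z)) %/ q%:Z)%Z.

Lemma dilate_bounds (Q M q : nat) a t j : (0 < Q)%N -> (0 < q)%N -> (j < M)%N ->
  `|((dilate Q M q a t j)%:~R / Q%:R - a%:~R / q%:R) -
     M%:R * (t%:R / Q%:R - a%:~R / q%:R)| <= M%:R / Q%:R :> R.
Proof.
move=> Q0 q0 jM; rewrite /dilate; set z := Q%:Z * a * (1 - M%:Z).
have Q0' : 0 < Q%:R :> R by rewrite ltr0n.
have q0' : 0 < q%:R :> R by rewrite ltr0n.
have q0z : 0 < q%:Z by rewrite ltz_nat.
have r0 := modz_ge0 z (lt0r_neq0 q0z); have r1 := ltz_pmod z q0z.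
have zE : z%:~R = ((z %/ q%:Z)%Z)%:~R * q%:R + ((z %% q%:Z)%Z)%:~R :> R.
  by rewrite {1}(divz_eq z q%:Z) intrD intrM -pmulrn.
move: r0 r1 zE; set d := (z %/ _)%Z; set r := (z %% _)%Z => r0 r1 zE.
have zR : z%:~R = Q%:R * a%:~R * (1 - M%:R) :> R by rewrite /z !intrM intrB -!pmulrn.
have r0' : 0 <= r%:~R :> R by rewrite ler0z.
have r1' : r%:~R < q%:R :> R by rewrite pmulrn ltr_int.
have jM' : j%:R + 1 <= M%:R :> R by rewrite natr1 ler_nat.
have j0' : 0 <= j%:R :> R by [].
have -> : ((M * t + j)%N%:Z + d)%:~R / Q%:R - a%:~R / q%:R - M%:R * (t%:R / Q%:R - a%:~R / q%:R)
    = (j%:R - r%:~R / q%:R) / Q%:R :> R.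
  have dE : d%:~R = (Q%:R * a%:~R * (1 - M%:R) - r%:~R) / q%:R :> R.
    by rewrite -zR zE addrK mulfK ?gt_eqF.
  by rewrite intrD -pmulrn natrD natrM dE; field; rewrite !gt_eqF.
have : r%:~R / q%:R < 1 :> R by rewrite ltr_pdivrMr// mul1r.
have : 0 <= r%:~R / q%:R :> R by rewrite divr_ge0// ltW.
rewrite normrM [`|Q%:R^-1|]ger0_norm ?invr_ge0// => h1 h2.
by rewrite ler_wpM2r ?invr_ge0// ler_norml; lra.
Qed.

(** If two images coincide modulo Q, the fractions a1/q1 and a2/q2 agree modulo 1, because distinct
    ones would be at least 1/(q1 q2) apart. The shifts then differ by a multiple of Q times 1 - M,
    and t and j are read off from M t + j by Euclidean division. *)
Lemma dilate_inj (Q M q1 q2 : nat) (a1 a2 : int) (t1 t2 j1 j2 : nat) (d : R) :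
  (0 < Q)%N -> (0 < q1)%N -> (0 < q2)%N -> (t1 < Q)%N -> (t2 < Q)%N ->
  (j1 < M)%N -> (j2 < M)%N -> 2 * d * (q1 * q2)%:R < 1 ->
  `|(dilate Q M q1 a1 t1 j1)%:~R / Q%:R - a1%:~R / q1%:R| <= d ->
  `|(dilate Q M q2 a2 t2 j2)%:~R / Q%:R - a2%:~R / q2%:R| <= d ->
  (exists n : int, dilate Q M q1 a1 t1 j1 = dilate Q M q2 a2 t2 j2 + n * Q%:Z) ->
  t1 = t2 /\ j1 = j2.
Proof.
move=> Q0 q10 q20 tQ1 tQ2 jM1 jM2 d1 h1 h2 [n nE].
have Q0' : 0 < Q%:R :> R by rewrite ltr0n.
have q10' : 0 < q1%:R :> R by rewrite ltr0n.
have q20' : 0 < q2%:R :> R by rewrite ltr0n.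
have aE : a1 * q2%:Z = (a2 + n * q2%:Z) * q1%:Z.
  have h : `|a1%:~R / q1%:R - a2%:~R / q2%:R - n%:~R : R| <= 2 * d.
    have -> : a1%:~R / q1%:R - a2%:~R / q2%:R - n%:~R =
      ((dilate Q M q2 a2 t2 j2)%:~R / Q%:R - a2%:~R / q2%:R) -
      ((dilate Q M q1 a1 t1 j1)%:~R / Q%:R - a1%:~R / q1%:R) :> R.
      by rewrite nE intrD intrM -pmulrn; field; rewrite !gt_eqF.
    by apply: le_trans (ler_normB _ _) _; lra.
  have : `|(a1 * q2%:Z - (a2 + n * q2%:Z) * q1%:Z)%:~R : R| < 1.
    apply: le_lt_trans d1.
    have -> : (a1 * q2%:Z - (a2 + n * q2%:Z) * q1%:Z)%:~R =
        (a1%:~R / q1%:R - a2%:~R / q2%:R - n%:~R) * (q1 * q2)%:R :> R.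
      by rewrite intrB !intrM intrD intrM natrM -!pmulrn; field; rewrite !gt_eqF.
    by rewrite normrM [`|_%:R|]ger0_norm// ler_wpM2r.
  rewrite -intr_norm (_ : 1 = 1%:~R)// ltr_int => h3.
  by apply/eqP; rewrite -subr_eq0 -normr_eq0; move: h3; clear; lia.
have q1z : 0 < q1%:Z by rewrite ltz_nat.
have q2z : 0 < q2%:Z by rewrite ltz_nat.
have FE : ((Q%:Z * a1 * (1 - M%:Z)) %/ q1%:Z)%Z =
   ((Q%:Z * a2 * (1 - M%:Z)) %/ q2%:Z)%Z + Q%:Z * n * (1 - M%:Z).
  rewrite -(@divzMpr q2%:Z (Q%:Z * a1 * (1 - M%:Z)) q1%:Z q2z).
  have -> : Q%:Z * a1 * (1 - M%:Z) * q2%:Z =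
    (Q%:Z * n * (1 - M%:Z) * q2%:Z + Q%:Z * a2 * (1 - M%:Z)) * q1%:Z.
    transitivity (Q%:Z * (1 - M%:Z) * (a1 * q2%:Z)); first by ring.
    by rewrite aE; ring.
  by rewrite [(q1%:Z * _)%R]mulrC divzMpr// divzMDl ?gt_eqF// addrC.
move: nE; rewrite /dilate FE => nE.
have : M%:Z * (t1%:Z - t2%:Z - Q%:Z * n) = j2%:Z - j1%:Z.
  by move: nE; rewrite !PoszD !PoszM; move: (_ %/ _)%Z => w; clear; lia.
set k := t1%:Z - t2%:Z - Q%:Z * n => kE.
have k0 : k = 0.
  by move: jM1 jM2 kE; clear; nia.
have tE : t1%:Z - t2%:Z = Q%:Z * n by move: k0; rewrite /k; clear; lia.
split; last by move: kE; rewrite k0; clear; lia.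
have n0 : n = 0 by move: tQ1 tQ2 tE; clear; nia.
by move: tE; rewrite n0; clear; lia.
Qed.

Definition level (Q N K : nat) : {set {ffun 'I_3 -> 'I_Q}} :=
  [set t | N%:R / K%:R <= nm (gsum N (pt R t))].

Lemma rational_approx : exists D, forall (K N Q : nat) (t : {ffun 'I_3 -> 'I_Q}),
  (2 <= K)%N -> (K ^ D <= N)%N -> t \in level Q N K ->
  exists qa : nat * ('I_3 -> int), (0 < qa.1 <= K ^ D)%N /\
    forall i, `|pt R t i - (qa.2 i)%:~R / qa.1%:R| <= K%:R ^+ D / N%:R ^+ i.+1.
Proof.
have [D HD] := weyl_inverse R; exists D => K N Q t K2 KN; rewrite inE => ht.
have [] := HD K N (pt R t ord0) (pt R t (lift ord0 ord0)) (pt R t (lift ord0 (lift ord0 ord0))) K2 KN.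
  apply: le_trans ht _; rewrite le_eqVlt; apply/orP; left; apply/eqP; congr nm.
  apply: eq_bigr => x _; congr e; rewrite phaseE; ring.
move=> q [/andP[q0 qK] [a1 h1] [a2 h2] [a3 h3]].
exists (q, fun i : 'I_3 => nth 0 [:: a1; a2; a3] i); rewrite q0 qK; split => // i /=.
have q1 : 1 <= q%:R :> R by rewrite ler1n.
have dq (th : R) (a : int) d : `|q%:R * th - a%:~R| <= d -> `|th - a%:~R / q%:R| <= d.
  move=> h; have -> : th - a%:~R / q%:R = (q%:R * th - a%:~R) / q%:R.
    by field; rewrite gt_eqF// (lt_le_trans _ q1).
  rewrite normrM normfV [`|q%:R|]ger0_norm// ler_pdivrMr ?(lt_le_trans _ q1)//.
  by apply: (le_trans h); rewrite ler_peMr// (le_trans _ h).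
case: i => -[|[|[|//]]] i3 /=; rewrite ?expr1.
- by apply: dq; rewrite (_ : Ordinal i3 = ord0)//; exact/val_inj.
- by apply: dq; rewrite (_ : Ordinal i3 = lift ord0 ord0)//; exact/val_inj.
- by apply: dq; rewrite (_ : Ordinal i3 = lift ord0 (lift ord0 ord0))//; exact/val_inj.
Qed.

(** Near a / q the size of the sum depends only on the rescaled deviations. A point of the level set
    for N can thus be moved away from its fraction by the factors (N/P)^(i+1) without the normalised
    sum of length P dropping below a quarter of the threshold. Each point produces about (N/P)^6
    grid points in this way, all of them distinct. *)
Lemma level_transfer : exists D2, forall K N P Q : nat, (2 <= K)%N -> (K ^ D2 <= P)%N ->
  (P * K ^ D2 <= N)%N -> (N ^ 9 <= Q)%N ->
  (#|level Q N K| * N ^ 6 <= 8 * P ^ 6 * #|level Q P (4 * K)|)%N.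
Proof.
have [D HD] := rational_approx; pose D2 := (3 * D + 40)%N.
exists D2 => K N P Q K2 KP PKN NQ.
have K0 : (0 < K)%N by apply: leq_trans K2.
have K0' : 0 < K%:R :> R by rewrite ltr0n.
have KD0 : (0 < K ^ D2)%N by rewrite expn_gt0 K0.
have P0 : (0 < P)%N by apply: leq_trans KP.
have PN : (P <= N)%N by apply: leq_trans PKN; rewrite leq_pmulr.
have N0 : (0 < N)%N by apply: leq_trans PN.
have Q0 : (0 < Q)%N by apply: leq_trans NQ; rewrite expn_gt0 N0.
have P0' : 0 < P%:R :> R by rewrite ltr0n.
have N0' : 0 < N%:R :> R by rewrite ltr0n.
have Q0' : 0 < Q%:R :> R by rewrite ltr0n.
have KN : (K ^ D <= N)%N.
  apply: leq_trans PN; apply: leq_trans KP; rewrite leq_pexp2l// /D2; clear; lia.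
(* The dilation factor (N/P)^(i+1) is rounded down to an integer so that the images can be placed on
   the grid. *)
pose M (i : 'I_3) := (N ^ i.+1 %/ P ^ i.+1)%N.
have M0 i : (0 < M i)%N by rewrite divn_gt0 ?expn_gt0 ?P0// leq_exp2r.
have MP i : (M i * P ^ i.+1 <= N ^ i.+1)%N by exact: leq_trunc_div.
have NM (i : 'I_3) : (N ^ i.+1 < (M i).+1 * P ^ i.+1)%N by rewrite -ltn_divLR ?expn_gt0 ?P0.
have ex (t : {ffun 'I_3 -> 'I_Q}) : exists qa : nat * ('I_3 -> int), t \in level Q N K ->
    (0 < qa.1 <= K ^ D)%N /\
    forall i, `|pt R t i - (qa.2 i)%:~R / qa.1%:R| <= K%:R ^+ D / N%:R ^+ i.+1.
  case: (boolP (t \in level Q N K)) => [tL|_]; last by exists (0%N, fun=> 0).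
  by have [qa h] := HD _ _ _ _ K2 KN tL; exists qa.
have [f fP] := boolp.choice ex.
(* The offsets below [M i] fill the gaps that dilation opens between neighbouring grid points. *)
pose box := {dffun forall i : 'I_3, 'I_(M i)}.
pose s (u : {ffun 'I_3 -> 'I_Q} * box) i := dilate Q (M i) (f u.1).1 ((f u.1).2 i) (u.1 i) (u.2 i).
pose F (u : {ffun 'I_3 -> 'I_Q} * box) : {ffun 'I_3 -> 'I_Q} := [ffun i => residue_ord Q0 (s u i)].
(* Everything below is measured in units of [K ^- 12]. *)
pose v : R := K%:R ^- 12.
have v0 : 0 < v by rewrite invr_gt0 exprn_gt0.
have vK : 2048 * v <= 1 / K%:R.
  rewrite /v ler_pdivlMr// mulrAC ler_pdivrMr ?exprn_gt0// mul1r.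
  by rewrite -[X in _ * X]expr1; apply: (@natpow_absorb _ _ _ 11) => //; lra.
have KvE m n : (m + 12 <= n)%N -> K%:R ^+ m / K%:R ^+ n <= v.
  move=> mn; rewrite ler_pdivrMr ?exprn_gt0// mulrC ler_pdivlMr ?exprn_gt0//.
  by rewrite -exprD; apply: natpow_le.
have v1 : v <= 1 by rewrite invf_le1 ?exprn_gt0// exprn_ege1// ler1n.
have v12 : 2 * v <= 1.
  have : 1 / K%:R <= 1 :> R by rewrite ler_pdivrMr// mul1r ler1n.
  by lra.
have KD1 : 1 <= K%:R ^+ D :> R by rewrite exprn_ege1// ler1n.
have PNK : P%:R / N%:R <= (K%:R ^+ D2)^-1 :> R.
  by rewrite ler_pdivrMr// mulrC ler_pdivlMr ?exprn_gt0// -natrX -natrM ler_nat.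
have perturb (i : 'I_3) (be be' : R) : `|be| <= K%:R ^+ D / N%:R ^+ i.+1 ->
    `|be' - (M i)%:R * be| <= (M i)%:R / Q%:R ->
    `|be * N%:R ^+ i.+1 - be' * P%:R ^+ i.+1| <= 2 * v.
  move=> b1 b2.
  have -> : be * N%:R ^+ i.+1 - be' * P%:R ^+ i.+1 =
    be * (N%:R ^+ i.+1 - (M i)%:R * P%:R ^+ i.+1) - (be' - (M i)%:R * be) * P%:R ^+ i.+1 by ring.
  apply: le_trans (ler_normB _ _) _; rewrite !normrM.
  have c1 : `|N%:R ^+ i.+1 - (M i)%:R * P%:R ^+ i.+1| <= P%:R ^+ i.+1 :> R.
    rewrite -!natrX -natrM ger0_norm ?subr_ge0 ?ler_nat// lerBlDr -natrD ler_nat.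
    by rewrite -mulSn ltnW.
  have c2 : `|be| * `|N%:R ^+ i.+1 - (M i)%:R * P%:R ^+ i.+1| <= v.
    apply: le_trans (ler_pM (normr_ge0 _) (normr_ge0 _) b1 c1) _.
    rewrite mulrAC -mulrA -expr_div_n exprS mulrA; apply: le_trans (_ : K%:R ^+ D * (P%:R / N%:R) <= _).
      rewrite -[leRHS]mulr1 ler_wpM2l ?exprn_ile1 ?mulr_ge0 ?divr_ge0 ?exprn_ge0 ?invr_ge0//.
      by rewrite ler_pdivrMr// mul1r ler_nat.
    apply: le_trans (ler_wpM2l (le_trans ler01 KD1) PNK) _; apply: KvE; rewrite /D2; clear; lia.
  have c3 : `|be' - (M i)%:R * be| * `|P%:R ^+ i.+1| <= v.
    apply: le_trans (ler_wpM2r (normr_ge0 _) b2) _; rewrite ger0_norm ?exprn_ge0//.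
    rewrite mulrAC -natrX -natrM; apply: le_trans (_ : (N ^ 3)%:R / Q%:R <= _).
      rewrite ler_wpM2r ?invr_ge0// ler_nat; apply: leq_trans (MP i) _.
      by rewrite leq_pexp2l.
    rewrite /v ler_pdivrMr// mulrC ler_pdivlMr ?exprn_gt0// -natrX -natrM ler_nat.
    apply: leq_trans NQ; rewrite (_ : 9 = 3 + 6)%N// expnD leq_mul2l; apply/orP; right.
    apply: (@leq_trans N); last by rewrite -{1}(expn1 N) leq_pexp2l.
    by apply: leq_trans PN; apply: leq_trans KP; rewrite leq_pexp2l// /D2; clear; lia.
  lra.
have near (u : {ffun 'I_3 -> 'I_Q} * box) (i : 'I_3) : u.1 \in level Q N K ->
    let be := pt R u.1 i - ((f u.1).2 i)%:~R / (f u.1).1%:R in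
    let be' := (s u i)%:~R / Q%:R - ((f u.1).2 i)%:~R / (f u.1).1%:R in
    [/\ `|be * N%:R ^+ i.+1| <= 2 * K%:R ^+ D, `|be' * P%:R ^+ i.+1| <= 2 * K%:R ^+ D &
        `|be * N%:R ^+ i.+1 - be' * P%:R ^+ i.+1| <= 2 * v].
  move=> uL be be'; have [/andP[q0 qK] /(_ i) b1] := fP _ uL.
  have b2 : `|be' - (M i)%:R * be| <= (M i)%:R / Q%:R by apply: dilate_bounds.
  have b3 := perturb i be be' b1 b2.
  have b4 : `|be * N%:R ^+ i.+1| <= K%:R ^+ D.
    by rewrite normrM [`|_ ^+ _|]ger0_norm ?exprn_ge0// -ler_pdivlMr ?exprn_gt0.
  split => //; first lra.
  have := ler_normB (be * N%:R ^+ i.+1) (be * N%:R ^+ i.+1 - be' * P%:R ^+ i.+1).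
  by rewrite subKr; lra.
have FL u : u.1 \in level Q N K -> F u \in level Q P (4 * K).
  move=> uL; have [/andP[q0 qK] b1] := fP _ uL; have := uL; rewrite !inE => h.
  pose be i := pt R u.1 i - ((f u.1).2 i)%:~R / (f u.1).1%:R.
  pose be' i : R := (s u i)%:~R / Q%:R - ((f u.1).2 i)%:~R / (f u.1).1%:R.
  have E1 : gsum N (pt R u.1) = gsum N (fun i => ((f u.1).2 i)%:~R / (f u.1).1%:R + be i).
    by congr gsum; apply/funext => i; rewrite /be addrC subrK.
  have E2 : gsum P (pt R (F u)) = gsum P (fun i => ((f u.1).2 i)%:~R / (f u.1).1%:R + be' i).
    apply: gsum_congr => i; rewrite /be' addrC subrK /pt ffunE.
    have [n nE] := residue_ordE Q0 (s u i); exists (- n).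
    rewrite [in RHS]nE intrD intrM intrN -!pmulrn; field; by rewrite gt_eqF.
  have T0 : (0 < K ^ (D + 12))%N by rewrite expn_gt0 K0.
  have qTK : ((f u.1).1 * K ^ (D + 12) <= K ^ (2 * D + 12))%N.
    have -> : (2 * D + 12 = D + (D + 12))%N by ring.
    by rewrite [X in (_ <= X)%N]expnD leq_mul2r qK orbT.
  have qTP : ((f u.1).1 * K ^ (D + 12) <= P)%N.
    apply: leq_trans qTK _; apply: leq_trans KP; rewrite leq_pexp2l// /D2; clear; lia.
  have B1 i : `|be i * N%:R ^+ i.+1| <= 2 * K%:R ^+ D by have [] := near u i uL.
  have B2 i : `|be' i * P%:R ^+ i.+1| <= 2 * K%:R ^+ D by have [] := near u i uL.
  have B3 i : `|be i * N%:R ^+ i.+1 - be' i * P%:R ^+ i.+1| <= 2 * v by have [] := near u i uL.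
  have := gsum_transfer (f u.1).2 q0 T0 qTP PN B1 B2 B3.
  rewrite -E1 -E2; set X := 2 * _ + _ => HT.
  have w1 : K%:R ^+ D * (((f u.1).1 * K ^ (D + 12))%:R / P%:R) <= v.
    apply: le_trans (_ : K%:R ^+ (3 * D + 12) / K%:R ^+ D2 <= _); last first.
      by apply: KvE; rewrite /D2; clear; lia.
    rewrite mulrA ler_pM ?invr_ge0 ?mulr_ge0 ?exprn_ge0//.
      have -> : (3 * D + 12 = D + (2 * D + 12))%N by ring.
      by rewrite [leRHS]exprD ler_wpM2l ?exprn_ge0// -natrX ler_nat.
    by rewrite lef_pV2 ?posrE ?exprn_gt0// -natrX ler_nat.
  have w2 : ((f u.1).1 * K ^ (D + 12))%:R / P%:R <= v.
    by apply: le_trans w1; rewrite ler_peMl// divr_ge0.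
  have w3 : K%:R ^+ D * (1 / (K ^ (D + 12))%:R) <= v.
    by rewrite mul1r natrX; apply: KvE.
  have XE : X <= 2 * v + 96 * (v + v).
    rewrite /X; apply: lerD; first by rewrite ler_wpM2l.
    have -> : 48 * (2 * K%:R ^+ D) * (((f u.1).1 * K ^ (D + 12))%:R / P%:R + 1 / (K ^ (D + 12))%:R) =
      96 * (K%:R ^+ D * (((f u.1).1 * K ^ (D + 12))%:R / P%:R) + K%:R ^+ D * (1 / (K ^ (D + 12))%:R)) :> R by ring.
    by rewrite ler_wpM2l// lerD.
  have HN : 1 / K%:R <= nm (gsum N (pt R u.1)) / N%:R by rewrite ler_pdivlMr// mulrAC mul1r.
  rewrite -[P%:R / _]mulrC -ler_pdivlMr// natrM invfM.
  by move: HN HT XE vK; rewrite mul1r; move: (K%:R^-1) (nm _ / _) (nm _ / _) => k1 k2 k3; lra.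
have Finj : {in finset.setX (level Q N K) [set: box] &, injective F}.
  move=> [t1 j1] [t2 j2]; rewrite !inE !andbT => h1 h2 FE.
  have L1 : t1 \in level Q N K by rewrite inE.
  have L2 : t2 \in level Q N K by rewrite inE.
  have [/andP[q10 q1K] _] := fP _ L1; have [/andP[q20 q2K] _] := fP _ L2.
  have tj i : t1 i = t2 i :> nat /\ j1 i = j2 i :> nat.
    have [_ d1 _] := near (t1, j1) i L1; have [_ d2 _] := near (t2, j2) i L2.
    have sm (x : R) : `|x * P%:R ^+ i.+1| <= 2 * K%:R ^+ D -> `|x| <= 2 * K%:R ^+ D / P%:R.
      rewrite normrM [`|_ ^+ _|]ger0_norm ?exprn_ge0// => hx.
      rewrite ler_pdivlMr//; apply: le_trans hx; rewrite ler_wpM2l//.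
      by rewrite exprS ler_peMr// exprn_ege1// ler1n.
    apply: (dilate_inj Q0 q10 q20 (ltn_ord _) (ltn_ord _) (ltn_ord (j1 i)) (ltn_ord (j2 i)) _
       (sm _ d1) (sm _ d2)).
      have qq : ((f t1).1 * (f t2).1)%:R <= K%:R ^+ (2 * D) :> R.
        by rewrite -natrX ler_nat mul2n -addnn expnD leq_mul.
      apply: (@le_lt_trans _ _ (4 * K%:R ^+ D / P%:R * K%:R ^+ (2 * D))).
        apply: le_trans (ler_wpM2l _ qq) _; first by rewrite !mulr_ge0 ?invr_ge0 ?exprn_ge0.
        by rewrite le_eqVlt; apply/orP; left; apply/eqP; ring.
      rewrite mulrAC ltr_pdivrMr// mul1r -mulrA -exprD.
      apply: (@lt_le_trans _ _ (K%:R ^+ D2)); last by rewrite -natrX ler_nat.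
      apply: (@lt_le_trans _ _ (8 * K%:R ^+ (D + 2 * D))).
        by rewrite ltr_pM2r ?exprn_gt0//; lra.
      by apply: (@natpow_absorb _ _ _ 3) => //; [lra|rewrite /D2; clear; lia].
    have [n1 e1] := residue_ordE Q0 (s (t1, j1) i); have [n2 e2] := residue_ordE Q0 (s (t2, j2) i).
    have e3 : residue_ord Q0 (s (t1, j1) i) = residue_ord Q0 (s (t2, j2) i).
      by have /ffunP/(_ i) := FE; rewrite !ffunE.
    exists (n1 - n2); rewrite -/(s (t1, j1) i) -/(s (t2, j2) i) e1 e2 e3; ring.
  congr (_, _); apply/ffunP => i; apply/val_inj; by have [] := tj i.
have sub : [set F u | u in finset.setX (level Q N K) [set: box]] \subset level Q P (4 * K).
  by apply/fintype.subsetP => _ /imsetP[u uL ->]; apply: FL; move: uL; rewrite inE => /andP[].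
have := subset_leq_card sub; rewrite card_in_imset// cardsX cardsT card_dep_ffun foldrE big_map.
rewrite big_enum /= => H.
(* Rounding down costs a factor at most 2 in each of the three coordinates. *)
have NE : (N ^ 6 <= 8 * P ^ 6 * \prod_i M i)%N.
  have -> : (N ^ 6 = \prod_(i < 3) N ^ i.+1)%N by rewrite !big_ord_recl big_ord0 /= muln1 -!expnD.
  have -> : (8 * P ^ 6 * \prod_i M i = \prod_(i < 3) (2 * (M i * P ^ i.+1)))%N.
    by rewrite !big_ord_recl !big_ord0 /= !muln1; ring.
  apply: leq_prod => i _; apply: leq_trans (ltnW (NM i)) _.
  by rewrite mulSn mul2n -addnn leq_add2r leq_pmull.
apply: leq_trans (leq_mul (leqnn _) NE) _; rewrite mulnCA leq_mul2l; apply/orP; right.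
apply: leq_trans H; rewrite leq_mul2l; apply/orP; right; apply: eq_leq.
by apply: eq_bigr => i _; rewrite card_ord.
Qed.

End LevelSets.

Lemma vinogradov_count_mono (M N : nat) : (M <= N)%N -> (vinogradov_count M <= vinogradov_count N)%N.
Proof.
move=> MN; pose w (x : {ffun 'I_6 -> 'I_M}) : {ffun 'I_6 -> 'I_N} := [ffun l => widen_ord MN (x l)].
have winj : injective w.
  move=> x y /ffunP xy; apply/ffunP => l; have := xy l.
  by rewrite !ffunE => /(congr1 val) /= h; apply/val_inj.
rewrite /vinogradov_count -(@card_image _ _ (fun xy => (w xy.1, w xy.2))); last first.
  by move=> [x y] [x' y'] /= [/winj -> /winj ->].
apply/subset_leq_card/fintype.subsetP => z /mapP[[x y]]; rewrite mem_enum => xy ->.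
move: xy; rewrite !inE /vinogradov_system /= => /forallP h; apply/forallP => i.
by move: (h i); congr is_true; congr (_ == _); apply: eq_bigr => l _; rewrite ffunE.
Qed.

(** * The thirteenth moment *)

Section DyadicMoments.
Variable R : realType.

Local Notation grid Q := {ffun 'I_3 -> 'I_Q}.
Local Notation g Q N t := (nm (gsum N (pt R (t : grid Q)))).

Lemma ch_mono Q (t : grid Q) (x : nat) : ch R (mono x%:Z) t = e (phase (pt R t) x%:R).
Proof.
rewrite /ch /phase; congr e; apply: eq_bigr => i _.
by rewrite ffunE rmorphXn /= -pmulrn mulrC.
Qed.

Lemma gsum_ch Q N (t : grid Q) : gsum N (pt R t) = \sum_(z < N) ch R (mono z%:Z) t.
Proof. by apply: eq_bigr => z _; rewrite ch_mono. Qed.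

Lemma gsum_moment12 (Q N : nat) : (6 * N ^ 3 < Q)%N ->
  \sum_(t : grid Q) g Q N t ^+ 12 = Q%:R ^+ 3 * (vinogradov_count N)%:R :> R.
Proof.
move=> NQ; rewrite -(@affine_mean_value R Q N 1 0) ?mul1n//.
by apply: eq_bigr => t _; rewrite gsum_ch; congr (nm _ ^+ _); apply: eq_bigr => z _; rewrite add0r mul1r.
Qed.

(** Chebyshev's inequality for the twelfth moment, applied at a length P that is bounded by a power
    of K = 4^k and carried to length N by [level_transfer]. At that length the loss of the mean
    value is only 2^k. *)
Lemma level_card : exists D, exists2 C : R, 0 <= C & forall k N Q : nat, (1 <= k)%N ->
  (4 ^ (D * k) <= N)%N -> (N ^ 9 <= Q)%N ->
  #|level R Q N (4 ^ k)|%:R * N%:R ^+ 6 <= C * Q%:R ^+ 3 * (4 ^ k)%:R ^+ 12 * 2 ^+ k.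
Proof.
have [D2 HD] := level_transfer R.
(* So large a prime reaches the length K^D2 required by the transfer after only about k/6 steps, and
   then 64^H is at most 64 . 2^k. *)
have [p p64 p_pr] := prime_above (64 ^ (2 * D2 + 1)).
have p0 : (0 < p)%N by apply: prime_gt0.
have p64' : (64 <= p)%N.
  by apply: leq_trans (ltnW p64); rewrite -{1}(expn1 64) leq_pexp2l// addn1.
have [C C0 HC] := vinogradov_mean_value R p_pr (leq_trans (isT : (5 <= 64)%N) p64').
exists (2 * p + D2)%N; exists (8 * 4 ^+ 12 * 64 * C); first by rewrite !mulr_ge0// exprn_ge0.
move=> k N Q k1 kN NQ; set H := (k %/ 6).+1; set P := (p ^ H)%N; set K := (4 ^ k)%N.
have kH : (k <= 6 * H)%N by rewrite /H; clear; lia.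
have Hk : (6 * (k %/ 6) <= k)%N by clear; lia.
have K2 : (2 <= K)%N.
  by apply: (@leq_trans (4 ^ 1)%N) => //; rewrite leq_pexp2l.
have KP : (K ^ D2 <= P)%N.
  apply: (@leq_trans ((64 ^ (2 * D2 + 1)) ^ H)); last by rewrite leq_exp2r// ltnW.
  have -> : K = (2 ^ (2 * k))%N by rewrite expnM.
  rewrite -[64%N]/(2 ^ 6)%N -!expnM leq_pexp2l//.
  by move: kH; clear; nia.
have p4 : (p <= 4 ^ p)%N by rewrite ltnW// ltn_expl.
have P4 : (P <= 4 ^ (2 * p * k))%N.
  apply: (@leq_trans ((4 ^ p) ^ H)); first by rewrite leq_exp2r.
  rewrite -expnM leq_pexp2l// mulnAC mulnC leq_mul2r /H; apply/orP; right.
  by move: Hk k1; clear; lia.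
have PKN : (P * K ^ D2 <= N)%N.
  apply: leq_trans kN; rewrite mulnDl expnD [(D2 * k)%N]mulnC -expnM -/P.
  by rewrite leq_mul2r P4 orbT.
have P0 : (0 < P)%N by rewrite expn_gt0 p0.
have PN : (P <= N)%N by apply: leq_trans PKN; rewrite leq_pmulr// expn_gt0 (leq_trans _ K2).
have pP : (p <= P)%N by rewrite /P -{1}(expn1 p) leq_pexp2l.
have PQ : (6 * P ^ 3 < Q)%N.
  apply: leq_trans NQ; rewrite (_ : 9 = 1 + (5 + 3))%N// !expnD mulnA.
  apply: (@leq_trans (7 * P ^ 3)); first by rewrite ltn_mul2r expn_gt0 P0.
  rewrite leq_mul ?leq_exp2r// expn1; apply: leq_trans (leq_pmulr _ _); last first.
    by rewrite expn_gt0 (leq_trans P0 PN).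
  by apply: leq_trans PN; apply: leq_trans pP; apply: leq_trans p64'.
have P0' : 0 < P%:R :> R by rewrite ltr0n.
have K0' : 0 < K%:R :> R by rewrite ltr0n (leq_trans _ K2).
have cheb : #|level R Q P (4 * K)|%:R * (P%:R / (4 * K)%:R) ^+ 12 <=
    Q%:R ^+ 3 * (C * P%:R ^+ 6 * 64 ^+ H).
  apply: (@le_trans _ _ (Q%:R ^+ 3 * (vinogradov_count P)%:R)); last first.
    rewrite ler_wpM2l ?exprn_ge0//; apply: le_trans (HC H) _.
    by rewrite /P natrX -exprM [(H * 6)%N]mulnC.
  rewrite -gsum_moment12// mulr_natl -sumr_const.
  rewrite [leRHS](bigID (fun t => t \in level R Q P (4 * K))) /= ler_wpDr//.
    by apply: sumr_ge0 => t _; rewrite exprn_ge0// nm_ge0.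
  apply: ler_sum => t; rewrite inE => h; rewrite lerXn2r ?nnegrE ?nm_ge0//.
  by rewrite divr_ge0.
have h : #|level R Q N K|%:R * N%:R ^+ 6 <= 8 * P%:R ^+ 6 * #|level R Q P (4 * K)|%:R :> R.
  by rewrite -!natrX -!natrM ler_nat; apply: HD.
apply: (le_trans h).
have H64 : 64 ^+ H <= 64 * 2 ^+ k :> R.
  rewrite /H exprS ler_wpM2l//; have -> : 64 = 2 ^+ 6 :> R by rewrite -natrX.
  by rewrite -exprM ler_weXn2l// ler1n.
have : #|level R Q P (4 * K)|%:R * P%:R ^+ 12 <= Q%:R ^+ 3 * (C * P%:R ^+ 6 * (64 * 2 ^+ k)) * (4 * K%:R) ^+ 12.
  move: cheb; rewrite expr_div_n [X in X <= _]mulrA ler_pdivrMr ?exprn_gt0 ?ltr0n ?muln_gt0 ?(leq_trans _ K2)// natrM.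
  move=> /le_trans; apply; rewrite ler_wpM2r ?exprn_ge0 ?mulr_ge0//.
  by rewrite ler_wpM2l ?exprn_ge0// ler_wpM2l// mulr_ge0 ?exprn_ge0.
rewrite (_ : 12 = 6 + 6)%N// [P%:R ^+ (6 + 6)]exprD exprMn.
have P6 : 0 < P%:R ^+ 6 :> R by rewrite exprn_gt0.
move=> h2; rewrite -(ler_pM2r P6); apply: le_trans (_ : 8 * (#|level R Q P (4 * K)|%:R * (P%:R ^+ 6 * P%:R ^+ 6)) <= _).
  by rewrite le_eqVlt; apply/orP; left; apply/eqP; move: (P%:R ^+ 6) => u; ring.
apply: le_trans (ler_wpM2l _ h2) _ => //; rewrite le_eqVlt; apply/orP; left; apply/eqP.
by move: (P%:R ^+ 6) (Q%:R ^+ 3) (2 ^+ k) (K%:R ^+ (6 + 6)) => u1 u2 u3 u4; ring.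
Qed.

(** The values between N/4^(j+1) and N/4^j contribute at most a constant times 2^-j: compared with
    the twelfth moment the thirteenth power gains 4^j, and [level_card] loses 2^j. The series over j
    >= k converges geometrically. *)
Theorem small_values : exists D, exists2 C : R, 0 <= C & forall k N Q : nat, (1 <= k)%N ->
  (4 ^ (D * k) <= N)%N -> (N ^ 9 <= Q)%N ->
  \sum_(t : grid Q | g Q N t < N%:R / 4 ^+ k) g Q N t ^+ 13 <= C * Q%:R ^+ 3 * N%:R ^+ 7 / 2 ^+ k /\
  \sum_(t : grid Q) g Q N t ^+ 13 <= C * Q%:R ^+ 3 * N%:R ^+ 7.
Proof.
have [D1 [C1 C10 HC]] := level_card; pose D := D1.+1.
have [p p64 p_pr] := prime_above (64 ^ (2 * D)).
have p0 : (0 < p)%N by apply: prime_gt0.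
have p64' : (64 <= p)%N.
  by apply: leq_trans (ltnW p64); rewrite -{1}(expn1 64) leq_pexp2l// muln_gt0.
have [C2 C20 HC2] := vinogradov_mean_value R p_pr (leq_trans (isT : (5 <= 64)%N) p64').
pose C3 := 128 * C2 * p%:R ^+ 6; pose A := 2 * 4 ^+ 12 * C1.
have A0 : 0 <= A by rewrite /A !mulr_ge0 ?exprn_ge0.
have C30 : 0 <= C3 by rewrite /C3 !mulr_ge0 ?exprn_ge0.
have main k N Q : (1 <= k)%N -> (4 ^ (D * k) <= N)%N -> (N ^ 9 <= Q)%N ->
    \sum_(t : grid Q | g Q N t < N%:R / 4 ^+ k) g Q N t ^+ 13 <=
    (2 * A + C3) * Q%:R ^+ 3 * N%:R ^+ 7 / 2 ^+ k.
  move=> k1 kN NQ.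
  have N0 : (0 < N)%N by apply: leq_trans kN; rewrite expn_gt0.
  have N0' : 0 < N%:R :> R by rewrite ltr0n.
  pose W : R := Q%:R ^+ 3 * N%:R ^+ 7; have W0 : 0 <= W by rewrite mulr_ge0 ?exprn_ge0.
  have dyadic m : (4 ^ (D * (k + m)) <= N)%N ->
      \sum_(t : grid Q | (N%:R / 4 ^+ (k + m) <= g Q N t) && (g Q N t < N%:R / 4 ^+ k)) g Q N t ^+ 13 <=
      2 * A * W * (2 ^- k - 2 ^- (k + m)).
    elim: m => [|m IHm] mN.
      rewrite addn0 subrr mulr0 big1// => t /andP[h1]; by rewrite ltNge h1.
    rewrite (bigID (fun t => N%:R / 4 ^+ (k + m) <= g Q N t)) /=.
    have s1 : \sum_(t : grid Q | ((N%:R / 4 ^+ (k + m.+1) <= g Q N t) && (g Q N t < N%:R / 4 ^+ k))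
        && (N%:R / 4 ^+ (k + m) <= g Q N t)) g Q N t ^+ 13 <= 2 * A * W * (2 ^- k - 2 ^- (k + m)).
      apply: le_trans (IHm _); last first.
        by apply: leq_trans mN; rewrite leq_pexp2l// leq_mul2l addnS leqnSn orbT.
      rewrite le_eqVlt; apply/orP; left; apply/eqP; apply: eq_bigl => t.
      have [h|] := leP (N%:R / 4 ^+ (k + m)) (g Q N t); last by rewrite andbF.
      rewrite andbT (le_trans _ h)// ler_wpM2l// lef_pV2 ?posrE ?exprn_gt0//.
      by rewrite ler_weXn2l// ?ler1n// addnS leqnSn.
    have s2 : \sum_(t : grid Q | ((N%:R / 4 ^+ (k + m.+1) <= g Q N t) && (g Q N t < N%:R / 4 ^+ k))
        && ~~ (N%:R / 4 ^+ (k + m) <= g Q N t)) g Q N t ^+ 13 <= A * W * 2 ^- (k + m).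
      apply: (@le_trans _ _ (\sum_(t in level R Q N (4 ^ (k + m.+1))) (N%:R / 4 ^+ (k + m)) ^+ 13)).
        rewrite [leRHS](bigID (fun t => ((N%:R / 4 ^+ (k + m.+1) <= g Q N t) && (g Q N t < N%:R / 4 ^+ k))
          && ~~ (N%:R / 4 ^+ (k + m) <= g Q N t))) /= ler_wpDr//.
          by apply: sumr_ge0 => t _; rewrite exprn_ge0// divr_ge0// exprn_ge0.
        rewrite [leRHS](eq_bigl (fun t => ((N%:R / 4 ^+ (k + m.+1) <= g Q N t) && (g Q N t < N%:R / 4 ^+ k))
          && ~~ (N%:R / 4 ^+ (k + m) <= g Q N t))).
          apply: ler_sum => t /andP[_]; rewrite -ltNge => /ltW h.
          by rewrite lerXn2r ?nnegrE ?nm_ge0// divr_ge0// exprn_ge0.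
        move=> t; rewrite inE natrX; case: (N%:R / 4 ^+ (k + m.+1) <= _) => //.
      rewrite sumr_const -[leLHS]mulr_natl expr_div_n.
      have h := HC (k + m.+1)%N N Q _ _ NQ; rewrite natrX in h.
      rewrite mulrA ler_pdivrMr ?exprn_gt0//.
      rewrite (_ : 13 = 6 + 7)%N// [N%:R ^+ (6 + 7)]exprD mulrA.
      apply: (le_trans (ler_wpM2r _ (h _ _))); first by rewrite exprn_ge0.
      + by rewrite addnS.
      + by apply: leq_trans mN; rewrite leq_pexp2l// leq_mul2r leqnSn orbT.
      have -> : 4 ^+ (k + m.+1) = 4 * 4 ^+ (k + m) :> R by rewrite addnS exprS.
      have -> : 2 ^+ (k + m.+1) = 2 * 2 ^+ (k + m) :> R by rewrite addnS exprS.
      have -> : (4 : R) = 2 ^+ 2 by rewrite -natrX.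
      rewrite le_eqVlt; apply/orP; left; apply/eqP; rewrite /A /W.
      have -> : (4 : R) = 2 ^+ 2 by rewrite -natrX.
      rewrite -!(exprM 2) [(2 * (k + m))%N]mulnC !(exprM 2).
      have : 2 ^+ (k + m) != 0 :> R by rewrite expf_neq0// pnatr_eq0.
      by move: (2 ^+ (k + m)) (Q%:R ^+ 3) (N%:R ^+ 7) => u u1 u2 un0; field.
    apply: le_trans (lerD s1 s2) _; rewrite le_eqVlt; apply/orP; left; apply/eqP.
    by rewrite addnS exprS invfM; move: (2 ^- (k + m)) (2 ^- k) => u1 u2; field.
  have D4 : (1 < 4 ^ D)%N by rewrite -{1}(expn0 4) ltn_exp2l.
  (* The last level to which [level_card] applies at length N. *)
  pose k1' := trunc_log (4 ^ D) N.
  have /andP[kN1 kN2] : (4 ^ (D * k1') <= N < 4 ^ (D * k1'.+1))%N by rewrite !expnM; apply: trunc_log_bounds.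
  have kk1 : (k <= k1')%N by rewrite /k1' trunc_log_max// -expnM.
  (* Below N/4^k1' one factor is bounded by N/4^k1' and the rest is a full twelfth moment. Its loss
     is at most of order 2^k1', because p > 64^(2D) and N < 4^(D(k1'+1)). *)
  have tail : \sum_(t : grid Q | g Q N t < N%:R / 4 ^+ k1') g Q N t ^+ 13 <= C3 * W * 2 ^- k1'.
    apply: (@le_trans _ _ (\sum_(t : grid Q) N%:R / 4 ^+ k1' * g Q N t ^+ 12)).
      rewrite [leRHS](bigID (fun t => g Q N t < N%:R / 4 ^+ k1')) /= ler_wpDr//.
        by apply: sumr_ge0 => t _; rewrite mulr_ge0 ?divr_ge0 ?exprn_ge0 ?nm_ge0.
      apply: ler_sum => t /ltW h; rewrite [g Q N t ^+ 13]exprS ler_wpM2r ?exprn_ge0 ?nm_ge0//.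
    have N7 : (6 * N ^ 3 < N ^ 9)%N.
      have N4 : (4 <= N)%N.
        apply: leq_trans kN; rewrite -{1}(expn1 4) leq_pexp2l// muln_gt0 k1.
        by rewrite /D.
      rewrite (_ : 9 = 6 + 3)%N// expnD ltn_mul2r expn_gt0 N0 /=.
      by apply: (@leq_trans (4 ^ 6)); rewrite ?leq_exp2r.
    set vc : R := (vinogradov_count N)%:R.
    rewrite -mulr_sumr gsum_moment12 -/vc; last first.
      by apply: leq_trans N7 NQ.
    have N4 : vc <= C2 * p%:R ^+ 6 * 128 * N%:R ^+ 6 * 2 ^+ k1'.
      pose tl := trunc_log p N; have /andP[pN Np] : (p ^ tl <= N < p ^ tl.+1)%N.
        by apply: trunc_log_bounds; rewrite ?prime_gt1.
      apply: (@le_trans _ _ (C2 * p%:R ^+ (6 * tl.+1) * 64 ^+ tl.+1)).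
        by apply: le_trans (HC2 _); rewrite ler_nat vinogradov_count_mono// ltnW.
      have t1 : 64 ^+ tl.+1 <= 128 * 2 ^+ k1' :> R.
        have : (64 ^ tl <= 2 ^ k1'.+1)%N.
          rewrite -(@leq_exp2r _ _ (2 * D))// -expnM mulnC expnM.
          apply: (@leq_trans (p ^ tl)); first by case: (tl) => [|n]; rewrite ?expn0// leq_exp2r// ltnW.
          apply: leq_trans pN _; apply: leq_trans (ltnW kN2) _.
          by rewrite -{1}[4%N]/(2 ^ 2)%N -!expnM; apply: eq_leq; congr (_ ^ _)%N; ring.
        rewrite -(ler_nat R) !natrX !exprS => h; lra.
      have t2 : p%:R ^+ (6 * tl.+1) <= p%:R ^+ 6 * N%:R ^+ 6 :> R.
        by rewrite mulnS exprD ler_wpM2l ?exprn_ge0// mulnC exprM lerXn2r ?nnegrE ?exprn_ge0// -natrX ler_nat.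
      apply: le_trans (_ : C2 * (p%:R ^+ 6 * N%:R ^+ 6) * (128 * 2 ^+ k1') <= _).
        by apply: ler_pM; rewrite ?mulr_ge0 ?exprn_ge0// ler_wpM2l.
      by rewrite le_eqVlt; apply/orP; left; apply/eqP; move: (p%:R ^+ 6) => u; ring.
    apply: (@le_trans _ _ (N%:R / 4 ^+ k1' * (Q%:R ^+ 3 * (C2 * p%:R ^+ 6 * 128 * N%:R ^+ 6 * 2 ^+ k1')))).
      by rewrite ler_wpM2l ?divr_ge0 ?exprn_ge0// ler_wpM2l ?exprn_ge0.
    rewrite le_eqVlt; apply/orP; left; apply/eqP; rewrite /C3 /W.
    have -> : 4 ^+ k1' = 2 ^+ k1' * 2 ^+ k1' :> R by rewrite -exprMn -natrM.
    have : 2 ^+ k1' != 0 :> R by rewrite expf_neq0// pnatr_eq0.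
    rewrite [N%:R ^+ 7]exprS.
    by move: (2 ^+ k1') (Q%:R ^+ 3) (N%:R ^+ 6) (p%:R ^+ 6) => u u1 u2 u3 un0; field.
  have dy := dyadic (k1' - k)%N; rewrite subnKC// in dy; have {}dy := dy kN1.
  rewrite (bigID (fun t => N%:R / 4 ^+ k1' <= g Q N t)) /=.
  have -> : (2 * A + C3) * Q%:R ^+ 3 * N%:R ^+ 7 / 2 ^+ k = 2 * A * W * 2 ^- k + C3 * W * 2 ^- k.
    by rewrite /W; ring.
  apply: lerD.
    rewrite (eq_bigl (fun t => (N%:R / 4 ^+ k1' <= g Q N t) && (g Q N t < N%:R / 4 ^+ k))).
      apply: (le_trans dy); rewrite ler_wpM2l ?mulr_ge0// gerBl invr_ge0 exprn_ge0//.
    by move=> t; rewrite andbC.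
  apply: (@le_trans _ _ (C3 * W * 2 ^- k1')); last first.
    rewrite ler_wpM2l ?mulr_ge0// lef_pV2 ?posrE ?exprn_gt0//.
    by rewrite ler_weXn2l// ler1n.
  apply: le_trans tail; rewrite [leRHS](bigID (fun t => (g Q N t < N%:R / 4 ^+ k))) /= ler_wpDr//.
    by apply: sumr_ge0 => t _; rewrite exprn_ge0// nm_ge0.
  rewrite le_eqVlt; apply/orP; left; apply/eqP; apply: eq_bigl => t.
  by rewrite -ltNge andbC.
exists D; exists (3 * A + C3); first by rewrite addr_ge0 ?mulr_ge0.
move=> k N Q k1 kN NQ; have W0 : 0 <= Q%:R ^+ 3 * N%:R ^+ 7 :> R by rewrite mulr_ge0 ?exprn_ge0.
split.
  apply: le_trans (main k N Q k1 kN NQ) _; rewrite -!mulrA ler_wpM2r ?mulr_ge0 ?invr_ge0 ?exprn_ge0//.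
  by lra.
have kN' : (4 ^ (D * 1) <= N)%N by apply: leq_trans kN; rewrite leq_pexp2l// leq_mul2l k1 orbT.
rewrite (bigID (fun t => g Q N t < N%:R / 4 ^+ 1)) /=.
have -> : (3 * A + C3) * Q%:R ^+ 3 * N%:R ^+ 7 = (2 * A + C3) * (Q%:R ^+ 3 * N%:R ^+ 7) + A * Q%:R ^+ 3 * N%:R ^+ 7 :> R.
  by ring.
apply: lerD.
  apply: le_trans (main 1%N N Q isT kN' NQ) _; rewrite expr1 -[X in X / _]mulrA.
  have : 0 <= (2 * A + C3) * (Q%:R ^+ 3 * N%:R ^+ 7) by rewrite mulr_ge0// addr_ge0// mulr_ge0.
  move: (_ * (Q%:R ^+ 3 * _)) => u; lra.
apply: (@le_trans _ _ (\sum_(t in level R Q N (4 ^ 1)) N%:R ^+ 13)).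
  rewrite [leLHS](eq_bigl (fun t => t \in level R Q N (4 ^ 1))); last first.
    by move=> t; rewrite inE -leNgt natrX.
  apply: ler_sum => t _; rewrite lerXn2r ?nnegrE ?nm_ge0//.
  by apply: (@nm_sum_le1 R N (fun x => e (phase (pt R t) x%:R))) => x; rewrite nm_e.
have := HC 1%N N Q isT _ NQ.
move=> h; rewrite sumr_const -[leLHS]mulr_natl.
rewrite (_ : 13 = 6 + 7)%N// exprD mulrA ler_wpM2r ?exprn_ge0//.
apply: (le_trans (h _)).
  by apply: leq_trans kN'; rewrite leq_pexp2l// leq_mul2r leqnSn orbT.
by rewrite le_eqVlt; apply/orP; left; apply/eqP; rewrite /A expn1; ring.
Qed.

End DyadicMoments.

(** * Comparison with a smoothed count *)

Section Fejer.
Variable R : realType.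
Local Notation grid Q := {ffun 'I_3 -> 'I_Q}.
Local Notation box s n := {ffun 'I_s -> 'I_(2 * n).+1}.

Definition centred s n (x : box s n) (j : 'I_s) : int := (x j : nat)%:Z - n%:Z.

(** A discrete tent: (h - |k|) / h^2 if m = k q with |k| <= h, and 0 otherwise. As a count of pairs
    it is visibly the Fourier transform of the square [fejker]. The height [h] will be about n^(i+1)
    / (L q). *)
Definition fej (h q : nat) (m : int) : R :=
  #|[pred uv : 'I_h * 'I_h | m + q%:Z * ((uv.1 : nat)%:Z - (uv.2 : nat)%:Z) == 0]|%:R / h%:R ^+ 2.

Definition wsum s (a : 'M[int]_(3, s)) n (h : 'I_3 -> nat) (q : nat) : R :=
  \sum_(x : box s n) \prod_(i < 3) fej (h i) q (phi a i (centred x)).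

Definition fejker (h q : nat) (th : R) : R :=
  nm (\sum_(u < h) e (q%:R * th * u%:R)) ^+ 2 / h%:R ^+ 2.

Definition fwave (c : 'I_3 -> int) n Q (t : grid Q) : R[i] :=
  \sum_(y < (2 * n).+1) e (phase (fun i => (c i)%:~R * pt R t i) (y%:R - n%:R)).

Lemma fejker_sum h q (m : int) (Q : nat) : (0 < Q)%N -> (`|m| + q%:Z * h%:Z < Q%:Z) ->
  \sum_(k < Q) (fejker h q (k%:R / Q%:R))%:C%C * e (m%:~R * (k%:R / Q%:R)) =
  (Q%:R * fej h q m)%:C%C :> R[i].
Proof.
move=> Q0 mQ; pose H : R[i] := (h%:R ^- 2)%:C%C.
have step (k : 'I_Q) : (fejker h q (k%:R / Q%:R))%:C%C * e (m%:~R * (k%:R / Q%:R)) =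
    \sum_(uv : 'I_h * 'I_h) H *
      e ((m + q%:Z * ((uv.1 : nat)%:Z - (uv.2 : nat)%:Z))%:~R * (k%:R / Q%:R)) :> R[i].
  set th := k%:R / Q%:R.
  rewrite /fejker rmorphM /= nm_sqr -/H rmorph_sum /= big_distrlr /= pair_bigA /= [_ * H]mulrC -mulrA.
  rewrite mulr_suml mulr_sumr; apply: eq_bigr => uv _.
  rewrite -[X in _ * (_ * X * _)]/((e (q%:R * th * uv.2%:R))^*%C) -eN -!eD; congr (_ * e _).
  by rewrite intrD intrM intrB -!pmulrn; ring.
under eq_bigr do rewrite step.
rewrite exchange_big /=; under eq_bigr do rewrite -mulr_sumr (sum_root_unity R Q0).
rewrite -mulr_sumr -big_mkcond /= sumr_const /fej.
rewrite (@eq_card _ _ [pred uv : 'I_h * 'I_h | m + q%:Z * ((uv.1 : nat)%:Z - (uv.2 : nat)%:Z) == 0]).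
  by rewrite /H !rmorphM /= !rmorph_nat -[Q%:R *+ _]mulr_natr; ring.
move=> [u v]; set z := m + q%:Z * ((u : nat)%:Z - (v : nat)%:Z).
change ((Q%:Z %| z)%Z = (z == 0)).
have zQ : `|z| < Q%:Z.
  apply: le_lt_trans mQ; apply: le_trans (ler_normD _ _) _; rewrite lerD2l normrM.
  have := ltn_ord u; have := ltn_ord v; move: (u : nat) (v : nat) => u' v' hv hu.
  by rewrite ler_pM//; move: hv hu; clear; lia.
apply/idP/eqP => [/dvdzP[k kE]|->]; last exact: dvdz0.
have k0 : k = 0 by move: zQ; rewrite kE; clear -Q0; nia.
by rewrite kE k0 mul0r.
Qed.

Lemma prod_fwave s (a : 'M[int]_(3, s)) n Q (t : grid Q) :
  \prod_j fwave (fun i => a i j) n t =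
  \sum_(x : box s n) \prod_(i < 3) e ((phi a i (centred x))%:~R * pt R t i).
Proof.
rewrite /fwave bigA_distr_bigA /=; apply: eq_bigr => x _.
rewrite -!e_sum; congr e; rewrite /phase exchange_big /=; apply: eq_bigr => i _.
rewrite /phi rmorph_sum /= mulr_suml; apply: eq_bigr => j _.
rewrite rmorphM /= rmorphXn /= intrB -!pmulrn intz; ring.
Qed.

Lemma wsum_identity s (a : 'M[int]_(3, s)) n (h : 'I_3 -> nat) q Q : (0 < Q)%N ->
  (forall (x : box s n) i, `|phi a i (centred x)| + q%:Z * (h i)%:Z < Q%:Z) ->
  \sum_(t : grid Q) (\prod_i fejker (h i) q (pt R t i))%:C%C * \prod_j fwave (fun i => a i j) n t
  = (Q%:R ^+ 3 * wsum a n h q)%:C%C.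
Proof.
move=> Q0 HQ; under eq_bigr do rewrite prod_fwave mulr_sumr.
rewrite exchange_big /= /wsum rmorphM /= rmorph_sum /= mulr_sumr; apply: eq_bigr => x _.
transitivity (\sum_(t : grid Q) \prod_i ((fejker (h i) q ((t i)%:R / Q%:R))%:C%C *
    e ((phi a i (centred x))%:~R * ((t i)%:R / Q%:R)))).
  by apply: eq_bigr => t _; rewrite rmorph_prod /= -big_split.
rewrite -(bigA_distr_bigA (fun (i : 'I_3) (k : 'I_Q) => (fejker (h i) q (k%:R / Q%:R))%:C%C *
    e ((phi a i (centred x))%:~R * (k%:R / Q%:R)))) /=.
under eq_bigr do rewrite (fejker_sum Q0 (HQ x _)) rmorphM.
by rewrite big_split /= prodr_const card_ord rmorph_prod rmorphXn.
Qed.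

(** At height 1 and modulus 1 the smoothed count is the exact number of solutions. *)
Lemma fej1 m : fej 1 1 m = (m == 0)%:R.
Proof.
rewrite /fej expr1n divr1; have [->|m0] := eqVneq m 0.
  rewrite (@eq_card _ _ predT); first by rewrite card_prod card_ord.
  by move=> [u v]; rewrite !inE (ord1 u) (ord1 v) /= subrr.
rewrite (@eq_card _ _ pred0) ?card0// => -[u v].
by rewrite !inE (ord1 u) (ord1 v) /= subrr mulr0 addr0 (negbTE m0).
Qed.

Lemma fejker1 q th : fejker 1 q th = 1.
Proof. by rewrite /fejker big_ord_recl big_ord0 addr0 mulr0 e0 nm1 expr1n divr1. Qed.

Lemma fejker_le1 h q th : 0 <= fejker h q th <= 1.
Proof.
rewrite /fejker divr_ge0 ?exprn_ge0 ?nm_ge0//=.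
have [->|h0] := posnP h; first by rewrite expr0n /= invr0 mulr0.
rewrite ler_pdivrMr ?exprn_gt0 ?ltr0n// mul1r lerXn2r ?nnegrE ?nm_ge0//.
by apply: (@nm_sum_le1 R h (fun u => e (q%:R * th * u%:R))) => u; rewrite nm_e.
Qed.

Lemma fejker_near h q th d : (0 < h)%N -> nint (q%:R * th) d -> 1 - fejker h q th <= 16 * h%:R * d.
Proof.
move=> h0 [a ha]; have h0' : 0 < h%:R :> R by rewrite ltr0n.
have d0 : 0 <= d by apply: le_trans ha.
set S := \sum_(u < h) e (q%:R * th * u%:R) : R[i].
have near : nm (h%:R - S) <= h%:R * (8 * (h%:R * d)).
  have -> : h%:R - S = \sum_(u < h) (e 0 - e ((q%:R * th - a%:~R) * u%:R)).
    rewrite sumrB e0 sumr_const card_ord; congr (_ - _); apply: eq_bigr => u _.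
    rewrite -[RHS](eDint _ (a * (u : nat)%:Z)) intrM -pmulrn; congr e; ring.
  apply: le_trans (nm_sum _ _ _) _; apply: (@le_trans _ _ (\sum_(u < h) 8 * (h%:R * d))); last first.
    by rewrite sumr_const card_ord [leRHS]mulr_natl.
  apply: ler_sum => u _; apply: le_trans (e_lip _ _) _; rewrite sub0r normrN normrM.
  rewrite ler_wpM2l// mulrC ler_pM// ?ger0_norm// ler_nat ltnW//.
have Sh : nm S <= h%:R.
  by apply: (@nm_sum_le1 R h (fun u => e (q%:R * th * u%:R))) => u; rewrite nm_e.
have hS : h%:R - nm S <= h%:R * (8 * (h%:R * d)).
  by apply: le_trans near; rewrite -{1}(nm_nat R h) nm_subr.
rewrite /fejker -/S lerBlDr addrC -lerBlDr ler_pdivlMr ?exprn_gt0//.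
have -> : (1 - 16 * h%:R * d) * h%:R ^+ 2 = h%:R * (h%:R - 2 * (h%:R * (8 * (h%:R * d)))) by ring.
move: hS (nm_ge0 S) Sh; move: (nm S) (h%:R * (8 * _)) => y z hS y0 yh.
have [z0|z0] := leP (h%:R - 2 * z) 0.
  by apply: (@le_trans _ _ 0); [rewrite pmulr_rle0|rewrite exprn_ge0].
apply: (@le_trans _ _ ((h%:R - z) * (h%:R - z))); last by rewrite -expr2 lerXn2r ?nnegrE//; lra.
have := sqr_ge0 z; rewrite -subr_ge0 => _; rewrite -subr_ge0.
have -> : (h%:R - z) * (h%:R - z) - h%:R * (h%:R - 2 * z) = z ^+ 2 by ring.
exact: sqr_ge0.
Qed.

Lemma one_sub_prod3 (k : 'I_3 -> R) d : (forall i, 0 <= k i <= 1) -> (forall i, 1 - k i <= d) ->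
  0 <= 1 - \prod_i k i <= 3 * d.
Proof.
move=> k01 kd; rewrite !big_ord_recl big_ord0 mulr1.
move: (k01 ord0) (k01 (lift ord0 ord0)) (k01 (lift ord0 (lift ord0 ord0))).
move: (kd ord0) (kd (lift ord0 ord0)) (kd (lift ord0 (lift ord0 ord0))).
move: (k ord0) (k (lift ord0 ord0)) (k (lift ord0 (lift ord0 ord0))).
move=> x y z hz hy hx /andP[x0 x1] /andP[y0 y1] /andP[z0 z1].
have yz : 0 <= y * z by rewrite mulr_ge0.
have yz1 : y * z <= 1 by rewrite mulr_ile1.
apply/andP; split; first by rewrite subr_ge0 mulr_ile1.
have : 1 - x * (y * z) = (1 - x) + x * ((1 - y) + y * (1 - z)) by ring.
have : x * ((1 - y) + y * (1 - z)) <= (1 - y) + y * (1 - z).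
  by rewrite ler_piMl// addr_ge0 ?mulr_ge0 ?subr_ge0.
have : y * (1 - z) <= 1 - z by rewrite ler_piMl// subr_ge0.
lra.
Qed.

End Fejer.

(** * Sums over symmetric intervals and with coefficients *)

Section MinorArcs.
Variable R : realType.
Local Notation grid Q := {ffun 'I_3 -> 'I_Q}.

Lemma ord3P (P : 'I_3 -> Prop) : P o0 -> P o1 -> P o2 -> forall i, P i.
Proof.
move=> p0 p1 p2 i; case: (unliftP o0 i) => [j ->|->//].
case: (unliftP ord0 j) => [k ->|->//]; by rewrite (ord1 k).
Qed.

(** The coefficients in y of the polynomial with coefficients [al] taken at y - n, without the
    constant term. *)
Definition shifted (S : pzRingType) (al : 'I_3 -> S) (n : S) (i : 'I_3) : S :=
  nth 0 [:: al o0 - 2 * n * al o1 + 3 * n ^+ 2 * al o2; al o1 - 3 * n * al o2; al o2] i.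

Lemma nm_fwave (c : 'I_3 -> int) n Q (t : grid Q) :
  nm (fwave R c n t) =
  nm (gsum (2 * n).+1 (shifted (fun i => (c i)%:~R * pt R t i) n%:R)).
Proof.
set al := fun i => _ * _; rewrite /gsum.
rewrite -(@nm_phase_sum _ (2 * n).+1 (fun y => phase al (y%:R - n%:R))
  (fun y => phase (shifted al n%:R) y%:R) (phase al (- n%:R))) //.
by move=> y _; rewrite !phaseE /shifted /=; ring.
Qed.

Definition shift_grid (c : 'I_3 -> int) n Q (Q0 : (0 < Q)%N) (t : grid Q) : grid Q :=
  [ffun i => residue_ord Q0 (shifted (fun i => c i * (t i : nat)%:Z) n%:Z i)].

Lemma nm_fwave_grid (c : 'I_3 -> int) n Q (Q0 : (0 < Q)%N) (t : grid Q) :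
  nm (fwave R c n t) = nm (gsum (2 * n).+1 (pt R (shift_grid c n Q0 t))).
Proof.
rewrite nm_fwave; congr nm; apply: gsum_congr => i.
have [k kE] := residue_ordE Q0 (shifted (fun i => c i * (t i : nat)%:Z) n%:Z i).
exists k; rewrite /pt ffunE.
have Q0' : Q%:R != 0 :> R by rewrite pnatr_eq0 -lt0n.
have -> : shifted (fun i => (c i)%:~R * ((t i)%:R / Q%:R)) n%:R i =
    (shifted (fun i => c i * (t i : nat)%:Z) n%:Z i)%:~R / Q%:R :> R.
  move: i {k kE}; apply: ord3P; rewrite /shifted /= ?(intrD, intrN, intrM, rmorphXn) /= -?pmulrn;
    by field.
by rewrite {1}kE intrD intrM -!pmulrn; field.
Qed.

(** The map is triangular with diagonal entries c_i, which are units modulo the prime Q; the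
    coordinates are recovered from the highest degree downwards. *)
Lemma shift_grid_inj (c : 'I_3 -> int) n Q (Q0 : (0 < Q)%N) : prime Q ->
  (forall i, c i != 0) -> (forall i, `|c i| < Q%:Z) -> injective (shift_grid c n Q0).
Proof.
move=> Qp c0 cQ t t' tt'.
have E i : exists k, shifted (fun i => c i * (t i : nat)%:Z) n%:Z i =
     shifted (fun i => c i * (t' i : nat)%:Z) n%:Z i + k * Q%:Z.
  have [k1 e1] := residue_ordE Q0 (shifted (fun i => c i * (t i : nat)%:Z) n%:Z i).
  have [k2 e2] := residue_ordE Q0 (shifted (fun i => c i * (t' i : nat)%:Z) n%:Z i).
  have /ffunP/(_ i) := tt'; rewrite !ffunE => e3; exists (k1 - k2).
  by rewrite e1 e2 e3; ring.
have cancel i (k : int) : c i * (t i : nat)%:Z = c i * (t' i : nat)%:Z + k * Q%:Z -> t i = t' i.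
  move=> ke; apply/val_inj; apply: (@dvdz_lt_eq Q) (ltn_ord _) (ltn_ord _) _.
  have : (Q%:Z %| c i * ((t i : nat)%:Z - (t' i : nat)%:Z))%Z.
    by apply/dvdzP; exists k; rewrite mulrBr ke; ring.
  rewrite Gauss_dvdzr// coprimezE /= prime_coprime//; apply/negP => /dvdn_leq.
  by have := c0 i; have := cQ i; clear; lia.
apply/ffunP; have [k2 e2] := E o2; have [k1 e1] := E o1; have [k0 e0] := E o0.
move: e0 e1 e2; rewrite /shifted /= => e0 e1 e2.
have t2 := cancel _ _ e2; rewrite t2 in e1 e0.
have t1 : t o1 = t' o1.
  by apply: (cancel _ k1); rewrite -[LHS](subrK (3 * n%:Z * (c o2 * (t' o2 : nat)%:Z))) e1; ring.
rewrite t1 in e0.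
have t0 : t o0 = t' o0.
  apply: (cancel _ k0); move: e0; set u := _ * _ * (c o1 * _); set v := _ * (c o2 * _) => e0.
  by rewrite -[LHS](subrK u) -[LHS](addrK v) [_ + v]addrAC e0; ring.
exact: ord3P.
Qed.

Lemma fwave_sum (f : R -> R) (c : 'I_3 -> int) n Q : prime Q ->
  (forall i, c i != 0) -> (forall i, `|c i| < Q%:Z) ->
  \sum_(t : grid Q) f (nm (fwave R c n t)) = \sum_(t : grid Q) f (nm (gsum (2 * n).+1 (pt R t))).
Proof.
move=> Qp c0 cQ; have Q0 := prime_gt0 Qp.
rewrite [RHS](reindex_inj (shift_grid_inj (n := n) (Q0 := Q0) Qp c0 cQ)).
by apply: eq_bigr => t _; rewrite -nm_fwave_grid.
Qed.

(** The inverse Weyl inequality approximates the shifted coefficients. The triangular shift is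
    undone from the top degree, and since 2n is below the length the errors grow by a factor at most
    5. *)
Lemma large_fwave : exists D, forall K n Q (c : 'I_3 -> int) (t : grid Q),
  (2 <= K)%N -> (K ^ D <= (2 * n).+1)%N -> (2 * n).+1%:R / K%:R <= nm (fwave R c n t) ->
  exists q, (0 < q <= K ^ D)%N /\
    forall i : 'I_3, nint (q%:R * ((c i)%:~R * pt R t i)) (5 * K%:R ^+ D / (2 * n).+1%:R ^+ i.+1).
Proof.
have [D HD] := weyl_inverse R; exists D => K n Q c t K2 KN.
rewrite nm_fwave; set al := fun i => _ * _; set N := (2 * n).+1 => h.
have [] := HD K N (shifted al n%:R o0) (shifted al n%:R o1) (shifted al n%:R o2) K2 KN.
  apply: le_trans h _; rewrite le_eqVlt; apply/orP; left; apply/eqP; congr nm.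
  by apply: eq_bigr => x _; congr e; rewrite phaseE; ring.
move=> q [qK h0 h1 h2]; exists q; split => //.
set E := K%:R ^+ D in h0 h1 h2 *; rewrite /shifted /= in h0 h1 h2.
have E0 : 0 <= E by rewrite exprn_ge0.
have N0 : 0 < N%:R :> R by rewrite ltr0n.
have nN : 2 * n%:R <= N%:R :> R by rewrite -natrM ler_nat leqnSn.
have n0 : 0 <= n%:R :> R by [].
have N1 : 1 <= N%:R :> R by rewrite ler1n.
have g1 : nint (q%:R * al o1) (5 / 2 * E / N%:R ^+ 2).
  have [z hz] := h1; have [w hw] := h2; exists (z + 3 * n%:Z * w).
  have -> : q%:R * al o1 - (z + 3 * n%:Z * w)%:~R =
     (q%:R * (al o1 - 3 * n%:R * al o2) - z%:~R) + 3 * n%:R * (q%:R * al o2 - w%:~R).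
    by rewrite intrD !intrM -pmulrn; ring.
  apply: le_trans (ler_normD _ _) _; rewrite normrM [`|3 * _|]ger0_norm ?mulr_ge0//.
  apply: le_trans (lerD hz (ler_wpM2l _ hw)) _; first by rewrite mulr_ge0.
  have : 3 * n%:R * (E / N%:R ^+ 3) <= 3 / 2 * (E / N%:R ^+ 2).
    have -> : 3 / 2 * (E / N%:R ^+ 2) = 3 / 2 * N%:R * (E / N%:R ^+ 3) by field; rewrite gt_eqF.
    by rewrite ler_wpM2r ?divr_ge0 ?exprn_ge0//; lra.
  lra.
apply: ord3P => /=.
- have [z hz] := h0; have [w hw] := g1; have [v hv] := h2.
  exists (z + 2 * n%:Z * w - 3 * n%:Z ^+ 2 * v); rewrite expr1.
  have -> : q%:R * al o0 - (z + 2 * n%:Z * w - 3 * n%:Z ^+ 2 * v)%:~R =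
     (q%:R * (al o0 - 2 * n%:R * al o1 + 3 * n%:R ^+ 2 * al o2) - z%:~R) +
      2 * n%:R * (q%:R * al o1 - w%:~R) + (- (3 * n%:R ^+ 2)) * (q%:R * al o2 - v%:~R).
    by rewrite intrB intrD !intrM -!pmulrn; ring.
  apply: le_trans (ler_normD _ _) _; apply: le_trans (lerD (ler_normD _ _) (lexx _)) _.
  rewrite !normrM normrN [`|n%:R|]ger0_norm// [`|3 * _|]ger0_norm ?mulr_ge0// [`|2|]ger0_norm//.
  apply: le_trans (lerD (lerD hz (ler_wpM2l _ hw)) (ler_wpM2l _ hv)) _; rewrite ?mulr_ge0//.
  have : 2 * n%:R * (5 / 2 * E / N%:R ^+ 2) <= 5 / 2 * (E / N%:R).
    have -> : 5 / 2 * (E / N%:R) = N%:R * (5 / 2 * E / N%:R ^+ 2) by field; rewrite gt_eqF.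
    by apply: ler_wpM2r => //; nneg.
  have : 3 * n%:R ^+ 2 * (E / N%:R ^+ 3) <= 3 / 4 * (E / N%:R).
    have -> : 3 / 4 * (E / N%:R) = (3 / 4 * N%:R ^+ 2) * (E / N%:R ^+ 3) by field; rewrite gt_eqF.
    rewrite ler_wpM2r ?divr_ge0 ?exprn_ge0//.
    have : (2 * n%:R) ^+ 2 <= N%:R ^+ 2 :> R by rewrite lerXn2r ?nnegrE ?mulr_ge0.
    by rewrite exprMn; lra.
  have : 0 <= E / N%:R by rewrite divr_ge0.
  have -> : 5 * E / N%:R = 5 * (E / N%:R) by rewrite mulrA.
  by move: (E / N%:R) => u u0 h3 h4; lra.
- apply: nint_le g1; rewrite ler_wpM2r ?invr_ge0 ?exprn_ge0//; lra.
- apply: nint_le h2; rewrite ler_wpM2r ?invr_ge0 ?exprn_ge0//; lra.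
Qed.

Lemma prod_le_sum_pow n (z : 'I_n.+1 -> R) : (forall j, 0 <= z j) ->
  \prod_j z j <= \sum_j z j ^+ n.+1.
Proof.
move=> z0; case: (@Order.TotalTheory.arg_maxP _ R 'I_n.+1 ord0 predT z isT) => i _ hi.
apply: (@le_trans _ _ (z i ^+ n.+1)).
  rewrite -[X in _ ^+ X]card_ord -prodr_const; apply: ler_prod => j _.
  by apply/andP; split => //; exact: hi.
by rewrite (bigD1 i)//= lerDl sumr_ge0// => j _; rewrite exprn_ge0.
Qed.

(** The first factor is weighted by M^12 and each of the other twelve by 1/M, which leaves the
    product unchanged. In the application the thirteenth moment of the first is tiny, that of the
    others merely bounded. *)
Lemma weighted_amgm (y : 'I_13 -> R) (M : R) : 0 < M -> (forall j, 0 <= y j) ->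
  \prod_j y j <= M ^+ 156 * y ord0 ^+ 13 + M ^- 13 * \sum_j y j ^+ 13.
Proof.
move=> M0 y0; pose z (j : 'I_13) := (if j == ord0 then M ^+ 12 else M^-1) * y j.
have z0 j : 0 <= z j by rewrite /z; case: ifP => _; rewrite mulr_ge0 ?exprn_ge0 ?invr_ge0//; apply: ltW.
have -> : \prod_j y j = \prod_j z j.
  rewrite /z big_split /= [X in _ = X * _]big_ord_recl /=.
  by rewrite prodr_const card_ord -exprMn mulfV ?gt_eqF// expr1n mul1r.
apply: le_trans (prod_le_sum_pow z0) _; rewrite big_ord_recl {1}/z eqxx exprMn -exprM.
rewrite lerD// [X in _ * X]big_ord_recl mulrDr ler_wpDl//.
  by rewrite mulr_ge0 ?invr_ge0 ?exprn_ge0// ltW.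
rewrite mulr_sumr ler_sum// => j _.
by rewrite /z exprMn exprVn.
Qed.

End MinorArcs.

Section Approximation.
Variable R : realType.
Local Notation grid Q := {ffun 'I_3 -> 'I_Q}.

Lemma nm_fwave_le (c : 'I_3 -> int) n Q (t : grid Q) : nm (fwave R c n t) <= (2 * n).+1%:R.
Proof.
apply: (@nm_sum_le1 R (2 * n).+1
  (fun y => e (phase (fun i => (c i)%:~R * pt R t i) (y%:R - n%:R)))) => y.
by rewrite nm_e.
Qed.

(** Here q th is r times w c th with r <= q, so it is within q E / X of an integer; the height h <=
    X / (L q) turns this into 16 E / L. *)
Lemma fejker_major (c q h : nat) (th L E X : R) (w : nat) : (0 < h)%N -> 0 < L -> 0 < X -> 0 <= E ->
  (0 < q)%N -> (0 < w)%N -> (w * c %| q)%N -> (0 < c)%N ->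
  nint (w%:R * (c%:R * th)) (E / X) -> h%:R * (L * q%:R) <= X ->
  1 - fejker h q th <= 16 * E / L.
Proof.
move=> h0 L0 X0 E0 q0 w0 /dvdnP[r qE] c0 hn hX.
have r0 : (0 < r)%N by move: q0; rewrite qE; case: (r).
have qn : nint (q%:R * th) (r%:R * (E / X)).
  have := nintMn r hn; rewrite qE !natrM.
  by congr nint; ring.
apply: le_trans (fejker_near h0 qn) _.
rewrite ler_pdivlMr//.
have rq : r%:R <= q%:R :> R by rewrite ler_nat qE leq_pmulr// muln_gt0 w0.
have -> : 16 * h%:R * (r%:R * (E / X)) * L = 16 * E * (h%:R * (L * r%:R) / X) by ring.
rewrite ler_piMr ?mulr_ge0// ler_pdivrMr// mul1r; apply: le_trans hX.
by rewrite ler_wpM2l// ler_wpM2l// ltW.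
Qed.

Lemma card_ord_ge m n : (m <= n)%N -> #|[pred i : 'I_n | ~~ (i < m)%N]| = (n - m)%N.
Proof.
move=> mn; have E := cardC [pred i : 'I_n | (i < m)%N].
rewrite card_ord -[X in (X + _)%N]sum1_card (big_ord_narrow mn) sum1_card card_ord in E.
by rewrite -(addKn m #|_|) -[in RHS]E; congr (_ + _ - _)%N; apply: eq_card.
Qed.

Lemma pow2_archi (B ep : R) : 0 <= B -> 0 < ep -> exists2 k, (1 <= k)%N & B / 2 ^+ k <= ep.
Proof.
move=> B0 ep0; exists (Num.bound (B / ep)).+1 => //; set k := (Num.bound (B / ep)).+1.
have k2 : 0 < 2 ^+ k :> R by rewrite exprn_gt0.
rewrite ler_pdivrMr// mulrC -ler_pdivrMr//.
have h0 : 0 <= B / ep by rewrite divr_ge0// ltW.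
apply: le_trans (ltW (archi_boundP h0)) _; rewrite -natrX ler_nat.
by apply: leq_trans (leqnSn _) _; rewrite ltnW// ltn_expl.
Qed.

(** The two counts differ by the average of 1 minus the kernels against the product of the waves.
    Where the wave of the single variable [j0] is large, its frequencies have denominators dividing
    W, hence q, and the kernels are nearly 1. Where it is small, its restricted thirteenth moment is
    small, and the weighted inequality of the means brings in the other waves. *)
Theorem wsum_approx s (a : 'M[int]_(3, s)) : (13 <= s)%N -> (forall i j, a i j != 0) ->
  forall eps : R, 0 < eps -> exists W : nat, (0 < W)%N /\ exists L0 : R, 0 < L0 /\ exists n0 : nat,
  forall n q (L : R) (h : 'I_3 -> nat), (n0 <= n)%N -> (0 < q)%N -> (W %| q)%N -> L0 <= L ->
  (forall i, (0 < h i)%N) -> (forall i : 'I_3, (h i)%:R * (L * q%:R) <= n%:R ^+ i.+1) ->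
  `|wsum R a n (fun=> 1%N) 1 - wsum R a n h q| <= eps * n%:R ^+ (s - 6).
Proof.
move=> s13 a0 eps eps0.
have [D [C C0 HC]] := small_values R; have [D1 HD1] := large_fwave R.
pose w := widen_ord s13; pose j0 := w ord0.
(* One third for each of the three error terms; the other factor comes from 2n + 1 <= 3n. *)
pose ep : R := eps / (3 * 3 ^+ (s - 6)).
have p3 : 0 < 3 ^+ (s - 6) :> R by rewrite exprn_gt0.
have ep0 : 0 < ep by rewrite divr_gt0// mulr_gt0.
(* M makes the share of the unrestricted moments small; [k] is chosen afterwards, so that the
   restricted moment beats the weight M^156. *)
pose M : R := 13 * C / ep + 1.
have M0 : 1 <= M by rewrite lerDr; nneg.
have M0' : 0 < M by apply: lt_le_trans M0.
have HM : 13 * C / M ^+ 13 <= ep.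
  rewrite ler_pdivrMr ?exprn_gt0//; apply: (@le_trans _ _ (ep * M)).
    by rewrite /M mulrDr mulrCA mulfV ?gt_eqF// !mulr1 lerDl ltW.
  by apply: ler_wpM2l; [exact: ltW|rewrite exprS ler_peMr ?exprn_ege1// ltW].
have B0 : 0 <= M ^+ 156 * C by rewrite mulr_ge0// exprn_ge0// ltW.
have [k kpos Hk] := pow2_archi B0 ep0.
pose K := (4 ^ k)%N.
have K2 : (2 <= K)%N by apply: (@leq_trans (4 ^ 1)%N) => //; rewrite leq_pexp2l.
(* All denominators up to K^D1 divide the factorial; the coefficients are needed because it is a i
   j0 times the frequency that is approximated. *)
pose W := ((K ^ D1)`! * \prod_i `|a i j0|)%N.
have cpos i : (0 < `|a i j0|)%N by rewrite absz_gt0.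
have W0 : (0 < W)%N by rewrite muln_gt0 fact_gt0 prodn_gt0.
(* 240 = 3 . 16 . 5: three kernels, the constant of [fejker_near] and the constant of
   [large_fwave]. *)
pose L0 : R := 240 * K%:R ^+ D1 * (13 * C) / ep + 1.
have L00 : 0 < L0 by apply: ltr_wpDl => //; nneg.
exists W; split => //; exists L0; split => //.
exists (4 ^ (D * k) + K ^ D1 + 1)%N => n q L h nn q0 Wq LL h0 hL.
set N := (2 * n).+1.
have nN : (n <= N)%N by rewrite /N mul2n -addnn; clear; lia.
have n1 : (1 <= n)%N by apply: leq_trans nn; rewrite addn1.
have N3 : (N <= 3 * n)%N by rewrite /N; move: n1; clear; lia.
have ND : (4 ^ (D * k) <= N)%N by apply: leq_trans nN; apply: leq_trans nn; rewrite -addnA leq_addr.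
have NK : (K ^ D1 <= N)%N by apply: leq_trans nN; apply: leq_trans nn; rewrite addn1 leqW// leq_addl.
pose Z (h' : 'I_3 -> nat) q' (x : {ffun 'I_s -> 'I_(2 * n).+1}) i :=
  (`|phi a i (centred x)| + q' * h' i).+1.
have [Q QB Qp] := prime_above (N ^ 9 + \sum_x \sum_i Z h q x i + \sum_x \sum_i Z (fun=> 1%N) 1%N x i +
   \sum_i \sum_j `|a i j|)%N.
have Q0 : (0 < Q)%N by exact: prime_gt0.
have NQ : (N ^ 9 <= Q)%N.
  by apply: leq_trans (ltnW QB); rewrite -!addnA leq_addr.
have ZQ h' q' (x : {ffun 'I_s -> 'I_(2 * n).+1}) i : (\sum_x \sum_i Z h' q' x i <= Q)%N ->
    `|phi a i (centred x)| + q'%:Z * (h' i)%:Z < Q%:Z.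
  move=> ZQ; have : (Z h' q' x i <= Q)%N.
    by apply: leq_trans ZQ; rewrite (bigD1 x)//= (bigD1 i)//= -addnA leq_addr.
  by rewrite /Z; clear; lia.
have aQ i j : `|a i j| < Q%:Z.
  have : (\sum_i \sum_j `|a i j| < Q)%N by apply: leq_ltn_trans QB; rewrite leq_addl.
  rewrite (bigD1 i)//= (bigD1 j)//=; clear; lia.
pose one (i : 'I_3) := 1%N.
have id1 : \sum_(t : grid Q) \prod_j fwave R (fun i => a i j) n t = (Q%:R ^+ 3 * wsum R a n one 1)%:C%C.
  rewrite -(@wsum_identity R s a n one 1 Q Q0); last first.
    move=> x i; apply: ZQ; apply: leq_trans (ltnW QB).
    by rewrite [X in (_ <= X + _)%N]addnC -addnA leq_addr.
  by apply: eq_bigr => t _; rewrite [X in X%:C%C]big1 ?rmorph1 ?mul1r// => i _; rewrite fejker1.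
have idh : \sum_(t : grid Q) (\prod_i fejker (h i) q (pt R t i))%:C%C * \prod_j fwave R (fun i => a i j) n t
    = (Q%:R ^+ 3 * wsum R a n h q)%:C%C.
  apply: wsum_identity => // x i; apply: ZQ; apply: leq_trans (ltnW QB).
  by rewrite [X in (_ <= X + _ + _)%N]addnC -!addnA leq_addr.
have Q3 : 0 < Q%:R ^+ 3 :> R by rewrite exprn_gt0// ltr0n.
pose y j (t : grid Q) := nm (fwave R (fun i => a i j) n t).
pose kk (t : grid Q) := \prod_i fejker (h i) q (pt R t i).
have y0 j t : 0 <= y j t by exact: nm_ge0.
have kk01 t : 0 <= 1 - kk t <= 1.
  have k0 : 0 <= kk t by apply: prodr_ge0 => i _; have /andP[] := fejker_le1 (h i) q (pt R t i).
  have k1 : kk t <= 1 by apply: prodr_ile1 => i _; exact: fejker_le1.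
  by rewrite subr_ge0 k1 gerBl.
have yprod t : \prod_j y j t <= N%:R ^+ (s - 13) * \prod_(j < 13) y (w j) t.
  rewrite (bigID (fun j : 'I_s => (j < 13)%N)) /= (big_ord_narrow s13) mulrC.
  rewrite ler_wpM2r ?prodr_ge0//.
  apply: (@le_trans _ _ (\prod_(i < s | ~~ (i < 13)%N) N%:R)).
    by apply: ler_prod => j _; rewrite y0 nm_fwave_le.
  by rewrite prodr_const -(card_ord_ge s13).
pose small t := y j0 t < N%:R / 4 ^+ k.
pose Y t := \sum_(j < 13) y (w j) t ^+ 13.
have Y0 t : 0 <= Y t by apply: sumr_ge0 => j _; rewrite exprn_ge0.
have L0' : 0 < L by apply: lt_le_trans LL.
pose del : R := 240 * K%:R ^+ D1 / L.
have del0 : 0 <= del by rewrite /del; nneg.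
have majorK t : ~~ small t -> 1 - kk t <= del.
  rewrite /small -leNgt -natrX -/K => hy.
  have [w' [/andP[w0 wK] hw]] := HD1 K n Q (fun i => a i j0) t K2 NK hy.
  have kd i : 1 - fejker (h i) q (pt R t i) <= 16 * (5 * K%:R ^+ D1) / L.
    have wc : (w' * `|a i j0| %| q)%N.
      apply: dvdn_trans Wq; rewrite dvdn_mul//; first by rewrite dvdn_fact// w0.
      by rewrite (bigD1 i)//= dvdn_mulr.
    have N0 : 0 < N%:R ^+ i.+1 :> R by rewrite exprn_gt0// ltr0n.
    apply: (fejker_major (h0 i) L0' N0 _ q0 w0 wc (cpos i)); first by rewrite mulr_ge0 ?exprn_ge0.
      have [z hz] := hw i.
      have [/ltW aij|aij] := ltP 0 (a i j0).
        by exists z; rewrite natr_absz (ger0_norm aij).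
      exists (- z); rewrite natr_absz (ler0_norm aij) intrN opprK -normrN.
      by move: hz; congr (`|_| <= _); rewrite intrN; ring.
    apply: le_trans (hL i) _; rewrite lerXn2r ?nnegrE ?ler_nat//.
  have /andP[_] := one_sub_prod3 (fun i => fejker_le1 (h i) q (pt R t i)) kd.
  by move=> /le_trans; apply; rewrite /del le_eqVlt; apply/orP; left; apply/eqP; ring.
have term t : (1 - kk t) * \prod_j y j t <= N%:R ^+ (s - 13) *
    (M ^+ 156 * (if small t then y j0 t ^+ 13 else 0) + (M ^- 13 + del) * Y t).
  have /andP[k0 k1] := kk01 t.
  have N13 : 0 <= N%:R ^+ (s - 13) :> R by rewrite exprn_ge0.
  apply: le_trans (ler_wpM2l k0 (yprod t)) _; rewrite mulrCA ler_wpM2l//.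
  have P0 : 0 <= \prod_(j < 13) y (w j) t by rewrite prodr_ge0.
  have Mi : 0 <= M ^- 13 by rewrite invr_ge0 exprn_ge0// ltW.
  case: ifPn => [sm|nsm].
    apply: (@le_trans _ _ (\prod_(j < 13) y (w j) t)); first by rewrite ler_piMl.
    apply: le_trans (weighted_amgm M0' (fun j => y0 (w j) t)) _.
    apply: lerD; first exact: lexx.
    by apply: ler_wpM2r; [exact: Y0|rewrite lerDl].
  rewrite mulr0 add0r; apply: (@le_trans _ _ (del * Y t)).
    apply: ler_pM => //; first exact: majorK.
    exact: (@prod_le_sum_pow R 12 (fun j => y (w j) t)).
  by rewrite ler_wpM2r// lerDr.
have S1 : \sum_t (if small t then y j0 t ^+ 13 else 0) <= C * Q%:R ^+ 3 * N%:R ^+ 7 / 2 ^+ k.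
  rewrite (@fwave_sum R (fun u => if u < N%:R / 4 ^+ k then u ^+ 13 else 0) (fun i => a i j0) n Q)//.
  by rewrite -big_mkcond; have [] := HC k N Q kpos ND NQ.
have S2 : \sum_t Y t <= 13 * (C * Q%:R ^+ 3 * N%:R ^+ 7).
  rewrite exchange_big /=; apply: (@le_trans _ _ (\sum_(j < 13) C * Q%:R ^+ 3 * N%:R ^+ 7)); last first.
    by rewrite sumr_const card_ord [leRHS]mulr_natl.
  apply: ler_sum => j _.
  rewrite (@fwave_sum R (fun u => u ^+ 13) (fun i => a i (w j)) n Q)//.
  by have [] := HC k N Q kpos ND NQ.
have tot : Q%:R ^+ 3 * `|wsum R a n one 1 - wsum R a n h q| <= \sum_t (1 - kk t) * \prod_j y j t.
  have E : (Q%:R ^+ 3 * (wsum R a n one 1 - wsum R a n h q))%:C%C =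
      \sum_(t : grid Q) \prod_j fwave R (fun i => a i j) n t -
      \sum_(t : grid Q) (kk t)%:C%C * \prod_j fwave R (fun i => a i j) n t.
    by rewrite id1 idh mulrBr rmorphB.
  rewrite -[X in X * _](gtr0_norm Q3) -normrM -nm_real E -sumrB.
  apply: le_trans (nm_sum _ _ _) _; apply: ler_sum => t _.
  have /andP[k0 _] := kk01 t.
  have -> : \prod_j fwave R (fun i => a i j) n t - (kk t)%:C%C * \prod_j fwave R (fun i => a i j) n t
    = (1 - kk t)%:C%C * \prod_j fwave R (fun i => a i j) n t.
    by rewrite rmorphB rmorph1 mulrBl mul1r.
  by rewrite nmM nm_real ger0_norm// nm_prod.
have fin : \sum_t (1 - kk t) * \prod_j y j t <= Q%:R ^+ 3 * (N%:R ^+ (s - 6) * (3 * ep)).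
  apply: le_trans (ler_sum _ (fun t _ => term t)) _; rewrite -mulr_sumr big_split /= -!mulr_sumr.
  have -> : N%:R ^+ (s - 6) = N%:R ^+ (s - 13) * N%:R ^+ 7 :> R.
    by rewrite -exprD; congr (_ ^+ _); have := s13; clear; lia.
  have -> : Q%:R ^+ 3 * (N%:R ^+ (s - 13) * N%:R ^+ 7 * (3 * ep)) =
     N%:R ^+ (s - 13) * ((Q%:R ^+ 3 * N%:R ^+ 7) * (3 * ep)) by ring.
  rewrite ler_wpM2l ?exprn_ge0//.
  set V := Q%:R ^+ 3 * N%:R ^+ 7; have V0 : 0 <= V by rewrite mulr_ge0 ?exprn_ge0.
  have l1 : M ^+ 156 * \sum_t (if small t then y j0 t ^+ 13 else 0) <= ep * V.
    apply: le_trans (ler_wpM2l _ S1) _; first by rewrite exprn_ge0// ltW.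
    have -> : M ^+ 156 * (C * Q%:R ^+ 3 * N%:R ^+ 7 / 2 ^+ k) = (M ^+ 156 * C / 2 ^+ k) * V.
      by rewrite /V; move: (M ^+ 156) => u; ring.
    by rewrite ler_wpM2r.
  have k2 : (M ^- 13 + del) * \sum_t Y t <= (ep + ep) * V.
    apply: le_trans (ler_wpM2l _ S2) _; first by rewrite addr_ge0// invr_ge0 exprn_ge0// ltW.
    have -> : (M ^- 13 + del) * (13 * (C * Q%:R ^+ 3 * N%:R ^+ 7)) =
      (13 * C / M ^+ 13 + del * (13 * C)) * V by rewrite /V; ring.
    rewrite ler_wpM2r// lerD// /del mulrAC ler_pdivrMr//.
    apply: le_trans (ler_wpM2l (ltW ep0) LL).
    have -> : ep * L0 = 240 * K%:R ^+ D1 * (13 * C) + ep.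
      by rewrite /L0; move: (K%:R ^+ D1) => u; field; rewrite gt_eqF.
    by rewrite lerDl ltW.
  lra.
rewrite -(ler_pM2l Q3); apply: le_trans tot _; apply: le_trans fin _.
apply: ler_wpM2l; first exact: ltW.
have N3' : N%:R ^+ (s - 6) <= 3 ^+ (s - 6) * n%:R ^+ (s - 6) :> R.
  by rewrite -exprMn lerXn2r ?nnegrE ?mulr_ge0// -natrM ler_nat.
apply: le_trans (ler_wpM2r _ N3') _; first by rewrite mulr_ge0// ltW.
rewrite le_eqVlt; apply/orP; left; apply/eqP; rewrite /ep; field.
by rewrite gt_eqF.
Qed.

End Approximation.

Lemma phi_congr s (a : 'M[int]_(3, s)) i (q : nat) (x y : 'I_s -> int) :
  (forall j, (q%:Z %| x j - y j)%Z) -> (q%:Z %| phi a i x)%Z = (q%:Z %| phi a i y)%Z.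
Proof.
move=> xy; have D : (q%:Z %| phi a i x - phi a i y)%Z.
  rewrite /phi -sumrB; elim/big_ind: _ => [|u v|j _]; [exact: dvdz0|exact: rpredD|].
  by rewrite -mulrBr dvdz_mull// subrXX dvdz_mulr.
by rewrite -[phi a i x](subrK (phi a i y)) (rpredDl _ D).
Qed.

Definition local_density (R : realType) s (a : 'M[int]_(3, s)) (q : nat) : R :=
  (count_mod a q)%:R * q%:R ^+ 3 / q%:R ^+ s.

(** * Lifting solutions to prime power moduli *)

Section Lifting.
Variables (s : nat) (a : 'M[int]_(3, s)).

Lemma residue_ord_dvd (Q : nat) (Q0 : (0 < Q)%N) (m : int) :
  (Q%:Z %| (residue_ord Q0 m : nat)%:Z - m)%Z.
Proof.
have [n e] := residue_ordE Q0 m; apply/dvdzP; exists (- n).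
by rewrite [X in _ - X = _]e; ring.
Qed.

Lemma phi_taylor (i : 'I_3) (x v : 'I_s -> int) (t : int) :
  (t ^+ 2 %| phi a i (fun j => x j + t * v j) - phi a i x - t * \sum_j Defs.jacobian a x i j * v j)%Z.
Proof.
rewrite /phi mulr_sumr -!sumrB; elim/big_ind: _ => [|u w|j _]; [exact: dvdz0|exact: rpredD|].
rewrite mxE !intz; move: (a i j) (x j) (v j) => c y w; move: i; apply: ord3P => /=.
- by apply/dvdzP; exists 0; rewrite /bump /= ; ring.
- by apply/dvdzP; exists (c * w ^+ 2); rewrite /bump /=; ring.
- by apply/dvdzP; exists (c * w ^+ 2 * (3 * y + t * w)); rewrite /bump /=; ring.
Qed.

Lemma jacobian_congr (d : int) (x y : 'I_s -> int) i j :
  (d %| x j - y j)%Z -> (d %| Defs.jacobian a x i j - Defs.jacobian a y i j)%Z.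
Proof. by move=> xy; rewrite !mxE -mulrBr dvdz_mull// subrXX dvdz_mulr. Qed.

Lemma prod_congr (d : int) (I : finType) (F G : I -> int) :
  (forall i, d %| F i - G i)%Z -> (d %| \prod_i F i - \prod_i G i)%Z.
Proof.
move=> FG; elim/big_ind2: _ => [|u v w z uv wz|i _]; [by rewrite subrr dvdz0| |exact: FG].
have -> : v * z - u * w = (v - u) * z + u * (z - w) by ring.
by apply: rpredD; [exact: dvdz_mulr|exact: dvdz_mull].
Qed.

Lemma det_congr (d : int) n (A B : 'M[int]_n) :
  (forall i j, d %| A i j - B i j)%Z -> (d %| \det A - \det B)%Z.
Proof.
move=> AB; rewrite /determinant -sumrB; elim/big_ind: _ => [|u w|g _]; [exact: dvdz0|exact: rpredD|].
by rewrite -mulrBr dvdz_mull// prod_congr.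
Qed.

Lemma ndvdz_congr (d x y : int) : (d %| x - y)%Z -> (d %| x)%Z = (d %| y)%Z.
Proof. by move=> xy; rewrite -[x](subrK y) (rpredDl _ xy). Qed.

(** The minor on the columns [f] is u p^k with u prime to p. Its adjugate, with u inverted modulo p,
    solves the linearised system for a correction with step t = p^(H-k). The quadratic remainder is
    divisible by t^2, hence by p^(H+1), since 2k + 1 <= H. *)
Lemma newton_step (p k H : nat) (x : 'I_s -> int) (f : 'I_3 -> 'I_s) : prime p ->
  (2 * k + 1 <= H)%N -> (forall i, ((p ^ H)%N%:Z %| phi a i x)%Z) ->
  ((p ^ k)%N%:Z %| \det (colsub f (Defs.jacobian a x)))%Z ->
  ~~ ((p ^ k.+1)%N%:Z %| \det (colsub f (Defs.jacobian a x)))%Z ->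
  exists y : 'I_s -> int, [/\ forall j, j \notin codom f -> y j = x j,
    forall j, ((p ^ (H - k))%N%:Z %| y j - x j)%Z & forall i, ((p ^ H.+1)%N%:Z %| phi a i y)%Z].
Proof.
move=> pp kH px /dvdzP[u uE] nd.
set A := colsub f (Defs.jacobian a x) in uE nd.
have cup : coprimez u p.
  rewrite coprimez_sym /coprimez; have : coprime p `|u| || (p %| `|u|)%N by rewrite prime_coprime// orNb.
  case/orP => [|pu]; first by rewrite /coprime => /eqP e; rewrite /gcdz absz_nat e.
  case/negP: nd; rewrite uE expnS PoszM dvdz_mul2r ?dvdzz//.
  by rewrite eqz_nat -lt0n expn_gt0 prime_gt0.
have [[u' p'] /= Bz] := coprimezP _ _ cup.
have [c cE] : exists c : 'I_3 -> int, forall i, phi a i x = c i * (p ^ H)%N%:Z.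
  by exists (fun i => (phi a i x %/ (p ^ H)%N%:Z)%Z) => i; rewrite divzK.
pose cv : 'cV[int]_3 := \col_i c i.
pose w : 'cV[int]_3 := - u' *: (\adj A *m cv).
pose v j : int := \sum_(l < 3) (f l == j)%:R * w l ord0.
have vE i : \sum_j Defs.jacobian a x i j * v j = - (u' * u * (p ^ k)%N%:Z) * c i.
  transitivity (\sum_(l < 3) A i l * w l ord0).
    under eq_bigr do rewrite mulr_sumr; rewrite exchange_big /=; apply: eq_bigr => l _.
    rewrite (bigD1 (f l))//= eqxx mul1r [A i l]mxE big1 ?addr0// => j /negbTE jl.
    by rewrite eq_sym jl mul0r mulr0.
  have := mul_mx_adj A; move/(congr1 (fun M => (M *m cv) i ord0)).
  rewrite -mulmxA mul_scalar_mx [RHS]mxE [cv i ord0]mxE uE => e.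
  have -> : - (u' * u * (p ^ k)%N%:Z) * c i = - u' * (u * (p ^ k)%N%:Z * c i) by ring.
  rewrite -e [(A *m _) i ord0]mxE mulr_sumr; apply: eq_bigr => l _.
  by rewrite [w l ord0]mxE mulrCA.
pose t : int := (p ^ (H - k))%N%:Z.
exists (fun j => x j + t * v j); split.
- move=> j jf; rewrite /v big1 ?mulr0 ?addr0// => l _.
  by case: eqP => [e|]; rewrite ?mul0r//; case/negP: jf; rewrite -e codom_f.
- by move=> j; rewrite addrC addKr dvdz_mulr ?dvdzz.
move=> i; have := phi_taylor i x v t; rewrite vE cE.
have -> : t * (- (u' * u * (p ^ k)%N%:Z) * c i) = - (u' * u * c i) * (p ^ H)%N%:Z.
  have -> : (p ^ H)%N%:Z = t * (p ^ k)%N%:Z.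
    by rewrite /t -PoszM -expnD subnK//; move: kH; clear; lia.
  by ring.
move=> D2; have D : ((p ^ H.+1)%N%:Z %| t ^+ 2)%Z.
  rewrite /t -PoszX dvdzE !absz_nat -expnM dvdn_exp2l//; move: kH; clear; lia.
have {D D2} D3 := dvdz_trans D D2.
set P := phi a i _ in D3 *.
have -> : P = (P - c i * (p ^ H)%N%:Z - - (u' * u * c i) * (p ^ H)%N%:Z) + c i * (1 - u' * u) * (p ^ H)%N%:Z by ring.
apply: rpredD => //; rewrite -Bz expnS PoszM.
have -> : c i * (u' * u + p' * p%:Z - u' * u) * (p ^ H)%N%:Z = c i * p' * (p%:Z * (p ^ H)%N%:Z) by ring.
by rewrite dvdz_mull ?dvdzz.
Qed.

Lemma hensel (p k : nat) (x : 'I_s -> int) (f : 'I_3 -> 'I_s) : prime p ->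
  (forall i, ((p ^ (2 * k + 1))%N%:Z %| phi a i x)%Z) ->
  ((p ^ k)%N%:Z %| \det (colsub f (Defs.jacobian a x)))%Z ->
  ~~ ((p ^ k.+1)%N%:Z %| \det (colsub f (Defs.jacobian a x)))%Z ->
  forall H, (2 * k + 1 <= H)%N ->
  exists y : 'I_s -> int, [/\ forall j, j \notin codom f -> y j = x j,
    forall j, ((p ^ k.+1)%N%:Z %| y j - x j)%Z & forall i, ((p ^ H)%N%:Z %| phi a i y)%Z].
Proof.
move=> pp px d0 d1; elim=> [|H IH]; first by rewrite addn1.
rewrite leq_eqVlt => /predU1P[<-|kH].
  by exists x; split => // j; rewrite subrr dvdz0.
have [y [y1 y2 y3]] := IH kH.
have dE : ((p ^ k.+1)%N%:Z %| \det (colsub f (Defs.jacobian a y)) - \det (colsub f (Defs.jacobian a x)))%Z.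
  by apply: det_congr => i j; rewrite ![colsub _ _ _ _]mxE; apply: jacobian_congr; exact: y2.
have dE' : ((p ^ k)%N%:Z %| \det (colsub f (Defs.jacobian a y)) - \det (colsub f (Defs.jacobian a x)))%Z.
  by apply: dvdz_trans dE; rewrite dvdzE !absz_nat dvdn_exp2l.
have [z [z1 z2 z3]] := newton_step pp kH y3 (etrans (ndvdz_congr dE') d0)
  (etrans (congr1 negb (ndvdz_congr dE)) d1).
exists z; split => // j; first by move=> jf; rewrite z1// y1.
rewrite -(subrK (y j) (z j)) -addrA; apply: rpredD; last exact: y2.
by apply: dvdz_trans (z2 j); rewrite dvdzE !absz_nat dvdn_exp2l//; move: kH; clear; lia.
Qed.

Definition congruent_solution p k H (x : 'I_s -> int) : pred {ffun 'I_s -> 'I_(p ^ H)} :=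
  [pred y : {ffun 'I_s -> 'I_(p ^ H)} | [forall i, ((p ^ H)%N%:Z %| phi a i (fun j => (y j : nat)%:Z))%Z] &&
     [forall j, ((p ^ k.+1)%N%:Z %| (y j : nat)%:Z - x j)%Z]].

Arguments congruent_solution : clear implicits.

(** At least s - 3 coordinates lie outside the columns [f]. Changing them by multiples of p^(2k+1)
    preserves the assumptions of [hensel], and lifting leaves them fixed, so different changes give
    different solutions. *)
Lemma hensel_count (p k : nat) (x : 'I_s -> int) (f : 'I_3 -> 'I_s) : prime p ->
  (forall i, ((p ^ (2 * k + 1))%N%:Z %| phi a i x)%Z) ->
  ((p ^ k)%N%:Z %| \det (colsub f (Defs.jacobian a x)))%Z ->
  ~~ ((p ^ k.+1)%N%:Z %| \det (colsub f (Defs.jacobian a x)))%Z ->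
  forall H, (2 * k + 1 <= H)%N ->
  (p ^ ((H - (2 * k + 1)) * (s - 3)) <= #|congruent_solution p k H x|)%N.
Proof.
move=> pp px d0 d1 H kH; have p0 := prime_gt0 pp.
set b := (2 * k + 1)%N; set m := (p ^ (H - b))%N.
have m0 : (0 < m)%N by rewrite expn_gt0 p0.
have q0 : (0 < p ^ H)%N by rewrite expn_gt0 p0.
have pHE : (p ^ H)%N = (p ^ b * m)%N by rewrite -expnD subnKC.
pose z0 := Ordinal m0.
pose st (y : {ffun 'I_s -> 'I_m}) j : int := x j + (p ^ b)%N%:Z * (y j : nat)%:Z.
have stx (y : {ffun 'I_s -> 'I_m}) j : ((p ^ b)%N%:Z %| st y j - x j)%Z.
  by rewrite /st addrC addKr dvdz_mulr ?dvdzz.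
have kb : ((p ^ k.+1)%N%:Z %| (p ^ b)%N%:Z)%Z.
  by rewrite dvdzE !absz_nat dvdn_exp2l// /b; clear; lia.
have stx' (y : {ffun 'I_s -> 'I_m}) j : ((p ^ k.+1)%N%:Z %| st y j - x j)%Z := dvdz_trans kb (stx y j).
have /choice[g gP] (y : {ffun 'I_s -> 'I_m}) : exists z : {ffun 'I_s -> 'I_(p ^ H)},
    congruent_solution p k H x z /\
    forall j, j \notin codom f -> ((p ^ H)%N%:Z %| (z j : nat)%:Z - st y j)%Z.
  have dE : ((p ^ k.+1)%N%:Z %| \det (colsub f (Defs.jacobian a (st y))) - \det (colsub f (Defs.jacobian a x)))%Z.
    by apply: det_congr => i j; rewrite ![colsub _ _ _ _]mxE; apply: jacobian_congr.
  have dE' : ((p ^ k)%N%:Z %| \det (colsub f (Defs.jacobian a (st y))) - \det (colsub f (Defs.jacobian a x)))%Z.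
    by apply: dvdz_trans dE; rewrite dvdzE !absz_nat dvdn_exp2l.
  have ps i : ((p ^ (2 * k + 1))%N%:Z %| phi a i (st y))%Z.
    by rewrite (@phi_congr s a i _ (st y) x)//; exact: stx.
  have [z [z1 z2 z3]] := hensel pp ps (etrans (ndvdz_congr dE') d0)
    (etrans (congr1 negb (ndvdz_congr dE)) d1) kH.
  exists [ffun j => residue_ord q0 (z j)]; split; last first.
    by move=> j jf; rewrite ffunE -(z1 _ jf); exact: residue_ord_dvd.
  apply/andP; split.
    apply/forallP => i; rewrite (@phi_congr s a i _ _ z)// => j; rewrite ffunE; exact: residue_ord_dvd.
  apply/forallP => j; rewrite ffunE.
  have -> : (residue_ord q0 (z j) : nat)%:Z - x j =
    ((residue_ord q0 (z j) : nat)%:Z - z j) + (z j - st y j) + (st y j - x j) by ring.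
  apply: rpredD => //; apply: rpredD; last exact: z2.
  apply: dvdz_trans (residue_ord_dvd q0 (z j)).
  by rewrite dvdzE !absz_nat dvdn_exp2l//; move: kH; clear; lia.
pose D : {pred 'I_s} := [predC codom f].
have Ds : (s - 3 <= #|D|)%N.
  have := cardC (mem (codom f)); have := @leq_image_card _ _ f predT.
  by rewrite /D !card_ord; move: #|_| #|_|; clear; lia.
have -> : (p ^ ((H - b) * (s - 3)) = m ^ (s - 3))%N by rewrite expnM.
apply: (@leq_trans (m ^ #|D|)%N); first by apply: leq_pexp2l.
have -> : (m ^ #|D|)%N = #|pffun_on z0 D predT| by rewrite card_pffun_on card_ord.
have gi : {in pffun_on z0 D predT &, injective g}.
  move=> y y' /pffun_onP[/fintype.subsetP sy _] /pffun_onP[/fintype.subsetP sy' _] gg.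
  apply/ffunP => j; have [jf|jf] := boolP (j \in codom f).
    have z (w : {ffun 'I_s -> 'I_m}) : (forall i, i \in (z0).-support w -> i \in D) -> w j = z0.
      move=> sw; apply/eqP/negPn/negP => wj; have := sw j wj.
      by move/negP; apply.
    by rewrite (z y)// (z y').
  apply/val_inj; apply: (@dvdz_lt_eq m) (ltn_ord _) (ltn_ord _) _.
  have := rpredB ((gP y').2 _ jf) ((gP y).2 _ jf).
  rewrite gg /st; move: (g y' j : nat) => w.
  have -> : w%:Z - (x j + (p ^ b)%N%:Z * (y' j : nat)%:Z) - (w%:Z - (x j + (p ^ b)%N%:Z * (y j : nat)%:Z)) =
    (p ^ b)%N%:Z * ((y j : nat)%:Z - (y' j : nat)%:Z) by ring.
  by rewrite pHE PoszM dvdz_mul2l // eqz_nat -lt0n expn_gt0 p0.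
rewrite -(card_in_imset gi); apply: subset_leq_card; apply/fintype.subsetP => z /imsetP[y _ ->].
exact: (gP y).1.
Qed.

Lemma count_mod_mul q1 q2 : (0 < q1)%N -> (0 < q2)%N -> coprime q1 q2 ->
  count_mod a (q1 * q2) = (count_mod a q1 * count_mod a q2)%N.
Proof.
move=> h1 h2 q12.
pose h (x : {ffun 'I_s -> 'I_(q1 * q2)}) : {ffun 'I_s -> 'I_q1} * {ffun 'I_s -> 'I_q2} :=
  ([ffun j => Ordinal (ltn_pmod (x j) h1)], [ffun j => Ordinal (ltn_pmod (x j) h2)]).
have hb : bijective h.
  apply: inj_card_bij; last by rewrite card_prod !card_ffun !card_ord expnMn.
  move=> x y [/ffunP e1 /ffunP e2]; apply/ffunP => j; apply/val_inj => /=.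
  have := e1 j; have := e2 j; rewrite !ffunE => /(congr1 val) /= E2 /(congr1 val) /= E1.
  have : (x j == y j %[mod q1 * q2])%N by rewrite chinese_remainder// E1 E2 !eqxx.
  by rewrite !modn_small// => /eqP.
have modE q (q0 : (0 < q)%N) (x : {ffun 'I_s -> 'I_(q1 * q2)}) i :
    (q%:Z %| phi a i (fun j => (([ffun j => Ordinal (ltn_pmod (x j) q0)] j : 'I_q) : nat)%:Z))%Z =
    (q%:Z %| phi a i (fun j => (x j : nat)%:Z))%Z.
  apply: phi_congr => j; rewrite ffunE /=; apply/dvdzP; exists (- (x j %/ q)%N%:Z).
  have := divn_eq (x j) q; move: (_ %/ q)%N (_ %% q)%N => u v; clear; nia.
rewrite /count_mod -!sum1_card.
transitivity (\sum_(uv : {ffun 'I_s -> 'I_q1} * {ffun 'I_s -> 'I_q2} | [forall i, (q1%:Z %| phi a i (fun j => (uv.1 j : nat)%:Z))%Z] &&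
   [forall i, (q2%:Z %| phi a i (fun j => (uv.2 j : nat)%:Z))%Z]) 1)%N; last first.
  rewrite big_distrlr /= pair_big /=; apply: eq_big => [[u v]|] //=; by rewrite !inE.
rewrite (reindex h) /=; last exact/onW_bij.
apply: eq_bigl => x; rewrite inE; apply/forallP/andP => [H|[/forallP H1 /forallP H2] i].
  split; apply/forallP => i; rewrite modE; apply: dvdz_trans (H i).
    by rewrite dvdzE !absz_nat dvdn_mulr.
  by rewrite dvdzE !absz_nat dvdn_mull.
by rewrite PoszM Gauss_dvdz// -(modE _ h1) -(modE _ h2) H1 H2.
Qed.

End Lifting.
Arguments congruent_solution {s} a p k H x.

(* From p-adic points to integers *)
From mathcomp Require Import fraction.

Lemma frac_num_den (D : idomainType) (x : {fraction D}) :
  exists n d : D, d != 0 /\ FracField.tofrac d * x = FracField.tofrac n.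
Proof.
elim/quotW: x => x; exists (\n_x), (\d_x); split; first exact: denom_ratioP.
rewrite !piE; apply/eqmodP; rewrite /= FracField.equivfE /FracField.mulf.
by rewrite !numden_Ratio ?(oner_neq0, mul1r, mulr1, denom_ratioP)// mulrC.
Qed.

Lemma common_denominator (D : idomainType) (I : finType) (x : I -> {fraction D}) :
  exists (n : I -> D) (d : D), d != 0 /\ forall j, FracField.tofrac d * x j = FracField.tofrac (n j).
Proof.
have /choice[n1 /choice[d1 nd]] (j : I) := frac_num_den (x j).
exists (fun j => n1 j * \prod_(k | k != j) d1 k), (\prod_k d1 k); split.
  by apply/prodf_neq0 => k _; have [] := nd k.
move=> j; rewrite (bigD1 j)//= !rmorphM/= -(nd j).2; ring.
Qed.

Lemma nonsingular_minor (K : fieldType) s (J : 'M[K]_(3, s)) : \rank J = 3%N ->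
  exists f : 'I_3 -> 'I_s, \det (colsub f J) != 0.
Proof.
move=> rJ; have rf : row_full J^T by rewrite /row_full mxrank_tr rJ.
exists (fullrankfun rf); rewrite -det_tr trmx_mxsub.
by have := fullrowsub_unit rf; rewrite unitmxE unitfE.
Qed.

Section Forms.
Variables (s : nat) (a : 'M[int]_(3, s)).

Lemma phi_scale (K : comPzRingType) (c : K) (x : 'I_s -> K) i :
  phi a i (fun j => c * x j) = c ^+ i.+1 * phi a i x.
Proof. by rewrite /phi mulr_sumr; apply: eq_bigr => j _; rewrite exprMn mulrCA. Qed.

Lemma minor_scale (K : comPzRingType) (c : K) (x : 'I_s -> K) (f : 'I_3 -> 'I_s) :
  \det (colsub f (Defs.jacobian a (fun j => c * x j))) =
  (\prod_(i < 3) c ^+ i) * \det (colsub f (Defs.jacobian a x)).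
Proof.
have -> : colsub f (Defs.jacobian a (fun j => c * x j)) =
    diag_mx (\row_(i < 3) c ^+ i) *m colsub f (Defs.jacobian a x).
  apply/matrixP => i j; rewrite mul_diag_mx !mxE exprMn; ring.
by rewrite det_mulmx det_diag; congr (_ * _); apply: eq_bigr => i _; rewrite mxE.
Qed.

Lemma phi_morph (K L : comPzRingType) (g : {rmorphism K -> L}) (x : 'I_s -> K) i :
  phi a i (fun j => g (x j)) = g (phi a i x).
Proof.
rewrite /phi rmorph_sum; apply: eq_bigr => j _.
by rewrite rmorphM rmorphXn rmorph_int.
Qed.

Lemma minor_morph (K L : comPzRingType) (g : {rmorphism K -> L}) (x : 'I_s -> K) (f : 'I_3 -> 'I_s) :
  \det (colsub f (Defs.jacobian a (fun j => g (x j)))) = g (\det (colsub f (Defs.jacobian a x))).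
Proof.
rewrite -det_map_mx; congr (\det _); apply/matrixP => i j.
by rewrite !mxE !rmorphM rmorphXn rmorph_int rmorph_nat.
Qed.

Section Residues.
Variables (p : nat) (pp : prime p) (m : nat).
Local Notation Zp := (padic_int pp).

(** [z] represents [x] modulo p^m. The relation respects ring operations, so the forms and minors of
    a p-adic point can be computed on integer representatives. *)
Definition res_rel (x : Zp) (z : int) : Prop := ((p ^ m)%N%:Z %| (residue x m)%:Z - z)%Z.

Lemma dvdz_modn_sub (d n : nat) : (d%:Z %| (n %% d)%N%:Z - n%:Z)%Z.
Proof.
apply/dvdzP; exists (- (n %/ d)%N%:Z).
have := divn_eq n d; move: (_ %/ d)%N (_ %% d)%N => u v; clear; nia.
Qed.

Lemma res_relD x y u v : res_rel x u -> res_rel y v -> res_rel (x + y) (u + v).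
Proof.
move=> xu yv; rewrite /res_rel /=.
have -> (A : int) : A - (u + v) = (A - (residue x m + residue y m)%N%:Z) + (((residue x m)%:Z - u) + ((residue y m)%:Z - v)).
  by rewrite PoszD; ring.
by apply: rpredD; [exact: dvdz_modn_sub|exact: rpredD].
Qed.

Lemma res_relM x y u v : res_rel x u -> res_rel y v -> res_rel (x * y) (u * v).
Proof.
move=> xu yv; rewrite /res_rel /=.
have -> (A : int) : A - u * v = (A - (residue x m * residue y m)%N%:Z) +
    (((residue x m)%:Z - u) * (residue y m)%:Z + u * ((residue y m)%:Z - v)).
  by rewrite PoszM; ring.
apply: rpredD; [exact: dvdz_modn_sub|apply: rpredD; [exact: dvdz_mulr|exact: dvdz_mull]].
Qed.

Lemma res_relN x u : res_rel x u -> res_rel (- x) (- u).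
Proof.
move=> xu; rewrite /res_rel /=.
have xp : (residue x m <= p ^ m)%N by rewrite -residue_id ltnW// ltn_mod expn_gt0 prime_gt0.
have -> (A : int) : A - - u = (A - (p ^ m - residue x m)%N%:Z) + ((p ^ m)%N%:Z - ((residue x m)%:Z - u)).
  by rewrite -(subzn xp); ring.
by apply: rpredD; [exact: dvdz_modn_sub|apply: rpredB; rewrite ?dvdzz].
Qed.

Lemma res_rel0 : res_rel 0 0.
Proof. by rewrite /res_rel /= mod0n subrr dvdz0. Qed.

Lemma res_rel1 : res_rel 1 1.
Proof. exact: (dvdz_modn_sub (p ^ m) 1). Qed.

Lemma res_relX x u n : res_rel x u -> res_rel (x ^+ n) (u ^+ n).
Proof. by move=> xu; elim: n => [|n IH]; [exact: res_rel1|rewrite !exprS; exact: res_relM]. Qed.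

Lemma res_rel_nat n : res_rel n%:R n%:R.
Proof. by elim: n => [|n IH]; [exact: res_rel0|rewrite !mulrS; apply: res_relD => //; exact: res_rel1]. Qed.

Lemma res_rel_int (c : int) : res_rel c%:~R c.
Proof.
case: c => n; first by rewrite -[X in res_rel _ X]intz; exact: res_rel_nat.
rewrite NegzE mulrNz; apply: res_relN; rewrite -[X in res_rel _ X]natz; exact: res_rel_nat.
Qed.

Lemma res_rel_sum (I : finType) (F : I -> Zp) (G : I -> int) :
  (forall i, res_rel (F i) (G i)) -> res_rel (\sum_i F i) (\sum_i G i).
Proof. by move=> FG; elim/big_ind2: _ => [|x u y v|i _]; [exact: res_rel0|exact: res_relD|exact: FG]. Qed.

Lemma res_rel_prod (I : finType) (F : I -> Zp) (G : I -> int) :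
  (forall i, res_rel (F i) (G i)) -> res_rel (\prod_i F i) (\prod_i G i).
Proof. by move=> FG; elim/big_ind2: _ => [|x u y v|i _]; [exact: res_rel1|exact: res_relM|exact: FG]. Qed.

Lemma res_rel_residue x : res_rel x (residue x m)%:Z.
Proof. by rewrite /res_rel subrr dvdz0. Qed.

Lemma res_rel_phi (x : 'I_s -> Zp) i : res_rel (phi a i x) (phi a i (fun j => (residue (x j) m)%:Z)).
Proof.
apply: res_rel_sum => j; apply: res_relM; first by rewrite intz; exact: res_rel_int.
exact/res_relX/res_rel_residue.
Qed.

Lemma res_rel_minor (x : 'I_s -> Zp) (f : 'I_3 -> 'I_s) :
  res_rel (\det (colsub f (Defs.jacobian a x))) (\det (colsub f (Defs.jacobian a (fun j => (residue (x j) m)%:Z)))).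
Proof.
apply: res_rel_sum => g; apply: res_relM.
  by case: (perm.odd_perm g); rewrite ?expr1 ?expr0; [apply/res_relN|]; exact: res_rel1.
apply: res_rel_prod => i; rewrite !mxE; apply: res_relM; last exact/res_relX/res_rel_residue.
by apply: res_relM; [exact: res_rel_nat|rewrite intz; exact: res_rel_int].
Qed.

Lemma res_rel_dvd x z k : (k <= m)%N -> res_rel x z -> ((p ^ k)%N%:Z %| z)%Z = (residue x k == 0)%N.
Proof.
move=> km xz; have {}xz : ((p ^ k)%N%:Z %| (residue x m)%:Z - z)%Z.
  by apply: dvdz_trans xz; rewrite dvdzE !absz_nat dvdn_exp2l.
by rewrite -(ndvdz_congr xz) dvdzE !absz_nat /dvdn (residue_mod x km).
Qed.

End Residues.

(** Each form is homogeneous and each minor only changes by a power of the scaling factor, so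
    denominators can be cleared. A non-zero minor has a finite valuation k, and truncation at
    p^(2k+1) keeps both the vanishing of the forms and this valuation. *)
Theorem padic_lift (p : nat) (pp : prime p) :
  (exists x : 'I_s -> padic pp, nonsingular_solution a x) ->
  exists k (x : 'I_s -> int) (f : 'I_3 -> 'I_s),
  [/\ forall i, ((p ^ (2 * k + 1))%N%:Z %| phi a i x)%Z,
  ((p ^ k)%N%:Z %| \det (colsub f (Defs.jacobian a x)))%Z &
  ~~ ((p ^ k.+1)%N%:Z %| \det (colsub f (Defs.jacobian a x)))%Z].
Proof.
case=> xi [sol rk]; have [f df] := nonsingular_minor rk.
have [n [d [d0 nd]]] := common_denominator xi.
have nE : (fun j => FracField.tofrac d * xi j) = (fun j => FracField.tofrac (n j)) by apply/funext.
have n0 i : phi a i n = 0.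
  apply/eqP; rewrite -tofrac_eq0 -phi_morph -nE phi_scale sol mulr0; exact: eqxx.
have D0 : \det (colsub f (Defs.jacobian a n)) != 0.
  rewrite -tofrac_eq0 -minor_morph -nE minor_scale mulf_neq0//.
  by apply/prodf_neq0 => i _; rewrite expf_neq0// tofrac_eq0.
set D := \det _ in D0.
have [N ND] : exists N, residue D N != 0%N.
  apply: contrapT => /forallNP H; case/negP: D0; apply/eqP/padic_int_eq => N /=.
  by rewrite mod0n; apply/eqP/negPn/negP/H.
(* The least exponent with non-zero residue is one more than the valuation. *)
have [k kD kmin] := ex_minnP (ex_intro (fun N => residue D N != 0%N) N ND).
case: k => [|k] in kD kmin.
  by case/negP: kD; rewrite -residue_id expn0 modn1.
have Dk : residue D k = 0%N.
  by apply/eqP/negPn/negP => /kmin; rewrite ltnn.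
exists k, (fun j => (residue (n j) (2 * k + 1))%:Z), f; split.
- move=> i; rewrite (res_rel_dvd (leqnn _) (res_rel_phi _ n i)) n0 /=; by rewrite mod0n.
- by rewrite (res_rel_dvd _ (res_rel_minor _ n f)) ?Dk//; clear; lia.
- by rewrite (res_rel_dvd _ (res_rel_minor _ n f))//; clear; lia.
Qed.

End Forms.

(** * Solutions modulo a large prime *)

Section PrimeSums.
Variables (R : realType) (p : nat).
Hypothesis pp : prime p.
Local Notation grid := {ffun 'I_3 -> 'I_p}.
Let p0 : (0 < p)%N := prime_gt0 pp.
Let p0' : 0 < p%:R :> R. Proof. by rewrite ltr0n. Qed.
Let p1 : 1 <= p%:R :> R. Proof. by rewrite ler1n. Qed.

Definition ez (m : int) : R[i] := e (m%:~R / p%:R).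

Lemma ezD m n : ez (m + n) = ez m * ez n.
Proof. by rewrite /ez intrD mulrDl eD. Qed.

Lemma ezN m : ez (- m) = (ez m)^*%C.
Proof. by rewrite /ez rmorphN mulNr eN. Qed.

Lemma ez_congr m n : (p%:Z %| m - n)%Z -> ez m = ez n.
Proof.
move=> /dvdzP[k kE]; have -> : m = n + k * p%:Z by rewrite -kE; ring.
rewrite ezD /ez intrM -!pmulrn mulfK ?gt_eqF//.
by rewrite -[X in _ * X]/(e k%:~R) e_int mulr1.
Qed.

Lemma nm_ez m : nm (ez m) = 1. Proof. exact: nm_e. Qed.

Lemma sum_ez m : \sum_(k < p) ez (m * (k : nat)%:Z) = if (p%:Z %| m)%Z then p%:R else 0.
Proof.
rewrite -(sum_root_unity R p0 m); apply: eq_bigr => k _.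
by rewrite /ez intrM -pmulrn mulrA.
Qed.

Lemma sum_shift (V : nmodType) (F : int -> V) (h : int) :
  (forall m n, (p%:Z %| m - n)%Z -> F m = F n) ->
  \sum_(k < p) F ((k : nat)%:Z + h) = \sum_(k < p) F (k : nat)%:Z.
Proof.
move=> Fp; pose g (k : 'I_p) := residue_ord p0 ((k : nat)%:Z + h).
have gE k : (p%:Z %| (g k : nat)%:Z - ((k : nat)%:Z + h))%Z.
  have [n e] := residue_ordE p0 ((k : nat)%:Z + h); apply/dvdzP; exists (- n).
  by rewrite [X in _ - X = _]e /g; ring.
have gi : injective g.
  move=> k l kl; apply/val_inj; apply: (@dvdz_lt_eq p) (ltn_ord _) (ltn_ord _) _.
  by have := rpredB (gE l) (gE k); rewrite kl; apply: dvdz_congr; ring.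
rewrite [RHS](reindex_inj gi); apply: eq_bigr => k _; apply: Fp.
by rewrite -rpredN opprB; exact: gE.
Qed.

Lemma autocorrelation (F : int -> R[i]) : (forall m n, (p%:Z %| m - n)%Z -> F m = F n) ->
  (nm (\sum_(k < p) F (k : nat)%:Z) ^+ 2)%:C%C =
  \sum_(h < p) \sum_(x < p) F ((x : nat)%:Z + (h : nat)%:Z) * (F (x : nat)%:Z)^*%C.
Proof.
move=> Fp; rewrite nm_sqr exchange_big /= rmorph_sum /= mulr_sumr; apply: eq_bigr => x _.
rewrite -mulr_suml; congr (_ * _); rewrite -(sum_shift (x : nat)%:Z Fp).
by apply: eq_bigr => h _; rewrite addrC.
Qed.

Definition cubic (c : 'I_3 -> int) (x : int) : int := \sum_i c i * x ^+ i.+1.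

Lemma cubicE c x :
  cubic c x = c ord0 * x + c (lift ord0 ord0) * x ^+ 2 + c (lift ord0 (lift ord0 ord0)) * x ^+ 3.
Proof. by rewrite /cubic !big_ord_recl big_ord0 /= addr0 addrA expr1. Qed.

Lemma cubic_periodic c m n : (p%:Z %| m - n)%Z -> ez (cubic c m) = ez (cubic c n).
Proof.
move=> mn; apply: ez_congr; rewrite /cubic -sumrB.
elim/big_ind: _ => [|u w|i _]; [exact: dvdz0|exact: rpredD|].
by rewrite -mulrBr dvdz_mull// subrXX dvdz_mulr.
Qed.

Definition csum (c : 'I_3 -> int) : R[i] := \sum_(x < p) ez (cubic c (x : nat)%:Z).

Lemma csum_congr c c' : (forall i, (p%:Z %| c i - c' i)%Z) -> csum c = csum c'.
Proof.
move=> cc; apply: eq_bigr => x _; apply: ez_congr; rewrite /cubic -sumrB.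
elim/big_ind: _ => [|u w|i _]; [exact: dvdz0|exact: rpredD|].
by rewrite -mulrBl dvdz_mulr.
Qed.

Hypothesis p5 : (5 <= p)%N.

Lemma prime_ndvdzM (u v : int) : ~~ (p%:Z %| u)%Z -> (p%:Z %| u * v)%Z -> (p%:Z %| v)%Z.
Proof.
by rewrite !dvdzE !absz_nat abszM Euclid_dvdM// => /negbTE ->.
Qed.

Lemma small_ndvdz (n : nat) : (0 < n < 5)%N -> ~~ (p%:Z %| n%:Z)%Z.
Proof.
move=> /andP[n0 n5]; rewrite dvdzE !absz_nat; apply/negP => /dvdn_leq -/(_ n0).
by rewrite leqNgt (leq_trans n5).
Qed.

Lemma ord_dvdz (h : 'I_p) : (p%:Z %| (h : nat)%:Z)%Z = (h == Ordinal p0).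
Proof.
apply/idP/eqP => [|->]; last exact: dvdz0.
by rewrite dvdzE !absz_nat /dvdn modn_small// => /eqP h0; apply/val_inj.
Qed.

Lemma quadratic_sum (u v : int) : ~~ (p%:Z %| u)%Z ->
  nm (\sum_(x < p) ez (u * (x : nat)%:Z ^+ 2 + v * (x : nat)%:Z)) ^+ 2 = p%:R.
Proof.
move=> pu; apply: (@complexI R).
rewrite (autocorrelation (F := fun x => ez (u * x ^+ 2 + v * x))); last first.
  move=> m n mn; apply: ez_congr.
  have -> : u * m ^+ 2 + v * m - (u * n ^+ 2 + v * n) = (m - n) * (u * (m + n) + v) by ring.
  exact: dvdz_mulr.
rewrite (bigD1 (Ordinal p0))//= [X in _ + X]big1 ?addr0.
  rewrite (eq_bigr (fun=> 1)) ?sumr_const ?card_ord ?rmorph_nat// => x _.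
  by rewrite addr0 -[X in _ * X]/((ez _)^*%C) -ezN -ezD subrr /ez mul0r e0.
move=> h h0.
transitivity (ez (u * (h : nat)%:Z ^+ 2 + v * (h : nat)%:Z) * \sum_(x < p) ez ((2 * u * (h : nat)%:Z) * (x : nat)%:Z)).
  by rewrite mulr_sumr; apply: eq_bigr => x _; rewrite -[X in _ * X = _]/((ez _)^*%C) -ezN -!ezD; congr ez; ring.
rewrite sum_ez ifF ?mulr0//; apply/negP => H.
have := prime_ndvdzM pu (v := 2 * (h : nat)%:Z); rewrite mulrCA mulrA => /(_ H) /(prime_ndvdzM (@small_ndvdz 2 isT)).
by rewrite ord_dvdz (negbTE h0).
Qed.

Let r : R := Num.sqrt p%:R.
Let r2 : r ^+ 2 = p%:R. Proof. by rewrite sqr_sqrtr// ler0n. Qed.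
Let r1 : 1 <= r. Proof. by rewrite -sqrtr1 ler_wsqrtr. Qed.

(** If the cubic coefficient is a unit, one differencing leads to Gauss sums of modulus the square
    root of p. Otherwise the sum is itself a Gauss sum or a vanishing linear sum. The resulting
    exponent 3/4 of p suffices for thirteen variables. *)
Lemma csum_bound (c : 'I_3 -> int) : ~ (forall i, (p%:Z %| c i)%Z) ->
  nm (csum c) ^+ 2 <= 2 * (p%:R * Num.sqrt p%:R).
Proof.
move=> c0; rewrite -/r; have r0 : 0 < r by apply: lt_le_trans r1.
have pr : p%:R <= p%:R * r by rewrite ler_peMr// ltW.
set v := c ord0; set u := c (lift ord0 ord0); set w := c (lift ord0 (lift ord0 ord0)).
have [pw|pw] := boolP (p%:Z %| w)%Z; last first.
  have -> : nm (csum c) ^+ 2 = nm ((nm (csum c) ^+ 2)%:C%C) :> R by rewrite nm_real ger0_norm// sqr_ge0.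
  rewrite (autocorrelation (@cubic_periodic c)).
  apply: le_trans (nm_sum _ _ _) _; rewrite (bigD1 (Ordinal p0))//=.
  have -> : 2 * (p%:R * r) = p%:R * r + p%:R * r by ring.
  apply: lerD.
    apply: le_trans (nm_sum _ _ _) _; apply: le_trans pr.
    rewrite (eq_bigr (fun=> 1)) ?sumr_const ?card_ord// => x _.
    by rewrite nmM -[X in _ * nm X]/((ez _)^*%C) nm_conj !nm_ez mulr1.
  apply: (@le_trans _ _ (\sum_(h < p | h != Ordinal p0) r)); last first.
    by rewrite sumr_const -[leLHS]mulr_natl ler_pM2r// ler_nat -[leqRHS]card_ord max_card.
  apply: ler_sum => h h0.
  have -> : \sum_(x < p) ez (cubic c ((x : nat)%:Z + (h : nat)%:Z)) * (ez (cubic c (x : nat)%:Z))^*%C =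
      ez (cubic c (h : nat)%:Z) * \sum_(x < p) ez ((3 * w * (h : nat)%:Z) * (x : nat)%:Z ^+ 2 +
         (3 * w * (h : nat)%:Z ^+ 2 + 2 * u * (h : nat)%:Z) * (x : nat)%:Z).
    rewrite mulr_sumr; apply: eq_bigr => x _; rewrite -[X in _ * X = _]/((ez _)^*%C) -ezN -!ezD; congr ez.
    by rewrite !cubicE -/u -/v -/w; ring.
  rewrite nmM nm_ez mul1r -(@ler_pXn2r _ 2)// ?nnegrE ?nm_ge0 ?(ltW r0)// r2 quadratic_sum//.
  apply/negP => H; have := prime_ndvdzM pw (v := 3 * (h : nat)%:Z).
  rewrite mulrCA mulrA => /(_ H) /(prime_ndvdzM (@small_ndvdz 3 isT)).
  by rewrite ord_dvdz (negbTE h0).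
have E x : (p%:Z %| cubic c x - (u * x ^+ 2 + v * x))%Z.
  have -> : cubic c x - (u * x ^+ 2 + v * x) = w * x ^+ 3 by rewrite cubicE -/u -/v -/w; ring.
  exact: dvdz_mulr.
have -> : csum c = \sum_(x < p) ez (u * (x : nat)%:Z ^+ 2 + v * (x : nat)%:Z).
  by apply: eq_bigr => x _; apply: ez_congr; exact: E.
have pr0 : 0 <= p%:R * r by apply: le_trans pr.
have [pu|pu] := boolP (p%:Z %| u)%Z; last by rewrite quadratic_sum//; lra.
have -> : \sum_(x < p) ez (u * (x : nat)%:Z ^+ 2 + v * (x : nat)%:Z) = \sum_(x < p) ez (v * (x : nat)%:Z).
  by apply: eq_bigr => x _; apply: ez_congr; rewrite addrK dvdz_mulr.
rewrite sum_ez ifF ?nm0 ?expr0n ?mulr_ge0 ?(ltW r0)//=; apply/negP => pv; apply: c0; exact: ord3P.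
Qed.

Lemma chE (v : {ffun 'I_3 -> int}) (t : grid) : ch R v t = ez (\sum_i v i * (t i : nat)%:Z).
Proof.
rewrite /ch /ez rmorph_sum /= mulr_suml; congr e; apply: eq_bigr => i _.
by rewrite /pt rmorphM /= -pmulrn mulrA.
Qed.

Definition power_vec (z : int) : {ffun 'I_3 -> int} := [ffun i : 'I_3 => z ^+ i.+1].

Lemma csum_ch (t : grid) :
  \sum_(z < p) ch R (power_vec (z : nat)%:Z) t = csum (fun i => (t i : nat)%:Z).
Proof.
apply: eq_bigr => z _; rewrite chE; congr ez; apply: eq_bigr => i _; rewrite ffunE mulrC //.
Qed.

(* By Newton's identities, modulo a prime [p > 3] the first three power sums
   determine a multiset of three residues. *)
Lemma power_sums_root (x y : 'I_3 -> int) :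
  (forall i : 'I_3, (p%:Z %| \sum_l x l ^+ i.+1 - \sum_l y l ^+ i.+1)%Z) ->
  forall l, exists k, (p%:Z %| x l - y k)%Z.
Proof.
move=> H l.
move: (H ord0) (H (lift ord0 ord0)) (H (lift ord0 (lift ord0 ord0))).
rewrite !big_ord_recl !big_ord0 !addr0 /= {H}.
set x1 := x ord0; set x2 := x (lift ord0 ord0); set x3 := x (lift ord0 (lift ord0 ord0)).
set y1 := y ord0; set y2 := y (lift ord0 ord0); set y3 := y (lift ord0 (lift ord0 ord0)).
have xl : (x l - x1) * ((x l - x2) * (x l - x3)) = 0.
  by move: l; apply: ord3P; rewrite subrr ?mul0r ?mulr0.
move: (x l) xl => z xl D1 D2 D3.
have nd : ~~ (p%:Z %| 3 * 2)%Z.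
  by apply/negP => /(prime_ndvdzM (@small_ndvdz 3 isT)); apply/negP; exact: (@small_ndvdz 2).
have : (p%:Z %| (z - y1) * ((z - y2) * (z - y3)))%Z.
  apply: (prime_ndvdzM nd).
  have -> : 3 * 2 * ((z - y1) * ((z - y2) * (z - y3))) =
    (3 * 2 * z ^+ 2 - 3 * z * (x1 + x2 + x3 + (y1 + y2 + y3)) + ((x1 + x2 + x3) ^+ 2 +
       (x1 + x2 + x3) * (y1 + y2 + y3) + (y1 + y2 + y3) ^+ 2 - 3 * (y1 ^+ 2 + y2 ^+ 2 + y3 ^+ 2))) *
      (x1 ^+ 1 + (x2 ^+ 1 + x3 ^+ 1) - (y1 ^+ 1 + (y2 ^+ 1 + y3 ^+ 1))) +
    (3 * z - 3 * (x1 + x2 + x3)) * (x1 ^+ 2 + (x2 ^+ 2 + x3 ^+ 2) - (y1 ^+ 2 + (y2 ^+ 2 + y3 ^+ 2))) +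
    2 * (x1 ^+ 3 + (x2 ^+ 3 + x3 ^+ 3) - (y1 ^+ 3 + (y2 ^+ 3 + y3 ^+ 3))) +
    3 * 2 * ((z - x1) * ((z - x2) * (z - x3))) by ring.
  by rewrite xl mulr0 addr0; apply: rpredD; [apply: rpredD|]; exact: dvdz_mull.
have [h1|h1] := boolP (p%:Z %| z - y1)%Z; first by exists ord0.
move=> /(prime_ndvdzM h1); have [h2|h2] := boolP (p%:Z %| z - y2)%Z; first by exists (lift ord0 ord0).
by move=> /(prime_ndvdzM h2) h3; exists (lift ord0 (lift ord0 ord0)).
Qed.

(** By [power_sums_root] a solution (x, y) of the congruences is determined by y and a map of the
    three indices, which gives at most 27 p^3 pairs. *)
Lemma sixth_moment : \sum_(t : grid) nm (csum (fun i => (t i : nat)%:Z)) ^+ 6 <= 27 * p%:R ^+ 6.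
Proof.
under eq_bigr do rewrite -csum_ch.
rewrite -[6%N]/(2 * 3)%N (mean_value_count R p0 (fun z : 'I_p => power_vec (z : nat)%:Z) 3).
have -> : 27 * p%:R ^+ (2 * 3) = p%:R ^+ 3 * (27 * p ^ 3)%N%:R :> R by rewrite natrM natrX; ring.
rewrite ler_pM2l ?exprn_gt0// ler_nat.
pose g (u : {ffun 'I_3 -> 'I_3} * {ffun 'I_3 -> 'I_p}) : {ffun 'I_3 -> 'I_p} * {ffun 'I_3 -> 'I_p} :=
  ([ffun l => u.2 (u.1 l)], u.2).
apply: (@leq_trans #|[set g u | u in [set: {ffun 'I_3 -> 'I_3} * {ffun 'I_3 -> 'I_p}]%SET]|); last first.
  by apply: leq_trans (leq_imset_card _ _) _; rewrite cardsT card_prod !card_ffun !card_ord.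
apply/subset_leq_card/fintype.subsetP => -[x y]; rewrite inE => /forallP H.
have H' (i : 'I_3) : (p%:Z %| \sum_l ((x l : nat)%:Z) ^+ i.+1 - \sum_l ((y l : nat)%:Z) ^+ i.+1)%Z.
  have := H i; rewrite !ffunE !sum_ffunE /=; apply: dvdz_congr.
  by congr (_ - _); apply: eq_bigr => l _; rewrite ffunE.
have /choice[k kP] := power_sums_root H'.
apply/imsetP; exists ([ffun l => k l], y); rewrite ?in_setT// /g /=; congr (_, _).
apply/ffunP => l; rewrite !ffunE; apply/val_inj/(@dvdz_lt_eq p); [exact: ltn_ord|exact: ltn_ord|exact: kP].
Qed.

End PrimeSums.

(** * The number of solutions modulo p *)

Section CountModPrime.
Variables (R : realType) (s : nat) (a : 'M[int]_(3, s)) (p : nat).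
Hypothesis pp : prime p.
Hypothesis p5 : (5 <= p)%N.
Hypothesis pa : forall i j, ~~ (p%:Z %| a i j)%Z.
Hypothesis s13 : (13 <= s)%N.
Local Notation grid := {ffun 'I_3 -> 'I_p}.
Let p0 : (0 < p)%N := prime_gt0 pp.
Let p0' : 0 < p%:R :> R. Proof. by rewrite ltr0n. Qed.
Let p1 : 1 <= p%:R :> R. Proof. by rewrite ler1n. Qed.

Lemma prod_le_power (y : 'I_s -> R) (Y : R) : (forall j, 0 <= y j <= Y) ->
  \prod_j y j <= Y ^+ (s - 6) * \sum_j y j ^+ 6.
Proof.
move=> yY; have s0 : (0 < s)%N by apply: leq_trans s13.
have y0 j : 0 <= y j by have /andP[] := yY j.
pose j0 := [arg max_(j > Ordinal s0) y j]%O.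
have jm j : y j <= y j0.
  by rewrite /j0; case: arg_maxP => // k _ H; exact: H.
apply: (@le_trans _ _ (y j0 ^+ s)).
  by rewrite -[X in _ ^+ X](card_ord s) -prodr_const; apply: ler_prod => j _; rewrite y0 jm.
have {1}-> : s = (s - 6 + 6)%N by rewrite subnK// (leq_trans _ s13).
rewrite exprD; apply: ler_pM; rewrite ?exprn_ge0//.
  by apply: lerXn2r; rewrite ?nnegrE//; [apply: le_trans (y0 j0) _|]; have /andP[] := yY j0.
by rewrite (bigD1 j0)//= lerDl sumr_ge0// => j _; rewrite exprn_ge0.
Qed.

Definition twist (j : 'I_s) (t : grid) : 'I_3 -> int := fun i => a i j * (t i : nat)%:Z.

Lemma twist_moment j : \sum_(t : grid) nm (csum R p (twist j t)) ^+ 6 <= 27 * p%:R ^+ 6.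
Proof.
apply: le_trans (sixth_moment R pp p5).
pose g (t : grid) : grid := [ffun i => residue_ord p0 (twist j t i)].
have gE t i : (p%:Z %| (g t i : nat)%:Z - twist j t i)%Z.
  have [n e] := residue_ordE p0 (twist j t i); apply/dvdzP; exists (- n).
  by rewrite [X in _ - X = _]e ffunE; ring.
have gi : injective g.
  move=> t u tu; apply/ffunP => i; apply/val_inj; apply: (@dvdz_lt_eq p) (ltn_ord _) (ltn_ord _) _.
  apply: (prime_ndvdzM pp (pa i j)).
  by have := rpredB (gE u i) (gE t i); rewrite tu /twist; apply: dvdz_congr; ring.
rewrite [leRHS](reindex_inj gi) le_eqVlt; apply/orP; left; apply/eqP; apply: eq_bigr => t _.
congr (nm _ ^+ 6); apply: csum_congr => // i; rewrite -rpredN opprB; exact: gE.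
Qed.

Lemma count_mod_fourier :
  (p ^ 3 * count_mod a p)%N%:R = \sum_(t : grid) \prod_j csum R p (twist j t) :> R[i].
Proof.
rewrite natrM natrX /count_mod.
pose v (x : {ffun 'I_s -> 'I_p}) : {ffun 'I_3 -> int} := [ffun i => phi a i (fun j => (x j : nat)%:Z)].
transitivity (\sum_(t : grid) \sum_x ch R (v x) t); last first.
  apply: eq_bigr => t _.
  rewrite /csum (bigA_distr_bigA (fun (j : 'I_s) (z : 'I_p) => ez R p (cubic (twist j t) (z : nat)%:Z))).
  apply: eq_bigr => x _; rewrite chE.
  transitivity (ez R p (\sum_j cubic (twist j t) (x j : nat)%:Z)).
    congr ez; rewrite exchange_big /=; apply: eq_bigr => i _; rewrite ffunE /phi mulr_suml.
    by apply: eq_bigr => j _; rewrite /twist intz; ring.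
  elim/big_rec2: _ => [|j u u' _ <-]; first by rewrite /ez mul0r e0.
  by rewrite ezD.
rewrite (orthogonality_count R p0); congr (_ * _%:R); apply: eq_card => x; apply: eq_forallb => i.
by rewrite ffunE.
Qed.

(** The zero frequency gives p^s. For the others, six factors are averaged by the sixth moment and
    the remaining s - 6 are bounded by p^(3/4). Everything is expressed in w = p^(1/4) so that only
    integral exponents occur. *)
Theorem count_mod_prime :
  `|(count_mod a p)%:R * p%:R ^+ 3 - p%:R ^+ s| <= (2 ^+ s * (s%:R * 27)) * p%:R ^+ s / (p%:R * Num.sqrt p%:R) :> R.
Proof.
set r := Num.sqrt p%:R; set w := Num.sqrt r.
have r0 : 0 <= r := sqrtr_ge0 _.
have r2 : r ^+ 2 = p%:R by rewrite sqr_sqrtr// ler0n.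
have r1 : 1 <= r by rewrite -sqrtr1 ler_wsqrtr.
have w2 : w ^+ 2 = r by rewrite sqr_sqrtr.
have w1 : 1 <= w by rewrite -sqrtr1 ler_wsqrtr.
have w0 : 0 < w by apply: lt_le_trans w1.
have wp : w ^+ 4 = p%:R by rewrite -[4%N]/(2 * 2)%N exprM w2 r2.
pose z (j : 'I_s) t : R := nm (csum R p (twist j t)).
have zY (t : grid) : t != [ffun=> Ordinal p0] -> forall j, 0 <= z j t <= 2 * w ^+ 3.
  move=> t0 j; rewrite nm_ge0 /= -(@ler_pXn2r _ 2)// ?nnegrE ?nm_ge0 ?mulr_ge0 ?exprn_ge0 ?(ltW w0)//.
  have nt : ~ (forall i, (p%:Z %| twist j t i)%Z).
    move=> H; case/eqP: t0; apply/ffunP => i; rewrite ffunE; apply/eqP.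
    by rewrite -(ord_dvdz pp); exact: (prime_ndvdzM pp (pa i j) (H i)).
  apply: le_trans (csum_bound R pp p5 nt) _; rewrite -/r -wp -w2.
  have -> : (2 * w ^+ 3) ^+ 2 = 2 * (2 * (w ^+ 4 * w ^+ 2)) by ring.
  have := exprn_ge0 6 (ltW w0); have -> : w ^+ 6 = w ^+ 4 * w ^+ 2 by ring.
  move: (w ^+ 4 * w ^+ 2) => u; lra.
have E : ((count_mod a p)%:R * p%:R ^+ 3 - p%:R ^+ s)%:C%C =
    \sum_(t : grid | t != [ffun=> Ordinal p0]) \prod_j csum R p (twist j t) :> R[i].
  rewrite rmorphB rmorphM !rmorphXn !rmorph_nat mulrC -natrX -natrM count_mod_fourier.
  rewrite (bigD1 [ffun=> Ordinal p0])//= [X in X + _ - _](_ : _ = p%:R ^+ s); first by rewrite addrC addKr.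
  rewrite -[X in _ ^+ X](card_ord s) -prodr_const; apply: eq_bigr => j _.
  rewrite /csum (eq_bigr (fun=> 1)) ?sumr_const ?card_ord// => x _.
  rewrite /cubic big1 => [|i _]; last by rewrite /twist ffunE mulr0 mul0r.
  by rewrite /ez mul0r e0.
rewrite -nm_real E; apply: le_trans (nm_sum _ _ _) _.
apply: (@le_trans _ _ (\sum_(t : grid) (2 * w ^+ 3) ^+ (s - 6) * \sum_j z j t ^+ 6)).
  rewrite big_mkcond /=; apply: ler_sum => t _; case: ifP => [t0|_].
    rewrite nm_prod; apply: prod_le_power; exact: zY.
  apply: mulr_ge0; first by apply: exprn_ge0; apply: mulr_ge0 => //; apply: exprn_ge0; exact: ltW.
  by apply: sumr_ge0 => j _; apply: exprn_ge0; exact: nm_ge0.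
rewrite -mulr_sumr exchange_big /=.
have w3 : 0 <= 2 * w ^+ 3 by apply: mulr_ge0 => //; apply: exprn_ge0; exact: ltW.
apply: le_trans (ler_wpM2l (exprn_ge0 _ w3) (ler_sum _ (fun j _ => twist_moment j))) _.
rewrite sumr_const card_ord -[_ *+ s]mulr_natl.
have pr : p%:R * r = w ^+ 6 by rewrite -wp -w2; ring.
have pr0 : 0 < w ^+ 6 by rewrite exprn_gt0.
rewrite pr ler_pdivlMr// -wp -!exprM.
have [m sm] : exists m, s = (m + 13)%N by exists (s - 13)%N; rewrite subnK.
have -> : (s - 6 = m + 7)%N by rewrite sm; clear; lia.
rewrite exprMn -exprM.
have -> : 2 ^+ (m + 7) * w ^+ (3 * (m + 7)) * (s%:R * (27 * w ^+ (4 * 6))) * w ^+ 6 =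
   (2 ^+ (m + 7) * (s%:R * 27)) * (w ^+ (3 * (m + 7)) * w ^+ 24 * w ^+ 6) by ring.
have c0 : 0 <= s%:R * 27 :> R by rewrite mulr_ge0.
apply: ler_pM.
- by rewrite mulr_ge0// exprn_ge0.
- by apply: mulr_ge0; [apply: mulr_ge0|]; apply: exprn_ge0; exact: ltW.
- apply: ler_wpM2r => //; rewrite sm; apply: ler_weXn2l; first by lra.
  by clear; lia.
- rewrite -!exprD sm; apply: ler_weXn2l => //; clear; lia.
Qed.

End CountModPrime.

(** * Singular points and lifting from p to p^H *)

Section SingularPoints.
Variables (s : nat) (a : 'M[int]_(3, s)) (p : nat).
Hypothesis pp : prime p.
Hypothesis p5 : (5 <= p)%N.
Hypothesis pa : forall i j, ~~ (p%:Z %| a i j)%Z.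
Let p0 : (0 < p)%N := prime_gt0 pp.
Local Notation F := 'F_p.

Lemma Fp_dvdz (m : int) : (p%:Z %| m)%Z = (m%:~R == 0 :> F).
Proof.
have nE (n : nat) : (p %| n)%N = (n%:R == 0 :> F) by rewrite -(dvdn_pcharf (pchar_Fp pp)).
case: m => n; first by rewrite dvdzE !absz_nat nE.
by rewrite NegzE rmorphN oppr_eq0 rpredN dvdzE !absz_nat nE.
Qed.

Definition singular_point (x : {ffun 'I_s -> 'I_p}) :=
  `[< forall f : 'I_3 -> 'I_s, (p%:Z %| \det (colsub f (Defs.jacobian a (fun j => (x j : nat)%:Z))))%Z >].

Definition annihilated (b : 'rV[F]_3) : pred {ffun 'I_s -> 'I_p} :=
  [pred x : {ffun 'I_s -> 'I_p} |
    [forall j, \sum_i b ord0 i * ((i.+1)%:R * (a i j)%:~R * ((x j : nat)%:R) ^+ i) == 0]].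

Lemma singular_annihilated x : singular_point x -> exists2 b : 'rV[F]_3, b != 0 & annihilated b x.
Proof.
move=> /asboolP sx; set J := Defs.jacobian a (fun j => ((x j : nat)%:Z)%:~R : F).
have rJ : \rank J <> 3%N.
  move=> /nonsingular_minor[f]; rewrite /J (minor_morph a (intmul (1 : F))) -Fp_dvdz.
  by move/negP; apply; exact: sx.
have : kermx J != 0.
  rewrite kermx_eq0 /row_free; apply/eqP; exact: rJ.
move=> /rowV0Pn[b bk b0]; exists b => //; apply/forallP => j.
have /matrixP/(_ ord0 j) := sub_kermxP bk; rewrite !mxE => Hj; apply/eqP; rewrite -[RHS]Hj.
by apply: eq_bigr => i _; rewrite [J i j]mxE.
Qed.

Lemma natr_Fp_inj (u v : nat) : (u < p)%N -> (v < p)%N -> u%:R = v%:R :> F -> u = v.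
Proof.
move=> up vp uv; apply: (@dvdz_lt_eq p) => //.
by rewrite Fp_dvdz rmorphB /= -!pmulrn uv subrr.
Qed.

(** For a fixed covector the conditions decouple: each x_j is a root of a non-zero polynomial of
    degree at most 2, as neither the coefficients nor 1, 2, 3 vanish modulo p. *)
Lemma card_annihilated (b : 'rV[F]_3) : b != 0 -> (#|annihilated b| <= 2 ^ s)%N.
Proof.
move=> b0.
pose P (j : 'I_s) : {poly F} := \poly_(i < 3) (if insub i is Some k then b ord0 k * ((k : 'I_3).+1%:R * (a k j)%:~R) else 0).
have PE j (z : F) : (P j).[z] = \sum_(i < 3) b ord0 i * ((i.+1)%:R * (a i j)%:~R * z ^+ i).
  rewrite horner_poly; apply: eq_bigr => i _.
  by rewrite (insubT (fun k => (k < 3)%N) (ltn_ord i)) /= !mulrA; congr (b _ _ * _ * (a _ _)%:~R * _); apply/val_inj.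
have Pn j : P j != 0.
  apply: contraNneq b0 => P0; apply/eqP/rowP => k; rewrite mxE.
  have : (P j)`_k = 0 by rewrite P0 coef0.
  rewrite coef_poly ltn_ord (insubT (fun k => (k < 3)%N) (ltn_ord k)) /=.
  have -> : Sub (k : nat) (ltn_ord k) = k by apply/val_inj.
  move/eqP; rewrite !mulf_eq0 => /or3P[/eqP//|k1|k1]; exfalso.
    move: k1; rewrite -(dvdn_pcharf (pchar_Fp pp)) => /dvdn_leq -/(_ isT).
    by rewrite leqNgt (leq_ltn_trans (ltn_ord k))// (leq_trans _ p5).
  by move: k1; rewrite -Fp_dvdz; apply/negP.
have cr j : (#|[pred z : 'I_p | (P j).[(z : nat)%:R] == 0%R]| <= 2)%N.
  rewrite -ltnS; apply: (@leq_trans (size (P j))); last exact: size_poly.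
  rewrite cardE -(size_map (fun z : 'I_p => (z : nat)%:R : F)).
  apply: max_poly_roots => //.
    apply/allP => u /mapP[z zz ->].
    by move: zz; rewrite mem_enum.
  rewrite map_inj_uniq ?enum_uniq// => u v uv; apply/val_inj.
  exact: (natr_Fp_inj (ltn_ord u) (ltn_ord v)).
rewrite -sum1_card.
apply: (@leq_trans (\prod_(j < s) \sum_(z < p | (P j).[(z : nat)%:R] == 0%R) 1)%N); last first.
  rewrite -[X in (_ <= 2 ^ X)%N](card_ord s) -prod_nat_const; apply: leq_prod => j _.
  by rewrite sum1_card; exact: cr.
rewrite bigA_distr_big_dep /= [leqLHS]big_mkcond [leqRHS]big_mkcond /=; apply: leq_sum => x _.
case: ifP => // /forallP H; rewrite ifT ?prod_nat_const ?exp1n//.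
by apply/familyP => j; rewrite unfold_in PE; exact: H.
Qed.

Lemma card_singular : (#|[pred x | singular_point x]| <= p ^ 3 * 2 ^ s)%N.
Proof.
have cF : #|F| = p by rewrite card_Fp.
rewrite -sum1_card.
apply: (@leq_trans (\sum_(b : 'rV[F]_3 | b != 0%R) \sum_(x | annihilated b x) 1)%N).
  rewrite (exchange_big_dep predT) //=.
  rewrite [leqLHS]big_mkcond /=; apply: leq_sum => x _; case: ifP => // sx.
  have [b b0 bx] := singular_annihilated sx.
  by rewrite (bigD1 b) ?b0//=; exact: leq_addr.
apply: (@leq_trans (\sum_(b : 'rV[F]_3 | b != 0%R) 2 ^ s)%N).
  by apply: leq_sum => b b0; rewrite sum1_card; exact: card_annihilated.
rewrite sum_nat_const leq_mul2r; apply/orP; right.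
by apply: leq_trans (max_card _) _; rewrite card_mx mul1n cF.
Qed.

(** At a nonsingular point some minor is a unit, so [hensel_count] applies with k = 0. Points over
    different residues modulo p are distinct. *)
Lemma count_mod_lift H : (0 < H)%N ->
  ((count_mod a p - p ^ 3 * 2 ^ s) * p ^ (H.-1 * (s - 3)) <= count_mod a (p ^ H))%N.
Proof.
move=> H0; pose S := [pred x : {ffun 'I_s -> 'I_p} |
   [forall i, (p%:Z %| phi a i (fun j => (x j : nat)%:Z))%Z] && ~~ singular_point x].
have SS : (count_mod a p - p ^ 3 * 2 ^ s <= #|S|)%N.
  rewrite leq_subLR; apply: leq_trans (leq_add card_singular (leqnn _)).
  rewrite -cardUI; apply: leq_trans (leq_addr _ _); apply/subset_leq_card/fintype.subsetP => x.
  rewrite !inE => ->; exact: orbN.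
apply: leq_trans (leq_mul SS (leqnn _)) _.
pose red (z : {ffun 'I_s -> 'I_(p ^ H)}) : {ffun 'I_s -> 'I_p} := [ffun j => Ordinal (ltn_pmod (z j) p0)].
rewrite -sum_nat_const /count_mod -sum1_card.
rewrite (partition_big red predT)//= [leqLHS]big_mkcond /=; apply: leq_sum => x _.
case: ifP => // /andP[/forallP xsol xns].
have [f fd] : exists f : 'I_3 -> 'I_s, ~ (p%:Z %| \det (colsub f (Defs.jacobian a (fun j => (x j : nat)%:Z))))%Z.
  by apply/existsNP => K; move/asboolP: xns; apply.
have px i : ((p ^ (2 * 0 + 1))%N%:Z %| phi a i (fun j => (x j : nat)%:Z))%Z by rewrite expn1.
have := @hensel_count s a p 0 (fun j => (x j : nat)%:Z) f pp px.
rewrite expn0 expn1 dvd1z => /(_ isT) /(_ (introN idP fd)) /(_ H H0).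
rewrite subn1 => /leq_trans; apply; rewrite -sum1_card.
rewrite [leqLHS]big_mkcond [leqRHS]big_mkcond /=; apply: leq_sum => z _.
case: ifP => // /andP[z1 /forallP z2]; rewrite ifT//.
apply/andP; split; first exact: z1.
apply/eqP/ffunP => j; rewrite ffunE; apply/val_inj/(@dvdz_lt_eq p); [exact: ltn_pmod|exact: ltn_ord|].
have z2j : (p%:Z %| (z j : nat)%:Z - (x j : nat)%:Z)%Z by have := z2 j; rewrite expn1.
have := rpredD (dvdz_modn_sub p (z j)) z2j; apply: dvdz_congr => /=; ring.
Qed.

End SingularPoints.

(** * A uniform lower bound for chi *)

Section LowerBound.
Variables (R : realType) (s : nat) (a : 'M[int]_(3, s)).
Hypothesis s13 : (13 <= s)%N.
Hypothesis a0 : forall i j, a i j != 0.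
Local Notation chi := (local_density R a).

Lemma chi_mul q1 q2 : (0 < q1)%N -> (0 < q2)%N -> coprime q1 q2 -> chi (q1 * q2) = chi q1 * chi q2.
Proof.
move=> h1 h2 q12; rewrite /local_density count_mod_mul// !natrM !exprMn.
have : q1%:R ^+ s != 0 :> R by rewrite expf_neq0// pnatr_eq0 -lt0n.
have : q2%:R ^+ s != 0 :> R by rewrite expf_neq0// pnatr_eq0 -lt0n.
move: (_ ^+ s) (q1%:R ^+ s) => u v u0 v0; field; by rewrite u0 v0.
Qed.

Lemma count_mod_gt0 q : (0 < q)%N -> (0 < count_mod a q)%N.
Proof.
move=> q0; apply/card_gt0P; exists [ffun=> Ordinal q0]; apply/forallP => i.
rewrite /phi big1 ?dvdz0// => j _; by rewrite ffunE /= expr0n mulr0.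
Qed.

Lemma chi1 : chi 1 = 1.
Proof.
have -> : chi 1 = (count_mod a 1)%:R by rewrite /local_density !expr1n divr1 mulr1.
suff -> : count_mod a 1 = 1%N by [].
apply/eqP; rewrite eqn_leq count_mod_gt0// andbT.
by apply: leq_trans (max_card _) _; rewrite card_ffun !card_ord exp1n.
Qed.

(** Against p^(s-3) solutions modulo p, the loss through singular points is at most p^3 2^s, a
    relative error 2^s p^(6-s); this and the error of [count_mod_prime] are both O(p^(-3/2)). *)
Lemma chi_large : exists P0 : nat, exists2 C : R, 0 <= C & forall p H, prime p -> (P0 <= p)%N ->
  1 - C / (p%:R * Num.sqrt p%:R) <= chi (p ^ H).
Proof.
pose C1 : R := 2 ^+ s * (s%:R * 27); have C10 : 0 <= C1 by rewrite !mulr_ge0// exprn_ge0.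
have C20 : 0 <= 2 ^+ s :> R by apply: exprn_ge0.
exists (5 + \sum_i \sum_j `|a i j|)%N, (C1 + 2 ^+ s); first exact: addr_ge0.
move=> p H pp Pp; have p5 : (5 <= p)%N by apply: leq_trans Pp; exact: leq_addr.
have p0 : 0 < p%:R :> R by rewrite ltr0n prime_gt0.
have p1 : 1 <= p%:R :> R by rewrite ler1n prime_gt0.
set r := Num.sqrt p%:R; have r1 : 1 <= r by rewrite -sqrtr1 ler_wsqrtr.
have r0 : 0 < r by apply: lt_le_trans r1.
have pr0 : 0 < p%:R * r by apply: mulr_gt0.
case: H => [|H].
  by rewrite expn0 chi1 gerBl divr_ge0// ?addr_ge0// ltW.
have pa i j : ~~ (p%:Z %| a i j)%Z.
  rewrite dvdzE absz_nat; apply/negP => /dvdn_leq; rewrite absz_gt0 a0 => /(_ isT).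
  apply/negP; rewrite -ltnNge; apply: leq_trans Pp; rewrite (bigD1 i)//= (bigD1 j)//=; clear; lia.
have h1 := count_mod_lift pp p5 pa (ltn0Sn H).
have h2 := @count_mod_prime R s a p pp p5 pa s13.
rewrite -/r -/C1 in h2.
have ps0 : 0 < p%:R ^+ s :> R by rewrite exprn_gt0.
set M := (count_mod a p)%:R : R in h2.
have h3 : p%:R ^+ s * (1 - C1 / (p%:R * r)) <= M * p%:R ^+ 3.
  move: h2; rewrite ler_norml => /andP[h2 _].
  have -> : p%:R ^+ s * (1 - C1 / (p%:R * r)) = p%:R ^+ s - C1 * p%:R ^+ s / (p%:R * r) by ring.
  by move: (M * _) (C1 * _ / _) h2 => u v; lra.
have h4 : (M - p%:R ^+ 3 * 2 ^+ s) * p%:R ^+ (H * (s - 3)) <= (count_mod a (p ^ H.+1))%:R.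
  have /(@leq_trans _ _ _)/(_ (leqnn _)) := h1; rewrite -(ler_nat R) natrM natrX => /(le_trans _); apply.
  rewrite /=; apply: ler_wpM2r; first exact: exprn_ge0.
  rewrite lerBlDr -!natrX -natrM -natrD ler_nat; clear; lia.
have e1 : chi (p ^ H.+1) = (count_mod a (p ^ H.+1))%:R / p%:R ^+ (H * (s - 3)) * p%:R ^+ 3 / p%:R ^+ s.
  rewrite /local_density natrX -!exprM.
  have -> : (H.+1 * s = H * (s - 3) + H * 3 + s)%N by move: s13; clear; nia.
  have -> : (H.+1 * 3 = H * 3 + 3)%N by clear; lia.
  rewrite !exprD; move: (expf_neq0 (H * (s - 3)) (lt0r_neq0 p0)) (expf_neq0 (H * 3) (lt0r_neq0 p0)) (lt0r_neq0 ps0).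
  move: (_ ^+ (H * (s - 3))) (_ ^+ (H * 3)) (p%:R ^+ s) (p%:R ^+ 3) => u v w x u0 v0 w0.
  by field; rewrite u0 v0 w0.
rewrite e1 ler_pdivlMr//.
apply: (@le_trans _ _ ((M - p%:R ^+ 3 * 2 ^+ s) * p%:R ^+ 3)); last first.
  by rewrite ler_pM2r ?exprn_gt0// ler_pdivlMr ?exprn_gt0.
have -> : (M - p%:R ^+ 3 * 2 ^+ s) * p%:R ^+ 3 = M * p%:R ^+ 3 - 2 ^+ s * p%:R ^+ 6 by ring.
have h5 : p%:R ^+ 6 * (p%:R * r) <= p%:R ^+ s.
  have rp : r <= p%:R.
    have r2 : r ^+ 2 = p%:R by rewrite sqr_sqrtr// ltW.
    by rewrite -r2 expr2 ler_peMr// ltW.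
  apply: (@le_trans _ _ (p%:R ^+ 8)).
    have -> : p%:R ^+ 8 = p%:R ^+ 6 * (p%:R * p%:R) :> R by ring.
    by apply: ler_wpM2l; [apply: exprn_ge0; exact: ltW|rewrite ler_pM2l].
  by apply: ler_weXn2l => //; apply: leq_trans s13.
have h6 : 2 ^+ s * p%:R ^+ 6 <= p%:R ^+ s * (2 ^+ s / (p%:R * r)).
  rewrite mulrA ler_pdivlMr// [leRHS]mulrC -mulrA; exact: ler_wpM2l.
have -> : (1 - (C1 + 2 ^+ s) / (p%:R * r)) * p%:R ^+ s =
  p%:R ^+ s * (1 - C1 / (p%:R * r)) - p%:R ^+ s * (2 ^+ s / (p%:R * r)) by ring.
exact: lerB.
Qed.

Lemma chi_padic p (pp : prime p) : (exists x : 'I_s -> padic pp, nonsingular_solution a x) ->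
  exists2 c : R, 0 < c & forall H, c <= chi (p ^ H).
Proof.
move=> /padic_lift[k [x [f [px d0 d1]]]]; set b := (2 * k + 1)%N in px.
have p0 : 0 < p%:R :> R by rewrite ltr0n prime_gt0.
have p1 : 1 <= p%:R :> R by rewrite ler1n prime_gt0.
exists (p%:R ^- (b * (s - 3))); first by rewrite invr_gt0 exprn_gt0.
move=> H; rewrite /local_density natrX -!exprM.
suff h : (p ^ ((H - b) * (s - 3)) <= count_mod a (p ^ H))%N.
  rewrite ler_pdivlMr ?exprn_gt0// -(ler_pM2l (exprn_gt0 (b * (s - 3)) p0)) mulrA divff ?expf_neq0 ?gt_eqF// mul1r.
  apply: (@le_trans _ _ (p%:R ^+ (b * (s - 3)) * (p%:R ^+ ((H - b) * (s - 3)) * p%:R ^+ (H * 3)))).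
    rewrite -!exprD; apply: ler_weXn2l => //; move: s13 => /(leq_trans (isT : (3 <= 13)%N)).
    case: (leqP b H) => bH; move: bH; clear; move: b => b; nia.
  apply: ler_wpM2l; first by apply: exprn_ge0; exact: ltW.
  apply: ler_wpM2r; first by apply: exprn_ge0; exact: ltW.
  by rewrite -natrX ler_nat.
(* Below the lifting level the zero solution alone is enough, because the constant is
   p^(-b(s-3)). *)
have [bH|Hb] := leqP b H; last first.
  have -> : (H - b = 0)%N by apply/eqP; rewrite subn_eq0 ltnW.
  by rewrite mul0n expn0 count_mod_gt0// expn_gt0 prime_gt0.
apply: leq_trans (hensel_count pp px d0 d1 bH) _; apply/subset_leq_card/fintype.subsetP => z.
by move=> /andP[].
Qed.

Lemma chi_step (N : nat) (B g : R) : 0 <= B -> 0 <= g <= 1 -> (prime N -> forall H, g <= chi (N ^ H)) ->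
  (forall q, (0 < q)%N -> (forall p, p \in primes q -> (p < N)%N) -> B <= chi q) ->
  forall q, (0 < q)%N -> (forall p, p \in primes q -> (p < N.+1)%N) -> B * g <= chi q.
Proof.
move=> B0 /andP[g0 g1] gN BN q q0 qN.
have [pN|npN] := boolP (prime N); last first.
  apply: (@le_trans _ _ B); first by rewrite ler_piMr.
  apply: BN => // p pq; have := qN _ pq; rewrite ltnS leq_eqVlt => /predU1P[pE|//].
  by move: pq npN; rewrite mem_primes pE => /andP[->].
rewrite -(partnC N q0) chi_mul ?part_gt0 ?coprime_partC// mulrC; apply: ler_pM => //.
  by rewrite p_part; exact: gN.
apply: BN; rewrite ?part_gt0// => p; rewrite primes_part mem_filter => /andP[pN' pq].
have := qN _ pq; rewrite ltnS leq_eqVlt => /predU1P[pE|//].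
by move: pN'; rewrite pE !inE eqxx.
Qed.

(** A bound for all moduli with prime factors below N is extended to N + 1 by splitting off the
    N-part. Finitely many primes are treated by [chi_padic], the others by [chi_large]. *)
Theorem chi_lower : (forall (p : nat) (pp : prime p), exists x : 'I_s -> padic pp, nonsingular_solution a x) ->
  exists2 c : R, 0 < c & forall q, (0 < q)%N -> c <= chi q.
Proof.
move=> padic_ns.
have /choice[c cP] (p : nat) : exists c : R, (0 < c <= 1) /\ (prime p -> forall H, c <= chi (p ^ H)).
  have [pp|np] := boolP (prime p); last by exists 1; rewrite ltr01 lexx.
  have [c c0 cH] := chi_padic (padic_ns p pp); exists (Num.min c 1).
  rewrite lt_min c0 ltr01 ge_min lexx orbT; split => // _ H.
  by rewrite ge_min cH.
have [P0 [C C0 large]] := chi_large; pose K := 6 * C; have K0 : 0 <= K by rewrite mulr_ge0.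
pose P1 := maxn P0 (Num.truncn (4 * K ^+ 2 + 4 * C + 1)).+1.
have P1_gt0 : (0 < P1)%N by rewrite leq_max orbT.
have P1K (N : nat) : (P1 <= N)%N -> 4 * K ^+ 2 + 4 * C + 1 <= N%:R.
  move=> PN; apply: le_trans (ltW (truncnS_gt _)) _; rewrite ler_nat; apply: leq_trans PN; exact: leq_maxr.
pose A := \prod_(p < P1) c p.
have c01 p : 0 < c p <= 1 by have [] := cP p.
have Apos N : 0 < \prod_(p < N) c p by apply: prodr_gt0 => p _; have /andP[] := c01 p.
have small N : forall q, (0 < q)%N -> (forall p, p \in primes q -> (p < N)%N) -> \prod_(p < N) c p <= chi q.
  elim: N => [|N IH] q q0 qN.
    rewrite big_ord0; have -> : q = 1%N; last by rewrite chi1.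
    apply/eqP; rewrite eqn_leq q0 andbT leqNgt; apply/negP => q1.
    by have := qN (pdiv q); rewrite mem_primes pdiv_prime// q0 pdiv_dvd => /(_ isT).
  rewrite big_ord_recr /=; have cN : 0 <= c N <= 1 by have /andP[/ltW -> ->] := c01 N.
  exact: (chi_step (ltW (Apos N)) cN (cP N).2 IH).
(* The convergent product of the factors 1 - C N^(-3/2) is replaced by an invariant: 1/2 + K / sqrt
   N decreases from N to N + 1 by at least C N^(-3/2). The choice K = 6 C rests on t (t + r) <= 6
   r^2 for t <= 2r, where r and t are consecutive square roots. *)
have big d : forall q, (0 < q)%N -> (forall p, p \in primes q -> (p < P1 + d)%N) ->
    A * (1 / 2 + K / Num.sqrt (P1 + d)%:R) <= chi q.
  have sq (N : nat) : (P1 <= N)%N -> [/\ 1 <= N%:R :> R, 1 <= Num.sqrt N%:R :> R, Num.sqrt N%:R ^+ 2 = N%:R :> R &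
      2 * K <= Num.sqrt N%:R].
    move=> PN; have N1 : 1 <= N%:R :> R by rewrite ler1n (leq_trans P1_gt0).
    have N0 : 0 <= N%:R :> R by [].
    have S1 : 1 <= Num.sqrt N%:R :> R by rewrite -[leLHS]sqrtr1; apply: ler_wsqrtr.
    have S2 : Num.sqrt N%:R ^+ 2 = N%:R :> R by rewrite sqr_sqrtr.
    split => //; rewrite -[leLHS]ger0_norm ?mulr_ge0// -sqrtr_sqr ler_wsqrtr//; apply: le_trans (P1K _ PN).
    have -> : (2 * K) ^+ 2 = 4 * K ^+ 2 by ring.
    by have := sqr_ge0 K; move: (K ^+ 2) => u; lra.
  elim: d => [|d IH] q q0 qN.
    have [N1 r1 r2 Kr] := sq _ (leqnn P1); rewrite addn0.
    apply: le_trans (small P1 q q0 _); last by move=> p /qN; rewrite addn0.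
    rewrite -/A ler_piMr ?(ltW (Apos _))//.
    have : K / Num.sqrt P1%:R <= 1 / 2 by rewrite ler_pdivrMr ?(lt_le_trans ltr01)//; lra.
    by lra.
  set N := (P1 + d)%N in IH; have PN : (P1 <= N)%N by exact: leq_addr.
  have [N1 r1 r2 Kr] := sq N PN; have [M1 t1 t2 Kt] := sq N.+1 (leqW PN).
  rewrite addnS -/N in qN *.
  set r := Num.sqrt N%:R in r1 r2 Kr IH *; set t := Num.sqrt N.+1%:R in t1 t2 Kt *.
  have r0 : 0 < r by apply: lt_le_trans r1.
  have t0 : 0 < t by apply: lt_le_trans t1.
  have Nr1 : 1 <= N%:R * r by exact: mulr_ege1.
  have Nr0 : 0 < N%:R * r by apply: lt_le_trans Nr1.
  pose g := 1 - C / (N%:R * r).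
  have gb : 0 <= g <= 1.
    rewrite /g gerBl divr_ge0 ?(ltW Nr0)// subr_ge0 ler_pdivrMr// mul1r andbT.
    apply: (@le_trans _ _ N%:R); last by rewrite ler_peMr// (le_trans ler01).
    by apply: le_trans (P1K _ PN); have := sqr_ge0 K; move: (K ^+ 2) => u; lra.
  have B0 : 0 <= A * (1 / 2 + K / r).
    by apply: mulr_ge0; [exact: ltW (Apos _)|apply: addr_ge0 => //; rewrite divr_ge0// ltW].
  have := @chi_step N _ g B0 gb _ IH q q0 qN.
  move=> H; apply: le_trans (H _); last first.
    move=> pN h; apply: large => //; apply: leq_trans PN; exact: leq_maxl.
  rewrite -mulrA ler_pM2l ?Apos//.
  have Kr1 : K / r <= 1 / 2 by rewrite ler_pdivrMr//; lra.
  have key : K / t <= K / r - C / (N%:R * r).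
    have -> : K / r - C / (N%:R * r) = (K - C / r ^+ 2) / r.
      by rewrite -r2; field; rewrite gt_eqF.
    have tr : r <= t by rewrite ler_wsqrtr// ler_nat.
    have tr2 : t ^+ 2 = r ^+ 2 + 1 by rewrite t2 r2 natr1.
    have t2r : t <= 2 * r.
      rewrite -(@ler_pXn2r _ 2)// ?nnegrE ?mulr_ge0 ?(ltW r0) ?(ltW t0)// tr2.
      have -> : (2 * r) ^+ 2 = 4 * r ^+ 2 by ring.
      by rewrite r2; lra.
    rewrite ler_pdivrMr// mulrAC ler_pdivlMr//.
    have -> : (K - C / r ^+ 2) * t = K * t - C * (t / r ^+ 2) by ring.
    rewrite lerBrDl -lerBrDr -mulrBr.
    have e : t - r = 1 / (t + r).
      have tr0 : t + r != 0 by rewrite gt_eqF ?addr_gt0.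
      by apply: (mulIf tr0); rewrite divfK//; move: tr2; rewrite !expr2 => ?; lra.
    rewrite e; have -> : K * (1 / (t + r)) = C * (6 / (t + r)) by rewrite /K; ring.
    apply: ler_wpM2l => //; have r20 : 0 < r ^+ 2 by rewrite exprn_gt0.
    rewrite ler_pdivrMr// mulrAC ler_pdivlMr ?addr_gt0//.
    have h1 : t * t <= 2 * r * t by rewrite ler_pM2r.
    have h2 : r * t <= r * (2 * r) by rewrite ler_pM2l.
    by rewrite mulrDr expr2; lra.
  have /andP[g0 g1] := gb.
  have C1 : 0 <= C / (N%:R * r) by rewrite divr_ge0// ltW.
  have : (1 / 2 + K / r) * (C / (N%:R * r)) <= 1 * (C / (N%:R * r)) by apply: ler_wpM2r => //; lra.
  by rewrite /g; move: (C / _) (K / r) (K / t) key => u v w; lra.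
exists (A * (1 / 2)); first by apply: mulr_gt0; [exact: Apos|lra].
move=> q q0; apply: le_trans (big q q q0 _); last first.
  move=> p; rewrite mem_primes => /and3P[_ _ /dvdn_leq -/(_ q0) pq].
  by move: P1_gt0 pq; clear; lia.
rewrite ler_pM2l ?Apos// lerDl divr_ge0//; exact: sqrtr_ge0.
Qed.

End LowerBound.

From mathcomp Require Import all_classical all_reals all_analysis.
From mathcomp Require Import measurable_realfun.

Import numFieldNormedType.Exports.

Local Open Scope classical_set_scope.
Local Open Scope ring_scope.

(** * Riemann sums over the cube *)

Lemma sum_residue_class (V : nmodType) (G : nat -> V) (N q r M : nat) : (r < q)%N ->
  (forall k, (k <= M)%N = (r + q * k < N)%N) ->
  \sum_(x < N | (x %% q == r)%N) G x = \sum_(k < M.+1) G (r + q * k)%N.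
Proof.
move=> rq HM; have q0 : (0 < q)%N by apply: leq_ltn_trans rq.
have NqN : (N <= q * N)%N by rewrite leq_pmull.
have MN : (M.+1 <= N)%N.
  have : (r + q * M < N)%N by rewrite -HM.
  by move: q0; clear; nia.
rewrite (big_ord_widen_cond (q * N)%N (fun x => (x %% q == r)%N) G)// big_mkcond /=.
rewrite (sum_ord_mul q N (fun x => if (x %% q == r)%N && (x < N)%N then G x else 0)).
have E w z : ((w + q * z) %% q = w %% q)%N by rewrite addnC mulnC modnMDl.
rewrite (bigD1 (Ordinal rq))//= [X in _ + X]big1 ?addr0; last first.
  move=> w wr; rewrite big1// => z _; rewrite E modn_small ?ltn_ord//.
  by rewrite -[(w == r :> nat)%N]/(w == Ordinal rq) (negbTE wr).
rewrite [RHS](big_ord_widen N (fun k => G (r + q * k)%N))// [RHS]big_mkcond /=.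
by apply: eq_bigr => z _; rewrite E modn_small// eqxx /= ltnS HM.
Qed.

Section OneDim.
Variable R : realType.
Local Notation mu := (@lebesgue_measure R).
Variables (h : R -> R) (A K : R).
Hypothesis mh : measurable_fun setT h.
Hypothesis hA : forall x, -1 <= x <= 1 -> `|h x| <= A.

Lemma integrable_unit : mu.-integrable `[-1, 1] (EFin \o h).
Proof.
have fin : (mu `[(-1)%R, 1%R] < +oo)%E by rewrite lebesgue_measure_itv /= lte_fin ifT -?EFinB ?ltry//; lra.
apply: measurable_bounded_integrable => //.
- exact: measurable_funTS.
- exists A; split; first exact: num_real.
  by move=> y Ay x /=; rewrite in_itv /= => x1; apply: le_trans (hA x1) (ltW Ay).
Qed.

Lemma integrable_sub (i : interval R) : [set` i] `<=` `[-1, 1] -> mu.-integrable [set` i] (EFin \o h).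
Proof. by move=> i1; apply: integrableS integrable_unit. Qed.

Lemma Rintegral_cell (u v c M : R) : -1 <= u -> u <= v -> v <= 1 ->
  (forall x, u < x <= v -> `|h x - c| <= M) ->
  `|\int[mu]_(t in `]u, v]) h t - c * (v - u)| <= M * (v - u).
Proof.
move=> u1 uv v1 H.
have muE : fine (mu `]u, v]) = v - u.
  rewrite lebesgue_measure_itv /= lte_fin; case: ltP => //= vu.
  by apply/eqP; rewrite eq_sym subr_eq0 eq_le uv vu.
have sub : `]u, v] `<=` `[-1, 1].
  by move=> x /=; rewrite !in_itv /=; lra.
have ih := integrable_sub sub.
have finmu : (mu `]u, v] < +oo)%E.
  by rewrite lebesgue_measure_itv /=; case: ifP => _; rewrite ?ltry// -EFinB ltry.
have ic (z : R) : mu.-integrable `]u, v] (EFin \o cst z).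
  by apply: measurable_bounded_integrable => //; exists `|z|; split=> // y zy x _ /=; exact: ltW.
have -> : c * (v - u) = \int[mu]_(t in `]u, v]) cst c t by rewrite Rintegral_cst// muE.
rewrite -RintegralB//; apply: le_trans (le_normr_Rintegral _ _) _ => //.
  exact: (integrableB _ ih (ic c)).
have -> : M * (v - u) = \int[mu]_(t in `]u, v]) cst M t by rewrite Rintegral_cst// muE.
apply: le_Rintegral => //.
  by apply: (integrable_norm (integrableB _ ih (ic c))).
Qed.

Lemma Rintegral_antideriv (u v : R) : -1 <= u -> u <= v -> v <= 1 ->
  \int[mu]_(t in `]-1, v]) h t - \int[mu]_(t in `]-1, u]) h t = \int[mu]_(t in `]u, v]) h t.
Proof.
move=> u1 uv v1; rewrite Rintegral_itvB ?bnd_simp//.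
by apply: integrable_sub => x /=; rewrite !in_itv /=; lra.
Qed.

Hypothesis hK : forall x y, -1 <= x <= 1 -> -1 <= y <= 1 -> `|h x - h y| <= K * `|x - y|.

Lemma riemann_sum1 (n q r : nat) : (0 < n)%N -> (r < q)%N ->
  `|\int[mu]_(t in `[-1, 1]) h t -
    q%:R / n%:R * \sum_(x < (2 * n).+1 | (x %% q == r)%N) h ((x%:R - n%:R) / n%:R)|
  <= (2 * K + 4 * A) * q%:R * (q%:R / n%:R).
Proof.
move=> n0 rq; have n0' : 0 < n%:R :> R by rewrite ltr0n.
have q0 : (0 < q)%N by apply: leq_ltn_trans rq.
have q1 : 1 <= q%:R :> R by rewrite ler1n.
have A0 : 0 <= A by apply: le_trans (hA (x := 0) _); rewrite ?lexx//; lra.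
have K0 : 0 <= K.
  have := @hK 1 0; rewrite subr0 normr1 mulr1 => H.
  by apply: le_trans (H _ _); rewrite ?normr_ge0//; lra.
set d := q%:R / n%:R; have d0 : 0 < d by rewrite divr_gt0// ltr0n.
have <- : \int[mu]_(t in `]-1, 1]) h t = \int[mu]_(t in `[-1, 1]) h t.
  rewrite Rintegral_itv_obnd_cbnd//.
  by apply: integrable_sub => x /=; rewrite !in_itv /=; lra.
pose F u := \int[mu]_(t in `]-1, u]) h t.
have Fcell u v : -1 <= u -> u <= v -> v <= 1 -> `|F v - F u - h v * (v - u)| <= K * (v - u) * (v - u).
  move=> u1 uv v1; rewrite /F Rintegral_antideriv//; apply: Rintegral_cell => // x /andP[ux xv].
  apply: le_trans (hK _ _) _; [lra|lra|]; rewrite ler_wpM2l// distrC ger0_norm; lra.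
have Fsmall u v : -1 <= u -> u <= v -> v <= 1 -> `|F v - F u| <= A * (v - u).
  move=> u1 uv v1; rewrite /F Rintegral_antideriv//.
  have := @Rintegral_cell u v 0 A u1 uv v1; rewrite mul0r subr0; apply=> x /andP[ux xv].
  by rewrite subr0; apply: hA; lra.
have F1 : F (-1) = 0.
  by rewrite /F /Rintegral set_itv_ge ?bnd_simp ?ltxx// integral_set0.
pose p k : R := ((r + q * k)%N%:R - n%:R) / n%:R.
have pS k : p k.+1 - p k = d by rewrite /p /d mulnS !natrD; field; rewrite gt_eqF.
have pd k : p k.+1 = p k + d by rewrite -(pS k); ring.
have p1 k : -1 <= p k by rewrite /p ler_pdivlMr// mulN1r lerBrDr addNr.
(* If r > 2n the class contains no sample point; but then the mesh is at least 2, and the trivial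
   bound for the integral is within the error. *)
have [rn|rn] := leqP r (2 * n); last first.
  rewrite big1 => [|x /eqP xr]; last first.
    by have := leq_mod x q; have := ltn_ord x; rewrite xr; move: rn; clear; lia.
  rewrite mulr0 subr0; have := Fsmall (-1) 1; rewrite F1 subr0 => /(_ _ _ _) H.
  apply: le_trans (H _ _ _) _; rewrite ?lexx//; try lra.
  have : 2 <= q%:R / n%:R :> R.
    by rewrite ler_pdivlMr// -natrM ler_nat ltnW// (ltn_trans rn).
  rewrite -/d => d2; have : 0 <= K * q%:R * d by rewrite !mulr_ge0// ltW.
  have : A * 2 <= A * (q%:R * d).
    by rewrite ler_wpM2l//; apply: le_trans d2 _; rewrite ler_peMl// ltW.
  have : 0 <= A * (q%:R * d) by rewrite !mulr_ge0// ltW.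
  lra.
pose M := ((2 * n - r) %/ q)%N.
have HM k : (k <= M)%N = (r + q * k < (2 * n).+1)%N.
  by rewrite leq_divRL// ltnS mulnC; move: (q * k)%N rn => w; clear; lia.
rewrite (sum_residue_class (fun x => h ((x%:R - n%:R) / n%:R)) rq HM).
rewrite (eq_bigr (fun k : 'I_M.+1 => h (p k)))//.
have pM k : (k <= M)%N -> p k <= 1.
  rewrite HM ltnS => kM; rewrite /p ler_pdivrMr// mul1r lerBlDr -natrD ler_nat.
  by move: kM; rewrite mul2n -addnn.
have pM1 : 1 - p M <= d.
  have : ~~ (M.+1 <= M)%N by rewrite ltnn.
  rewrite HM -leqNgt lerBlDl -pd /p => h2.
  rewrite ler_pdivlMr// mul1r lerBrDr -natrD ler_nat; apply: leq_trans (ltnW h2).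
  by rewrite mul2n -addnn.
have p0 : p 0%N + 1 <= d.
  rewrite /p /d muln0 addn0 mulrBl divff ?gt_eqF// subrK ler_pM2r ?invr_gt0// ler_nat ltnW//.
have Md : M%:R * d <= 2.
  have := pM M (leqnn _); have := p1 0%N.
  have -> : p M = p 0%N + M%:R * d by rewrite /p /d natrD natrM muln0 addn0; field; rewrite gt_eqF.
  lra.
have tele : F (p M) = F (p 0%N) + \sum_(k < M) (F (p k.+1) - F (p k)).
  elim: (M) => [|m IHm]; first by rewrite big_ord0 addr0.
  by rewrite big_ord_recr /= addrA -IHm addrC subrK.
have cells : `|\sum_(k < M) (F (p k.+1) - F (p k)) - d * \sum_(k < M) h (p k.+1)| <= 2 * K * d.
  rewrite mulr_sumr -sumrB; apply: le_trans (ler_norm_sum _ _ _) _.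
  apply: (@le_trans _ _ (\sum_(k < M) K * d * d)).
    apply: ler_sum => k _; have := Fcell (p k) (p k.+1); rewrite pS [h _ * d]mulrC; apply=> //.
      by rewrite pd lerDl ltW.
    exact: pM.
  rewrite sumr_const card_ord -[leLHS]mulr_natl.
  have -> : M%:R * (K * d * d) = (M%:R * d) * (K * d) by ring.
  by rewrite -[leRHS]mulrA; apply: ler_wpM2r => //; rewrite mulr_ge0// ltW.
rewrite big_ord_recl /=.
have e1 := Fsmall (p M) 1 (p1 M) (pM M (leqnn _)) (lexx _).
have e0 := Fsmall (-1) (p 0%N) (lexx _) (p1 0%N) (pM 0%N (leq0n _)).
rewrite F1 subr0 opprK in e0.
have e2 : `|d * h (p 0%N)| <= d * A.
  by rewrite normrM gtr0_norm// ler_pM2l//; apply: hA; rewrite p1 pM.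
have e1' : `|F 1 - F (p M)| <= A * d by apply: le_trans e1 _; rewrite ler_wpM2l.
have e0' : `|F (p 0%N)| <= A * d by apply: le_trans e0 _; rewrite ler_wpM2l.
rewrite -/(F 1).
have -> : F 1 - d * (h (p 0%N) + \sum_(i < M) h (p (bump 0 i))) =
  (F 1 - F (p M)) + F (p 0%N) - d * h (p 0%N) +
   (\sum_(k < M) (F (p k.+1) - F (p k)) - d * \sum_(k < M) h (p k.+1)).
  have -> : \sum_(i < M) h (p (bump 0 i)) = \sum_(k < M) h (p k.+1) by [].
  by rewrite tele; ring.
apply: le_trans (ler_normD _ _) _; apply: le_trans (lerD (ler_normB _ _) (lexx _)) _.
apply: le_trans (lerD (lerD (ler_normD _ _) (lexx _)) (lexx _)) _.
apply: (@le_trans _ _ ((2 * K + 4 * A) * d)).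
  have : 0 <= A * d by rewrite mulr_ge0// ltW.
  lra.
rewrite -mulrA ler_wpM2l ?ler_peMl//; lra.
Qed.

End OneDim.

(** * Iterated integrals and Riemann sums *)

Section Cube.
Variable R : realType.
Local Notation MR := (measurableTypeR R).

Definition cube s : set (s.-tuple MR) := [set t | forall j, `|tnth t j| <= 1].
Arguments cube : clear implicits.

Definition cube_int s (f : s.-tuple MR -> R) : \bar R :=
  (\int[lebesgue_tuple R s]_(t in cube s) (f t)%:E)%E.

Definition tcons s (x : R) (t : s.-tuple MR) : s.+1.-tuple MR := [tuple of x :: t].

Lemma cube_cons s x (t : s.-tuple MR) : cube s.+1 (tcons x t) <-> `|x| <= 1 /\ cube s t.
Proof.
split => [H|[x1 tc] j].
  split; first by have := H ord0; rewrite tnth0.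
  by move=> j; have := H (lift ord0 j); rewrite tnthS.
by case: (unliftP ord0 j) => [k ->|->]; rewrite ?tnth0// tnthS.
Qed.

Lemma measurable_cube s : measurable (cube s).
Proof.
rewrite (_ : cube s = \bigcap_(j in [set: 'I_s])
    ((fun t : s.-tuple MR => tnth t j) @^-1` [set` `[(-1)%R, 1%R]])).
  apply: fin_bigcap_measurable => // j _; rewrite -[X in measurable X]setTI.
  by apply: measurable_tnth.
apply/seteqP; split => t /= H j; last by have := H j I; rewrite /= in_itv /= -ler_norml.
by move=> _; rewrite /= in_itv /= -ler_norml; exact: H.
Qed.

(** Non-negativity is what Tonelli's theorem asks for. The constants are parameters because the
    induction on the dimension needs one error bound for all slices of a function. *)
Record nice (K A : R) s (f : s.-tuple MR -> R) : Prop := Nice {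
  nice_meas : measurable_fun setT f;
  nice_ge0 : forall t, 0 <= f t;
  nice_le : forall t, cube s t -> f t <= A;
  nice_lip : forall t t', cube s t -> cube s t' ->
    `|f t - f t'| <= K * \sum_j `|tnth t j - tnth t' j| }.

Lemma measurable_tcons s : measurable_fun setT (fun u : MR * s.-tuple MR => tcons u.1 u.2).
Proof. exact: measurable_cons. Qed.

Lemma nice_cons K A s (f : s.+1.-tuple MR -> R) x : `|x| <= 1 -> nice K A f ->
  nice K A (fun t => f (tcons x t)).
Proof.
move=> x1 [mf f0 fA fK]; split => //.
- apply: (measurableT_comp mf).
  by apply: measurable_cons.
- by move=> t tc; apply: fA; apply/cube_cons.
- move=> t t' tc tc'; apply: le_trans (fK _ _ _ _) _; try exact/cube_cons.
  rewrite big_ord_recl !tnth0 subrr normr0 add0r.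
  by rewrite le_eqVlt; apply/orP; left; apply/eqP; congr (_ * _); apply: eq_bigr => j _; rewrite !tnthS.
Qed.

Lemma cube_int0 (f : 0.-tuple MR -> R) : cube_int f = (f [tuple])%:E.
Proof.
have -> : f = cst (f [tuple]) by apply/funext => t; rewrite tuple0.
rewrite /cube_int /= integral_dirac//=; last exact: measurable_cube.
rewrite diracE mem_set ?mul1e//.
by case.
Qed.

Lemma cube_int_rec K A s (f : s.+1.-tuple MR -> R) : nice K A f ->
  exists2 F : MR -> \bar R, measurable_fun setT F &
    (forall x, F x = if `|x| <= 1 then cube_int (fun t => f (tcons x t)) else 0%E) /\
    cube_int f = (\int[lebesgue_measure]_(x in `[(-1)%R, 1%R]) F x)%E.
Proof.
move=> [mf f0 _ _].
pose g := (fun t => (f t)%:E) \_ (cube s.+1).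
have mg : measurable_fun setT g.
  have mc := @measurable_cube s.+1.
  apply: (@measurable_restrictT _ _ _ _ _ (fun t => (f t)%:E) mc).1.
  by apply: measurable_funTS; apply: (measurableT_comp (@EFin_measurable R setT) mf).
have g0 t : (0 <= g t)%E by rewrite /g patchE; case: ifP => // _; rewrite lee_fin.
pose gg (u : MR * s.-tuple MR) := g (tcons u.1 u.2).
have mgg : measurable_fun setT gg by apply: (measurableT_comp mg); exact: measurable_tcons.
pose F := fubini_F (lebesgue_tuple R s) gg.
have FE x : F x = if `|x| <= 1 then cube_int (fun t => f (tcons x t)) else 0%E.
  rewrite /F /fubini_F; case: ifP => x1.
    rewrite /cube_int [RHS]integral_mkcond; apply: eq_integral => t _.
    rewrite /gg /g !patchE /=; case: (asboolP (cube s t)) => tc.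
      by rewrite !mem_set//; apply/cube_cons.
    by rewrite !memNset// => /cube_cons[].
  rewrite -[RHS](integral0 (lebesgue_tuple R s) setT); apply: eq_integral => t _.
  rewrite /gg /g patchE memNset// => /cube_cons[]; by rewrite x1.
exists F; first by apply: measurable_fun_fubini_tonelli_F => // u; exact: g0.
split => //.
rewrite /cube_int integral_mkcond -/g [lebesgue_tuple R s.+1]/= /cons_measure.
rewrite ge0_integral_pushforward//; last exact: measurable_tcons.
rewrite preimage_setT.
transitivity (\int[lebesgue_measure]_x F x)%E.
  by rewrite -fubini_tonelli1// => u; exact: g0.
rewrite [RHS]integral_mkcond; apply: eq_integral => x _; rewrite patchE.
case: ifPn => //; rewrite notin_setE /= in_itv /= -ler_norml => /negP x1.
by rewrite FE (negbTE x1).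
Qed.

Fixpoint rsum (q n : nat) (r : nat -> nat) s : (s.-tuple MR -> R) -> R :=
  match s return (s.-tuple MR -> R) -> R with
  | 0 => fun f => f [tuple]
  | s'.+1 => fun f => \sum_(x < (2 * n).+1 | (x %% q == r 0)%N)
      rsum q n (fun k => r k.+1) (fun t => f (tcons ((x%:R - n%:R) / n%:R) t))
  end.

Lemma grid_point n (x : 'I_(2 * n).+1) : (0 < n)%N -> `|(x%:R - n%:R) / n%:R : R| <= 1.
Proof.
move=> n0; have n0' : 0 < n%:R :> R by rewrite ltr0n.
rewrite normrM normfV [`|n%:R|]gtr0_norm// ler_pdivrMr// mul1r ler_norml.
have := ltn_ord x; rewrite ltnS -(ler_nat R) natrM => xn.
have : 0 <= x%:R :> R by [].
lra.
Qed.

Lemma rsum_dist q n r s (f g : s.-tuple MR -> R) M : (0 < n)%N ->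
  (forall t, cube s t -> `|f t - g t| <= M) ->
  `|rsum q n r f - rsum q n r g| <= (2 * n).+1%:R ^+ s * M.
Proof.
move=> n0; elim: s r f g => [|s IHs] r f g H /=.
  by rewrite expr0 mul1r; apply: H; case.
rewrite -sumrB; apply: le_trans (ler_norm_sum _ _ _) _.
have M0 : 0 <= (2 * n).+1%:R ^+ s * M.
  rewrite mulr_ge0 ?exprn_ge0//.
  apply: le_trans (H [tuple 0 | _ < s.+1] _) => // j.
  by rewrite tnth_mktuple normr0.
apply: (@le_trans _ _ (\sum_(x < (2 * n).+1) (2 * n).+1%:R ^+ s * M)); last first.
  by rewrite sumr_const card_ord -[leLHS]mulr_natl exprS mulrA.
rewrite [leRHS](bigID (fun x : 'I_(2 * n).+1 => (x %% q == r 0)%N)) /= ler_wpDr//.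
  by apply: sumr_ge0.
apply: ler_sum => x _; apply: IHs => t tc; apply: H.
by apply/cube_cons; split => //; exact: grid_point.
Qed.

Lemma rsum0 q n r s : rsum q n r (fun _ : s.-tuple MR => 0) = 0.
Proof. by elim: s r => [|s IHs] r //=; rewrite big1. Qed.

Lemma archimed_le (x y c : R) : (forall n, (0 < n)%N -> x <= y + c / n%:R) -> x <= y.
Proof.
move=> H; rewrite leNgt; apply/negP => yx.
have d0 : 0 < x - y by rewrite subr_gt0.
have c0 : 0 <= `|c| / (x - y) by rewrite divr_ge0// ltW.
have := H (Num.bound (`|c| / (x - y))).+1 isT.
set n := _.+1; have n0 : 0 < n%:R :> R by rewrite ltr0n.
have : `|c| / (x - y) < n%:R.
  by apply: lt_le_trans (archi_boundP c0) _; rewrite ler_nat.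
rewrite ltr_pdivrMr// -lerBlDl => h1; rewrite ler_pdivlMr// => h2.
by have := ler_norm c; move: h1 h2; rewrite mulrC; move: (_ * _) => u; lra.
Qed.

(** Induction on the dimension: integrating over all coordinates but the first gives a bounded
    Lipschitz function of one variable, to which [riemann_sum1] applies. The classes modulo q may
    differ from one coordinate to the next. *)
Theorem riemann_sum s q (K A : R) : (0 < q)%N -> 0 <= K -> 0 <= A ->
  exists2 C, 0 <= C & forall f : s.-tuple MR -> R, nice K A f ->
  exists2 v : R, cube_int f = v%:E & forall n r, (0 < n)%N -> (forall k, r k < q)%N ->
    `|v - (q%:R / n%:R) ^+ s * rsum q n r f| <= C / n%:R.
Proof.
move=> q0 K0 A0; elim: s => [|s [C C0 IHs]].
  exists 0 => // f _; exists (f [tuple]); first exact: cube_int0.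
  by move=> n r n0 rq; rewrite expr0 mul1r /= subrr normr0 mul0r.
pose A' := C + q%:R ^+ s * (3 ^+ s * A); pose K' := (3 * q%:R) ^+ s * K.
have q0' : 0 <= q%:R :> R by [].
exists ((2 * K' + 4 * A') * q%:R * q%:R + 3 * q%:R * C).
  by rewrite !(addr_ge0, mulr_ge0, exprn_ge0).
move=> f nf; have [F mF [FE fF]] := cube_int_rec nf.
pose h x := fine (F x).
have val x : `|x| <= 1 -> exists2 v : R, F x = v%:E & forall n r, (0 < n)%N -> (forall k, r k < q)%N ->
    `|v - (q%:R / n%:R) ^+ s * rsum q n r (fun t => f (tcons x t))| <= C / n%:R.
  move=> x1; have [v vE H] := IHs _ (nice_cons x1 nf).
  by exists v; rewrite ?FE ?x1.
have hval x n r : `|x| <= 1 -> (0 < n)%N -> (forall k, r k < q)%N ->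
    `|h x - (q%:R / n%:R) ^+ s * rsum q n r (fun t => f (tcons x t))| <= C / n%:R.
  by move=> x1; have [v vE H] := val x x1; rewrite /h vE; exact: H.
have n1 (x : R) : (-1 <= x <= 1) = (`|x| <= 1) by rewrite ler_norml.
have mh : measurable_fun setT h by apply: (measurableT_comp _ mF); exact: fine_measurable.
have hA x : -1 <= x <= 1 -> `|h x| <= A'.
  rewrite n1 => x1; have := hval x 1%N (fun=> 0%N) x1 isT (fun=> q0).
  rewrite !divr1; set S := rsum _ _ _ _ => H.
  have : `|S| <= 3 ^+ s * A.
    have := @rsum_dist q 1 (fun=> 0%N) s (fun t => f (tcons x t)) (fun=> 0) A isT.
    rewrite rsum0 subr0; apply=> t tc; rewrite subr0 ger0_norm; last exact: (nice_ge0 nf).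
    by apply: (nice_le nf); apply/cube_cons.
  move=> SA; have : `|q%:R ^+ s * S| <= q%:R ^+ s * (3 ^+ s * A).
    by rewrite normrM ger0_norm ?exprn_ge0// ler_wpM2l ?exprn_ge0.
  have := ler_normD (h x - q%:R ^+ s * S) (q%:R ^+ s * S); rewrite subrK /A'; lra.
(* The Lipschitz bound is proved for the Riemann sums of two slices and passes to their integrals as
   n tends to infinity. *)
have hK x y : -1 <= x <= 1 -> -1 <= y <= 1 -> `|h x - h y| <= K' * `|x - y|.
  rewrite !n1 => x1 y1; apply: (@archimed_le _ _ (C + C)) => n n0.
  have hx := hval x n (fun=> 0%N) x1 n0 (fun=> q0); have hy := hval y n (fun=> 0%N) y1 n0 (fun=> q0).
  have n0' : 0 < n%:R :> R by rewrite ltr0n.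
  have := @rsum_dist q n (fun=> 0%N) s (fun t => f (tcons x t)) (fun t => f (tcons y t)) (K * `|x - y|) n0.
  set S := rsum _ _ _ _ in hx *; set T := rsum _ _ _ _ in hy *.
  move=> /(_ _) HS; have {}HS : `|S - T| <= (2 * n).+1%:R ^+ s * (K * `|x - y|).
    apply: HS => t tc; apply: le_trans (nice_lip nf _ _) _; try exact/cube_cons.
    rewrite big_ord_recl !tnth0 big1 ?addr0// => j _; by rewrite !tnthS subrr normr0.
  have HS' : `|(q%:R / n%:R) ^+ s * S - (q%:R / n%:R) ^+ s * T| <= K' * `|x - y|.
    rewrite -mulrBr normrM ger0_norm ?exprn_ge0 ?divr_ge0//.
    apply: le_trans (ler_wpM2l _ HS) _; first by rewrite exprn_ge0 ?divr_ge0.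
    have qn : q%:R / n%:R * (2 * n).+1%:R <= 3 * q%:R :> R.
      rewrite mulrAC ler_pdivrMr// -!natrM ler_nat.
      by move: n0; clear; nia.
    rewrite [leLHS]mulrA /K' -[leRHS]mulrA ler_wpM2r ?mulr_ge0// -exprMn.
    by rewrite lerXn2r ?nnegrE ?mulr_ge0 ?divr_ge0.
  rewrite mulrDl; have := ler_distD ((q%:R / n%:R) ^+ s * S) (h x) (h y).
  have := ler_distD ((q%:R / n%:R) ^+ s * T) ((q%:R / n%:R) ^+ s * S) (h y).
  by rewrite [`|_ * T - h y|]distrC; lra.
have ih := integrable_unit mh hA.
exists (\int[lebesgue_measure]_(t in `[-1, 1]) h t).
  rewrite fF /Rintegral fineK; last by apply: integrable_fin_num.
  apply: eq_integral => x; rewrite inE /= in_itv /= => xi.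
  rewrite n1 in xi; have [v vE _] := val x xi.
  by rewrite /h vE.
move=> n r n0 rq; have n0' : 0 < n%:R :> R by rewrite ltr0n.
have := riemann_sum1 mh hA hK n0 (rq 0%N); set I := Rintegral _ _ _.
set S := \sum_(x < _ | _) _ => H1 /=; set T := \sum_(x < _ | _) _.
have ST : `|S - (q%:R / n%:R) ^+ s * T| <= (2 * n).+1%:R * (C / n%:R).
  rewrite mulr_sumr -sumrB; apply: le_trans (ler_norm_sum _ _ _) _.
  apply: (@le_trans _ _ (\sum_(x < (2 * n).+1) C / n%:R)); last first.
    by rewrite sumr_const card_ord -[leLHS]mulr_natl.
  rewrite [leRHS](bigID (fun x : 'I_(2 * n).+1 => (x %% q == r 0)%N)) /= ler_wpDr//.
    by apply: sumr_ge0 => x _; rewrite divr_ge0.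
  by apply: ler_sum => x _; apply: hval => //; exact: grid_point.
have H2 : `|q%:R / n%:R * S - (q%:R / n%:R) ^+ s.+1 * T| <= 3 * q%:R * C / n%:R.
  have -> : q%:R / n%:R * S - (q%:R / n%:R) ^+ s.+1 * T = q%:R / n%:R * (S - (q%:R / n%:R) ^+ s * T).
    by rewrite exprS; ring.
  rewrite normrM ger0_norm ?divr_ge0//.
  apply: le_trans (ler_wpM2l _ ST) _; first by rewrite divr_ge0.
  have n3 : (2 * n).+1%:R <= 3 * n%:R :> R by rewrite -natrM ler_nat; move: n0; clear; lia.
  have : (2 * n).+1%:R * (C / n%:R) <= 3 * n%:R * (C / n%:R) by rewrite ler_wpM2r ?divr_ge0.
  move=> /(ler_wpM2l (_ : 0 <= q%:R / n%:R)) H3; apply: le_trans (H3 _) _; first by rewrite divr_ge0.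
  by rewrite le_eqVlt; apply/orP; left; apply/eqP; field; rewrite gt_eqF.
have := ler_distD (q%:R / n%:R * S) I ((q%:R / n%:R) ^+ s.+1 * T).
have -> : ((2 * K' + 4 * A') * q%:R * q%:R + 3 * q%:R * C) / n%:R =
   (2 * K' + 4 * A') * q%:R * (q%:R / n%:R) + 3 * q%:R * C / n%:R by ring.
lra.
Qed.

End Cube.

(** * The smoothed count as a Riemann sum *)

Section Weights.
Variable R : realType.
Local Notation MR := (measurableTypeR R).

Lemma lambdaE (L eta : R) : 0 < L -> lambda L eta = L * Num.max 0 (1 - L * `|eta|).
Proof.
move=> L0; rewrite /lambda -[L^-1]mul1r ler_pdivlMr// mulrC.
case: leP => h; first by rewrite max_r// subr_ge0.
by rewrite max_l ?mulr0// subr_le0 ltW.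
Qed.

Lemma max0_lip (x y : R) : `|Num.max 0 x - Num.max 0 y| <= `|x - y|.
Proof.
have := ler_norm (x - y); have := ler_norm (- (x - y)); rewrite normrN.
have := normr_ge0 (x - y); move: (`|x - y|) => d.
by case: (leP 0 x) => ?; case: (leP 0 y) => ?; rewrite ler_norml; lra.
Qed.

Lemma lambda_ge0 (L eta : R) : 0 < L -> 0 <= lambda L eta.
Proof. by move=> L0; rewrite lambdaE//; apply: mulr_ge0; [exact: ltW|rewrite le_max lexx]. Qed.

Lemma lambda_le (L eta : R) : 0 < L -> lambda L eta <= L.
Proof.
move=> L0; rewrite lambdaE//; apply: ler_piMr; first exact: ltW.
by rewrite ge_max ler01/= gerBl mulr_ge0// ltW.
Qed.

Lemma lambda_lip (L x y : R) : 0 < L -> `|lambda L x - lambda L y| <= L ^+ 2 * `|x - y|.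
Proof.
move=> L0; rewrite !lambdaE// -mulrBr normrM gtr0_norm// expr2 -mulrA ler_pM2l//.
apply: le_trans (max0_lip _ _) _; rewrite opprB addrC addrA subrK -mulrBr normrM gtr0_norm//.
by rewrite ler_pM2l// (distrC x y); exact: ler_dist_dist.
Qed.

Definition coef_size s (a : 'M[int]_(3, s)) : R := \sum_i \sum_j `|(a i j)%:~R|.

Lemma phi_lip s (a : 'M[int]_(3, s)) i (x y : 'I_s -> R) :
  (forall j, `|x j| <= 1) -> (forall j, `|y j| <= 1) ->
  `|phi a i x - phi a i y| <= 3 * coef_size a * \sum_j `|x j - y j|.
Proof.
move=> x1 y1; rewrite /phi -sumrB; apply: le_trans (ler_norm_sum _ _ _) _.
rewrite mulr_sumr; apply: ler_sum => j _; rewrite -mulrBr normrM.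
have ac : `|(a i j)%:~R| <= coef_size a.
  rewrite /coef_size (bigD1 i)//= (bigD1 j)//= -addrA lerDl addr_ge0 ?sumr_ge0// => k _.
  by rewrite sumr_ge0.
have c0 : 0 <= coef_size a by apply: le_trans ac.
have -> : 3 * coef_size a * `|x j - y j| = coef_size a * (3 * `|x j - y j|) by ring.
apply: ler_pM => //.
move: (x j) (y j) (x1 j) (y1 j) => u v u1 v1.
rewrite subrXX normrM mulrC ler_wpM2r//.
apply: le_trans (ler_norm_sum _ _ _) _.
apply: (@le_trans _ _ (\sum_(k < i.+1) 1)).
  apply: ler_sum => k _; rewrite normrM !normrX mulr_ile1 ?exprn_ge0// exprn_ile1//.
by rewrite sumr_const card_ord ler_nat.
Qed.

Definition weight s (a : 'M[int]_(3, s)) (L : R) (t : s.-tuple MR) : R :=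
  \prod_(i < 3) lambda L (phi a i (tnth t : 'I_s -> R)).

Lemma prod3_dist (f g : 'I_3 -> R) (M d : R) : (forall i, `|f i| <= M) -> (forall i, `|g i| <= M) ->
  (forall i, `|f i - g i| <= d) -> `|\prod_i f i - \prod_i g i| <= 3 * M ^+ 2 * d.
Proof.
move=> fM gM fg; rewrite !big_ord_recl !big_ord0 !mulr1.
move: (fM ord0) (fM (lift ord0 ord0)) (gM (lift ord0 ord0)) (gM (lift ord0 (lift ord0 ord0)))
  (gM ord0) (fM (lift ord0 (lift ord0 ord0))).
move: (fg ord0) (fg (lift ord0 ord0)) (fg (lift ord0 (lift ord0 ord0))).
move: (f ord0) (f (lift ord0 ord0)) (f (lift ord0 (lift ord0 ord0))).
move: (g ord0) (g (lift ord0 ord0)) (g (lift ord0 (lift ord0 ord0))).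
move=> x' y' z' x y z hx hy hz xM yM y'M z'M x'M zM.
have M0 : 0 <= M by apply: le_trans xM.
have d0 : 0 <= d by apply: le_trans hx.
have -> : x * (y * z) - x' * (y' * z') = (x - x') * (y * z) + x' * ((y - y') * z) + x' * (y' * (z - z')).
  by ring.
have b (u v w : R) (U V W : R) : `|u| <= U -> `|v| <= V -> `|w| <= W -> `|u * (v * w)| <= U * (V * W).
  by move=> hu hv hw; rewrite !normrM !ler_pM// mulr_ge0.
apply: le_trans (ler_normD _ _) _; apply: le_trans (lerD (ler_normD _ _) (lexx _)) _.
have := b _ _ _ _ _ _ hx yM zM; have := b _ _ _ _ _ _ x'M hy zM; have := b _ _ _ _ _ _ x'M y'M hz.
by rewrite expr2; lra.
Qed.

Lemma nice_weight s (a : 'M[int]_(3, s)) (L : R) : 0 < L ->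
  nice (3 * L ^+ 2 * (L ^+ 2 * (3 * coef_size a))) (L ^+ 3) (weight a L).
Proof.
move=> L0; split.
- apply: measurable_prod => i _.
  have -> : (fun t : s.-tuple MR => lambda L (phi a i (tnth t : 'I_s -> R))) =
      (fun t : s.-tuple MR => L * Num.max 0 (1 - L * `|\sum_j (a i j)%:~R * (tnth t j : R) ^+ i.+1|)).
    by apply/funext => t; rewrite lambdaE.
  apply: measurable_funM => //; apply: measurable_maxr => //.
  apply: measurable_funB => //; apply: measurable_funM => //.
  apply: measurableT_comp => //; apply: measurable_sum => j.
  apply: measurable_funM => //; apply: measurable_funX; exact: measurable_tnth.
- by move=> t; apply: prodr_ge0 => i _; exact: lambda_ge0.
- move=> t _; rewrite -[X in _ ^+ X](card_ord 3) -prodr_const; apply: ler_prod => i _.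
  by rewrite lambda_ge0 ?lambda_le.
- move=> t t' tc tc'.
  have lamL (z : R) : `|lambda L z| <= L by rewrite ger0_norm ?lambda_ge0 ?lambda_le.
  have := @prod3_dist (fun i => lambda L (phi a i (tnth t : 'I_s -> R)))
    (fun i => lambda L (phi a i (tnth t' : 'I_s -> R))) L
    (L ^+ 2 * (3 * coef_size a * \sum_j `|tnth t j - tnth t' j|)) (fun i => lamL _) (fun i => lamL _).
  rewrite /weight => H; apply: le_trans (H _) _.
    move=> i; apply: le_trans (lambda_lip _ _ L0) _; apply: ler_wpM2l; first by rewrite exprn_ge0// ltW.
    exact: phi_lip.
  by rewrite le_eqVlt; apply/orP; left; apply/eqP; ring.
Qed.

Definition gpoint s n (x : {ffun 'I_s -> 'I_(2 * n).+1}) : s.-tuple MR :=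
  [tuple (((x j)%:R - n%:R) / n%:R : R) | j < s].

Definition ffcons s n (p : 'I_(2 * n).+1 * {ffun 'I_s -> 'I_(2 * n).+1}) : {ffun 'I_s.+1 -> 'I_(2 * n).+1} :=
  [ffun j => if unlift ord0 j is Some k then p.2 k else p.1].

Lemma ffcons_bij s n : bijective (@ffcons s n).
Proof.
exists (fun u : {ffun 'I_s.+1 -> 'I_(2 * n).+1} => (u ord0, [ffun k : 'I_s => u (lift ord0 k)])).
  move=> [x g]; rewrite /ffcons ffunE unlift_none; congr (_, _).
  by apply/ffunP => k; rewrite !ffunE liftK.
by move=> u; apply/ffunP => j; rewrite !ffunE; case: unliftP => [k ->|->] //=; rewrite ffunE.
Qed.

Lemma rsum_ffun q n r s (f : s.-tuple MR -> R) :
  rsum q n r f = \sum_(x : {ffun 'I_s -> 'I_(2 * n).+1} | [forall j, (x j %% q == r j)%N]) f (gpoint x).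
Proof.
elim: s r f => [|s IHs] r f /=.
  have x0 : {ffun 'I_0 -> 'I_(2 * n).+1} by apply: finfun; case.
  rewrite (bigD1 x0) /=; last by apply/forallP; case.
  rewrite [X in _ + X]big1 ?addr0; first by congr f; rewrite [RHS]tuple0.
  by move=> x /andP[_ /eqP]; case; apply/ffunP; case.
rewrite (reindex (@ffcons s n)) /=; last exact/onW_bij/ffcons_bij.
rewrite (eq_bigl (fun p : 'I_(2 * n).+1 * {ffun 'I_s -> 'I_(2 * n).+1} =>
   ((p.1 %% q == r 0)%N) && [forall j, (p.2 j %% q == r j.+1)%N])); last first.
  move=> [x g] /=; apply/forallP/andP => [H|[xr /forallP H] j].
    split; first by have := H ord0; rewrite ffunE unlift_none.
    by apply/forallP => j; have := H (lift ord0 j); rewrite ffunE liftK.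
  rewrite ffunE; case: unliftP => [k ->|->] //; exact: H.
rewrite -(pair_big (fun x : 'I_(2 * n).+1 => (x %% q == r 0)%N)
   (fun g : {ffun 'I_s -> 'I_(2 * n).+1} => [forall j, (g j %% q == r j.+1)%N])
   (fun x g => f (gpoint (ffcons (x, g))))) /=.
apply: eq_bigr => x _; rewrite IHs; apply: eq_bigr => g _; congr f.
apply: eq_from_tnth => j; rewrite tnth_mktuple ffunE.
by case: unliftP => [k ->|->]; rewrite ?tnthS ?tnth_mktuple// tnth0.
Qed.

(** The coordinates of a grid point are x_j - n, so the admissible classes are a translate of the
    solutions modulo q, and translation preserves their number. *)
Lemma modulus_sum s (a : 'M[int]_(3, s)) (q n : nat) (f : s.-tuple MR -> R) : (0 < q)%N ->
  exists2 P : pred {ffun 'I_s -> 'I_q}, #|P| = count_mod a q &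
  \sum_(x : {ffun 'I_s -> 'I_(2 * n).+1} | [forall i, (q%:Z %| phi a i (centred x))%Z]) f (gpoint x) =
  \sum_(r | P r) \sum_(x : {ffun 'I_s -> 'I_(2 * n).+1} | [forall j, (x j %% q == r j)%N]) f (gpoint x).
Proof.
move=> q0; pose P (r : {ffun 'I_s -> 'I_q}) :=
  [forall i, (q%:Z %| phi a i (fun j => (r j : nat)%:Z - n%:Z))%Z].
exists P.
  pose sh (r : {ffun 'I_s -> 'I_q}) : {ffun 'I_s -> 'I_q} :=
    [ffun j => Ordinal (ltn_pmod (r j + (q - n %% q)) q0)].
  have shE r j : (q%:Z %| ((sh r j : nat)%:Z - ((r j : nat)%:Z - n%:Z)))%Z.
    rewrite ffunE /=; have nq : (n %% q < q)%N by rewrite ltn_pmod.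
    have e1 := divn_eq (r j + (q - n %% q)) q; have e2 := divn_eq n q.
    apply/dvdzP; exists (1 + (n %/ q)%N%:Z - ((r j + (q - n %% q)) %/ q)%N%:Z).
    move: nq e1 e2; move: (_ %% q)%N => w; move: (_ %/ q)%N (_ %/ q)%N (_ %% q)%N; clear.
    move=> u v z; nia.
  have shinj : injective sh.
    move=> r r' rr; apply/ffunP => j; apply/val_inj; apply: (@dvdz_lt_eq q) (ltn_ord _) (ltn_ord _) _.
    have := rpredB (shE r' j) (shE r j); rewrite rr.
    by apply: dvdz_congr; ring.
  rewrite /count_mod -!sum1_card [RHS](reindex_inj shinj); apply: eq_bigl => r.
  rewrite inE; apply: eq_forallb => i; apply: esym; apply: phi_congr => j; exact: shE.
pose res (x : {ffun 'I_s -> 'I_(2 * n).+1}) : {ffun 'I_s -> 'I_q} :=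
  [ffun j => Ordinal (ltn_pmod (x j) q0)].
have resE x : P (res x) = [forall i, (q%:Z %| phi a i (centred x))%Z].
  apply: eq_forallb => i; apply: phi_congr => j; rewrite ffunE /centred /=.
  apply/dvdzP; exists (- (x j %/ q)%N%:Z).
  have := divn_eq (x j) q; move: (_ %/ q)%N (_ %% q)%N => u v; clear; nia.
rewrite (partition_big res P) => [|x]; last by rewrite resE.
apply: eq_bigr => r Pr; apply: eq_bigl => x.
apply/andP/forallP => [[_ /eqP <-] j|H]; first by rewrite ffunE.
have rE : res x = r by apply/ffunP => j; rewrite ffunE; apply/val_inj/eqP/H.
by rewrite rE eqxx -resE rE.
Qed.

Lemma fej_closed (h q : nat) (m : int) : (0 < h)%N -> (0 < q)%N ->
  fej R h q m = if (q%:Z %| m)%Z then h%:R^-1 * Num.max 0 (1 - `|m|%:~R / (q * h)%:R) else 0.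
Proof.
move=> h0 q0; have h0' : 0 < h%:R :> R by rewrite ltr0n.
have q0' : 0 < q%:R :> R by rewrite ltr0n.
case: ifPn => [/dvdzP[k ->]|nq]; last first.
  rewrite /fej (@eq_card _ _ pred0) ?card0 ?mul0r// => -[u v]; rewrite !inE /=.
  apply: contraNF nq => /eqP E; apply/dvdzP; exists ((v : nat)%:Z - (u : nat)%:Z).
  by apply/eqP; rewrite -subr_eq0; apply/eqP; rewrite -E; ring.
have cnt : #|[pred uv : 'I_h * 'I_h | k * q%:Z + q%:Z * ((uv.1 : nat)%:Z - (uv.2 : nat)%:Z) == 0]|
    = (h - `|k|)%N.
  have E (u v : 'I_h) : (k * q%:Z + q%:Z * ((u : nat)%:Z - (v : nat)%:Z) == 0) =
      ((v : nat)%:Z == k + (u : nat)%:Z).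
    have -> : k * q%:Z + q%:Z * ((u : nat)%:Z - (v : nat)%:Z) = q%:Z * (k + (u : nat)%:Z - (v : nat)%:Z) by ring.
    by rewrite mulf_eq0 eqz_nat (gtn_eqF q0) /= subr_eq0 eq_sym.
  rewrite (eq_card (B := [pred uv : 'I_h * 'I_h | (uv.2 : nat)%:Z == k + (uv.1 : nat)%:Z])); last first.
    by move=> [u v]; rewrite !inE E.
  clear E; case: k => k.
    have w (u : 'I_(h - k)) : (u < h)%N by apply: leq_trans (ltn_ord u) _; rewrite leq_subr.
    have w' (u : 'I_(h - k)) : (k + u < h)%N by have := ltn_ord u; clear; lia.
    pose g (u : 'I_(h - k)) : 'I_h * 'I_h := (Ordinal (w u), Ordinal (w' u)).
    have gi : injective g by move=> u u' [] /val_inj.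
    rewrite -[RHS]card_ord -(fintype.card_image gi).
    apply: eq_card => -[u v]; rewrite !inE /=; apply/eqP/fintype.imageP => [[E]|[z _ [-> ->]] //].
    have uk : (u < h - k)%N by have := ltn_ord v; rewrite E; clear; lia.
    by exists (Ordinal uk) => //; congr (_, _); apply/val_inj => //=; rewrite E.
  rewrite NegzE abszN absz_nat.
  have w (u : 'I_(h - k.+1)) : (u < h)%N by apply: leq_trans (ltn_ord u) _; rewrite leq_subr.
  have w' (u : 'I_(h - k.+1)) : (k.+1 + u < h)%N by have := ltn_ord u; clear; lia.
  pose g (u : 'I_(h - k.+1)) : 'I_h * 'I_h := (Ordinal (w' u), Ordinal (w u)).
  have gi : injective g by move=> u u' [_ /val_inj].
  rewrite -[RHS]card_ord -(fintype.card_image gi).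
  apply: eq_card => -[u v]; rewrite !inE /=; apply/eqP/fintype.imageP => [E|[z _ [-> ->]]] /=; last first.
    by rewrite PoszD addrA addNr add0r.
  have uE : (u = k.+1 + v :> nat)%N by move: E; clear; lia.
  have uk : (v < h - k.+1)%N by have := ltn_ord u; rewrite uE; clear; lia.
  by exists (Ordinal uk) => //; congr (_, _); apply/val_inj => //=.
rewrite /fej cnt normrM intrM natrM.
have -> : `|q%:Z|%:~R = q%:R :> R by rewrite ger0_norm.
have -> : `|k|%:~R = `|k|%N%:R :> R by rewrite natr_absz.
have -> : `|k|%N%:R * q%:R / (q%:R * h%:R) = `|k|%N%:R / h%:R :> R by field; rewrite !gt_eqF.
have [hk|hk] := leqP h `|k|%N.
  rewrite (eqP hk) mul0r max_l ?mulr0// subr_le0 ler_pdivlMr// mul1r ler_nat//.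
rewrite max_r; last by rewrite subr_ge0 ler_pdivrMr// mul1r ler_nat ltnW.
have -> : (h - `|k|)%N%:R = h%:R - `|k|%N%:R :> R by apply: natrB; exact: ltnW.
by move: (h%:R : R) h0' (`|k|%N%:R : R) => u u0 v; field; rewrite gt_eqF.
Qed.

(* [y = X / h] is compared with its limit [q * L]. *)
Lemma fej_approx (h q : nat) (m : int) (L X B : R) : (0 < h)%N -> (0 < q)%N -> 0 < L -> 0 < X -> 0 <= B ->
  h%:R * (L * q%:R) <= X -> X <= (h%:R + 1) * (L * q%:R) -> `|m|%:~R <= B * X ->
  `|X * fej R h q m - (if (q%:Z %| m)%Z then q%:R * lambda L (m%:~R / X) else 0)|
     <= (L * q%:R) / h%:R * (1 + L * B).
Proof.
move=> h0 q0 L0 X0 B0 h1 h2 mB.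
have h0' : 0 < h%:R :> R by rewrite ltr0n.
have q0' : 0 < q%:R :> R by rewrite ltr0n.
rewrite fej_closed//; case: ifPn => _; last first.
  by rewrite mulr0 subrr normr0 !mulr_ge0 ?invr_ge0 ?addr_ge0 ?mulr_ge0// ltW.
rewrite lambdaE//; set y := X / h%:R; set z := L * q%:R; pose c := `|m|%:~R / (q%:R * X).
have -> : X * (h%:R^-1 * Num.max 0 (1 - `|m|%:~R / (q * h)%:R)) = y * Num.max 0 (1 - c * y).
  rewrite mulrA; congr (_ * Num.max _ (1 - _)).
  by rewrite /c /y natrM; field; rewrite !gt_eqF.
have -> : q%:R * (L * Num.max 0 (1 - L * `|m%:~R / X|)) = z * Num.max 0 (1 - c * z).
  rewrite mulrA [q%:R * L]mulrC; congr (_ * Num.max _ (1 - _)).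
  by rewrite normrM normfV (gtr0_norm X0) -intr_norm /c /z; field; rewrite !gt_eqF.
have c0 : 0 <= c by rewrite divr_ge0 ?mulr_ge0 ?ler0z// ltW.
have z0 : 0 < z by rewrite mulr_gt0.
have y0 : 0 < y by rewrite divr_gt0.
have cz : c * z <= L * B.
  have -> : c * z = L * (`|m|%:~R / X) by rewrite /c /z; field; rewrite !gt_eqF.
  by rewrite ler_pM2l// ler_pdivrMr.
have yz : 0 <= y - z <= z / h%:R.
  rewrite subr_ge0 /y ler_pdivlMr// mulrC h1 /= lerBlDr ler_pdivrMr//.
  have -> : (z / h%:R + z) * h%:R = (h%:R + 1) * z by field; rewrite gt_eqF.
  by [].
have m1 : `|Num.max 0 (1 - c * y)| <= 1.
  rewrite ger0_norm ?le_max ?lexx// ge_max ler01 /= gerBl mulr_ge0// ltW//.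
have -> : y * Num.max 0 (1 - c * y) - z * Num.max 0 (1 - c * z) =
   (y - z) * Num.max 0 (1 - c * y) + z * (Num.max 0 (1 - c * y) - Num.max 0 (1 - c * z)) by ring.
have /andP[d0 d1] := yz; apply: le_trans (ler_normD _ _) _.
have nM (u v : R) : 0 <= u -> `|u * v| = u * `|v| by move=> u0; rewrite normrM ger0_norm.
rewrite (nM (y - z)) ?(nM z) ?(ltW z0)//.
have m2 : `|Num.max 0 (1 - c * y) - Num.max 0 (1 - c * z)| <= c * (y - z).
  apply: le_trans (max0_lip _ _) _.
  have -> : 1 - c * y - (1 - c * z) = - (c * (y - z)) by ring.
  by rewrite normrN ger0_norm// mulr_ge0.
apply: (@le_trans _ _ ((y - z) * 1 + z * (c * (y - z)))).
  by apply: lerD; [rewrite ler_wpM2l|rewrite ler_pM2l].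
have -> : (y - z) * 1 + z * (c * (y - z)) = (y - z) * (1 + c * z) by ring.
apply: ler_pM => //; first by rewrite addr_ge0// mulr_ge0// ltW.
by rewrite lerD2l.
Qed.

(** Distribute n^6 over the kernels as n, n^2, n^3. Each scaled kernel is then close to q
    lambda_L(phi_i / n^(i+1)) where q divides phi_i, and to 0 elsewhere. For each admissible class
    modulo q the remaining sum is a Riemann sum for mu_L, and the factor q^3 M(q) q^(-s) is
    chi(q). *)
Theorem wsum_limit s (a : 'M[int]_(3, s)) (L : R) (q : nat) : 0 < L -> (0 < q)%N -> (6 <= s)%N ->
  exists C : R, forall n (h : 'I_3 -> nat), (0 < n)%N -> L * q%:R <= n%:R ->
  (forall i, (0 < h i)%N) -> (forall i : 'I_3, (h i)%:R * (L * q%:R) <= n%:R ^+ i.+1) ->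
  (forall i : 'I_3, n%:R ^+ i.+1 <= ((h i)%:R + 1) * (L * q%:R)) ->
  `|wsum R a n h q - local_density R a q * real_density_approx a L * n%:R ^+ (s - 6)| <= C / n%:R * n%:R ^+ (s - 6).
Proof.
move=> L0 q0 s6.
have z0 : 0 < L * q%:R by rewrite mulr_gt0// ltr0n.
set z := L * q%:R in z0 *.
have c0 : 0 <= coef_size a by rewrite /coef_size sumr_ge0// => i _; rewrite sumr_ge0.
have [K K0 [A A0 nw]] : exists2 K : R, 0 <= K & exists2 A : R, 0 <= A & nice K A (weight a L).
  exists (3 * L ^+ 2 * (L ^+ 2 * (3 * coef_size a))).
    by have := sqr_ge0 L; move: (L ^+ 2) => u u0; rewrite !mulr_ge0.
  by exists (L ^+ 3); [rewrite exprn_ge0// ltW|exact: nice_weight].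
have [C1 C10 H1] := riemann_sum s q0 K0 A0.
have [v vE Hv] := H1 _ nw.
have muE : real_density_approx a L = v.
  by rewrite /real_density_approx /Rintegral -[RHS]/(fine v%:E) -vE.
pose B := 3 * coef_size a * s%:R; have B0 : 0 <= B by rewrite !mulr_ge0.
pose e1 := 2 * z ^+ 2 * (1 + L * B).
have LB0 : 0 <= 1 + L * B by rewrite addr_ge0// mulr_ge0// ltW.
have e10 : 0 <= e1 by have := sqr_ge0 z; rewrite /e1; move: (z ^+ 2) => u u0; rewrite !mulr_ge0.
pose M := 2 * z + L * q%:R.
pose C2 := 3 ^+ s * (3 * M ^+ 2 * e1).
pose C3 := (count_mod a q)%:R * q%:R ^+ 3 / q%:R ^+ s * C1.
exists (C2 + C3) => n h n0 zn h0 h1 h2.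
have n0' : 0 < n%:R :> R by rewrite ltr0n.
have n1' : 1 <= n%:R :> R by rewrite ler1n.
have q0' : 0 < q%:R :> R by rewrite ltr0n.
have nh i : z / (h i)%:R <= 2 * z ^+ 2 / n%:R.
  have hi0 : 0 < (h i)%:R :> R by rewrite ltr0n.
  have hi1 : 1 <= (h i)%:R :> R by rewrite ler1n.
  rewrite ler_pdivrMr// mulrAC ler_pdivlMr//.
  have n_le : n%:R <= n%:R ^+ i.+1 :> R by rewrite exprS ler_peMr ?exprn_ege1// ltW.
  have : n%:R <= 2 * (h i)%:R * z.
    apply: le_trans n_le _; apply: le_trans (h2 i) _; rewrite ler_pM2r//; lra.
  move=> /(ler_wpM2l (ltW z0)) /le_trans; apply.
  by rewrite le_eqVlt; apply/orP; left; apply/eqP; ring.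
have nge i : n%:R ^+ (i : 'I_3).+1 != 0 :> R by rewrite expf_neq0// gt_eqF.
pose T (x : {ffun 'I_s -> 'I_(2 * n).+1}) i : R :=
  if (q%:Z %| phi a i (centred x))%Z then q%:R * lambda L ((phi a i (centred x))%:~R / n%:R ^+ i.+1) else 0.
pose F (x : {ffun 'I_s -> 'I_(2 * n).+1}) (i : 'I_3) : R := n%:R ^+ i.+1 * fej R (h i) q (phi a i (centred x)).
have phiE (x : {ffun 'I_s -> 'I_(2 * n).+1}) i : (phi a i (centred x))%:~R / n%:R ^+ i.+1 = phi a i (tnth (gpoint x) : 'I_s -> R).
  rewrite /phi rmorph_sum /= mulr_suml; apply: eq_bigr => j _; rewrite tnth_mktuple expr_div_n.
  by rewrite rmorphM /= rmorphXn /= /centred intrB -!pmulrn intz mulrA.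
have gp1 (x : {ffun 'I_s -> 'I_(2 * n).+1}) j : `|tnth (gpoint x) j| <= 1 :> R.
  rewrite tnth_mktuple; exact: (grid_point R (x j) n0).
have FT x i : `|F x i - T x i| <= e1 / n%:R.
  rewrite /F /T; apply: le_trans (fej_approx (B := B) (h0 i) q0 L0 _ B0 (h1 i) (h2 i) _) _.
  - by rewrite exprn_gt0.
  - have -> : `|phi a i (centred x)|%:~R = `|phi a i (tnth (gpoint x) : 'I_s -> R)| * n%:R ^+ i.+1.
      rewrite -phiE normrM normfV [`|_ ^+ _|]ger0_norm ?exprn_ge0// divfK//.
      by rewrite intr_norm.
    rewrite ler_wpM2r ?exprn_ge0//.
    have := phi_lip a i (gp1 x) (y := fun=> 0) (fun _ => ltac:(by rewrite normr0)).
    have -> : phi a i (fun _ : 'I_s => 0 : R) = 0 by rewrite /phi big1// => j _; rewrite expr0n mulr0.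
    rewrite subr0 => /le_trans; apply; rewrite /B ler_wpM2l ?mulr_ge0//.
    apply: (@le_trans _ _ (\sum_(j < s) 1)); last by rewrite sumr_const card_ord.
    by apply: ler_sum => j _; rewrite subr0.
  rewrite -/z /e1 [leRHS]mulrAC ler_wpM2r// addr_ge0// mulr_ge0// ltW.
have TM x i : `|T x i| <= M.
  rewrite /T; case: ifP => _; last by rewrite normr0 addr_ge0 ?mulr_ge0// ltW.
  rewrite ger0_norm ?mulr_ge0 ?lambda_ge0// /M.
  apply: ler_wpDl; first by apply: mulr_ge0 => //; exact: ltW.
  by rewrite [L * _]mulrC ler_pM2l// lambda_le.
have FM x i : `|F x i| <= M.
  rewrite /F normrM [`|_ ^+ _|]ger0_norm ?exprn_ge0//.
  have fh : `|fej R (h i) q (phi a i (centred x))| <= (h i)%:R^-1.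
    rewrite fej_closed//; case: ifP => _; last by rewrite normr0 invr_ge0.
    have mx0 (u : R) : 0 <= Num.max 0 u by rewrite le_max lexx.
    rewrite ger0_norm ?mulr_ge0 ?invr_ge0// ler_piMr ?invr_ge0// ge_max ler01 /= gerBl divr_ge0// ler0z.
  apply: le_trans (ler_wpM2l _ fh) _; first by rewrite exprn_ge0.
  have hi0 : 0 < (h i)%:R :> R by rewrite ltr0n.
  have hi1 : 1 <= (h i)%:R :> R by rewrite ler1n.
  rewrite ler_pdivrMr//; apply: le_trans (h2 i) _; rewrite -/z /M -/z.
  have : z * 1 <= z * (h i)%:R by rewrite ler_pM2l.
  have : 0 <= z * (h i)%:R by rewrite mulr_ge0// ltW.
  lra.
have n6 : n%:R ^+ s = n%:R ^+ (s - 6) * n%:R ^+ 6 :> R by rewrite -exprD subnK.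
have wE : n%:R ^+ 6 * wsum R a n h q = \sum_(x : {ffun 'I_s -> 'I_(2 * n).+1}) \prod_i F x i.
  rewrite /wsum mulr_sumr; apply: eq_bigr => x _; rewrite /F [RHS]big_split.
  have e6 (u : R) : \prod_(i < 3) u ^+ i.+1 = u ^+ 6 by rewrite !big_ord_recl big_ord0 /= mulr1 -!exprD.
  by rewrite -(e6 n%:R).
have d1 : `|\sum_(x : {ffun 'I_s -> 'I_(2 * n).+1}) \prod_i F x i - \sum_x \prod_i T x i| <=
    (2 * n).+1%:R ^+ s * (3 * M ^+ 2 * (e1 / n%:R)).
  rewrite -sumrB; apply: le_trans (ler_norm_sum _ _ _) _.
  apply: (@le_trans _ _ (\sum_(x : {ffun 'I_s -> 'I_(2 * n).+1}) 3 * M ^+ 2 * (e1 / n%:R))); last first.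
    by rewrite sumr_const card_ffun !card_ord -[leLHS]mulr_natl natrX.
  by apply: ler_sum => x _; apply: prod3_dist.
have TE : \sum_(x : {ffun 'I_s -> 'I_(2 * n).+1}) \prod_i T x i = q%:R ^+ 3 *
    \sum_(x : {ffun 'I_s -> 'I_(2 * n).+1} | [forall i, (q%:Z %| phi a i (centred x))%Z]) weight a L (gpoint x).
  rewrite mulr_sumr [RHS]big_mkcond /=; apply: eq_bigr => x _; case: ifPn => [/forallP H|].
    rewrite -[X in _ ^+ X](card_ord 3) -prodr_const -big_split /=; apply: eq_bigr => i _.
    by rewrite /T H phiE.
  by rewrite negb_forall => /existsP[i /negbTE iH]; rewrite (bigD1 i)//= /T iH mul0r.
have [P cP PE] := modulus_sum a n (weight a L) q0.
have d2 : `|(count_mod a q)%:R * v - (q%:R / n%:R) ^+ s *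
    \sum_(x : {ffun 'I_s -> 'I_(2 * n).+1} | [forall i, (q%:Z %| phi a i (centred x))%Z]) weight a L (gpoint x)|
    <= (count_mod a q)%:R * (C1 / n%:R).
  rewrite PE -cP mulr_sumr !mulr_natl -!sumr_const -sumrB; apply: le_trans (ler_norm_sum _ _ _) _.
  apply: ler_sum => r _.
  pose r' k := nth 0%N [seq (r j : nat) | j <- enum 'I_s] k.
  have r'E (j : 'I_s) : r' j = r j.
    by rewrite /r' (nth_map j) ?size_enum_ord// nth_ord_enum.
  have r'q k : (r' k < q)%N.
    have [ks|sk] := ltnP k s; first by rewrite (r'E (Ordinal ks)).
    by rewrite /r' nth_default// size_map size_enum_ord.
  have := Hv n r' n0 r'q; rewrite rsum_ffun; congr (`|_ - _ * _| <= _); first by rewrite mulr_natl.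
  by apply: eq_bigl => x; apply: eq_forallb => j; rewrite r'E.
move: d1 d2; rewrite TE -wE muE; set W := wsum R a n h q; set Sm := \sum_(x | _) _ => d1 d2.
have n6p : 0 < n%:R ^+ 6 :> R by rewrite exprn_gt0.
have nsp : 0 < n%:R ^+ s :> R by rewrite exprn_gt0.
rewrite -(ler_pM2l n6p) -{1}(gtr0_norm n6p) -normrM.
have -> : n%:R ^+ 6 * (W - local_density R a q * v * n%:R ^+ (s - 6)) =
   (n%:R ^+ 6 * W - q%:R ^+ 3 * Sm) +
   - (q%:R ^+ 3 / q%:R ^+ s * n%:R ^+ s) * ((count_mod a q)%:R * v - (q%:R / n%:R) ^+ s * Sm).
  rewrite /local_density expr_div_n n6.
  have : q%:R ^+ s != 0 :> R by rewrite expf_neq0// gt_eqF.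
  have : n%:R ^+ (s - 6) != 0 :> R by rewrite expf_neq0// gt_eqF.
  move: (gt_eqF n6p); move: (n%:R ^+ 6) (n%:R ^+ (s - 6)) (q%:R ^+ s) (q%:R ^+ 3) => u1 u2 u3 u4 u10 u20 u30.
  by field; rewrite u20 u30 u10.
apply: le_trans (ler_normD _ _) _.
have -> : n%:R ^+ 6 * ((C2 + C3) / n%:R * n%:R ^+ (s - 6)) = C2 / n%:R * n%:R ^+ s + C3 / n%:R * n%:R ^+ s.
  by rewrite n6; ring.
apply: lerD.
  apply: le_trans d1 _.
  have -> : C2 / n%:R * n%:R ^+ s = (3 * n%:R) ^+ s * (3 * M ^+ 2 * (e1 / n%:R)).
    by rewrite exprMn /C2; ring.
  have M20 : 0 <= M ^+ 2 by rewrite sqr_ge0.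
  apply: ler_wpM2r.
    by apply: mulr_ge0; [apply: mulr_ge0|apply: divr_ge0].
  apply: lerXn2r; rewrite ?nnegrE ?ler0n ?mulr_ge0 ?ler0n// -natrM ler_nat.
  by move: n0; clear; lia.
set u := q%:R ^+ 3 / q%:R ^+ s * n%:R ^+ s.
have u0 : 0 <= u by apply: mulr_ge0; [apply: divr_ge0|]; exact: exprn_ge0.
rewrite normrM normrN (ger0_norm u0); apply: le_trans (ler_wpM2l u0 d2) _.
by rewrite le_eqVlt; apply/orP; left; apply/eqP; rewrite /C3 /u; ring.
Qed.

End Weights.

(** * Positivity of the real density *)

Section RealPoint.
Variables (R : realType) (s : nat) (a : 'M[int]_(3, s)).
Local Notation MR := (measurableTypeR R).
Local Notation c := (coef_size R a).

Lemma coef_ge0 : 0 <= c.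
Proof. by rewrite /coef_size sumr_ge0// => i _; rewrite sumr_ge0. Qed.

Lemma coef_row i (F : 'I_s -> R) (M : R) : 0 <= M -> (forall j, `|F j| <= `|(a i j)%:~R| * M) ->
  `|\sum_j F j| <= c * M.
Proof.
move=> M0 FM; apply: le_trans (ler_norm_sum _ _ _) _.
apply: le_trans (ler_sum _ (fun j _ => FM j)) _; rewrite -mulr_suml; apply: ler_wpM2r => //.
by rewrite /coef_size (bigD1 i)//= lerDl sumr_ge0// => k _; rewrite sumr_ge0.
Qed.

Lemma phi_taylor_real i (x v : 'I_s -> R) (V : R) : (forall j, `|x j| <= 1) -> (forall j, `|v j| <= V) -> V <= 1 ->
  `|phi a i (fun j => x j + v j) - phi a i x - \sum_j Defs.jacobian a x i j * v j| <= c * (4 * V ^+ 2).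
Proof.
move=> x1 vV V1; rewrite /phi -!sumrB; apply: (coef_row (i := i)); first by rewrite mulr_ge0// sqr_ge0.
move=> j; rewrite mxE -mulrBr.
have -> : (a i j)%:~R * ((x j + v j) ^+ i.+1 - x j ^+ i.+1) - i.+1%:R * (a i j)%:~R * x j ^+ i * v j =
   (a i j)%:~R * ((x j + v j) ^+ i.+1 - x j ^+ i.+1 - i.+1%:R * x j ^+ i * v j) by ring.
rewrite normrM; apply: ler_wpM2l => //.
move: (x j) (v j) (x1 j) (vV j) => y w y1 wV.
have V0 : 0 <= V by apply: le_trans wV.
have w2 : `|w ^+ 2| <= V ^+ 2 by rewrite normrX lerXn2r// nnegrE.
have V2 : 0 <= V ^+ 2 by exact: sqr_ge0.
move: i; apply: ord3P; rewrite /= /bump /=.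
- have -> : (y + w) ^+ 1 - y ^+ 1 - 1%:R * y ^+ 0 * w = 0 by ring.
  by rewrite normr0 mulr_ge0.
- have -> : (y + w) ^+ 2 - y ^+ 2 - 2%:R * y ^+ 1 * w = w ^+ 2 by ring.
  by apply: le_trans w2 _; lra.
- have -> : (y + w) ^+ 3 - y ^+ 3 - 3%:R * y ^+ 2 * w = (3 * y + w) * w ^+ 2 by ring.
  rewrite normrM; apply: ler_pM => //; apply: le_trans (ler_normD _ _) _.
  by rewrite normrM ger0_norm//; lra.
Qed.

Lemma jacobian_lip (x y : 'I_s -> R) (d : R) i j : `|x j| <= 1 -> `|y j| <= 1 -> `|x j - y j| <= d ->
  `|Defs.jacobian a x i j - Defs.jacobian a y i j| <= `|(a i j)%:~R| * (6 * d).
Proof.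
rewrite !mxE; move: (x j) (y j) => u v u1 v1 uv.
have -> : i.+1%:R * (a i j)%:~R * u ^+ i - i.+1%:R * (a i j)%:~R * v ^+ i =
   (a i j)%:~R * (i.+1%:R * (u ^+ i - v ^+ i)) by ring.
rewrite normrM; apply: ler_wpM2l => //; have d0 : 0 <= d by apply: le_trans uv.
move: i; apply: ord3P; rewrite /= /bump /=.
- by rewrite subrr mulr0 normr0 mulr_ge0.
- by rewrite normrM ger0_norm// !expr1; lra.
- have -> : u ^+ 2 - v ^+ 2 = (u + v) * (u - v) by ring.
  rewrite !normrM ger0_norm//.
  have h : `|u + v| * `|u - v| <= 2 * d.
    by apply: ler_pM => //; apply: le_trans (ler_normD _ _) _; lra.
  lra.
Qed.

(** Newton's step with the inverse minor frozen at x0. The Taylor remainder and the drift of the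
    Jacobian together contribute at most 10 c rho b d. *)
Lemma quasi_newton (x0 : 'I_s -> R) (f : 'I_3 -> 'I_s) : (forall j, `|x0 j| <= 1 / 2) ->
  \det (colsub f (Defs.jacobian a x0)) != 0 ->
  exists b rho : R, [/\ 0 < b, 0 < rho, rho <= 1 / 4 &
    forall (x : 'I_s -> R) (d : R), (forall j, `|x j - x0 j| <= rho) -> (forall i, `|phi a i x| <= d) -> b * d <= rho ->
    exists x' : 'I_s -> R, [/\ forall j, j \notin codom f -> x' j = x j, forall j, `|x' j - x j| <= b * d &
      forall i, `|phi a i x'| <= d / 2]].
Proof.
move=> x01 dA; set A := colsub f (Defs.jacobian a x0) in dA.
have c0 := coef_ge0.
pose B := invmx A; pose b := 1 + \sum_l \sum_i `|B l i|.
have Bs0 : 0 <= \sum_l \sum_i `|B l i| by apply: sumr_ge0 => l _; apply: sumr_ge0.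
have b0 : 0 < b by rewrite /b; lra.
have cb0 : 0 <= c * b by rewrite mulr_ge0// ltW.
have den : 0 < 4 + 20 * (c * b) by lra.
(* This radius makes 10 c rho b at most 1/2 and rho at most 1/4. *)
exists b, (1 / (4 + 20 * (c * b))); set rho := 1 / _.
have rho0 : 0 < rho by rewrite divr_gt0.
have rho4 : rho <= 1 / 4 by rewrite /rho !div1r lef_pV2 ?posrE//; lra.
have rhoc : 10 * (c * rho) * b <= 1 / 2.
  have -> : 10 * (c * rho) * b = 10 * (c * b) / (4 + 20 * (c * b)) by rewrite /rho; ring.
  by rewrite ler_pdivrMr//; lra.
split => // x d xx0 phid bd.
have d0 : 0 <= d by apply: le_trans (phid ord0).
pose w l : R := - \sum_i B l i * phi a i x.
pose v j : R := \sum_(l < 3) (f l == j)%:R * w l.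
have wE : \sum_l `|w l| <= b * d.
  apply: (@le_trans _ _ (\sum_l (\sum_i `|B l i|) * d)).
    apply: ler_sum => l _; rewrite /w normrN mulr_suml; apply: le_trans (ler_norm_sum _ _ _) _.
    by apply: ler_sum => i _; rewrite normrM ler_wpM2l.
  by rewrite -mulr_suml; apply: ler_wpM2r => //; rewrite /b lerDr.
have vb j : `|v j| <= b * d.
  apply: le_trans wE; rewrite /v; apply: le_trans (ler_norm_sum _ _ _) _; apply: ler_sum => l _.
  by case: eqP => _; rewrite ?mul1r// mul0r normr0.
have x1 j : `|x j| <= 1.
  rewrite -[x j](subrK (x0 j)); apply: le_trans (ler_normD _ _) _.
  by have := xx0 j; have := x01 j; lra.
exists (fun j => x j + v j); split.
- move=> j jf; rewrite /v big1 ?addr0// => l _.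
  by case: eqP => [e|]; rewrite ?mul0r//; case/negP: jf; rewrite -e codom_f.
- by move=> j; rewrite addrC addKr.
move=> i; have bd1 : b * d <= 1 by lra.
have T := phi_taylor_real i x1 vb bd1.
have J0 : \sum_j Defs.jacobian a x0 i j * v j = - phi a i x.
  transitivity (\sum_(l < 3) A i l * w l).
    under eq_bigr do rewrite mulr_sumr; rewrite exchange_big /=; apply: eq_bigr => l _.
    rewrite (bigD1 (f l))//= eqxx mul1r [A i l]mxE big1 ?addr0// => j /negbTE jl.
    by rewrite eq_sym jl mul0r mulr0.
  have uA : A \in unitmx by rewrite unitmxE unitfE.
  pose P : 'cV[R]_3 := \col_k phi a k x.
  have := mulmxV uA; move/(congr1 (fun M => (M *m P) i ord0)).
  rewrite mul1mx -mulmxA [RHS]mxE [LHS]mxE => <-; rewrite -sumrN; apply: eq_bigr => l _.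
  rewrite /w mulrN; congr (- (_ * _)); rewrite [RHS]mxE; apply: eq_bigr => k _.
  by rewrite [P k ord0]mxE.
have J1 : `|\sum_j (Defs.jacobian a x i j - Defs.jacobian a x0 i j) * v j| <= c * (6 * rho * (b * d)).
  have bd0 : 0 <= b * d by rewrite mulr_ge0// ltW.
  apply: (coef_row (i := i)); first by apply: (mulr_ge0 _ bd0); apply: (mulr_ge0 _ (ltW rho0)).
  move=> j; rewrite normrM mulrA; apply: ler_pM => //; apply: jacobian_lip => //.
  by apply: le_trans (x01 j) _; lra.
have JE : \sum_j Defs.jacobian a x i j * v j = - phi a i x + \sum_j (Defs.jacobian a x i j - Defs.jacobian a x0 i j) * v j.
  by rewrite -J0 -big_split /=; apply: eq_bigr => j _; ring.
set S := \sum_j (_ - _) * _ in J1 JE; rewrite JE in T.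
set X := phi a i _ in T *.
have -> : X = (X - phi a i x - (- phi a i x + S)) + S by ring.
apply: le_trans (ler_normD _ _) _; apply: le_trans (lerD T J1) _.
have bd2 : (b * d) ^+ 2 <= rho * (b * d).
  by rewrite expr2 ler_wpM2r// mulr_ge0// ltW.
have h1 : c * (4 * (b * d) ^+ 2) <= c * (4 * (rho * (b * d))) by rewrite !ler_wpM2l.
have h2 : 10 * (c * rho) * b * d <= 1 / 2 * d by rewrite ler_wpM2r.
have -> : d / 2 = 1 / 2 * d by ring.
apply: le_trans (lerD h1 (lexx _)) _; apply: le_trans h2.
by rewrite le_eqVlt; apply/orP; left; apply/eqP; ring.
Qed.

(** The corrections form a geometric series, and [de] is chosen so that the initial deviation plus
    the whole series is exactly rho. Finitely many steps reach any precision, so no limit has to be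
    taken. *)
Lemma near_solution (x0 : 'I_s -> R) (f : 'I_3 -> 'I_s) : (forall j, `|x0 j| <= 1 / 2) ->
  solution a x0 -> \det (colsub f (Defs.jacobian a x0)) != 0 ->
  exists2 de : R, 0 < de <= 1 / 4 & forall (y : 'I_s -> R) (eps : R), 0 < eps ->
    (forall j, `|y j - x0 j| <= de) ->
    exists z : 'I_s -> R, [/\ forall j, j \notin codom f -> z j = y j, forall j, `|z j - x0 j| <= 1 / 4 &
      forall i, `|phi a i z| <= eps].
Proof.
move=> x01 sol dA; have [b [rho [b0 rho0 rho4 step]]] := quasi_newton x01 dA.
pose C := 3 * c * s%:R; have C0 : 0 <= C by rewrite !mulr_ge0// coef_ge0.
have den : 0 < 1 + 2 * b * C by have := mulr_ge0 (ltW b0) C0; rewrite -mulrA; lra.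
exists (rho / (1 + 2 * b * C)).
  rewrite divr_gt0//=; apply: le_trans rho4; rewrite ler_pdivrMr// ler_peMr ?(ltW rho0)//.
  by have := mulr_ge0 (ltW b0) C0; rewrite -mulrA; lra.
set de := rho / _; have de0 : 0 < de by rewrite divr_gt0.
have deE : de + 2 * (b * (C * de)) = rho by rewrite /de; field; rewrite gt_eqF.
move=> y eps eps0 yx0.
have bCd : 0 <= b * (C * de) by apply: (mulr_ge0 (ltW b0)); exact: (mulr_ge0 C0 (ltW de0)).
have iter k : exists z : 'I_s -> R, [/\ forall j, j \notin codom f -> z j = y j,
    forall j, `|z j - x0 j| <= de + 2 * (b * (C * de)) * (1 - 2 ^- k) &
    forall i, `|phi a i z| <= C * de * 2 ^- k].
  elim: k => [|k [z [z1 z2 z3]]].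
    exists y; split => // [j|i]; first by rewrite expr0 invr1 subrr mulr0 addr0.
    rewrite expr0 invr1 mulr1.
    have ya j : `|y j| <= 1.
      rewrite -[y j](subrK (x0 j)); apply: le_trans (ler_normD _ _) _.
      have := yx0 j; have := x01 j; have : de <= rho by rewrite -deE lerDl mulr_ge0.
      by lra.
    have xa j : `|x0 j| <= 1 by have := x01 j; lra.
    have := phi_lip a i ya xa; rewrite sol subr0 => /le_trans; apply.
    have -> : C * de = 3 * c * (s%:R * de) by rewrite /C; ring.
    apply: ler_wpM2l; first by apply: mulr_ge0 => //; exact: coef_ge0.
    by apply: le_trans (ler_sum _ (fun j _ => yx0 j)) _; rewrite sumr_const card_ord mulr_natl.
  have k0 : 0 < 2 ^- k :> R by rewrite invr_gt0 exprn_gt0.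
  have k1 : 2 ^- k <= 1 :> R by rewrite invf_le1 ?exprn_gt0// exprn_ege1// ler1n.
  have bk0 : 0 <= b * (C * de) * 2 ^- k by rewrite mulr_ge0// ltW.
  have bk1 : b * (C * de) * 2 ^- k <= b * (C * de) by rewrite ler_piMr.
  have zr j : `|z j - x0 j| <= rho.
    by apply: le_trans (z2 j) _; move: deE bk0; move: (b * (C * de)) => u; lra.
  have bd : b * (C * de * 2 ^- k) <= rho by rewrite mulrA; move: deE de0; lra.
  have [z' [h1 h2 h3]] := step z _ zr z3 bd; exists z'; split.
  - by move=> j jf; rewrite h1// z1.
  - move=> j; rewrite -[z' j](subrK (z j)) -addrA; apply: le_trans (ler_normD _ _) _.
    apply: le_trans (lerD (h2 j) (z2 j)) _.
    have -> : 2 ^- k.+1 = 2 ^- k / 2 :> R by rewrite exprS invfM mulrC.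
    by rewrite le_eqVlt; apply/orP; left; apply/eqP; field.
  - move=> i; apply: le_trans (h3 i) _.
    by rewrite exprS invfM le_eqVlt; apply/orP; left; apply/eqP; field; rewrite expf_neq0.
have Cd0 : 0 <= C * de by rewrite mulr_ge0// ltW.
pose k := (Num.truncn (C * de / eps)).+1.
have hk : C * de * 2 ^- k <= eps.
  rewrite ler_pdivrMr ?exprn_gt0// [leRHS]mulrC -ler_pdivrMr//.
  apply: le_trans (ltW (truncnS_gt _)) _; rewrite -/k -natrX ler_nat; exact: ltnW (ltn_expl _ _).
have [z [z1 z2 z3]] := iter k; exists z; split => // [j|i]; last exact: le_trans (z3 i) hk.
apply: le_trans (z2 j) _; have k0 : 0 <= 2 ^- k :> R by rewrite invr_ge0 exprn_ge0.
have := mulr_ge0 bCd k0; move: deE rho4; move: (b * (C * de)) (2 ^- k) => u v; clear.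
move=> deE rho4 uv; lra.
Qed.

Lemma density_grid (L : R) : 0 < L -> exists2 C : R, 0 <= C & forall n, (0 < n)%N ->
  `|real_density_approx a L - (\sum_(x : {ffun 'I_s -> 'I_(2 * n).+1}) weight a L (gpoint R x)) / n%:R ^+ s| <= C / n%:R.
Proof.
move=> L0; have nw := nice_weight a L0.
have [||C C0 H] := riemann_sum s (isT : (0 < 1)%N) (K := 3 * L ^+ 2 * (L ^+ 2 * (3 * c))) (A := L ^+ 3).
- by have := sqr_ge0 L; have := coef_ge0; move: (L ^+ 2) => u c0 u0; rewrite !mulr_ge0.
- by apply: exprn_ge0; exact: ltW.
exists C => // n n0; have [v vE Hv] := H _ nw.
have -> : real_density_approx a L = v.
  by rewrite /real_density_approx /Rintegral -[RHS]/(fine v%:E) -vE.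
have := Hv n (fun=> 0%N) n0 (fun _ => isT); rewrite rsum_ffun; apply: le_trans.
rewrite le_eqVlt; apply/orP; left; apply/eqP; congr (`|_ - _|).
rewrite div1r exprVn mulrC; congr (_ * _); apply: eq_bigl => x.
by apply/esym/forallP => j; rewrite modn1.
Qed.

End RealPoint.

Section RealLower.
Variables (R : realType) (s : nat) (a : 'M[int]_(3, s)).
Local Notation c := (coef_size R a).

Lemma card_small_family n (m : 'I_s -> nat) : (forall j, (m j <= n)%N) ->
  #|family (fun j => [pred k : 'I_n | (k < m j)%N])| = (\prod_j m j)%N.
Proof.
move=> mn; rewrite card_family foldrE big_map big_enum /=; apply: eq_bigr => j _.
rewrite -[RHS]card_ord; pose g (k : 'I_(m j)) : 'I_n := widen_ord (mn j) k.
have gi : injective g by move=> k l /(congr1 val) /= kl; apply/val_inj.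
rewrite -(fintype.card_image gi); apply: eq_card => k.
apply/idP/fintype.imageP => [|[l _ ->]]; last by rewrite unfold_in; exact: (ltn_ord l).
move=> km; have {}km : (k < m j)%N by move: km; rewrite unfold_in.
by exists (Ordinal km) => //; apply/val_inj.
Qed.

Lemma det_minor_inj (K : fieldType) (J : 'M[K]_(3, s)) (f : 'I_3 -> 'I_s) :
  \det (colsub f J) != 0 -> injective f.
Proof.
move=> dJ k l kl; apply/eqP; apply: contraNT dJ => nkl; rewrite -det_tr; apply/eqP.
by apply: (determinant_alternate nkl) => i; rewrite !mxE kl.
Qed.

Lemma grid_floor n (t : R) : (0 < n)%N -> `|t| <= 3 / 4 ->
  exists k : nat, [/\ k%:R <= n%:R * (1 + t), n%:R * (1 + t) < k%:R + 1 & k%:R <= n%:R * (1 + t)].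
Proof.
move=> n0 t1; exists (Num.truncn (n%:R * (1 + t))).
have h : 0 <= n%:R * (1 + t) by rewrite mulr_ge0//; move: t1; rewrite ler_norml; lra.
by have /andP[-> h2] := truncn_itv h; split; rewrite // natr1.
Qed.

Lemma weight_ge (L : R) (t : s.-tuple (measurableTypeR R)) : 0 < L ->
  (forall i, `|phi a i (tnth t : 'I_s -> R)| <= 1 / (2 * L)) -> (L / 2) ^+ 3 <= weight a L t.
Proof.
move=> L0 H; rewrite -[X in _ ^+ X](card_ord 3) -prodr_const; apply: ler_prod => i _.
have L2 : 0 < 2 * L by rewrite mulr_gt0.
apply/andP; split; first by rewrite divr_ge0// ltW.
rewrite lambdaE// ler_pM2l// le_max; apply/orP; right.
have := H i; rewrite ler_pdivlMr//; move: `|_| => u; lra.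
Qed.

Lemma quarter1 : 1 / 4 <= 1 :> R. Proof. lra. Qed.

Lemma quarter3 : 3 / 4 <= 1 :> R. Proof. lra. Qed.

Lemma half_grid (n : nat) (u : R) : 0 < u -> u <= 1 -> 4 / u <= n%:R ->
  exists m : nat, [/\ (m <= n)%N, n%:R * (u / 4) <= m%:R & (m%:R + 1) <= n%:R * u].
Proof.
move=> u0 u1 un; have nu : 4 <= n%:R * u by move: un; rewrite ler_pdivrMr.
have h : 0 <= n%:R * u / 2 by rewrite divr_ge0// (le_trans _ nu).
have [t [h1 h2]] : exists t : nat, t%:R <= n%:R * u / 2 /\ n%:R * u / 2 < t%:R + 1.
  by exists (Num.truncn (n%:R * u / 2)); have /andP[? ?] := truncn_itv h; rewrite natr1.
exists t; split; [|rewrite mulrA; lra|lra].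
have : n%:R * u <= n%:R * 1 by rewrite ler_wpM2l.
by rewrite -(ler_nat R); lra.
Qed.

Lemma floor_dist (N K U M x d : R) : 0 < N -> K <= N * (1 + x) -> N * (1 + x) < K + 1 ->
  0 <= U -> U <= M -> M + 1 <= N * d -> `|(K + U - N) / N - x| <= d.
Proof.
move=> N0 h1 h2 h3 h4 h5.
have -> : (K + U - N) / N - x = (K + U - N * (1 + x)) / N by field; rewrite gt_eqF.
by rewrite normrM normfV (gtr0_norm N0) ler_pdivrMr// ler_norml [d * _]mulrC; apply/andP; split; lra.
Qed.

Lemma floor_in_grid (N K U M x d : R) : 0 < N -> K <= N * (1 + x) -> `|x| <= 3 / 4 ->
  U <= M -> M + 1 <= N * d -> d <= 1 / 4 -> K + U <= 2 * N.
Proof.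
move=> N0 h1; rewrite ler_norml => /andP[_ h2] h3 h4 h5.
have : N * d <= N * (1 / 4) by rewrite ler_pM2l.
have : N * (1 + x) <= N * (1 + 3 / 4) by rewrite ler_pM2l// lerD2l.
lra.
Qed.

Lemma three_quarters (u v : R) : `|u - v| <= 1 / 4 -> `|v| <= 1 / 2 -> `|u| <= 3 / 4.
Proof. by move=> h1 h2; rewrite -[u](subrK v); apply: le_trans (ler_normD _ _) _; lra. Qed.

(** Lattice points of large weight are counted. The s - 3 coordinates outside [f] run over a box of
    side proportional to n; for each choice [near_solution] adjusts the other three, which may then
    move in boxes of side proportional to n / L. The weight there is at least (L/2)^3, so that L
    cancels and the bound is uniform. *)
Theorem real_density_lower : (6 <= s)%N -> (exists x : 'I_s -> R, nonsingular_solution a x) ->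
  exists2 c0 : R, 0 < c0 & exists2 L0 : R, 0 < L0 & forall L, L0 <= L -> c0 <= real_density_approx a L.
Proof.
move=> s6 [xi [sol rk]]; have [f df] := nonsingular_minor rk.
have s0 : 0 < s%:R :> R by rewrite ltr0n (leq_trans _ s6).
have c0 := coef_ge0 R a.
(* By homogeneity the solution is scaled into the half cube, which leaves room for perturbations. *)
pose T := 1 / (2 * (1 + \sum_j `|xi j|)).
have S0 : 0 <= \sum_j `|xi j| by apply: sumr_ge0.
have T0 : 0 < T by rewrite divr_gt0// mulr_gt0//; lra.
pose x0 j := T * xi j.
have x01 j : `|x0 j| <= 1 / 2.
  rewrite /x0 normrM gtr0_norm// /T mulrAC mul1r ler_pdivrMr ?mulr_gt0//; last by lra.
  have : `|xi j| <= \sum_j `|xi j| by rewrite (bigD1 j)//= lerDl sumr_ge0.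
  by lra.
have sol0 : solution a x0 by move=> i; rewrite /x0 phi_scale sol mulr0.
have df0 : \det (colsub f (Defs.jacobian a x0)) != 0.
  by rewrite /x0 minor_scale mulf_neq0//; apply/prodf_neq0 => i _; rewrite expf_neq0// gt_eqF.
have finj := det_minor_inj df0.
have [de /andP[de0 de4] near] := near_solution x01 sol0 df0.
pose D : {pred 'I_s} := [predC codom f].
have c3 : #|codom f| = 3%N by rewrite (card_codom finj) card_ord.
have cD : #|D| = (s - 3)%N.
  have : (#|codom f| + #|D| = #|'I_s|)%N by rewrite -(cardC (mem (codom f))).
  by rewrite c3 card_ord; move: #|D|; clear; lia.
pose ka := 2 + 12 * (c * s%:R).
have ka0 : 0 < ka by have := mulr_ge0 c0 (ltW s0); rewrite /ka; lra.
pose K := (de / 4) ^+ (s - 3) * (1 / (16 * ka)) ^+ 3.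
have K0 : 0 < K by rewrite mulr_gt0// exprn_gt0// divr_gt0// mulr_gt0.
exists (K / 2); first by rewrite divr_gt0.
exists 1 => // L L1; have L0 : 0 < L by apply: lt_le_trans L1.
have [C C0 HC] := density_grid a L0.
(* Within this distance of a near solution the forms change by at most 1/(4L); the summand 2 in [ka]
   keeps the radius below 1/4. *)
pose be := 1 / (2 * (ka * L)).
have kaL0 : 0 < ka * L by rewrite mulr_gt0.
have be0 : 0 < be by rewrite divr_gt0// mulr_gt0.
have be1 : be <= 1 / 4.
  have kaL : 2 <= ka * L.
    have k2 : 2 <= ka by rewrite /ka lerDl mulr_ge0// mulr_ge0// ltW.
    by apply: le_trans k2 _; rewrite ler_peMr// ltW.
  by rewrite /be !div1r lef_pV2 ?posrE//; lra.
(* Large enough for the Riemann sum error to be at most K/2 and for both boxes to contain lattice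
   points in proportion to their sides. *)
pose n := (Num.truncn (2 * C / K + 4 / de + 4 / be)).+1.
have n0 : (0 < n)%N by [].
have n0' : 0 < n%:R :> R by rewrite ltr0n.
have nB : 2 * C / K + 4 / de + 4 / be <= n%:R by apply: ltW; exact: truncnS_gt.
have p1 : 0 <= 2 * C / K by exact: (divr_ge0 (mulr_ge0 (ler0n _ 2) C0) (ltW K0)).
have p2 : 0 < 4 / de by rewrite divr_gt0.
have p3 : 0 < 4 / be by rewrite divr_gt0.
have nC : C / n%:R <= K / 2.
  rewrite ler_pdivrMr// mulrC mulrA ler_pdivlMr//.
  have : 2 * C / K <= n%:R.
    by move: nB p2 p3; clear; move: (2 * C / K) (4 / de) (4 / be) => u v w; lra.
  by rewrite ler_pdivrMr// [C * 2]mulrC.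
have [de_n be_n] : 4 / de <= n%:R /\ 4 / be <= n%:R.
  by move: nB p1 p2 p3; clear; move: (2 * C / K) (4 / de) (4 / be) => u v w; split; lra.
have [m [mn m1 m2]] := half_grid de0 (le_trans de4 quarter1) de_n.
have [m' [m'n m'1 m'2]] := half_grid be0 (le_trans be1 quarter1) be_n.
pose mm j := if j \in D then m else m'.
pose U := family (fun j => [pred k : 'I_n | (k < mm j)%N]).
have cU : #|U| = (m ^ (s - 3) * m' ^ 3)%N.
  rewrite card_small_family; last by move=> j; rewrite /mm; case: ifP.
  rewrite (bigID (mem D)) /=; congr (_ * _)%N.
    by rewrite (eq_bigr (fun=> m)) ?prod_nat_const ?cD// => j jD; rewrite /mm jD.
  rewrite (eq_bigr (fun=> m')) => [|j /negbTE jD]; last by rewrite /mm jD.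
  rewrite prod_nat_const -c3; congr (_ ^ _)%N; apply: eq_card => j.
  by rewrite unfold_in /= /D !unfold_in negbK.
have fl (t : R) : exists k : nat, `|t| <= 3 / 4 -> k%:R <= n%:R * (1 + t) /\ n%:R * (1 + t) < k%:R + 1.
  have [t1|t1] := boolP (`|t| <= 3 / 4); last by exists 0%N.
  by have [k [k1 k2 _]] := grid_floor n0 t1; exists k.
have /choice[fl' flP] := fl.
have x034 j : `|x0 j| <= 3 / 4 by apply: (three_quarters _ (x01 j)); rewrite subrr normr0 divr_ge0.
pose y (u : {ffun 'I_s -> 'I_n}) j : R := if j \in D then ((fl' (x0 j) + u j)%N%:R - n%:R) / n%:R else x0 j.
have yx0 u : u \in U -> forall j, `|y u j - x0 j| <= de.
  move=> /familyP uU j; rewrite /y; case: ifPn => jD; last by rewrite subrr normr0 ltW.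
  have [k1 k2] := flP _ (x034 j).
  have um : (u j)%:R <= m%:R :> R by have := uU j; rewrite unfold_in /= /mm jD ler_nat => /ltnW.
  have u0 : 0 <= (u j)%:R :> R by [].
  by rewrite natrD; exact: (floor_dist n0' k1 k2 u0 um m2).
have /choice[z zP] (w : 'I_s -> R) : exists z : 'I_s -> R, (forall j, `|w j - x0 j| <= de) ->
    [/\ forall j, j \notin codom f -> z j = w j, forall j, `|z j - x0 j| <= 1 / 4 &
     forall i, `|phi a i z| <= 1 / (4 * L)].
  have [uU|nU] := pselect (forall j, `|w j - x0 j| <= de); last by exists x0 => /nU.
  have e0 : 0 < 1 / (4 * L) by rewrite divr_gt0// mulr_gt0.
  by have [z zP] := near w _ e0 uU; exists z.
pose base u j := if j \in D then fl' (x0 j) else fl' (z (y u) j).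
pose X u : {ffun 'I_s -> 'I_(2 * n).+1} := [ffun j => inord (base u j + u j)].
have z34 u : u \in U -> forall j, `|z (y u) j| <= 3 / 4.
  move=> uU j; have [_ z2 _] := zP _ (yx0 u uU).
  exact: (three_quarters (z2 j) (x01 j)).
have uD u : u \in U -> forall j, (u j)%:R <= (if j \in D then m else m')%:R :> R.
  by move=> /familyP uU j; have := uU j; rewrite unfold_in /= /mm ler_nat => /ltnW.
have XE u : u \in U -> forall j, X u j = (base u j + u j)%N :> nat.
  move=> uU j; rewrite ffunE inordK// ltnS -(ler_nat R) natrD natrM /base.
  have := uD u uU j; have u0 : 0 <= (u j)%:R :> R by [].
  case: ifP => _ um.
    have [k1 k2] := flP _ (x034 j); exact: (floor_in_grid n0' k1 (x034 j) um m2 de4).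
  have [k1 k2] := flP _ (z34 u uU j); exact: (floor_in_grid n0' k1 (z34 u uU j) um m'2 be1).
(* The free coordinates are recovered first. They determine the near solution, hence the base points
   of the other three. *)
have Xinj : {in U &, injective X}.
  move=> u u' uU uU' XX.
  have eD j : j \in D -> u j = u' j.
    move=> jD; apply/val_inj; have := XE u uU j; rewrite XX (XE u' uU') /base jD => /addnI /esym; exact.
  have yy : y u = y u' by apply/funext => j; rewrite /y; case: ifP => // jD; rewrite eD.
  apply/ffunP => j; apply/val_inj; have := XE u uU j.
  by rewrite XX (XE u' uU') /base yy => /addnI /esym; exact.
have XW u : u \in U -> (L / 2) ^+ 3 <= weight a L (gpoint R (X u)).
  move=> uU; apply: weight_ge => // i; have [z1 z2 z3] := zP _ (yx0 u uU).
  have g1 j : `|tnth (gpoint R (X u)) j| <= 1 :> R by rewrite tnth_mktuple; exact: (grid_point R (X u j) n0).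
  have zz1 j : `|z (y u) j| <= 1 by apply: le_trans (z34 u uU j) quarter3.
  have gz j : `|tnth (gpoint R (X u)) j - z (y u) j| <= be.
    rewrite tnth_mktuple (XE u uU) /base; case: ifPn => jD.
      by rewrite z1// /y jD subrr normr0 ltW.
    have [k1 k2] := flP _ (z34 u uU j); have := uD u uU j; rewrite (negbTE jD) => um.
    have u0 : 0 <= (u j)%:R :> R by [].
    by rewrite natrD; exact: (floor_dist n0' k1 k2 u0 um m'2).
  have := phi_lip a i g1 zz1; set P := phi a i _ => PL.
  have -> : P = P - phi a i (z (y u)) + phi a i (z (y u)) by ring.
  apply: le_trans (ler_normD _ _) _; apply: le_trans (lerD PL (z3 i)) _.
  have Sbe : \sum_j `|tnth (gpoint R (X u)) j - z (y u) j| <= s%:R * be.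
    by apply: le_trans (ler_sum _ (fun j _ => gz j)) _; rewrite sumr_const card_ord mulr_natl.
  have h1 : 3 * c * \sum_j `|tnth (gpoint R (X u)) j - z (y u) j| <= 3 * c * (s%:R * be).
    by apply: ler_wpM2l => //; apply: mulr_ge0.
  apply: le_trans (lerD h1 (lexx _)) _.
  have h2 : 3 * c * (s%:R * be) <= 1 / (4 * L).
    have -> : 3 * c * (s%:R * be) = (12 * (c * s%:R) / ka) * (1 / (8 * L)).
      by rewrite /be; field; rewrite !gt_eqF.
    have h3 : 12 * (c * s%:R) / ka <= 1 by rewrite ler_pdivrMr// mul1r /ka lerDr.
    have h4 : 0 <= 1 / (8 * L) by rewrite divr_ge0// mulr_ge0// ltW.
    apply: (@le_trans _ _ (1 * (1 / (8 * L)))); first exact: ler_wpM2r.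
    have -> : 1 / (4 * L) = 1 / (8 * L) + 1 / (8 * L) by field; rewrite gt_eqF.
    by rewrite mul1r lerDl.
  have -> : 1 / (2 * L) = 1 / (4 * L) + 1 / (4 * L) by field; rewrite gt_eqF.
  by rewrite lerD2r.
have W0 x : 0 <= weight a L (gpoint R (n := n) x) by apply: prodr_ge0 => i _; exact: lambda_ge0.
have SW : (m ^ (s - 3) * m' ^ 3)%N%:R * (L / 2) ^+ 3 <=
    \sum_(x : {ffun 'I_s -> 'I_(2 * n).+1}) weight a L (gpoint R x).
  rewrite -cU mulr_natl -sumr_const.
  apply: (@le_trans _ _ (\sum_(u in U) weight a L (gpoint R (X u)))); first exact: ler_sum.
  rewrite -(big_imset (fun x => weight a L (gpoint R x)) Xinj) /= big_mkcond /=.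
  by apply: ler_sum => x _; case: ifP.
have ns0 : 0 < n%:R ^+ s :> R by rewrite exprn_gt0.
have KS : K <= (\sum_(x : {ffun 'I_s -> 'I_(2 * n).+1}) weight a L (gpoint R x)) / n%:R ^+ s.
  rewrite ler_pdivlMr//; apply: le_trans SW; rewrite natrM !natrX.
  have -> : K * n%:R ^+ s = ((n%:R * (de / 4)) ^+ (s - 3) * (n%:R * (be / 4)) ^+ 3) * (L / 2) ^+ 3.
    have -> : n%:R ^+ s = n%:R ^+ (s - 3) * n%:R ^+ 3 :> R by rewrite -exprD subnK// (leq_trans _ s6).
    have -> : (n%:R * (de / 4)) ^+ (s - 3) = n%:R ^+ (s - 3) * (de / 4) ^+ (s - 3) by rewrite exprMn.
    have e3 : (n%:R * (be / 4)) ^+ 3 * (L / 2) ^+ 3 = n%:R ^+ 3 * (1 / (16 * ka)) ^+ 3.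
      by rewrite -!exprMn; congr (_ ^+ 3); rewrite /be; field; rewrite !gt_eqF.
    by rewrite -[RHS]mulrA e3 /K; ring.
  apply: ler_wpM2r; first by apply: exprn_ge0; rewrite divr_ge0// ltW.
  apply: ler_pM; try by apply: exprn_ge0; apply: mulr_ge0 => //; apply: divr_ge0 => //; exact: ltW.
    by apply: lerXn2r; rewrite ?nnegrE// mulr_ge0// divr_ge0// ltW.
  by apply: lerXn2r; rewrite ?nnegrE// mulr_ge0// divr_ge0// ltW.
have := HC n n0; rewrite distrC ler_norml => /andP[_].
by move: KS nC; move: (_ / n%:R ^+ s) (C / n%:R) (real_density_approx a L) => u v w; lra.
Qed.

End RealLower.

(** * Convergence of the densities *)

Section Limits.
Variable R : realType.

(** Besides the limit, every approximate bound valid eventually is returned for the limit itself, so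
    that one estimate yields both existence and value. *)
Lemma cauchy_limit (T : Type) (F : set_system T) (FF : ProperFilter F) (f : T -> R) :
  (forall eps : R, 0 < eps -> exists x, \forall t \near F, `|x - f t| <= eps) ->
  exists2 l : R, f t @[t --> F] --> l & forall x eps, (\forall t \near F, `|x - f t| <= eps) -> `|x - l| <= eps.
Proof.
move=> H; have cf : cvg (f t @[t --> F]).
  apply: cauchy_cvg; apply: cauchy_exP => e e0; have e20 : 0 < e / 2 by rewrite divr_gt0.
  have [x xF] := H _ e20; exists x; apply: filterS xF => t xt.
  by rewrite -ball_normE /=; apply: le_lt_trans xt _; lra.
exists (lim (f t @[t --> F])) => // x eps xF; set l := lim _.
have fl : f t @[t --> F] --> l by [].
apply/ler_addgt0Pr => e e0; move/cvgrPdist_le : fl => /(_ _ e0) fl.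
have [t [h1 h2]] := filter_ex (filterI xF fl).
have -> : x - l = (x - f t) + - (l - f t) by ring.
by apply: le_trans (ler_normD _ _) _; rewrite normrN lerD.
Qed.

Lemma cvg_big_prod (I : Type) (r : seq I) (P : pred I) (F : I -> nat -> R) (l : I -> R) :
  (forall i, P i -> F i h @[h --> \oo] --> l i) ->
  \prod_(i <- r | P i) F i h @[h --> \oo] --> \prod_(i <- r | P i) l i.
Proof.
move=> H; elim: r => [|i r IH].
  by rewrite big_nil; under eq_fun do rewrite big_nil; exact: cvg_cst.
rewrite big_cons; under eq_fun do rewrite big_cons.
by case: ifP => // Pi; apply: cvgM => //; exact: H.
Qed.

Variables (mu : R -> R) (chi : nat -> R).
Variables (cn : nat -> R) (c0 c1 L1 : R).
Hypothesis c00 : 0 < c0.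
Hypothesis c10 : 0 < c1.
Hypothesis chi_ge : forall q, (0 < q)%N -> c1 <= chi q.
Hypothesis mu_ge : forall L, L1 <= L -> c0 <= mu L.
Hypothesis main : forall eps : R, 0 < eps -> exists W, (0 < W)%N /\ exists L0, forall q L,
  (0 < q)%N -> (W %| q)%N -> L0 <= L -> \forall n \near \oo, `|cn n - chi q * mu L| <= eps.

Lemma density_limits : exists l sg : R, [/\ 0 < l, 0 < sg, cn n @[n --> \oo] --> l,
  mu L @[L --> (+oo : set_system R)] --> sg &
  forall eps, 0 < eps -> exists W, (0 < W)%N /\ forall q, (0 < q)%N -> (W %| q)%N -> `|chi q - l / sg| <= eps].
Proof.
have cc : 0 < c1 * c0 by rewrite mulr_gt0.
have [|l cl lP] := @cauchy_limit nat \oo _ cn.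
  move=> eps eps0; have [W [W0 [L0 H]]] := main eps0; exists (chi W * mu L0).
  by apply: filterS (H W L0 W0 (dvdnn _) (lexx _)) => n; rewrite distrC.
have main' eps : 0 < eps -> exists W, (0 < W)%N /\ exists L0, forall q L,
    (0 < q)%N -> (W %| q)%N -> L0 <= L -> `|chi q * mu L - l| <= eps.
  move=> eps0; have [W [W0 [L0 H]]] := main eps0; exists W; split => //; exists L0 => q L q0 Wq LL.
  by apply: lP; apply: filterS (H q L q0 Wq LL) => n; rewrite distrC.
have l0 : 0 < l.
  have e0 : 0 < c1 * c0 / 2 by rewrite divr_gt0.
  have [W [W0 [L0 H]]] := main' _ e0.
  have h1 : L0 <= Num.max L0 L1 by rewrite le_max lexx.
  have h2 : L1 <= Num.max L0 L1 by rewrite le_max lexx orbT.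
  have := H W _ W0 (dvdnn _) h1; rewrite ler_norml => /andP[_].
  have : c1 * c0 <= chi W * mu (Num.max L0 L1).
    by apply: ler_pM; rewrite ?(ltW c00) ?(ltW c10)//; [exact: chi_ge|exact: mu_ge].
  lra.
have chi0 q : (0 < q)%N -> 0 < chi q by move=> q0; apply: lt_le_trans (chi_ge q0).
have [|sg csg sgP] := @cauchy_limit R (+oo : set_system R) _ mu.
  move=> eps eps0; have e0 : 0 < eps * c1 by rewrite mulr_gt0.
  have [W [W0 [L0 H]]] := main' _ e0; exists (l / chi W).
  apply: filterS (nbhs_pinfty_ge (num_real L0)) => L LL.
  have := H W L W0 (dvdnn _) LL; have W0' := chi0 W W0.
  have -> : l / chi W - mu L = - (chi W * mu L - l) / chi W by field; rewrite gt_eqF.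
  rewrite normrM normrN normfV (gtr0_norm W0') ler_pdivrMr// => /le_trans; apply.
  by rewrite ler_pM2l// chi_ge.
have sg0 : c0 <= sg.
  have cv : cvg (mu L @[L --> (+oo : set_system R)]) by apply/cvg_ex; exists sg.
  rewrite -(cvg_lim (@norm_hausdorff _ _) csg); apply: limr_ge => //.
  by apply: filterS (nbhs_pinfty_ge (num_real L1)) => L; exact: mu_ge.
have sg0' : 0 < sg by apply: lt_le_trans sg0.
exists l, sg; split => // eps eps0; have e0 : 0 < eps * sg by rewrite mulr_gt0.
have [W [W0 [L0 H]]] := main' _ e0; exists W; split => // q q0 Wq.
have q0' := chi0 q q0.
have := sgP (l / chi q) (eps * sg / chi q).
have h : \forall L \near (+oo : set_system R), `|l / chi q - mu L| <= eps * sg / chi q.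
  apply: filterS (nbhs_pinfty_ge (num_real L0)) => L LL.
  have -> : l / chi q - mu L = - (chi q * mu L - l) / chi q by field; rewrite gt_eqF.
  by rewrite normrM normrN normfV (gtr0_norm q0') ler_pM2r ?invr_gt0// H.
move=> /(_ h).
have -> : l / chi q - sg = - (chi q - l / sg) * sg / chi q by field; rewrite !gt_eqF.
rewrite !normrM normrN normfV (gtr0_norm q0') (gtr0_norm sg0').
by rewrite ler_pM2r ?invr_gt0// ler_pM2r.
Qed.

End Limits.

(** * Separation of the real and p-adic factors *)

Section Main.
Variables (R : realType) (s : nat) (a : 'M[int]_(3, s)).
Hypothesis s13 : (13 <= s)%N.
Hypothesis a0 : forall i j, a i j != 0.
Local Notation chi := (local_density R a).
Local Notation mu := (real_density_approx a).

Definition nsol n : nat := #|[pred x : {ffun 'I_s -> 'I_(2 * n).+1} | [forall i, phi a i (centred x) == 0]]|.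

Lemma nsol_wsum n : (nsol n)%:R = wsum R a n (fun=> 1%N) 1.
Proof.
rewrite /nsol -sum1_card natr_sum big_mkcond /=; apply: eq_bigr => x _.
under [RHS]eq_bigr do rewrite fej1.
case: ifPn => [/forallP H|].
  by rewrite big1// => i _; rewrite (H i).
by rewrite negb_forall => /existsP[i /negbTE ix]; rewrite (bigD1 i)//= ix mul0r.
Qed.

Lemma kernel_heights (n : nat) (z : R) : (0 < n)%N -> 0 < z -> z <= n%:R ->
  exists h : 'I_3 -> nat, [/\ forall i, (0 < h i)%N, forall i : 'I_3, (h i)%:R * z <= n%:R ^+ i.+1 &
   forall i : 'I_3, n%:R ^+ i.+1 <= ((h i)%:R + 1) * z].
Proof.
move=> n0 z0 zn; have n1 : 1 <= n%:R :> R by rewrite ler1n.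
exists (fun i => Num.truncn (n%:R ^+ i.+1 / z)).
have nz (i : 'I_3) : 1 <= n%:R ^+ i.+1 / z.
  rewrite ler_pdivlMr// mul1r; apply: le_trans zn _; rewrite exprS ler_peMr ?exprn_ege1//.
have it (i : 'I_3) := truncn_itv (le_trans ler01 (nz i)).
split => i; have /andP[h1 h2] := it i.
- have : 1 < (Num.truncn (n%:R ^+ i.+1 / z)).+1%:R :> R by apply: le_lt_trans (nz i) h2.
  by rewrite (ltr_nat R 1).
- by rewrite -ler_pdivlMr.
- by rewrite natr1 -ler_pdivrMr// ltW.
Qed.

Lemma main_approx (eps : R) : 0 < eps -> exists W, (0 < W)%N /\ exists L0, forall q L,
  (0 < q)%N -> (W %| q)%N -> L0 <= L -> \forall n \near \oo,
  `|(nsol n)%:R / n%:R ^+ (s - 6) - chi q * mu L| <= eps.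
Proof.
move=> eps0; have e20 : 0 < eps / 2 by rewrite divr_gt0.
have [W [W0 [L0 [L00 [N H]]]]] := wsum_approx s13 a0 e20.
exists W; split => //; exists L0 => q L q0 Wq LL.
have LL0 : 0 < L by apply: lt_le_trans LL.
have [C HC] := wsum_limit a LL0 q0 (leq_trans (isT : (6 <= 13)%N) s13).
have z0 : 0 < L * q%:R by rewrite mulr_gt0// ltr0n.
near=> n.
have n0 : (0 < n)%N by near: n; exact: nbhs_infty_ge.
have n0' : 0 < n%:R :> R by rewrite ltr0n.
have nN : (N <= n)%N by near: n; exact: nbhs_infty_ge.
have zn : L * q%:R <= n%:R.
  apply: (@le_trans _ _ (Num.truncn (L * q%:R)).+1%:R); first exact/ltW/truncnS_gt.
  by rewrite ler_nat; near: n; exact: nbhs_infty_ge.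
have Cn : C / n%:R <= eps / 2.
  rewrite ler_pdivrMr// mulrC -ler_pdivrMr//.
  apply: (@le_trans _ _ (Num.truncn (C / (eps / 2))).+1%:R); first exact/ltW/truncnS_gt.
  by rewrite ler_nat; near: n; exact: nbhs_infty_ge.
have [h [h0 h1 h2]] := kernel_heights n0 z0 zn.
have B1 := H n q L h nN q0 Wq LL h0 h1.
have B2 := HC n h n0 zn h0 h1 h2.
have ns : 0 < n%:R ^+ (s - 6) :> R by rewrite exprn_gt0.
have -> : (nsol n)%:R / n%:R ^+ (s - 6) - chi q * mu L =
   ((wsum R a n (fun=> 1%N) 1 - wsum R a n h q) + (wsum R a n h q - chi q * mu L * n%:R ^+ (s - 6))) / n%:R ^+ (s - 6).
  by rewrite nsol_wsum; field; rewrite gt_eqF.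
rewrite normrM normfV (gtr0_norm ns) ler_pdivrMr//; apply: le_trans (ler_normD _ _) _.
apply: le_trans (lerD B1 B2) _; rewrite -mulrDl ler_pM2r//; lra.
Unshelve. all: by end_near. Qed.

Lemma padic_approxE p H : prime p -> padic_density_approx R a p H = chi (p ^ H).
Proof.
move=> pp; have p0 : p%:R != 0 :> R by rewrite pnatr_eq0 -lt0n prime_gt0.
rewrite /padic_density_approx /local_density mulrBr expfzDr// mulrC -mulrA natrX -!exprM; congr (_ * _).
have -> : H%:Z * 3 = (H * 3)%N%:Z by rewrite PoszM.
have -> : H%:Z * s%:Z = (H * s)%N%:Z by rewrite PoszM.
by rewrite -exprnP exprnN.
Qed.

Hypothesis real_ns : exists x : 'I_s -> R, nonsingular_solution a x.
Hypothesis padic_ns : forall (p : nat) (p_pr : prime p), exists x : 'I_s -> padic p_pr, nonsingular_solution a x.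

Lemma chi_prod (H n : nat) : chi (\prod_(p < n | prime p) p ^ H)%N = \prod_(p < n | prime p) chi (p ^ H).
Proof.
elim: n => [|n IH]; first by rewrite !big_ord0 chi1.
rewrite big_mkcond [RHS]big_mkcond !big_ord_recr /= -big_mkcond -[in RHS]big_mkcond /=.
case: ifP => pn; last by rewrite muln1 mulr1.
have n0 : (0 < n ^ H)%N by rewrite expn_gt0 prime_gt0.
rewrite chi_mul ?IH//.
  by apply: prodn_cond_gt0 => p pp; rewrite expn_gt0 prime_gt0.
apply: coprimeXr; rewrite coprime_sym.
elim/big_ind: _ => [|u v hu hv|p pp]; [exact: coprimen1|by rewrite coprimeMr hu|].
apply: coprimeXr; rewrite prime_coprime// dvdn_prime2//.
by rewrite gtn_eqF.
Qed.

Lemma dvdn_primorial_power (W H n : nat) : (0 < W)%N -> (W <= H)%N -> (W < n)%N ->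
  (W %| \prod_(p < n | prime p) p ^ H)%N.
Proof.
move=> W0 WH Wn; apply/dvdn_partP => // p; rewrite mem_primes => /and3P[pp _ pW].
have pn : (p < n)%N by apply: leq_ltn_trans Wn; exact: dvdn_leq.
rewrite (bigD1 (Ordinal pn))//= p_part; apply: dvdn_mulr; apply: dvdn_exp2l; apply: leq_trans WH.
apply: ltnW; apply: leq_trans (ltn_expl _ (prime_gt1 pp)) _.
by apply: dvdn_leq => //; rewrite pfactor_dvdnn.
Qed.

Theorem density_product : exists l sg P : R, [/\ [/\ 0 < l, 0 < sg & l = sg * P],
  (nsol n)%:R / n%:R ^+ (s - 6) @[n --> \oo] --> l,
  mu L @[L --> (+oo : set_system R)] --> sg,
  forall p, prime p -> cvg (padic_density_approx R a p @ \oo) &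
  padic_partial_product R a @ \oo --> P].
Proof.
have s6 : (6 <= s)%N by apply: leq_trans s13.
have [c1 c10 chi_ge] := chi_lower R s13 a0 padic_ns.
have [c0 c00 [L1 _ mu_ge]] := real_density_lower s6 real_ns.
have [l [sg [l0 sg0 cl csg HS]]] := density_limits c00 c10 chi_ge mu_ge main_approx.
exists l, sg, (l / sg); set S := l / sg in HS *.
have chi0 q : (0 < q)%N -> 0 < chi q by move=> q0; exact: lt_le_trans c10 (chi_ge _ q0).
have local p : prime p -> cvg (padic_density_approx R a p @ \oo).
  move=> pp; have [|x cx _] := @cauchy_limit R nat \oo _ (padic_density_approx R a p); last by apply/cvg_ex; exists x.
  move=> eps eps0; have e0 : 0 < eps * c1 by rewrite mulr_gt0.
  (* The part V of W prime to p is frozen. For large h the number p^h V is a multiple of W, so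
     chi(p^h) chi(V) is close to S. *)
  have [W [W0 H]] := HS _ e0; pose V := (W`_p^')%N; exists (S / chi V); near=> h.
  have W'p : (0 < V)%N by exact: part_gt0.
  have W'0 := chi0 _ W'p.
  have hW : (logn p W <= h)%N by near: h; exact: nbhs_infty_ge.
  have ph0 : (0 < p ^ h)%N by rewrite expn_gt0 prime_gt0.
  rewrite padic_approxE//.
  have : `|chi (p ^ h * V)%N - S| <= eps * c1.
    apply: H; first by rewrite muln_gt0 ph0 W'p.
    by rewrite -{1}(partnC p W0) dvdn_mul// p_part dvdn_exp2l.
  have cop : coprime (p ^ h) V.
    by apply: coprimeXl; apply: pnat_coprime (part_pnat _ _); apply: pnat_id.
  rewrite chi_mul//.
  move=> K; have -> : S / chi V - chi (p ^ h) = - (chi (p ^ h) * chi V - S) / chi V.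
    by field; rewrite gt_eqF.
  rewrite normrM normrN normfV (gtr0_norm W'0) ler_pdivrMr//; apply: le_trans K _.
  by rewrite ler_pM2l// chi_ge.
split => //; first by split => //; rewrite /S; field; rewrite gt_eqF.
apply/cvgrPdist_le => eps eps0; have [W [W0 H]] := HS _ eps0; near=> n.
have Wn : (W < n)%N by near: n; exact: nbhs_infty_ge.
have cP : (\prod_(p < n | prime p) padic_density_approx R a p h) @[h --> \oo] --> padic_partial_product R a n.
  by apply: cvg_big_prod => p pp; exact: (local p pp).
have cv : cvg ((\prod_(p < n | prime p) padic_density_approx R a p h) @[h --> \oo]) by apply/cvg_ex; eexists; exact: cP.
apply/ler_addgt0Pr => e e0; move/cvgrPdist_le : cP => /(_ _ e0) cP.
have [h [h1 h2]] := filter_ex (filterI cP (nbhs_infty_ge W)).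
(* At a common exponent h the product over p < n is chi of a single modulus, which W divides once n
   and h exceed W. The exponent tends to infinity before n. *)
have PE : \prod_(p < n | prime p) padic_density_approx R a p h = chi (\prod_(p < n | prime p) p ^ h)%N.
  by rewrite chi_prod; apply: eq_bigr => p pp; rewrite padic_approxE.
have := H _ _ (dvdn_primorial_power W0 h2 Wn); rewrite -PE.
have Q0 : (0 < \prod_(p < n | prime p) p ^ h)%N.
  by apply: prodn_cond_gt0 => p pp; rewrite expn_gt0 prime_gt0.
move=> /(_ Q0) h3; move: h1 h3; set X := \prod_(p < n | _) _; set Y := padic_partial_product _ _ _ => h1 h3.
have -> : S - Y = - (X - S) + - (Y - X) by ring.
by apply: le_trans (ler_normD _ _) _; rewrite !normrN lerD.
Unshelve. all: by end_near. Qed.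

End Main.

From mathcomp Require Import finmap.

(** * The count in the box and the conclusion *)

Section Counting.
Variables (R : realType) (s : nat) (a : 'M[int]_(3, s)).

Definition box_point n (x : {ffun 'I_s -> 'I_(2 * n).+1}) : {ffun 'I_s -> int} := [ffun j => centred x j].

Lemma box_point_inj n : injective (@box_point n).
Proof.
move=> x y /ffunP xy; apply/ffunP => j; apply/val_inj => /=; have := xy j; rewrite !ffunE /centred.
by move=> /addIr [].
Qed.

Lemma phi_box_point n (x : {ffun 'I_s -> 'I_(2 * n).+1}) i : phi a i (box_point x) = phi a i (centred x).
Proof. by apply: eq_bigr => j _; rewrite ffunE. Qed.

Lemma in_box (n : nat) (x : {ffun 'I_s -> int}) : (forall j, `|x j| <= n%:Z) ->
  exists y : {ffun 'I_s -> 'I_(2 * n).+1}, x = box_point y.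
Proof.
move=> xn; exists [ffun j => inord (absz (x j + n%:Z))]; apply/ffunP => j; rewrite !ffunE /centred ffunE.
have := xn j; rewrite ler_norml => /andP[h1 h2].
have h3 : 0 <= x j + n%:Z by move: h1; clear; lia.
rewrite inordK; first by rewrite gez0_abs// addrK.
by rewrite -ltz_nat gez0_abs//; move: h2; clear; lia.
Qed.

Lemma count_solutionsE (B : R) : 0 <= B -> count_solutions a B = nsol a (Num.truncn B).
Proof.
move=> B0; set n := Num.truncn B; rewrite /count_solutions; set A := [set x | _].
have AE : A = @box_point n @` [set x | [forall i, phi a i (centred x) == 0]].
  apply/seteqP; split => [x [xs xB]|_ [x /= /forallP xs <-]] /=.
    have [|y yE] := @in_box n x.
      move=> j; have := xB j; have /andP[_ h2] := truncn_itv B0 => h1.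
      have := le_lt_trans h1 h2; rewrite -/n pmulrn ltr_int -addn1 PoszD ltzD1//.
    exists y; last by rewrite yE.
    by apply/forallP => i; rewrite -phi_box_point -yE; apply/eqP; exact: xs.
  split => [i|j]; first by rewrite phi_box_point; apply/eqP; exact: xs.
  have /andP[h1 _] := truncn_itv B0; apply: le_trans h1.
  rewrite -/n pmulrn ler_int ffunE /centred; have := ltn_ord (x j); move: (x j : nat) => k; clear; lia.
have fA : finite_set A by rewrite AE; exact: finite_image.
have -> : nsol a n = size [seq box_point x | x <- enum [pred x : {ffun 'I_s -> 'I_(2 * n).+1} | [forall i, phi a i (centred x) == 0]]].
  by rewrite size_map -cardE.
apply: perm_size; apply: uniq_perm; first exact: fset_uniq.
  by rewrite map_inj_uniq ?enum_uniq//; exact: box_point_inj.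
move=> x; rewrite -[LHS]/(x \in fset_set A) in_fset_set//; apply/idP/mapP => [|[y]].
  by move=> /set_mem; rewrite AE => -[y /= ys <-]; exists y => //; rewrite mem_enum.
by rewrite mem_enum => ys ->; apply/mem_set; rewrite AE /=; exists y.
Qed.

Lemma nontrivial_solution n : (1 < nsol a n)%N -> nontrivially_soluble rat a.
Proof.
(* In shifted coordinates the zero solution is the point with all entries n. *)
move=> n1; pose z : {ffun 'I_s -> 'I_(2 * n).+1} := [ffun=> inord n].
have [x xs xz] : exists2 x : {ffun 'I_s -> 'I_(2 * n).+1}, [forall i, phi a i (centred x) == 0] & x != z.
  apply/exists_inP; apply: contraTT n1; rewrite negb_exists_in -leqNgt => /forall_inP H.
  apply: (@leq_trans #|pred1 z|); last by rewrite card1.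
  by apply/subset_leq_card/fintype.subsetP => x xs; rewrite inE; apply/negPn/H.
exists (fun j => (centred x j)%:~R).
  by move=> i; rewrite (phi_morph a (intmul (1 : rat))) (eqP (forallP xs i)).
apply/existsP; apply: contraNT xz; rewrite negb_exists => /forallP H; apply/eqP/ffunP => j.
apply/val_inj; rewrite ffunE /= inordK; last by clear; lia.
have := H j; rewrite negbK intr_eq0 /centred subr_eq0 => /eqP[]; exact.
Qed.

End Counting.

Lemma truncn_cvg (R : realType) : Num.truncn B @[B --> (+oo : set_system R)] --> \oo.
Proof.
move=> A [N _ NA]; apply: filterS (nbhs_pinfty_ge (num_real (N%:R : R))) => B NB; apply: NA => /=.
by rewrite truncn_ge_nat// (le_trans _ NB).
Qed.

Lemma cvg_power (R : realType) (T : Type) (F : set_system T) {FF : ProperFilter F} (f : T -> R) (l : R) k :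
  f t @[t --> F] --> l -> f t ^+ k @[t --> F] --> l ^+ k.
Proof.
move=> fl; elim: k => [|k IH]; first by rewrite expr0; under eq_fun do rewrite expr0; exact: cvg_cst.
by rewrite exprS; under eq_fun do rewrite exprS; exact: cvgM.
Qed.

Theorem theorem8p2 (R : realType) (s : nat) (a : 'M[int]_(3, s))
    (s_ge13 : (13 <= s)%N)
    (a_neq0 : forall i j, a i j != 0)
    (real_nonsingular : exists x : 'I_s -> R, nonsingular_solution a x)
    (padic_nonsingular : forall (p : nat) (p_pr : prime p),
      exists x : 'I_s -> padic p_pr, nonsingular_solution a x) :
  [/\ cvg (real_density_approx a L @[L --> (+oo : set_system R)]),
      forall p : nat, prime p -> cvg (padic_density_approx R a p @ \oo),
      cvg (padic_partial_product R a @ \oo),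
      (count_solutions a B)%:R /
        (real_density R a * padic_product R a * B ^+ (s - 6))
        @[B --> (+oo : set_system R)] --> (1 : R)
    & hasse_principle R a].
Proof.
have [l [sg [P [[l0 sg0 lE] cl csg local cP]]]] := density_product s_ge13 a_neq0 real_nonsingular padic_nonsingular.
split => //; [by apply/cvg_ex; exists sg|by apply/cvg_ex; exists P| |].
  have -> : real_density R a = sg by apply: cvg_lim csg; exact: norm_hausdorff.
  have -> : padic_product R a = P by apply: cvg_lim cP; exact: norm_hausdorff.
  rewrite -lE; set k := (s - 6)%N.
  (* The count depends only on the integer part of B, and replacing it by B changes the power by a
     factor tending to 1. *)
  have c1 : (nsol a (Num.truncn B))%:R / (Num.truncn B)%:R ^+ k @[B --> (+oo : set_system R)] --> l.
    exact: (cvg_comp _ _ (@truncn_cvg R) cl).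
  have c2 : (Num.truncn B)%:R / B @[B --> (+oo : set_system R)] --> (1 : R).
    apply/cvgrPdist_le => eps eps0; near=> B.
    have B1 : 1 <= B by near: B; exact: nbhs_pinfty_ge.
    have B0 : 0 < B by apply: lt_le_trans B1.
    have Be : eps^-1 <= B by near: B; apply: nbhs_pinfty_ge; exact: num_real.
    have /andP[h1 h2] := truncn_itv (ltW B0); rewrite -natr1 in h2.
    have -> : 1 - (Num.truncn B)%:R / B = (B - (Num.truncn B)%:R) / B by field; rewrite gt_eqF.
    rewrite normrM normfV (gtr0_norm B0) ler_pdivrMr// ger0_norm ?subr_ge0//.
    have : 1 <= eps * B by rewrite mulrC -ler_pdivrMr// div1r.
    lra.
  have c2k : ((Num.truncn B)%:R / B) ^+ k @[B --> (+oo : set_system R)] --> (1 : R).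
    have h := @cvg_power _ _ _ _ _ _ k c2; rewrite expr1n in h; exact: h.
  have c3 : (nsol a (Num.truncn B))%:R / (Num.truncn B)%:R ^+ k * ((Num.truncn B)%:R / B) ^+ k * l^-1
      @[B --> (+oo : set_system R)] --> l * 1 * l^-1.
    by apply: cvgM; [apply: cvgM|exact: cvg_cst].
  rewrite mulr1 divff ?gt_eqF// in c3.
  apply: cvg_trans c3; apply: near_eq_cvg; near=> B.
  have B1 : 1 <= B by near: B; exact: nbhs_pinfty_ge.
  have B0 : 0 < B by apply: lt_le_trans B1.
  have n0 : (Num.truncn B)%:R != 0 :> R by rewrite pnatr_eq0 -lt0n truncn_gt0.
  rewrite /= (count_solutionsE a (ltW B0)) expr_div_n.
  have := expf_neq0 k n0; have := expf_neq0 k (lt0r_neq0 B0).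
  move: (_ ^+ k) ((Num.truncn B)%:R ^+ k) => u v u0 v0; field.
  by rewrite u0 v0 gt_eqF.
move=> _ _.
(* For large n the count is at least l n^(s-6) / 2 > 1, so some integral solution differs from
   zero. *)
move/cvgrPdist_le : cl => /(_ (l / 2)); rewrite divr_gt0// => /(_ isT) cl.
have [n [n1 n2]] := filter_ex (filterI cl (nbhs_infty_ge (Num.truncn (2 / l)).+2)).
apply: (@nontrivial_solution s a n); rewrite -(ltr_nat R).
have n1' : 1 <= n%:R :> R by rewrite ler1n (leq_trans _ n2).
have nk : n%:R <= n%:R ^+ (s - 6) :> R.
  have -> : (s - 6 = (s - 7).+1)%N by move: s_ge13; clear; lia.
  by rewrite exprS ler_peMr ?exprn_ege1// (le_trans ler01).
have nk0 : 0 < n%:R ^+ (s - 6) :> R by rewrite exprn_gt0// (lt_le_trans ltr01).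
have : l / 2 <= (nsol a n)%:R / n%:R ^+ (s - 6).
  by move: n1; rewrite ler_norml => /andP[_]; lra.
rewrite ler_pdivlMr//; apply: lt_le_trans.
have h : 2 / l < n%:R by apply: lt_le_trans (truncnS_gt _) _; rewrite ler_nat ltnW.
have : 2 / l < n%:R ^+ (s - 6) by apply: lt_le_trans nk.
by rewrite ltr_pdivrMr// mulrC; lra.
Unshelve. all: by end_near. Qed.
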